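(* Let $\beta\in\{1,2\}$, $\mathfrak d=N/M\to d\in(0,\infty)$, and let $W=XX^*$ and $\tilde W=YY^*$ be two (real if $\beta=1$, complex if $\beta=2$) sample covariance matrices such that $$\mathbb E(\Re X_{ij})^\ell(\Im X_{ij})^p=\mathbb E(\Re Y_{ij})^\ell(\Im Y_{ij})^p,\quad \ell+p\le4,\ 1\le i\le N,\ 1\le j\le M.$$ For $j=1,\dots,n$ let $\Gamma_j=\partial\Omega_j$ be a simple smooth positively oriented closed curve (with $\Omega_j$ closed) uniformly bounded away from the support of the Marchenko–Pastur law $\varrho_d$, and let $f_1,\dots,f_n$ be analytic in a neighbourhood of $\Omega_1\cup\dots\cup\Omega_n$. Let $\vec b=\vec b_N\in\mathbb C^N$ be unit vectors, $T=T(W,\vec b)$, $\tilde T=T(\tilde W,\vec b)$. Then for any admissible test function $\Phi:\mathbb C^n\to\mathbb R$, $$\Big|\mathbb E\,\Phi\big(I_1(T),\dots,I_n(T)\big)-\mathbb E\,\Phi\big(I_1(\tilde T),\dots,I_n(\tilde T)\big)\Big|\le CM^{-\sigma},\qquad I_j(T):=\frac{\sqrt M}{2\pi i}\oint_{\Gamma_j}f_j(z)\big(c_0(z;\mu_T)-s_{\mathfrak d}(z)\big)\,\mathrm dz,$$ for some $C,\sigma>0$, where $C$ depends on $n$, the constants $C_p$, $\Phi$, the $\Gamma_j$ and the $f_j$, and $\sigma$ depends on the constant $C_0$ of $\Phi$.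
   Context: A real ($\beta=1$) or complex ($\beta=2$) sample covariance matrix is $XX^*$ with $X$ an $N\times M$ random matrix with independent entries satisfying $\mathbb EX_{ij}=0$, $\mathbb E(\Re X_{ij})(\Im X_{ij})=0$, $\mathbb E(\Re X_{ij})^2=\frac1{\beta M}$, $\mathbb E|X_{ij}|^2=\frac1M$, and $\mathbb E|\sqrt MX_{ij}|^p\le C_p$ for all $p\in\mathbb N$ (entries real if $\beta=1$). Marchenko–Pastur law: $\varrho_d(\mathrm dx)=\frac{1}{2\pi d}\sqrt{\frac{[(x-\gamma_-)(\gamma_+-x)]_+}{x^2}}\mathrm dx+[1-\frac1d]_+\delta_0(\mathrm dx)$, $\gamma_\pm=(1\pm\sqrt d)^2$; $s_d(z)=\int\frac{\varrho_d(\mathrm d\lambda)}{\lambda-z}$. $T(W,\vec b)$ is the Lanczos (Jacobi) matrix of $(W,\vec b)$; $\mu_T=\sum_j|(U^*\vec b)_j|^2\delta_{\lambda_j}$ for $W=U\mathrm{diag}(\lambda_j)U^*$, and $c_0(z;\mu)=\int\frac{\mu(\mathrm d\lambda)}{\lambda-z}$. A bounded $\Phi:\mathbb C^n\to\mathbb R$ is admissible if there is $C_0>0$ such that for every multi-index $\alpha$ with $1\le|\alpha|\le5$ and every sufficiently small $\epsilon'>0$, $\max\{|\partial^\alpha\Phi(x_1,\dots,x_n)|:\max_j|x_j|\le M^{\epsilon'}\}\le M^{C_0\epsilon'}$. *)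

(* Defs.v *)
From HB Require Import structures.
From mathcomp Require Import all_boot all_order all_algebra.
From mathcomp Require Import all_classical all_reals all_analysis.
From mathcomp.real_closed Require Import complex.

Set Implicit Arguments.
Unset Strict Implicit.
Unset Printing Implicit Defensive.

Import Order.TTheory GRing.Theory Num.Theory.
Import numFieldNormedType.Exports.
Local Open Scope classical_set_scope.
Local Open Scope ring_scope.
Local Open Scope complex_scope.

Section Defs.
Variable R : realType.
Local Notation C := (R[i]).
Local Notation cabs := (@Normc.normc R).

Definition c_open (U : set C) : Prop :=
  forall z, U z -> exists2 r : R, 0 < r & forall w, cabs (w - z) < r -> U w.

Definition c_analytic_on (U : set C) (f : C -> C) : Prop :=
  forall z, U z -> exists2 r : R, 0 < r & exists a : nat -> C,
    forall w, cabs (w - z) < r ->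
      forall e : R, 0 < e -> exists K : nat, forall k, (K <= k)%N ->
        cabs (\sum_(i < k) a i * (w - z) ^+ i - f w) < e.

Definition analytic_near (K : set C) (f : C -> C) : Prop :=
  exists U : set C, [/\ c_open U, K `<=` U & c_analytic_on U f].

Definition cpt (gx gy : R -> R) (t : R) : C := gx t +i* gy t.

Definition cint01 (h : R -> C) : C :=
  Rintegral lebesgue_measure `[0, 1] (fun t => @complex.Re R (h t)) +i*
  Rintegral lebesgue_measure `[0, 1] (fun t => @complex.Im R (h t)).

Definition contour_int (gx gy : R -> R) (g : C -> C) : C :=
  cint01 (fun t => g (cpt gx gy t) * (derive1 gx t +i* derive1 gy t)).

Definition ctrace (gx gy : R -> R) : set C :=
  [set w | exists2 t, 0 <= t <= 1 & w = cpt gx gy t].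

Definition winding (gx gy : R -> R) (w : C) : C :=
  ((2 * pi)%:C * 'i)^-1 * contour_int gx gy (fun z => (z - w)^-1).

Definition simple_smooth_closed_curve (gx gy : R -> R) : Prop :=
  [/\ (forall k x, derivable (derive1n k gx) x 1 /\ derivable (derive1n k gy) x 1),
      (forall t, derive1 gx t ^+ 2 + derive1 gy t ^+ 2 != 0),
      (forall t, gx (t + 1) = gx t /\ gy (t + 1) = gy t) &
      (forall s t, 0 <= s < 1 -> 0 <= t < 1 -> cpt gx gy s = cpt gx gy t -> s = t)].

(* positive orientation: the interior points have winding number +1 *)
Definition positively_oriented (gx gy : R -> R) : Prop :=
  exists w, ~ ctrace gx gy w /\ winding gx gy w = 1.

(* Omega : the closed region bounded by Gamma = its trace together with
   its interior (points with winding number 1). *)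
Definition cregion (gx gy : R -> R) : set C :=
  ctrace gx gy `|` [set w | ~ ctrace gx gy w /\ winding gx gy w = 1].

Definition gam_m (d : R) : R := (1 - Num.sqrt d) ^+ 2.
Definition gam_p (d : R) : R := (1 + Num.sqrt d) ^+ 2.

Definition mp_density (d x : R) : R :=
  (2 * pi * d)^-1 *
  Num.sqrt (Num.max 0 ((x - gam_m d) * (gam_p d - x)) / x ^+ 2).

Definition mp_atom (d : R) : R := Num.max 0 (1 - d^-1).

Definition mp_mass (d : R) (A : set R) : \bar R :=
  (\int[lebesgue_measure]_(x in A) (mp_density d x)%:E +
   (mp_atom d * (if `[< A 0 >] then 1 else 0))%:E)%E.

Definition mp_support (d : R) : set R :=
  [set x | forall e : R, 0 < e -> (0 < mp_mass d (ball x e))%E].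

Definition mp_stieltjes (d : R) (z : C) : C :=
  (Rintegral lebesgue_measure setT
     (fun x => @complex.Re R ((mp_density d x)%:C / (x%:C - z))) +i*
   Rintegral lebesgue_measure setT
     (fun x => @complex.Im R ((mp_density d x)%:C / (x%:C - z))))
  + (mp_atom d)%:C / (0 - z).

Definition adjmx m n (A : 'M[C]_(m, n)) : 'M[C]_(n, m) := map_mx conjc A^T.

Definition unitary_mx n (U : 'M[C]_n) : Prop := U *m adjmx U = 1%:M.

Definition spectral_decomp n (W : 'M[C]_n) (p : 'M[C]_n * 'rV[R]_n) : Prop :=
  unitary_mx p.1 /\
  W = p.1 *m diag_mx (map_mx (fun x : R => x%:C) p.2) *m adjmx p.1.

(* c_0(z; mu_T) for mu_T = \sum_j |(U^* b)_j|^2 delta_{lambda_j},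
   computed from a (chosen) spectral decomposition W = U diag(lambda) U^*. *)
Definition c0 n (W : 'M[C]_n) (b : 'cV[C]_n) (z : C) : C :=
  let p := xget (0, 0) (spectral_decomp W) in
  \sum_(k < n) (cabs ((adjmx p.1 *m b) k 0) ^+ 2)%:C / ((p.2 0 k)%:C - z).

Definition unit_cvec n (b : 'cV[C]_n) : Prop :=
  \sum_(k < n) cabs (b k 0) ^+ 2 = 1.

Definition Ifun (N M : nat) (W : 'M[C]_N) (b : 'cV[C]_N)
    (gx gy : R -> R) (f : C -> C) : C :=
  ((Num.sqrt (M%:R : R))%:C / ((2 * pi)%:C * 'i)) *
  contour_int gx gy (fun z => f z * (c0 W b z - mp_stieltjes (N%:R / M%:R) z)).

(* Admissible test functions Phi : C^n -> R, where C^n is identified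
   with R^(2n) = 'rV_(n + n) via (Re x_1..Re x_n, Im x_1..Im x_n).    *)

Definition cvec_to_rv n (v : 'I_n -> C) : 'rV[R]_(n + n) :=
  row_mx (\row_j @complex.Re R (v j)) (\row_j @complex.Im R (v j)).

Definition rv_cabs n (x : 'rV[R]_(n + n)) (j : 'I_n) : R :=
  Num.sqrt (x 0 (lshift n j) ^+ 2 + x 0 (rshift n j) ^+ 2).

Definition ebasis n (k : 'I_(n + n)) : 'rV[R]_(n + n) := delta_mx 0 k.

Definition pdiff n (ks : seq 'I_(n + n)) (Phi : 'rV[R]_(n + n) -> R) :
    'rV[R]_(n + n) -> R :=
  foldr (fun k F => fun x => derive F x (ebasis k)) Phi ks.

Definition admissible n (Phi : 'rV[R]_(n + n) -> R) (C0 : R) : Prop :=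
  [/\ 0 < C0,
      (exists B : R, forall x, `|Phi x| <= B),
      (forall (ks : seq 'I_(n + n)) k x, (size ks < 5)%N ->
          derivable (pdiff ks Phi) x (ebasis k)) &
      exists2 eps0 : R, 0 < eps0 & exists M0 : nat,
        forall (eps : R) (M : nat), 0 < eps < eps0 -> (M0 <= M)%N ->
        forall (ks : seq 'I_(n + n)) x, (1 <= size ks <= 5)%N ->
          (forall j, rv_cabs x j <= powR (M%:R) eps) ->
          `|pdiff ks Phi x| <= powR (M%:R) (C0 * eps)].

(* mutual independence of the random vectors (XR i j, XI i j), stated on
   the generating pi-system of Borel rectangles *)
Definition indep_entries (dT : measure_display) (T : measurableType dT)
    (P : probability T R) N M (XR XI : 'I_N -> 'I_M -> T -> R) : Prop :=
  forall A B : 'I_N -> 'I_M -> set R,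
    (forall i j, measurable (A i j) /\ measurable (B i j)) ->
    fine (P [set t | forall i j, A i j (XR i j t) /\ B i j (XI i j t)]) =
    \prod_(i < N) \prod_(j < M)
       fine (P [set t | A i j (XR i j t) /\ B i j (XI i j t)]).

Definition sample_cov_entries (beta : nat) (Cp : nat -> R)
    (dT : measure_display) (T : measurableType dT) (P : probability T R)
    N M (XR XI : 'I_N -> 'I_M -> T -> R) : Prop :=
  [/\ (forall i j, measurable_fun setT (XR i j) /\ measurable_fun setT (XI i j)),
      indep_entries P XR XI,
      (beta = 1%N -> forall i j t, XI i j t = 0) &
      forall i j,
      [/\ ('E_P[XR i j] = 0)%E /\ ('E_P[XI i j] = 0)%E,
          ('E_P[(XR i j \* XI i j)%R] = 0)%E,
          ('E_P[(fun t => XR i j t ^+ 2)%R] = ((beta%:R * M%:R)^-1)%:E)%E,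
          ('E_P[(fun t => XR i j t ^+ 2 + XI i j t ^+ 2)%R] = ((M%:R)^-1)%:E)%E &
          forall p : nat,
            ('E_P[(fun t => Num.sqrt (M%:R * (XR i j t ^+ 2 + XI i j t ^+ 2)) ^+ p)%R]
               <= (Cp p)%:E)%E]].

Definition cmx N M (XR XI : 'I_N -> 'I_M -> R) : 'M[C]_(N, M) :=
  \matrix_(i, j) (XR i j +i* XI i j).

Definition covW N M (XR XI : 'I_N -> 'I_M -> R) : 'M[C]_N :=
  cmx XR XI *m adjmx (cmx XR XI).

End Defs.

(* Main.v *)
(** Let [G z = (YY^* - z)^-1] and let [s] be the Stieltjes transform of the Marchenko-Pastur
law.  All estimates are made at distance at least [1/h] from the real axis, where [h] is a
small power of [M] depending on [C0], so that crude bounds cost powers of [h] only.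
Removing a column (Sherman-Morrison) gives [E|<b, G b> - s|^2 <= h^51/M] and identifies
[E tr G - N s] up to small errors with an expression of imaginary part [O(1/h)].  A product
of Lorentzians is a combination of such imaginary parts; hence with probability
[1 - O(1/h)] the bounded eigenvalues are close to the support.  On that event [1/(x - z)],
[z] on the contour, is extrapolated from the points [z + k i/h], [k = 1..m], with error
[O(h^-m)], and the contour integrals become finite sums of [<b, G b> - s].  Smooth functions of
these sums are compared by exchanging one column at a time (Lindeberg): given the other
columns, the first two moments of an increment only involve, up to negligible errors, entry
moments of order at most 4. *)
Require Import Defs.
From HB Require Import structures.
From mathcomp Require Import all_boot all_order all_algebra.
From mathcomp Require Import all_classical all_reals all_analysis measurable_realfun.
From mathcomp.real_closed Require Import complex.
From mathcomp Require Import ring lra.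

Set Implicit Arguments.
Unset Strict Implicit.
Unset Printing Implicit Defensive.

Import Order.TTheory GRing.Theory Num.Theory.
Import numFieldNormedType.Exports.
Local Open Scope classical_set_scope.
Local Open Scope ring_scope.
Local Open Scope complex_scope.

(** One integer [m = 4 * expQ c], with [c >= C0], fixes all scales: [h] is [M] to the power [1 / m],
    and [rho], which is [M] to the power [-1/4], equals [h ^- expQ c]. So [rho] beats every power of
    [h] lost in crude bounds or to the growth of the test function, and [1 / m] is the final
    exponent. The same [m] is the number of Lorentzians, whose tails [h ^- (2 * m)] must beat [N],
    and the order of the extrapolation, whose error [h ^- m = 1 / M] must beat [sqrt M]. The
    obstacle is that [E tr G - N s] does not tend to zero: a bound of order one on it cannot exclude
    even a single stray eigenvalue. What saves the argument is that this order-one term is explicit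
    and real on the real axis off the support, whereas a Lorentzian sum is an imaginary part. A
    failure probability [O(1/h)] is affordable because the test function is bounded. The spectral
    decomposition behind [c0] is a choice, so the integrands of the statement are trapped between
    measurable functions built from resolvents. *)

Notation cabs := (@Normc.normc _).

Notation Re := (@complex.Re _).
Notation Im := (@complex.Im _).

(** * Complex vectors and resolvents *)

Lemma le_of_eq d (T : porderType d) (x y : T) : x = y -> (x <= y)%O.
by move=> ->. Qed.

Section ComplexModulus.
Variable R : realType.
Local Notation C := R[i].
Implicit Types x y z : C.

Lemma cabs_ge0 x : 0 <= cabs x.
by case: x => a b; rewrite sqrtr_ge0. Qed.
Lemma cabsM x y : cabs (x * y) = cabs x * cabs y.
exact: Normc.normcM. Qed.
Lemma cabsN x : cabs (- x) = cabs x.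
exact: (@normcN R x). Qed.
Lemma cabsV x : cabs x^-1 = (cabs x)^-1.
exact: Normc.normcV. Qed.
Lemma cabsD x y : cabs (x + y) <= cabs x + cabs y.
exact: (@le_normcD R x y). Qed.
Lemma cabs0 : cabs (0 : C) = 0.
exact: Normc.normc0. Qed.
Lemma cabs1 : cabs (1 : C) = 1.
exact: Normc.normc1. Qed.
Lemma cabsB x y : cabs (x - y) <= cabs x + cabs y.
by rewrite -(cabsN y); exact: cabsD. Qed.
Lemma cabsBC x y : cabs (x - y) = cabs (y - x).
by rewrite -cabsN opprB. Qed.
Lemma cabsX x n : cabs (x ^+ n) = cabs x ^+ n.
by elim: n => [|n IH]; rewrite ?expr0 ?cabs1 // !exprS cabsM IH. Qed.
Lemma cabs_eq0 x : (cabs x == 0) = (x == 0).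
by apply/eqP/eqP => [/Normc.eq0_normc //|->]; exact: cabs0.
Qed.
Lemma cabs_gt0 x : (0 < cabs x) = (x != 0).
by rewrite lt_neqAle cabs_ge0 andbT eq_sym cabs_eq0. Qed.
Lemma cabs_sum (I : Type) (r : seq I) (P : pred I) (F : I -> C) :
 cabs (\sum_(i <- r | P i) F i) <= \sum_(i <- r | P i) cabs (F i).
elim/big_rec2: _ => [|i y1 y2 _ H]; first by rewrite cabs0.
by apply: (le_trans (cabsD _ _)); rewrite lerD2l.
Qed.
Lemma cabs_sq x : cabs x ^+ 2 = Re x ^+ 2 + Im x ^+ 2.
by case: x => a b /=; rewrite sqr_sqrtr // addr_ge0 // sqr_ge0. Qed.
Lemma cabs_conj x : cabs (x^*)%C = cabs x.
by case: x => a b /=; rewrite sqrrN. Qed.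
Lemma cabs_real (r : R) : cabs (r%:C) = `|r|.
by rewrite /= expr0n /= addr0 sqrtr_sqr. Qed.
Lemma cabs_ge0r (r : R) : 0 <= r -> cabs (r%:C) = r.
by move=> r0; rewrite cabs_real ger0_norm. Qed.
Lemma cabs_natr n : cabs (n%:R : C) = n%:R.
by rewrite -(rmorph_nat (real_complex R)) cabs_ge0r // ler0n. Qed.
Lemma le_Re_cabs x : `|Re x| <= cabs x.
by rewrite -(@ler_pXn2r _ 2) ?nnegrE ?cabs_ge0 // cabs_sq real_normK ?num_real // lerDl sqr_ge0.
Qed.
Lemma le_Im_cabs x : `|Im x| <= cabs x.
by rewrite -(@ler_pXn2r _ 2) ?nnegrE ?cabs_ge0 // cabs_sq real_normK ?num_real // lerDr sqr_ge0.
Qed.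
Lemma cabs_le_ReIm x : cabs x <= `|Re x| + `|Im x|.
rewrite -(@ler_pXn2r _ 2) ?nnegrE ?cabs_ge0 ?addr_ge0 // cabs_sq.
rewrite sqrrD !real_normK ?num_real // -addrA lerD2l lerDr.
by rewrite mulrn_wge0 // mulr_ge0.
Qed.
Lemma conj_mul x : x * (x^*)%C = (cabs x ^+ 2)%:C.
by rewrite cabs_sq; case: x => a b /=; simpc; congr (_ +i* _); ring.
Qed.
Lemma cReD x y : Re (x + y) = Re x + Re y.
by case: x; case: y. Qed.
Lemma cImD x y : Im (x + y) = Im x + Im y.
by case: x; case: y. Qed.
Lemma cReN x : Re (- x) = - Re x.
by case: x. Qed.
Lemma cImN x : Im (- x) = - Im x.
by case: x. Qed.
Lemma cReM x y : Re (x * y) = Re x * Re y - Im x * Im y.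
by case: x; case: y. Qed.
Lemma cImM x y : Im (x * y) = Re x * Im y + Im x * Re y.
by case: x => a b; case: y => c e. Qed.
Lemma cRe_real (r : R) : Re (r%:C) = r. Proof. by []. Qed.
Lemma cIm_real (r : R) : Im (r%:C) = 0. Proof. by []. Qed.
Lemma cRe_conj x : Re (x^*)%C = Re x. Proof. by case: x. Qed.
Lemma cIm_conj x : Im (x^*)%C = - Im x. Proof. by case: x. Qed.
Lemma cIm_sum (I : Type) (r : seq I) (P : pred I) (F : I -> C) :
 Im (\sum_(i <- r | P i) F i) = \sum_(i <- r | P i) Im (F i).
by elim/big_rec2: _ => // i y1 y2 _ <-; rewrite cImD. Qed.
Lemma conjcD x y : ((x + y)^* = x^* + y^*)%C. Proof. exact: rmorphD. Qed.
Lemma conjcN x : ((- x)^* = - x^*)%C. Proof. exact: rmorphN. Qed.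
Lemma eqcP x y : Re x = Re y -> Im x = Im y -> x = y.
by case: x => a b; case: y => c e /= -> ->. Qed.

End ComplexModulus.

(** The squares of [B * f i - D * g i] add up to [B * (A * B - D ^+ 2)]; divide by [B], and if
    [B = 0] then [g] vanishes. *)
Lemma cauchy_schwarz_sum (R : realType) (I : finType) (f g : I -> R) :
 (\sum_i f i * g i) ^+ 2 <= (\sum_i f i ^+ 2) * (\sum_i g i ^+ 2).
set A := \sum_i f i ^+ 2; set B := \sum_i g i ^+ 2; set D := \sum_i f i * g i.
have B0 : 0 <= B by apply: sumr_ge0 => i _; exact: sqr_ge0.
have H : 0 <= \sum_i (B * f i - D * g i) ^+ 2.
 by apply: sumr_ge0 => i _; exact: sqr_ge0.
have E : \sum_i (B * f i - D * g i) ^+ 2 = B * (A * B - D ^+ 2).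
 under eq_bigr do rewrite sqrrB !exprMn.
 rewrite big_split sumrB /= -!mulr_sumr -/A -/B.
 have -> : \sum_i B * f i * (D * g i) *+ 2 = B * D * D *+ 2.
  rewrite [in RHS]/D mulr_sumr -sumrMnl; apply: eq_bigr => i _; congr (_ *+ 2).
  by rewrite -/D; ring.
 by rewrite mulr2n; ring.
have [B_eq0|Bn0] := eqVneq B 0.
 have g0 i : g i = 0.
  apply/eqP; rewrite -sqrf_eq0; apply/eqP.
  have/psumr_eq0P := B_eq0; apply => // k _; exact: sqr_ge0.
 rewrite B_eq0 mulr0 /D big1 ?expr0n // => i _; by rewrite g0 mulr0.
move: H; rewrite E pmulr_rge0 ?lt_neqAle ?B0 ?andbT 1?eq_sym //.
by rewrite subr_ge0.
Qed.

Section Vectors.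
Variable R : realType.
Local Notation C := R[i].

Lemma adjmxE m n (A : 'M[C]_(m, n)) i j : adjmx A i j = ((A j i)^*)%C.
by rewrite !mxE. Qed.
Lemma adjmxM m n p (A : 'M[C]_(m, n)) (B : 'M[C]_(n, p)) :
 adjmx (A *m B) = adjmx B *m adjmx A.
by rewrite /adjmx trmx_mul map_mxM. Qed.
Lemma adjmxK m n (A : 'M[C]_(m, n)) : adjmx (adjmx A) = A.
by apply/matrixP => i j; rewrite !mxE conjcK. Qed.
Lemma adjmxD m n (A B : 'M[C]_(m, n)) : adjmx (A + B) = adjmx A + adjmx B.
by apply/matrixP => i j; rewrite !mxE conjcD. Qed.
Lemma adjmxN m n (A : 'M[C]_(m, n)) : adjmx (- A) = - adjmx A.
by apply/matrixP => i j; rewrite !mxE conjcN. Qed.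
Lemma adjmx_scalar n (a : C) : adjmx (a%:M : 'M[C]_n) = ((a^*)%C)%:M.
by apply/matrixP => i j; rewrite !mxE rmorphMn /= eq_sym.
Qed.
Definition ip n (u v : 'cV[C]_n) : C := (adjmx u *m v) 0 0.
(** The squared norm, not the norm, so that bounds on vectors and operators involve no square
    roots. *)
Definition nv n (u : 'cV[C]_n) : R := \sum_i cabs (u i 0) ^+ 2.

Lemma ipE n (u v : 'cV[C]_n) : ip u v = \sum_i ((u i 0)^*)%C * v i 0.
by rewrite /ip mxE; apply: eq_bigr => i _; rewrite adjmxE. Qed.
Lemma nv_ge0 n (u : 'cV[C]_n) : 0 <= nv u.
by apply: sumr_ge0 => i _; exact: sqr_ge0. Qed.
Lemma ipuu n (u : 'cV[C]_n) : ip u u = (nv u)%:C.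
rewrite ipE /nv rmorph_sum /=; apply: eq_bigr => i _.
by rewrite mulrC conj_mul.
Qed.
Lemma ip_conj n (u v : 'cV[C]_n) : ((ip u v)^*)%C = ip v u.
rewrite !ipE rmorph_sum; apply: eq_bigr => i _.
by rewrite rmorphM /= conjcK mulrC.
Qed.
Lemma ip_adj m n (A : 'M[C]_(m, n)) u v : ip u (A *m v) = ip (adjmx A *m u) v.
by rewrite /ip adjmxM adjmxK mulmxA. Qed.
Lemma ipDr n (u v w : 'cV[C]_n) : ip u (v + w) = ip u v + ip u w.
by rewrite /ip mulmxDr mxE. Qed.
Lemma ipNr n (u v : 'cV[C]_n) : ip u (- v) = - ip u v.
by rewrite /ip mulmxN mxE. Qed.
Lemma ipZr n a (u v : 'cV[C]_n) : ip u (a *: v) = a * ip u v.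
by rewrite /ip -scalemxAr mxE. Qed.
Lemma ip_sumr n (I : finType) (u : 'cV[C]_n) (F : I -> 'cV[C]_n) :
 ip u (\sum_i F i) = \sum_i ip u (F i).
by rewrite /ip mulmx_sumr summxE. Qed.
Lemma cabs_ip n (u v : 'cV[C]_n) : cabs (ip u v) ^+ 2 <= nv u * nv v.
rewrite ipE; apply: (@le_trans _ _ ((\sum_i cabs (u i 0) * cabs (v i 0)) ^+ 2)).
 rewrite ler_pXn2r ?nnegrE ?cabs_ge0 //; last first.
  by apply: sumr_ge0 => i _; rewrite mulr_ge0 ?cabs_ge0.
 apply: (le_trans (cabs_sum _ _ _)); apply: ler_sum => i _.
 by rewrite cabsM cabs_conj.
exact: cauchy_schwarz_sum.
Qed.
Lemma nv_delta n (i : 'I_n) : nv (delta_mx i 0 : 'cV[C]_n) = 1.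
rewrite /nv (bigD1 i) //= big1 ?addr0 => [|k ki].
 by rewrite mxE !eqxx cabs1 expr1n.
by rewrite mxE (negbTE ki) cabs0 expr0n.
Qed.
Lemma ip_delta n (A : 'M[C]_n) i j : ip (delta_mx i 0) (A *m delta_mx j 0) = A i j.
rewrite ipE (bigD1 i) //= big1 ?addr0 => [|k ki]; last first.
 by rewrite mxE (negbTE ki) conjc0 mul0r.
rewrite mxE !eqxx conjc1 mul1r mxE (bigD1 j) //= big1 ?addr0 => [|k kj].
 by rewrite mxE !eqxx mulr1.
by rewrite mxE (negbTE kj) mulr0.
Qed.
(** A bound [k] on the operator norm, expressed on squared norms and without a supremum. *)
Definition opb n (A : 'M[C]_n) (k : R) := 0 <= k /\ forall u, nv (A *m u) <= k ^+ 2 * nv u.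

Lemma opbM n (A B : 'M[C]_n) k l : opb A k -> opb B l -> opb (A *m B) (k * l).
move=> [k0 HA] [l0 HB]; split; first exact: mulr_ge0.
move=> u; rewrite -mulmxA; apply: (le_trans (HA _)).
have := HB u; have := sqr_ge0 k; rewrite exprMn; nra.
Qed.
Lemma opb_entry n (A : 'M[C]_n) k i j : opb A k -> cabs (A i j) <= k.
move=> [k0 H]; rewrite -(@ler_pXn2r _ 2) ?nnegrE ?cabs_ge0 //.
rewrite -ip_delta; apply: (le_trans (cabs_ip _ _)).
by rewrite nv_delta mul1r; apply: (le_trans (H _)); rewrite nv_delta mulr1.
Qed.
Lemma opb_tr n (A : 'M[C]_n) k : opb A k -> cabs (\tr A) <= n%:R * k.
move=> H; apply: (le_trans (cabs_sum _ _ _)).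
apply: (@le_trans _ _ (\sum_(i < n) k)).
 by apply: ler_sum => i _; exact: opb_entry.
by rewrite sumr_const card_ord -[leLHS]mulr_natl.
Qed.
(** The [j]-th column is [A] applied to a unit vector, so its squared norm is at most [k ^+ 2]; add
    over the columns. *)
Lemma opb_fro n (A : 'M[C]_n) k : opb A k ->
 \sum_i \sum_j cabs (A i j) ^+ 2 <= n%:R * k ^+ 2.
move=> [k0 H]; rewrite exchange_big /=.
apply: (@le_trans _ _ (\sum_(i < n) k ^+ 2)); last first.
 by rewrite sumr_const card_ord -[leLHS]mulr_natl.
apply: ler_sum => j _; have := H (delta_mx j 0); rewrite nv_delta mulr1.
apply: le_trans; rewrite /nv; apply: ler_sum => i _.
rewrite mxE (bigD1 j) //= big1 ?addr0 => [|k' kj]; first by rewrite mxE !eqxx mulr1.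
by rewrite mxE (negbTE kj) mulr0.
Qed.

End Vectors.

Section Resolvent.
Variables (R : realType) (N M : nat).
Local Notation C := R[i].
Implicit Types (Y : 'M[C]_(N, M)) (z : C) (u v b : 'cV[C]_N) (j : 'I_M).

Definition shifted Y z : 'M[C]_N := Y *m adjmx Y - z%:M.
Definition Rs Y z : 'M[C]_N := invmx (shifted Y z).
(** Removing a column is done by zeroing it, so that matrix sizes, and hence types, do not
    change. *)
Definition zcol j Y : 'M[C]_(N, M) := \matrix_(i, k) (if k == j then 0 else Y i k).

Lemma ip_shifted Y z v :
 ip v (shifted Y z *m v) = (nv (adjmx Y *m v))%:C - z * (nv v)%:C.
rewrite /shifted mulmxBl ipDr ipNr -mulmxA ip_adj ipuu mul_scalar_mx ipZr ipuu.
by [].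
Qed.
(** The form [ip v (shifted Y z *m v)] has imaginary part [- Im z * nv v], and Cauchy-Schwarz
    compares it with the image of [v]. Invertibility off the real axis and the resolvent bound both
    follow. *)
Lemma shifted_lower Y z v : (Im z) ^+ 2 * nv v <= nv (shifted Y z *m v).
have [->|vn0] := eqVneq (nv v) 0; first by rewrite mulr0 nv_ge0.
have v0 : 0 < nv v by rewrite lt_neqAle eq_sym vn0 nv_ge0.
have H := cabs_ip v (shifted Y z *m v).
have : (Im (ip v (shifted Y z *m v))) ^+ 2 <= nv v * nv (shifted Y z *m v).
 by apply: le_trans H; rewrite cabs_sq lerDr sqr_ge0.
rewrite ip_shifted cImD cImN cImM cRe_real !cIm_real mulr0 !add0r sqrrN exprMn.
by rewrite [X in _ * X]expr2 mulrA mulrC ler_pM2l.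
Qed.

Section NonReal.
Variables (z : C).
Hypothesis z0 : Im z != 0.

Lemma nv_eq0 n (v : 'cV[C]_n) : nv v = 0 -> v = 0.
move=> H; apply/matrixP => i j; rewrite (ord1 j) mxE; apply/eqP.
rewrite -cabs_eq0 -sqrf_eq0; apply/eqP.
by have/psumr_eq0P := H; apply => // k _; exact: sqr_ge0.
Qed.
Lemma shifted_unit Y : shifted Y z \in unitmx.
rewrite unitmxE unitfE -det_tr; apply/negP => /det0P [v vn0 H].
have {}H : shifted Y z *m v^T = 0 by rewrite -[shifted Y z]trmxK -trmx_mul H trmx0.
have := shifted_lower Y z v^T; rewrite H.
have -> : nv (0 : 'cV[C]_N) = 0.
 by rewrite /nv big1 // => i _; rewrite mxE cabs0 expr0n.
rewrite pmulr_rle0 ?exprn_even_gt0 // => H0.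
have /nv_eq0 E : nv v^T = 0 by apply/eqP; rewrite eq_le H0 nv_ge0.
by move: vn0; rewrite -(trmxK v) E trmx0 eqxx.
Qed.
Lemma mul_shifted_Rs Y : shifted Y z *m Rs Y z = 1%:M.
by rewrite mulmxV // shifted_unit. Qed.
Lemma mul_Rs_shifted Y : Rs Y z *m shifted Y z = 1%:M.
by rewrite mulVmx // shifted_unit. Qed.
Lemma Rs_uniq Y (B : 'M[C]_N) : shifted Y z *m B = 1%:M -> B = Rs Y z.
by move=> H; rewrite -[B]mul1mx -(mul_Rs_shifted Y) -mulmxA H mulmx1. Qed.
Lemma Rs_opb Y : opb (Rs Y z) (`|Im z|^-1).
split; first by rewrite invr_ge0.
move=> u; have := shifted_lower Y z (Rs Y z *m u).
rewrite mulmxA mul_shifted_Rs mul1mx exprVn real_normK ?num_real // => H.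
by rewrite ler_pdivlMl // exprn_even_gt0.
Qed.
Lemma Rs_adj Y : adjmx (Rs Y z) = Rs Y (z^*)%C.
have z0' : Im (z^*)%C != 0 by rewrite cIm_conj oppr_eq0.
have : adjmx (Rs Y z) *m shifted Y (z^*)%C = 1%:M.
 have := congr1 (@adjmx R _ _) (mul_shifted_Rs Y); rewrite adjmxM adjmx_scalar conjc1.
 by rewrite /shifted adjmxD adjmxN adjmxM adjmxK adjmx_scalar.
move=> H; rewrite -[LHS]mulmx1 -(@mulmxV _ _ (shifted Y (z^*)%C)) ?mulmxA ?H ?mul1mx //.
move: z0' (Y); rewrite cIm_conj => z0' Y'.
rewrite unitmxE unitfE.
have -> : shifted Y' (z^*)%C = adjmx (shifted Y' z).
 by rewrite /shifted adjmxD adjmxN adjmxM adjmxK adjmx_scalar.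
rewrite /adjmx det_map_mx det_tr conjc_eq0 -unitfE -unitmxE.
exact: shifted_unit.
Qed.
(** With [v] the resolvent applied to [u], the number [z * ip u v] equals [z * nv (adjmx Y *m v)]
    minus a real number. Hence its imaginary part has the sign of [Im z]: this positivity keeps
    every denominator [1 + ip x (G x)] away from zero, and it is the sign condition that selects the
    root in [mpsol]. *)
Lemma ImM_ip_Rs Y u :
 Im z * Im (z * ip u (Rs Y z *m u)) = (Im z) ^+ 2 * nv (adjmx Y *m (Rs Y z *m u)).
set v := Rs Y z *m u.
have E : u = shifted Y z *m v by rewrite mulmxA mul_shifted_Rs mul1mx.
have -> : ip u v = ((ip v (shifted Y z *m v))^*)%C by rewrite ip_conj -E.
rewrite cImM cRe_conj cIm_conj ip_shifted cReD cImD cReN cImN cReM cImM !cRe_real !cIm_real; ring.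
Qed.
(** In [z + z * ip u (G u)] the two imaginary parts have the same sign and cannot cancel. *)
Lemma Im_den Y u : `|Im z| <= cabs z * cabs (1 + ip u (Rs Y z *m u)).
rewrite -cabsM; apply: le_trans (le_Im_cabs _).
rewrite mulrDr mulr1 cImD.
have H : 0 <= Im z * Im (z * ip u (Rs Y z *m u)).
 by rewrite ImM_ip_Rs mulr_ge0 ?sqr_ge0 ?nv_ge0.
move: H; set y := Im (z * _) => H.
rewrite -(@ler_pXn2r _ 2) ?nnegrE // !real_normK ?num_real // sqrrD.
by rewrite -addrA lerDl addr_ge0 ?sqr_ge0 // mulr2n addr_ge0.
Qed.
Lemma den_neq0 Y u : 1 + ip u (Rs Y z *m u) != 0.
apply/eqP => H; have := Im_den Y u; rewrite H cabs0 mulr0.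
by rewrite leNgt normr_gt0 z0.
Qed.
Lemma ImM_tr_Rs Y (m : R) : 0 <= m -> 0 <= Im z * Im (z * (\tr (Rs Y z) * m%:C)).
move=> m0; rewrite mulrA cImM cRe_real cIm_real mulr0 add0r.
rewrite mulrA mulr_ge0 // /mxtrace mulr_sumr cIm_sum mulr_sumr sumr_ge0 // => i _.
by rewrite -ip_delta ImM_ip_Rs mulr_ge0 ?sqr_ge0 ?nv_ge0.
Qed.

End NonReal.

Lemma gram_sum Y : Y *m adjmx Y = \sum_k col k Y *m adjmx (col k Y).
apply/matrixP => i l; rewrite summxE mxE; apply: eq_bigr => k _.
by rewrite [RHS]mxE big_ord1 !mxE.
Qed.
Lemma col_zcol j k Y : col k (zcol j Y) = if k == j then 0 else col k Y.
apply/matrixP => i l; rewrite !mxE; case: eqP => _; by rewrite !mxE.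
Qed.
Lemma shifted_zcol j Y z :
 shifted Y z = shifted (zcol j Y) z + col j Y *m adjmx (col j Y).
rewrite /shifted !gram_sum (bigD1 j) //= [in RHS](bigD1 j) //=.
rewrite col_zcol eqxx mul0mx add0r.
rewrite [in RHS](eq_bigr (fun k => col k Y *m adjmx (col k Y))) => [|k kj].
 by rewrite [RHS]addrC addrA.
by rewrite col_zcol (negbTE kj).
Qed.

Lemma sub_frac (F : fieldType) (a q : F) : 1 + q != 0 -> a - q * a / (1 + q) = a / (1 + q).
by move=> q0; field. Qed.
Section ShermanMorrison.
Variables (z : C) (Y : 'M[C]_(N, M)) (j : 'I_M).
Hypothesis z0 : Im z != 0.
Let x := col j Y.
Let G := Rs Y z.
Let Gj := Rs (zcol j Y) z.
Let q := ip x (Gj *m x).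

Lemma Rs_sm : G = Gj - (1 + q)^-1 *: (Gj *m x *m (adjmx x *m Gj)).
apply/esym/Rs_uniq => //.
rewrite (shifted_zcol j) mulmxDl !mulmxBr -!scalemxAr mul_shifted_Rs //.
rewrite !mulmxA mul_shifted_Rs // mul1mx.
have -> : col j Y *m adjmx (col j Y) *m Gj *m x *m adjmx x *m Gj
  = q *: (x *m adjmx x *m Gj).
 rewrite -/x -!mulmxA (mulmxA (adjmx x)) (mulmxA (adjmx x *m Gj)).
 rewrite [adjmx x *m Gj *m x]mx11_scalar -mulmxA -/(ip x _) -/q.
 by rewrite mul_scalar_mx -scalemxAr.
rewrite -/x scalerA.
set K := x *m adjmx x *m Gj.
have := den_neq0 z0 (zcol j Y) x; rewrite -/Gj -/q => qn0.
have E : K - (1 + q)^-1 *: K - ((1 + q)^-1 * q) *: K = 0.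
 rewrite -{1}[K]scale1r -!scalerBl (_ : _ - _ - _ = 0) ?scale0r //.
 by field.
by rewrite -[RHS]addr0 -E -!addrA; congr (_ + _); rewrite addrCA.
Qed.
Lemma ip_Rs_sm (a u : 'cV[C]_N) :
 ip a (G *m u) = ip a (Gj *m u) - ip a (Gj *m x) * ip x (Gj *m u) / (1 + q).
rewrite Rs_sm mulmxBl ipDr ipNr -scalemxAl ipZr; congr (_ - _).
rewrite mulrC -(mulmxA (Gj *m x)) -(mulmxA (adjmx x)).
rewrite [adjmx x *m (Gj *m u)]mx11_scalar -/(ip x _).
by rewrite mul_mx_scalar ipZr [in RHS](mulrC (ip a _)).
Qed.
Lemma ip_Rs_col (u : 'cV[C]_N) : ip x (G *m u) = ip x (Gj *m u) / (1 + q).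
rewrite ip_Rs_sm -/q; have := den_neq0 z0 (zcol j Y) x; rewrite -/Gj -/q => qn0.
exact: sub_frac.
Qed.
Lemma tr_Rs_sm : \tr G = \tr Gj - ip x (Gj *m Gj *m x) / (1 + q).
rewrite Rs_sm raddfB /= mxtraceZ mulrC; congr (_ - _ / _).
by rewrite mxtrace_mulC /mxtrace big_ord1 /ip !mulmxA.
Qed.

End ShermanMorrison.

Lemma mulz_Rs Y z : Im z != 0 -> z *: Rs Y z = Y *m adjmx Y *m Rs Y z - 1%:M.
move=> z0; rewrite -(mul_shifted_Rs z0 Y) /shifted mulmxBl mul_scalar_mx.
by rewrite opprB addrC subrK.
Qed.
(** From [z G = Y Y^* G - 1], split over the columns: a column [x] contributes
    [ip x (G x) = q / (1 + q)] by the rank-one formula. This identity is the source of the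
    self-consistent equation. *)
Lemma mulz_tr_Rs Y z : Im z != 0 ->
 z * \tr (Rs Y z) = \sum_j (1 - (1 + ip (col j Y) (Rs (zcol j Y) z *m col j Y))^-1) - N%:R.
move=> z0; rewrite -mxtraceZ mulz_Rs // raddfB /= mxtrace1 gram_sum mulmx_suml.
rewrite raddf_sum /=; congr (_ - _); apply: eq_bigr => j _.
rewrite -mulmxA mxtrace_mulC /mxtrace big_ord1 -mulmxA -/(ip _ _) ip_Rs_col //.
have := den_neq0 z0 (zcol j Y) (col j Y) => q0; by field.
Qed.
Lemma mulz_ip_Rs Y z b : Im z != 0 ->
 z * ip b (Rs Y z *m b) = \sum_j (ip b (col j Y) * ip (col j Y) (Rs (zcol j Y) z *m b)
   / (1 + ip (col j Y) (Rs (zcol j Y) z *m col j Y))) - ip b b.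
move=> z0; rewrite -ipZr scalemxAl mulz_Rs // mulmxBl mul1mx ipDr ipNr; congr (_ - _).
rewrite gram_sum mulmx_suml mulmx_suml ip_sumr; apply: eq_bigr => j _.
rewrite -mulrA -ip_Rs_col // -!mulmxA [adjmx (col j Y) *m _]mx11_scalar -/(ip _ _).
by rewrite mul_mx_scalar ipZr mulrC.
Qed.

End Resolvent.

(** * Random variables with all moments finite *)

Section Tame.
Context d (T : measurableType d) (R : realType) (P : probability T R).
Local Notation C := R[i].

(* Random variables with all moments finite: an algebra on which the
  expectation is a genuine linear functional. *)
Definition tame (f : T -> R) :=
 measurable_fun setT f /\ forall p : nat, (\int[P]_t (`|f t| ^+ p)%:E < +oo)%E.

Definition Ex (f : T -> R) : R := \int[P]_t f t.

Implicit Types f g : T -> R.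

Lemma integral_cst_prob (r : R) : (\int[P]_t r%:E = r%:E)%E.
by have := expectation_cst P r; rewrite unlock. Qed.
Lemma mfun_normX f p : measurable_fun setT f ->
 measurable_fun setT (fun t => (`|f t| ^+ p)%:E).
move=> mf; apply/measurable_EFinP; apply: measurable_funX.
by apply: measurableT_comp.
Qed.
Lemma tame_integrable f : tame f -> P.-integrable setT (EFin \o f).
move=> [mf H]; apply/integrableP; split; first exact/measurable_EFinP.
by have := H 1%N; under eq_integral do rewrite expr1.
Qed.
Lemma tame_le f g : measurable_fun setT f -> (forall t, `|f t| <= g t) ->
 tame g -> tame f.
move=> mf H [mg tg]; split=> // p; apply: le_lt_trans (tg p).
apply: ge0_le_integral => //.
- exact: mfun_normX.
- exact: mfun_normX.
- move=> t _; rewrite lee_fin lerXn2r ?nnegrE //.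
 by apply: (le_trans (H t)); rewrite ler_norm.
Qed.
Lemma tame_bnd f (B : R) : measurable_fun setT f -> (forall t, `|f t| <= B) -> tame f.
move=> mf H; split=> // p.
apply: (@le_lt_trans _ _ (\int[P]_t (B ^+ p)%:E)%E).
 apply: ge0_le_integral => //.
 - exact: mfun_normX.
 - by move=> t _; rewrite lee_fin lerXn2r ?nnegrE // (le_trans _ (H t)).
rewrite integral_cst_prob; exact: ltry.
Qed.
Lemma tameC c : tame (fun _ => c).
by apply: (@tame_bnd _ `|c|). Qed.
Lemma tame_abs f : tame f -> tame (fun t => `|f t|).
move=> [mf tf]; split; first exact: measurableT_comp.
by move=> p; under eq_integral do rewrite normr_id.
Qed.
Lemma addnX_le (a b : R) (p : nat) : 0 <= a -> 0 <= b ->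
 (a + b) ^+ p <= 2 ^+ p * (a ^+ p + b ^+ p).
move=> a0 b0; wlog ab : a b a0 b0 / a <= b.
 move=> H; case: (leP a b) => [ab|/ltW ba]; first exact: H.
 by rewrite addrC [_ ^+ p + _]addrC; apply: H.
apply: (@le_trans _ _ ((2 * b) ^+ p)).
 rewrite lerXn2r ?nnegrE ?addr_ge0 ?mulr_ge0 //.
 by rewrite mulr2n mulrDl !mul1r lerD2r.
rewrite exprMn; apply: ler_wpM2l; first by rewrite exprn_ge0.
by rewrite lerDr exprn_ge0.
Qed.
Lemma tameD f g : tame f -> tame g -> tame (fun t => f t + g t).
move=> [mf tf] [mg tg]; split; first exact: measurable_funD.
move=> p.
apply: (@le_lt_trans _ _ (\int[P]_t ((2 ^+ p)%:E * ((`|f t| ^+ p)%:E + (`|g t| ^+ p)%:E)))%E).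
 apply: ge0_le_integral => //.
 - by apply: mfun_normX; exact: measurable_funD.
 - by apply: measurable_funeM; apply: emeasurable_funD; exact: mfun_normX.
 - move=> t _; rewrite -EFinD -EFinM lee_fin.
  apply: le_trans (addnX_le _ _ _) => //.
  by rewrite lerXn2r ?nnegrE ?addr_ge0 // ler_normD.
rewrite ge0_integralZl //; last 2 first.
- by apply: emeasurable_funD; exact: mfun_normX.
- by move=> t _; rewrite adde_ge0 // lee_fin exprn_ge0.
rewrite ge0_integralD //; try exact: mfun_normX.
rewrite lte_mul_pinfty // ?lee_fin ?exprn_ge0 //.
by apply: lte_add_pinfty.
Qed.
Lemma tameX f n : tame f -> tame (fun t => f t ^+ n).
move=> [mf tf]; split; first exact: measurable_funX.
by move=> p; under eq_integral do rewrite normrX -exprM.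
Qed.
Lemma tameZ c f : tame f -> tame (fun t => c * f t).
move=> [mf tf]; split; first exact: measurable_funM.
move=> p; under eq_integral do rewrite normrM exprMn EFinM.
rewrite ge0_integralZl //; last exact: mfun_normX.
by rewrite lte_mul_pinfty // ?lee_fin ?exprn_ge0.
Qed.
Lemma tameN f : tame f -> tame (fun t => - f t).
move=> /(tameZ (-1)); congr tame; apply/funext => t; by rewrite mulN1r.
Qed.
Lemma tameB f g : tame f -> tame g -> tame (fun t => f t - g t).
by move=> tf tg; apply: tameD => //; exact: tameN. Qed.
Lemma tameM f g : tame f -> tame g -> tame (fun t => f t * g t).
move=> tf tg; have [mf _] := tf; have [mg _] := tg.
apply: (@tame_le _ (fun t => f t ^+ 2 + g t ^+ 2)).
- exact: measurable_funM.
- move=> t; rewrite normrM -(real_normK (num_real (f t))) -(real_normK (num_real (g t))).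
 have := sqr_ge0 (`|f t| - `|g t|); have := normr_ge0 (f t); have := normr_ge0 (g t); nra.
- by apply: tameD; exact: tameX.
Qed.
Lemma tame_sum (I : Type) (r : seq I) (Q : pred I) (F : I -> T -> R) :
 (forall i, tame (F i)) -> tame (fun t => \sum_(i <- r | Q i) F i t).
move=> H; elim: r => [|i r IH].
 by under eq_fun do rewrite big_nil; exact: tameC.
under eq_fun do rewrite big_cons; case: (Q i) => //; exact: tameD.
Qed.
Lemma ExD f g : tame f -> tame g -> Ex (fun t => f t + g t) = Ex f + Ex g.
by move=> tf tg; apply: RintegralD => //; exact: tame_integrable. Qed.
Lemma ExZ c f : tame f -> Ex (fun t => c * f t) = c * Ex f.
by move=> tf; apply: RintegralZl => //; exact: tame_integrable. Qed.
Lemma ExN f : tame f -> Ex (fun t => - f t) = - Ex f.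
by move=> tf; rewrite -mulN1r -ExZ //; apply: eq_Rintegral => t _; rewrite mulN1r.
Qed.
Lemma ExB f g : tame f -> tame g -> Ex (fun t => f t - g t) = Ex f - Ex g.
by move=> tf tg; rewrite ExD ?ExN //; exact: tameN. Qed.
Lemma Ex_cst c : Ex (fun _ => c) = c.
by rewrite /Ex /Rintegral integral_cst_prob. Qed.
Lemma Ex_sum (I : Type) (r : seq I) (Q : pred I) (F : I -> T -> R) :
 (forall i, tame (F i)) ->
 Ex (fun t => \sum_(i <- r | Q i) F i t) = \sum_(i <- r | Q i) Ex (F i).
move=> H; elim: r => [|i r IH].
 by under [in LHS]eq_fun do rewrite big_nil; rewrite big_nil Ex_cst.
under [in LHS]eq_fun do rewrite big_cons; rewrite big_cons.
case: (Q i) => //; rewrite ExD ?IH //; exact: tame_sum.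
Qed.
Lemma le_Ex f g : tame f -> tame g -> (forall t, f t <= g t) -> Ex f <= Ex g.
by move=> tf tg H; apply: le_Rintegral => //; exact: tame_integrable. Qed.
Lemma Ex_ge0 f : (forall t, 0 <= f t) -> 0 <= Ex f.
by move=> H; apply: Rintegral_ge0. Qed.
Lemma eq_Ex f g : f =1 g -> Ex f = Ex g.
by move=> H; apply: eq_Rintegral => t _. Qed.
Lemma Ex_abs f : tame f -> `|Ex f| <= Ex (fun t => `|f t|).
by move=> tf; apply: le_normr_Rintegral => //; exact: tame_integrable. Qed.
Lemma Ex_CS f g : tame f -> tame g ->
 (Ex (fun t => f t * g t)) ^+ 2 <= Ex (fun t => f t ^+ 2) * Ex (fun t => g t ^+ 2).
move=> tf tg; set D := Ex (fun t => f t * g t); set A := Ex (fun t => f t ^+ 2).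
set B := Ex (fun t => g t ^+ 2).
have tff := tameX 2 tf; have tgg := tameX 2 tg; have tfg := tameM tf tg.
have H u v : 0 <= u ^+ 2 * A - 2 * u * v * D + v ^+ 2 * B.
 have E : Ex (fun t => u ^+ 2 * f t ^+ 2 - 2 * u * v * (f t * g t) + v ^+ 2 * g t ^+ 2)
   = u ^+ 2 * A - 2 * u * v * D + v ^+ 2 * B.
  rewrite ExD ?ExB ?ExZ //; [exact: tameZ|exact: tameZ| |exact: tameZ].
  by apply: tameB; exact: tameZ.
 rewrite -E; apply: Ex_ge0 => t.
 by rewrite (_ : _ + _ = (u * f t - v * g t) ^+ 2) ?sqr_ge0 //; ring.
have A0 : 0 <= A by apply: Ex_ge0 => t; exact: sqr_ge0.
have B0 : 0 <= B by apply: Ex_ge0 => t; exact: sqr_ge0.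
have [B_eq0|Bn0] := eqVneq B 0.
 have D0 : D = 0.
  apply/eqP; apply/negP => /negP Dn0.
  (* With [B = 0] the form is affine in its second argument; at this point it takes the value
     [A - (A + 1) = -1]. *)
  have := H 1 ((A + 1) / (2 * D)); rewrite B_eq0 mulr0 addr0 expr1n mul1r mulr1.
  have -> : 2 * ((A + 1) / (2 * D)) * D = A + 1 by field.
  lra.
 by rewrite D0 B_eq0 mulr0 expr0n.
have Bp : 0 < B by rewrite lt_neqAle eq_sym Bn0.
have := H B D.
rewrite (_ : _ + _ = B * (A * B - D ^+ 2)); last by ring.
by rewrite pmulr_rge0 // subr_ge0.
Qed.
Definition mfc (f : T -> C) :=
 measurable_fun setT (fun t => Re (f t)) /\ measurable_fun setT (fun t => Im (f t)).
Definition tamec (f : T -> C) := tame (fun t => Re (f t)) /\ tame (fun t => Im (f t)).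
Definition Exc (f : T -> C) : C := Ex (fun t => Re (f t)) +i* Ex (fun t => Im (f t)).

Implicit Types F G : T -> C.

Lemma mfcC c : mfc (fun _ => c). Proof. by split; exact: measurable_cst. Qed.
Lemma mfcD F G : mfc F -> mfc G -> mfc (fun t => F t + G t).
move=> [? ?] [? ?]; split.
- by under eq_fun do rewrite cReD; exact: measurable_funD.
- by under eq_fun do rewrite cImD; exact: measurable_funD.
Qed.
Lemma mfcM F G : mfc F -> mfc G -> mfc (fun t => F t * G t).
move=> [? ?] [? ?]; split.
- by under eq_fun do rewrite cReM; apply: measurable_funB; exact: measurable_funM.
- by under eq_fun do rewrite cImM; apply: measurable_funD; exact: measurable_funM.
Qed.
Lemma mfcN F : mfc F -> mfc (fun t => - F t).
move=> /(mfcM (mfcC (-1))); congr mfc; apply/funext => t; exact: mulN1r.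
Qed.
Lemma mfcB F G : mfc F -> mfc G -> mfc (fun t => F t - G t).
by move=> mF mG; apply: mfcD => //; exact: mfcN. Qed.
Lemma mfcJ F : mfc F -> mfc (fun t => ((F t)^*)%C).
move=> [? ?]; split; first by under eq_fun do rewrite cRe_conj.
by under eq_fun do rewrite cIm_conj; exact: measurable_funN.
Qed.
Lemma mfc_sum (I : Type) (r : seq I) (Q : pred I) (F : I -> T -> C) :
 (forall i, mfc (F i)) -> mfc (fun t => \sum_(i <- r | Q i) F i t).
move=> H; elim: r => [|i r IH].
 by under eq_fun do rewrite big_nil; exact: mfcC.
under eq_fun do rewrite big_cons; case: (Q i) => //; exact: mfcD.
Qed.
Lemma mfc_prod (I : Type) (r : seq I) (Q : pred I) (F : I -> T -> C) :
 (forall i, mfc (F i)) -> mfc (fun t => \prod_(i <- r | Q i) F i t).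
move=> H; elim: r => [|i r IH].
 by under eq_fun do rewrite big_nil; exact: mfcC.
under eq_fun do rewrite big_cons; case: (Q i) => //; exact: mfcM.
Qed.
Lemma mfc_cabs2 F : mfc F -> measurable_fun setT (fun t => cabs (F t) ^+ 2).
move=> [? ?]; under eq_fun do rewrite cabs_sq.
by apply: measurable_funD; exact: measurable_funX.
Qed.
Lemma mfc_cabs F : mfc F -> measurable_fun setT (fun t => cabs (F t)).
move=> mF; have := mfc_cabs2 mF => H.
under eq_fun do rewrite -[cabs _](ger0_norm (cabs_ge0 _)) -sqrtr_sqr -powR12_sqrt ?sqr_ge0 //.
exact: measurableT_comp (measurable_powR _) H.
Qed.
Lemma mfcV F : mfc F -> mfc (fun t => (F t)^-1).
move=> mF.
(* Inversion is written through a real power, whose measurability is known; where [F] vanishes both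
   sides are zero. *)
have E t : (F t)^-1 = ((F t)^*)%C * (powR (cabs (F t) ^+ 2) (-1))%:C.
 have [->|Fn0] := eqVneq (F t) 0; first by rewrite invr0 conjc0 mul0r.
 rewrite powR_inv1 ?sqr_ge0 //.
 have c0 : ((cabs (F t) ^+ 2)%:C) != 0 :> C.
  by rewrite -conj_mul mulf_neq0 // conjc_eq0.
 apply: (mulfI c0); rewrite mulrCA -rmorphM mulfV ?mulr1 /=; last first.
  by rewrite sqrf_eq0 cabs_eq0.
 by rewrite -conj_mul mulrAC mulfV // mul1r.
under eq_fun do rewrite E.
apply: mfcM; first exact: mfcJ.
split; last exact: measurable_cst.
exact: measurableT_comp (measurable_powR _) (mfc_cabs2 mF).
Qed.
Lemma mfc_real f : measurable_fun setT f -> mfc (fun t => (f t)%:C).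
by move=> mf; split => //; exact: measurable_cst. Qed.
Lemma tamec_mfc F : tamec F -> mfc F. Proof. by move=> [[? _] [? _]]. Qed.
Lemma tamec_cabs F : tamec F -> tame (fun t => cabs (F t)).
move=> tF; apply: (@tame_le _ (fun t => `|Re (F t)| + `|Im (F t)|)).
- exact: mfc_cabs (tamec_mfc tF).
- by move=> t; rewrite ger0_norm ?cabs_ge0 // cabs_le_ReIm.
- by case: tF => ? ?; apply: tameD; exact: tame_abs.
Qed.
Lemma tame_cabsX F n : tamec F -> tame (fun t => cabs (F t) ^+ n).
by move=> tF; apply: tameX; exact: tamec_cabs. Qed.
Lemma tamec_le F g : mfc F -> (forall t, cabs (F t) <= g t) -> tame g -> tamec F.
move=> [m1 m2] H tg; split; apply: (tame_le _ _ tg) => // t.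
- exact: le_trans (le_Re_cabs _) (H t).
- exact: le_trans (le_Im_cabs _) (H t).
Qed.
Lemma tamec_bnd F B : mfc F -> (forall t, cabs (F t) <= B) -> tamec F.
by move=> mF H; apply: (tamec_le mF H); exact: tameC. Qed.
Lemma tamecC c : tamec (fun _ => c). Proof. by split; exact: tameC. Qed.
Lemma tamec_real f : tame f -> tamec (fun t => (f t)%:C).
by move=> tf; split => //; exact: tameC. Qed.
Lemma tamecD F G : tamec F -> tamec G -> tamec (fun t => F t + G t).
move=> [? ?] [? ?]; split.
- by under eq_fun do rewrite cReD; exact: tameD.
- by under eq_fun do rewrite cImD; exact: tameD.
Qed.
Lemma tamecM F G : tamec F -> tamec G -> tamec (fun t => F t * G t).
move=> [? ?] [? ?]; split.
- by under eq_fun do rewrite cReM; apply: tameB; exact: tameM.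
- by under eq_fun do rewrite cImM; apply: tameD; exact: tameM.
Qed.
Lemma tamecZ c F : tamec F -> tamec (fun t => c * F t).
by apply: tamecM; exact: tamecC. Qed.
Lemma tamecN F : tamec F -> tamec (fun t => - F t).
move=> /(tamecM (tamecC (-1))); congr tamec; apply/funext => t; exact: mulN1r.
Qed.
Lemma tamecB F G : tamec F -> tamec G -> tamec (fun t => F t - G t).
by move=> mF mG; apply: tamecD => //; exact: tamecN. Qed.
Lemma tamecJ F : tamec F -> tamec (fun t => ((F t)^*)%C).
move=> [? ?]; split; first by under eq_fun do rewrite cRe_conj.
by under eq_fun do rewrite cIm_conj; exact: tameN.
Qed.
Lemma tamecX F n : tamec F -> tamec (fun t => F t ^+ n).
move=> tF; elim: n => [|n IH]; first by under eq_fun do rewrite expr0; exact: tamecC.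
by under eq_fun do rewrite exprS; exact: tamecM.
Qed.
Lemma tamec_sum (I : Type) (r : seq I) (Q : pred I) (F : I -> T -> C) :
 (forall i, tamec (F i)) -> tamec (fun t => \sum_(i <- r | Q i) F i t).
move=> H; elim: r => [|i r IH].
 by under eq_fun do rewrite big_nil; exact: tamecC.
under eq_fun do rewrite big_cons; case: (Q i) => //; exact: tamecD.
Qed.
Lemma eq_Exc F G : F =1 G -> Exc F = Exc G.
by move=> H; congr (_ +i* _); apply: eq_Ex => t; rewrite H. Qed.
Lemma ExcD F G : tamec F -> tamec G -> Exc (fun t => F t + G t) = Exc F + Exc G.
move=> [? ?] [? ?]; rewrite /Exc; simpc; congr (_ +i* _); rewrite -ExD //; apply: eq_Ex => t.
- exact: cReD.
- exact: cImD.
Qed.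
Lemma Exc_real f : Exc (fun t => (f t)%:C) = (Ex f)%:C.
by rewrite /Exc /= Ex_cst. Qed.
Lemma Exc_cst c : Exc (fun _ => c) = c.
by rewrite /Exc !Ex_cst; case: c. Qed.
Lemma ExcZ c F : tamec F -> Exc (fun t => c * F t) = c * Exc F.
move=> [? ?]; apply: eqcP; rewrite ?cReM ?cImM /=.
- by rewrite -!ExZ // -ExB; [apply: eq_Ex => t; exact: cReM|exact: tameZ|exact: tameZ].
- by rewrite -!ExZ // -ExD; [apply: eq_Ex => t; exact: cImM|exact: tameZ|exact: tameZ].
Qed.
Lemma ExcN F : tamec F -> Exc (fun t => - F t) = - Exc F.
by move=> tF; rewrite -mulN1r -ExcZ //; apply: eq_Exc => t; rewrite mulN1r.
Qed.
Lemma ExcB F G : tamec F -> tamec G -> Exc (fun t => F t - G t) = Exc F - Exc G.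
by move=> tF tG; rewrite ExcD ?ExcN //; exact: tamecN. Qed.
Lemma Exc_sum (I : Type) (r : seq I) (Q : pred I) (F : I -> T -> C) :
 (forall i, tamec (F i)) ->
 Exc (fun t => \sum_(i <- r | Q i) F i t) = \sum_(i <- r | Q i) Exc (F i).
move=> H; elim: r => [|i r IH].
 by under eq_Exc do rewrite big_nil; rewrite big_nil Exc_cst.
under eq_Exc do rewrite big_cons; rewrite big_cons.
case: (Q i) => //; rewrite ExcD ?IH //; exact: tamec_sum.
Qed.
Lemma Exc_conj F : tamec F -> Exc (fun t => ((F t)^*)%C) = ((Exc F)^*)%C.
move=> [? ?]; rewrite /Exc /=; congr (_ +i* _); first by apply: eq_Ex => t; rewrite cRe_conj.
by rewrite -ExN //; apply: eq_Ex => t; rewrite cIm_conj.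
Qed.
(** Rotating by the conjugate of the expectation [e] turns [cabs e ^+ 2] into the mean of a real
    part, which is at most [cabs e] times the mean modulus. *)
Lemma cabs_Exc F : tamec F -> cabs (Exc F) <= Ex (fun t => cabs (F t)).
move=> tF; set e := Exc F.
have [->|en0] := eqVneq e 0.
 by rewrite cabs0; apply: Ex_ge0 => t; exact: cabs_ge0.
have ep : 0 < cabs e by rewrite cabs_gt0.
rewrite -(ler_pM2l ep) -expr2.
have -> : cabs e ^+ 2 = Ex (fun t => Re ((e^*)%C * F t)).
 have -> : Ex (fun t => Re ((e^*)%C * F t)) = Re (Exc (fun t => (e^*)%C * F t)) by [].
 by rewrite ExcZ // mulrC conj_mul.
rewrite -ExZ; last exact: tamec_cabs.
have t1 : tamec (fun t => (e^*)%C * F t) by exact: tamecZ.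
apply: le_Ex; [by case: t1|by apply: tameZ; exact: tamec_cabs|].
move=> t; apply: le_trans (ler_norm _) _; apply: le_trans (le_Re_cabs _) _.
by rewrite cabsM cabs_conj.
Qed.
Definition mfmx m n (A : T -> 'M[C]_(m, n)) := forall i j, mfc (fun t => A t i j).
Definition tamemx m n (A : T -> 'M[C]_(m, n)) := forall i j, tamec (fun t => A t i j).

Lemma mfmxC m n (A : 'M[C]_(m, n)) : mfmx (fun _ => A).
by move=> i j; exact: mfcC. Qed.
Lemma mfmxM m n p (A : T -> 'M[C]_(m, n)) (B : T -> 'M[C]_(n, p)) :
 mfmx A -> mfmx B -> mfmx (fun t => A t *m B t).
move=> mA mB i j; under eq_fun do rewrite mxE; apply: mfc_sum => k; exact: mfcM.
Qed.
Lemma mfmxB m n (A B : T -> 'M[C]_(m, n)) : mfmx A -> mfmx B -> mfmx (fun t => A t - B t).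
by move=> mA mB i j; under eq_fun do rewrite !mxE; exact: mfcB. Qed.
Lemma mfmx_adj m n (A : T -> 'M[C]_(m, n)) : mfmx A -> mfmx (fun t => adjmx (A t)).
by move=> mA i j; under eq_fun do rewrite adjmxE; exact: mfcJ. Qed.
Lemma mfc_ip n (u v : T -> 'cV[C]_n) : mfmx u -> mfmx v -> mfc (fun t => ip (u t) (v t)).
by move=> mu mv; apply: mfmxM => //; exact: mfmx_adj. Qed.
Lemma mfc_det n (A : T -> 'M[C]_n) : mfmx A -> mfc (fun t => \det (A t)).
move=> mA; apply: mfc_sum => s; apply: mfcM; first exact: mfcC.
by apply: mfc_prod => i.
Qed.
Lemma mfmx_inv n (A : T -> 'M[C]_n) : (forall t, A t \in unitmx) ->
 mfmx A -> mfmx (fun t => invmx (A t)).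
move=> uA mA i j; under eq_fun do rewrite /invmx uA !mxE.
apply: mfcM; first by apply: mfcV; exact: mfc_det.
apply: mfcM; first exact: mfcC.
by apply: mfc_det => k l; under eq_fun do rewrite !mxE; exact: mA.
Qed.
Lemma mfmx_Rs N M (Y : T -> 'M[C]_(N, M)) z : Im z != 0 ->
 mfmx Y -> mfmx (fun t => Rs (Y t) z).
move=> z0 mY; apply: mfmx_inv => [t|]; first exact: shifted_unit.
by apply: mfmxB; [apply: mfmxM => //; exact: mfmx_adj|exact: mfmxC].
Qed.
Lemma tamemx_mf m n (A : T -> 'M[C]_(m, n)) : tamemx A -> mfmx A.
by move=> tA i j; exact: tamec_mfc. Qed.
Lemma tamemxC m n (A : 'M[C]_(m, n)) : tamemx (fun _ => A).
by move=> i j; exact: tamecC. Qed.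
Lemma tamemxM m n p (A : T -> 'M[C]_(m, n)) (B : T -> 'M[C]_(n, p)) :
 tamemx A -> tamemx B -> tamemx (fun t => A t *m B t).
move=> mA mB i j; under eq_fun do rewrite mxE; apply: tamec_sum => k; exact: tamecM.
Qed.
Lemma tamemx_adj m n (A : T -> 'M[C]_(m, n)) : tamemx A -> tamemx (fun t => adjmx (A t)).
by move=> mA i j; under eq_fun do rewrite adjmxE; exact: tamecJ. Qed.
Lemma tamec_tr n (A : T -> 'M[C]_n) : tamemx A -> tamec (fun t => \tr (A t)).
by move=> mA; apply: tamec_sum. Qed.
Lemma tamec_ip n (u v : T -> 'cV[C]_n) : tamemx u -> tamemx v -> tamec (fun t => ip (u t) (v t)).
by move=> mu mv; apply: tamemxM => //; exact: tamemx_adj. Qed.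
Lemma tamemx_Rs N M (Y : T -> 'M[C]_(N, M)) z : Im z != 0 ->
 mfmx Y -> tamemx (fun t => Rs (Y t) z).
move=> z0 mY i j; apply: (@tamec_bnd _ (`|Im z|^-1)); first exact: mfmx_Rs.
by move=> t; apply: opb_entry; exact: Rs_opb.
Qed.

End Tame.

(** * The space of matrices and independence of entries *)

Definition mfun_of d d' (T : measurableType d) (T' : measurableType d') (f : T -> T')
  (mf : measurable_fun setT f) : {mfun T >-> T'} :=
 HB.pack f (isMeasurableFun.Build _ _ _ _ f mf).

Section EntrySpace.
Variables (R : realType) (N M : nat).
Local Notation C := R[i].

Definition Ent : Type := 'I_N -> 'I_M -> R * R.
HB.instance Definition _ := Pointed.on Ent.

Implicit Types (A B : 'I_N -> 'I_M -> set R).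

Definition rect A B : set Ent :=
 [set c | forall i j, A i j (c i j).1 /\ B i j (c i j).2].
Definition mrect A B := forall i j, measurable (A i j) /\ measurable (B i j).
(** These are the sets on which independence is assumed. The sigma-algebra on the space of entries
    is generated by them, so the hypothesis determines the law of the matrix. *)
Definition rects : set (set Ent) := [set S | exists A B, mrect A B /\ S = rect A B].
Definition EntT := g_sigma_algebraType rects.

Definition entmx (c : Ent) : 'M[C]_(N, M) := \matrix_(i, j) ((c i j).1 +i* (c i j).2).

Lemma measurable_rect A B : mrect A B -> measurable (rect A B : set EntT).
by move=> m; apply: sub_sigma_algebra; exists A, B. Qed.
Lemma rectsI : setI_closed rects.
move=> _ _ [A [B [mAB ->]]] [A' [B' [mAB' ->]]].
exists (fun i j => A i j `&` A' i j), (fun i j => B i j `&` B' i j); split.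
 by move=> i j; have [? ?] := mAB i j; have [? ?] := mAB' i j; split; exact: measurableI.
apply/seteqP; split => c /=.
 by move=> [H H'] i j; have [? ?] := H i j; have [? ?] := H' i j.
by move=> H; split=> i j; have [[? ?] [? ?]] := H i j.
Qed.
Lemma measurable_ent1 i j : measurable_fun setT (fun c : EntT => (c i j).1).
move=> _ X mX; rewrite setTI; apply: sub_sigma_algebra.
exists (fun k l => if (k == i) && (l == j) then X else setT), (fun _ _ => setT); split.
 by move=> k l; split => //; case: ifP.
apply/seteqP; split => c /=.
 by move=> H k l; split => //; case: ifP => // /andP[/eqP -> /eqP ->].
by move=> /(_ i j); rewrite !eqxx /= => -[].
Qed.
Lemma measurable_ent2 i j : measurable_fun setT (fun c : EntT => (c i j).2).
move=> _ X mX; rewrite setTI; apply: sub_sigma_algebra.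
exists (fun _ _ => setT), (fun k l => if (k == i) && (l == j) then X else setT); split.
 by move=> k l; split => //; case: ifP.
apply/seteqP; split => c /=.
 by move=> H k l; split => //; case: ifP => // /andP[/eqP -> /eqP ->].
by move=> /(_ i j); rewrite !eqxx /= => -[].
Qed.
Lemma measurable_rect_preimage d (T : measurableType d) (f : T -> Ent) A B :
 (forall i j, measurable_fun setT (fun t => (f t i j).1)) ->
 (forall i j, measurable_fun setT (fun t => (f t i j).2)) ->
 mrect A B -> measurable (f @^-1` rect A B).
move=> m1 m2 mAB.
have -> : f @^-1` rect A B = \bigcap_(i in [set: 'I_N]) \bigcap_(j in [set: 'I_M])
  (((fun t => (f t i j).1) @^-1` A i j) `&` ((fun t => (f t i j).2) @^-1` B i j)).
 by apply/seteqP; split => [t H i _ j _|t H i j]; [exact: H|exact: (H i _ j _)].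
apply: fin_bigcap_measurable => // i _; apply: fin_bigcap_measurable => // j _.
have [mA mB] := mAB i j; apply: measurableI.
- by rewrite -[X in measurable X]setTI; exact: m1.
- by rewrite -[X in measurable X]setTI; exact: m2.
Qed.
Lemma measurable_EntP d (T : measurableType d) (f : T -> EntT) :
 (forall i j, measurable_fun setT (fun t => (f t i j).1)) ->
 (forall i j, measurable_fun setT (fun t => (f t i j).2)) ->
 measurable_fun setT f.
move=> m1 m2; apply: (@measurability _ _ T EntT setT f rects) => //.
move=> _ [_ [A [B [mAB ->]]] <-]; rewrite setTI.
exact: measurable_rect_preimage.
Qed.

Implicit Types (p q : 'I_N -> 'I_M -> set R -> set R -> R).

(** [p i j A B] is the joint probability that the real part lies in [A] and the imaginary part in
    [B]: different entries are independent, while the two parts of one entry may be dependent. *)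
Definition prodlaw (mu : probability EntT R) p :=
 (forall i j, p i j setT setT = 1) /\
 forall A B, mrect A B -> mu (rect A B) = (\prod_(i < N) \prod_(j < M) p i j (A i j) (B i j))%:E.

Lemma prodlaw_uniq mu nu p : prodlaw mu p -> prodlaw nu p ->
 forall S, measurable S -> mu S = nu S.
move=> [p1 Hm] [_ Hn] S mS.
apply: (@measure_unique _ R EntT rects (fun _ => setT) erefl rectsI _ _ mu nu) => //.
- move=> _; exists (fun _ _ => setT), (fun _ _ => setT); split; first by [].
 by apply/seteqP; split.
- by apply/seteqP; split => // x _; exists 0%N.
- by move=> _ [A [B [mAB ->]]]; exact: etrans (Hm _ _ mAB) (esym (Hn _ _ mAB)).
- move=> _; apply: (le_lt_trans (probability_le1 _ _)) => //.
 exact: ltry.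
Qed.
(** Resampling: for independent [x] and [y], freezing [y] amounts to conditioning on the coordinates
    outside [S]. *)
Definition mix (S : 'I_N -> 'I_M -> bool) (x y : Ent) : Ent :=
 fun i j => if S i j then x i j else y i j.

Lemma measurable_mix S :
 measurable_fun setT (fun yx : EntT * EntT => mix S yx.2 yx.1 : EntT).
apply: measurable_EntP => i j; rewrite /mix; case: (S i j).
- exact: measurableT_comp (measurable_ent1 i j) measurable_snd.
- exact: measurableT_comp (measurable_ent1 i j) measurable_fst.
- exact: measurableT_comp (measurable_ent2 i j) measurable_snd.
- exact: measurableT_comp (measurable_ent2 i j) measurable_fst.
Qed.
Lemma prodlaw_mix mu nu p q S : prodlaw mu p -> prodlaw nu q ->
 prodlaw (distribution (nu \x mu)%E (mfun_of (measurable_mix S)))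
  (fun i j => if S i j then p i j else q i j).
move=> [p1 Hm] [q1 Hn]; split; first by move=> i j; case: ifP.
move=> A B mAB; rewrite /distribution /pushforward /=.
pose R1 (X : 'I_N -> 'I_M -> set R) i j := if S i j then setT else X i j.
pose R2 (X : 'I_N -> 'I_M -> set R) i j := if S i j then X i j else setT.
have m1 : mrect (R1 A) (R1 B) by move=> i j; rewrite /R1; case: (S i j) => //; split.
have m2 : mrect (R2 A) (R2 B) by move=> i j; rewrite /R2; case: (S i j) => //; split.
have -> : (fun yx : EntT * EntT => mix S yx.2 yx.1) @^-1` rect A B =
  rect (R1 A) (R1 B) `*` rect (R2 A) (R2 B).
 apply/seteqP; split => -[y x] /=.
  move=> H; split => i j; have := H i j; rewrite /mix /R1 /R2; case: (S i j) => //=.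
 by move=> [H1 H2] i j; have := H1 i j; have := H2 i j; rewrite /mix /R1 /R2; case: (S i j).
rewrite product_measure1E; try exact: measurable_rect.
apply: (etrans (congr2 mule (Hn _ _ m1) (Hm _ _ m2))).
rewrite -EFinM; congr (_%:E); rewrite -big_split; apply: eq_bigr => i _ /=.
rewrite -big_split; apply: eq_bigr => j _ /=; rewrite /R1 /R2.
by case: (S i j); rewrite ?p1 ?q1 ?mul1r ?mulr1.
Qed.
(** Fubini on the product law, pushed forward by [mix]. With equal laws this is the tower property;
    letting the three laws differ is what allows a column to be exchanged between two ensembles. *)
Lemma Ex_mix3 (ka mu nu : probability EntT R) p q r S (F : EntT -> R) :
 prodlaw mu p -> prodlaw nu q -> prodlaw ka r ->
 (forall i j, r i j = if S i j then p i j else q i j) ->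
 ka.-integrable setT (EFin \o F) ->
 (forall y, mu.-integrable setT (EFin \o (fun x => F (mix S x y)))) ->
 nu.-integrable setT (EFin \o (fun y => Ex mu (fun x => F (mix S x y)))) /\
 Ex ka F = Ex nu (fun y => Ex mu (fun x => F (mix S x y))).
move=> Hm Hn Hk rE iF iy.
have Hk' := prodlaw_mix S Hm Hn.
set Z := mfun_of (measurable_mix S) in Hk'.
set PP := (nu \x mu)%E in Hk'.
have kE : forall X, measurable X -> ka X = distribution PP Z X.
 apply: (prodlaw_uniq Hk); split; first by have [] := Hk.
 move=> A B mAB; rewrite (proj2 Hk') //; congr (_%:E).
 by apply: eq_bigr => i _; apply: eq_bigr => j _; rewrite rE.
have mF : measurable_fun setT (EFin \o F) by case/integrableP: iF.
have iZ : PP.-integrable setT ((EFin \o F) \o Z).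
 apply/integrableP; split; first exact: measurableT_comp.
 case/integrableP: iF => _; rewrite (eq_measure_integral (distribution PP Z)) => [|X mX _]; last exact: kE.
 rewrite ge0_integral_distribution //; exact: measurableT_comp.
have E1 y : fubini_F mu ((EFin \o F) \o Z) y = (Ex mu (fun x => F (mix S x y)))%:E.
 rewrite /fubini_F /= /Ex /Rintegral fineK //.
 exact: (integrable_fin_num _ (iy y)).
split.
 have := integrable_fubini_F iZ.
 by congr (_.-integrable _ _); apply/funext => y; rewrite E1.
rewrite {1}/Ex /Rintegral (eq_measure_integral (distribution PP Z)) => [|X mX _]; last exact: kE.
rewrite integral_distribution // -integral12_prod_meas1 //.
by rewrite [RHS]/Ex /Rintegral; congr fine; apply: eq_integral => y _; rewrite E1.
Qed.

End EntrySpace.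

Notation mxlaw R N M := (probability (EntT R N M) R).

Section Decouple.
Variables (R : realType) (N M : nat).
Local Notation C := R[i].
Variables (mu : mxlaw R N M) (p : 'I_N -> 'I_M -> set R -> set R -> R).
Hypothesis Hmu : prodlaw mu p.
Implicit Types (F H f g : EntT R N M -> R) (S : 'I_N -> 'I_M -> bool).

Lemma Ex_mix S F : tame mu F -> (forall y, tame mu (fun x => F (mix S x y))) ->
 mu.-integrable setT (EFin \o (fun y => Ex mu (fun x => F (mix S x y)))) /\
 Ex mu F = Ex mu (fun y => Ex mu (fun x => F (mix S x y))).
move=> tF ty; apply: (Ex_mix3 Hmu Hmu Hmu).
- by move=> i j; case: ifP.
- exact: tame_integrable.
- by move=> y; exact: tame_integrable.
Qed.
Lemma Ex_mix_close S F H (c : R) : tame mu F -> tame mu H ->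
 (forall y, tame mu (fun x => F (mix S x y))) ->
 (forall y, `|Ex mu (fun x => F (mix S x y)) - H y| <= c) ->
 `|Ex mu F - Ex mu H| <= c.
move=> tF tH ty Hc; have [iG ->] := Ex_mix tF ty.
have iH := tame_integrable tH.
have E : Ex mu (fun y => Ex mu (fun x => F (mix S x y))) - Ex mu H =
  Ex mu (fun y => Ex mu (fun x => F (mix S x y)) - H y).
 by rewrite /Ex RintegralB.
have iD : mu.-integrable setT (EFin \o (fun y => Ex mu (fun x => F (mix S x y)) - H y)).
 have := integrableB measurableT iG iH.
 by congr (_.-integrable _ _); apply/funext => y /=; rewrite EFinB.
rewrite E; apply: (@le_trans _ _ (Ex mu (fun y => `|Ex mu (fun x => F (mix S x y)) - H y|))).
 by apply: le_normr_Rintegral.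
rewrite -[leRHS](Ex_cst mu); apply: le_Rintegral => //.
- exact: integrable_abse iD.
- exact: tame_integrable (tameC _ _).
Qed.
Lemma Ex_mix_le S F (c : R) : tame mu F -> (forall t, 0 <= F t) ->
 (forall y, tame mu (fun x => F (mix S x y))) ->
 (forall y, Ex mu (fun x => F (mix S x y)) <= c) -> Ex mu F <= c.
move=> tF F0 ty Hc.
have := @Ex_mix_close S F (fun _ => 0) c tF (tameC _ 0) ty.
rewrite Ex_cst subr0 => H; apply: le_trans (ler_norm _) (H _) => y.
by rewrite subr0 ger0_norm //; apply: Ex_ge0.
Qed.
Lemma Exc_mix_eq S (F H : EntT R N M -> C) : tamec mu F -> tamec mu H ->
 (forall y, tamec mu (fun x => F (mix S x y))) ->
 (forall y, Exc mu (fun x => F (mix S x y)) = H y) ->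
 Exc mu F = Exc mu H.
move=> [tF1 tF2] [tH1 tH2] ty E; rewrite /Exc; congr (_ +i* _).
- apply/eqP; rewrite -subr_eq0 -normr_le0; apply: (@Ex_mix_close S) => //.
 + by move=> y; case: (ty y).
 + by move=> y; rewrite -E /= subrr normr0.
- apply/eqP; rewrite -subr_eq0 -normr_le0; apply: (@Ex_mix_close S) => //.
 + by move=> y; case: (ty y).
 + by move=> y; rewrite -E /= subrr normr0.
Qed.
Definition dep_on (X : Type) S (f : Ent R N M -> X) :=
 forall c c', (forall i j, S i j -> c i j = c' i j) -> f c = f c'.

Lemma Exc_indep S (f g : EntT R N M -> C) : tamec mu f -> tamec mu g ->
 dep_on S f -> dep_on (fun i j => ~~ S i j) g ->
 Exc mu (fun c => f c * g c) = Exc mu f * Exc mu g.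
move=> tf tg df dg.
have fm x y : f (mix S x y) = f x by apply: df => i j Sij; rewrite /mix Sij.
have gm x y : g (mix S x y) = g y by apply: dg => i j Sij; rewrite /mix (negbTE Sij).
rewrite (@Exc_mix_eq S _ (fun y => Exc mu f * g y)).
- by rewrite ExcZ.
- exact: tamecM.
- by exact: tamecZ.
- move=> y; under eq_fun do rewrite fm gm; apply: tamecM => //; exact: tamecC.
- move=> y; under eq_Exc do rewrite fm gm mulrC; rewrite ExcZ //; exact: mulrC.
Qed.
Lemma Ex_indep S f g : tame mu f -> tame mu g ->
 dep_on S f -> dep_on (fun i j => ~~ S i j) g ->
 Ex mu (fun c => f c * g c) = Ex mu f * Ex mu g.
move=> tf tg df dg; apply: complexI.
rewrite rmorphM /= -!Exc_real -(@Exc_indep S); [|exact: tamec_real|exact: tamec_real| |].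
- by apply: eq_Exc => t; rewrite rmorphM.
- by move=> c c' E; rewrite (df c c').
- by move=> c c' E; rewrite (dg c c').
Qed.

End Decouple.

(** * Moments of linear and quadratic forms in a column *)

Lemma sq_add3 (R : realFieldType) (y p q r : R) : 0 <= y -> 0 <= p -> 0 <= q -> 0 <= r -> y <= p + (q + r) ->
 y ^+ 2 <= 3 * p ^+ 2 + (3 * q ^+ 2 + 3 * r ^+ 2).
move=> y0 p0 q0 r0 H; have : y ^+ 2 <= (p + (q + r)) ^+ 2 by rewrite lerXn2r ?nnegrE ?addr_ge0.
have := sqr_ge0 (p - q); have := sqr_ge0 (p - r); have := sqr_ge0 (q - r); nra.
Qed.
Lemma pow4 (R : pzSemiRingType) (x : R) : x ^+ 4 = (x ^+ 2) ^+ 2.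
by rewrite -exprM. Qed.
Lemma pow8 (R : pzSemiRingType) (x : R) : x ^+ 8 = (x ^+ 2) ^+ 4.
by rewrite -exprM. Qed.
Lemma cconj_scale (R : realType) (r : R) (x : R[i]) : ((r%:C * x)^*)%C = r%:C * (x^*)%C.
by case: x => a b; apply: eqcP => /=; ring. Qed.
Lemma conj_conj_sq (R : realType) (x : R[i]) : ((x^* * x^*)^*)%C = x ^+ 2.
by rewrite expr2; case: x => a b; apply: eqcP => /=; ring. Qed.

Section LinearBounds.
Context d (T : measurableType d) (R : realType) (P : probability T R).

Lemma Ex_lin3 (a b c : R) (f g h : T -> R) : tame P f -> tame P g -> tame P h ->
 tame P (fun t => a * f t + b * g t + c * h t) /\
 Ex P (fun t => a * f t + b * g t + c * h t) = a * Ex P f + b * Ex P g + c * Ex P h.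
move=> tf tg th; have t1 := tameZ a tf; have t2 := tameZ b tg; have t3 := tameZ c th.
split; first by apply: tameD => //; exact: tameD.
by rewrite ExD //; [rewrite ExD // !ExZ|exact: tameD].
Qed.
Lemma le_Ex_lin3 (a b c : R) (e f g h : T -> R) : tame P e -> tame P f -> tame P g -> tame P h ->
 (forall t, e t <= a * f t + b * g t + c * h t) ->
 Ex P e <= a * Ex P f + b * Ex P g + c * Ex P h.
move=> te tf tg th H; have [t1 <-] := Ex_lin3 a b c tf tg th; exact: le_Ex.
Qed.

End LinearBounds.

Section GoodLaw.
Variables (R : realType) (N M : nat).
Local Notation C := R[i].
Variables (mu : mxlaw R N M).

(* The moment assumptions on the entries, for the law of the matrix; [eps]
  is 1 in the real case and 0 in the complex case, so that E x^2 = eps / M. *)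
Definition goodlaw (K eps : R) :=
 [/\ (exists p, prodlaw mu p), (0 < M)%N, 1 <= K &
 forall i j, [/\ tamec mu (fun c => entmx c i j),
  Exc mu (fun c => entmx c i j) = 0,
  Ex mu (fun c => cabs (entmx c i j) ^+ 2) = M%:R^-1,
  Exc mu (fun c => entmx c i j ^+ 2) = (eps / M%:R)%:C &
  Ex mu (fun c => cabs (entmx c i j) ^+ 4) <= K / M%:R ^+ 2 /\
  Ex mu (fun c => cabs (entmx c i j) ^+ 8) <= K / M%:R ^+ 4]].

End GoodLaw.

Section ColumnMoments.
Variables (R : realType) (N M : nat).
Local Notation C := R[i].
Variables (mu : mxlaw R N M) (K eps : R).
Hypothesis Hg : goodlaw mu K eps.
Variable (j : 'I_M).
Local Notation E := (Ex mu).
Local Notation EC := (Exc mu).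
Local Notation m := (M%:R^-1 : R).

Definition xe (i : 'I_N) (c : EntT R N M) : C := entmx c i j.

Let M0 : (0 : R) < M%:R.
by case: Hg => _ H _ _; rewrite ltr0n. Qed.
Let m0 : 0 < m. Proof. by rewrite invr_gt0. Qed.
Let K1 : 1 <= K. Proof. by case: Hg. Qed.
Let tx i : tamec mu (xe i). Proof. by case: Hg => _ _ _ /(_ i j)[]. Qed.
Let Ex1 i : EC (xe i) = 0. Proof. by case: Hg => _ _ _ /(_ i j)[]. Qed.
Let Ex2 i : E (fun c => cabs (xe i c) ^+ 2) = m. Proof. by case: Hg => _ _ _ /(_ i j)[]. Qed.
Let Exx i : EC (fun c => xe i c ^+ 2) = (eps * m)%:C. Proof. by case: Hg => _ _ _ /(_ i j)[]. Qed.
Let Ex4 i : E (fun c => cabs (xe i c) ^+ 4) <= K * m ^+ 2.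
by case: Hg => _ _ _ /(_ i j)[_ _ _ _ [+ _]]; rewrite exprVn. Qed.
Let Ex8 i : E (fun c => cabs (xe i c) ^+ 8) <= K * m ^+ 4.
by case: Hg => _ _ _ /(_ i j)[_ _ _ _ [_ +]]; rewrite exprVn. Qed.
Let tax i n : tame mu (fun c => cabs (xe i c) ^+ n).
exact: tame_cabsX. Qed.
(** The rows of column [j] are revealed one by one: [past n] means dependence on the rows before [n]
    only, [onlyat n] on row [n] only. The pair plays the role of a filtration in the martingale
    arguments below. *)
Definition onlyat (X : Type) (n : 'I_N) (f : EntT R N M -> X) :=
 forall c c' : EntT R N M, c n j = c' n j -> f c = f c'.
Definition past (X : Type) (n : nat) (g : EntT R N M -> X) :=
 forall c c' : EntT R N M, (forall k : 'I_N, (k < n)%N -> c k j = c' k j) -> g c = g c'.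

Lemma indepC_past n f g : tamec mu f -> tamec mu g -> onlyat n f -> past n g ->
 EC (fun c => f c * g c) = EC f * EC g.
move=> tf tg of_ pg; case: Hg => -[p Hp] _ _ _.
apply: (Exc_indep Hp (S := fun i k => (i == n) && (k == j))) => //.
- by move=> c c' H; apply: of_; apply: H; rewrite !eqxx.
- move=> c c' H; apply: pg => k kn; apply: H.
 by rewrite eqxx andbT; apply/eqP => kn'; rewrite kn' ltnn in kn.
Qed.
Lemma indep_past n (f g : EntT R N M -> R) : tame mu f -> tame mu g -> onlyat n f -> past n g ->
 E (fun c => f c * g c) = E f * E g.
move=> tf tg of_ pg; case: Hg => -[p Hp] _ _ _.
apply: (Ex_indep Hp (S := fun i k => (i == n) && (k == j))) => //.
- by move=> c c' H; apply: of_; apply: H; rewrite !eqxx.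
- move=> c c' H; apply: pg => k kn; apply: H.
 by rewrite eqxx andbT; apply/eqP => kn'; rewrite kn' ltnn in kn.
Qed.
Lemma xe_onlyat n : onlyat n (xe n).
by move=> c c' H; rewrite /xe !mxE H. Qed.
Lemma sum_ltS (V : nmodType) (F : 'I_N -> V) (n : 'I_N) :
 \sum_(i < N | (i < n.+1)%N) F i = F n + \sum_(i < N | (i < n)%N) F i.
rewrite (bigD1 n) //=; congr (_ + _); apply: eq_bigl => i.
by rewrite ltnS ltn_neqAle andbC.
Qed.
Lemma sum_ltN (V : nmodType) (F : 'I_N -> V) : \sum_(i < N | (i < N)%N) F i = \sum_i F i.
by apply: eq_bigl => i; rewrite ltn_ord. Qed.
(** In the expansion of the fourth power the term linear in [y] has mean zero by assumption; the
    square of the real part of [S^* y] and the cubic term in [y] are absorbed into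
    [8 |S|^2 |y|^2 + 3 |y|^4]. Iterated, this gives a fourth-moment inequality of Burkholder
    type. *)
Lemma quartic_step (S y : EntT R N M -> C) : tamec mu S -> tamec mu y ->
 EC (fun c => (cabs (S c) ^+ 2)%:C * (S c)^* * y c) = 0 ->
 E (fun c => cabs (S c + y c) ^+ 4) <=
 E (fun c => cabs (S c) ^+ 4) + 8 * E (fun c => cabs (S c) ^+ 2 * cabs (y c) ^+ 2)
  + 3 * E (fun c => cabs (y c) ^+ 4).
move=> tS ty H0.
have tS2 : tame mu (fun c => cabs (S c) ^+ 2) by exact: tame_cabsX.
have ty2 : tame mu (fun c => cabs (y c) ^+ 2) by exact: tame_cabsX.
have tS4 : tame mu (fun c => cabs (S c) ^+ 4) by exact: tame_cabsX.
have ty4 : tame mu (fun c => cabs (y c) ^+ 4) by exact: tame_cabsX.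
have tC : tamec mu (fun c => (cabs (S c) ^+ 2)%:C * (S c)^* * y c).
 by apply: tamecM => //; apply: tamecM; [exact: tamec_real|exact: tamecJ].
have H1 : E (fun c => Re ((cabs (S c) ^+ 2)%:C * (S c)^* * y c)) = 0.
 by have := congr1 Re H0.
have tR : tame mu (fun c => Re ((cabs (S c) ^+ 2)%:C * (S c)^* * y c)) by case: tC.
have tSy : tame mu (fun c => cabs (S c) ^+ 2 * cabs (y c) ^+ 2) by apply: tameM.
have tS4R : tame mu (fun c => cabs (S c) ^+ 4 + 4 * Re ((cabs (S c) ^+ 2)%:C * (S c)^* * y c)).
 by apply: tameD => //; exact: tameZ.
have -> : E (fun c => cabs (S c) ^+ 4) =
  E (fun c => cabs (S c) ^+ 4 + 4 * Re ((cabs (S c) ^+ 2)%:C * (S c)^* * y c)).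
 by rewrite ExD ?ExZ ?H1 ?mulr0 ?addr0 //; exact: tameZ.
rewrite -[X in X + _ + _]mul1r.
apply: le_Ex_lin3 => //; first by apply: tame_cabsX; exact: tamecD.
move=> c; move: (S c) (y c) => [a b] [u v] /=.
rewrite (_ : 4 = 2 * 2)%N // !exprM !sqr_sqrtr ?addr_ge0 ?sqr_ge0 //.
rewrite !mul0r !subr0 !addr0.
have := sqr_ge0 (a * v - b * u).
have := sqr_ge0 (a * u + b * v - (u ^+ 2 + v ^+ 2)).
nra.
Qed.

Section Linear.
Variable a : 'I_N -> C.
Definition lin n (c : EntT R N M) : C := \sum_(k < N | (k < n)%N) a k * xe k c.
Definition lw n : R := \sum_(k < N | (k < n)%N) cabs (a k) ^+ 2.

Lemma tame_lin n : tamec mu (lin n).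
by apply: tamec_sum => k; exact: tamecZ. Qed.
Lemma lin_past n : past n (lin n).
by move=> c c' H; apply: eq_bigr => k kn; rewrite /xe !mxE H. Qed.
Lemma lw_ge0 n : 0 <= lw n.
by apply: sumr_ge0 => k _; exact: sqr_ge0. Qed.
Lemma lin_mean n : EC (lin n) = 0.
rewrite Exc_sum; last by move=> k; exact: tamecZ.
by rewrite big1 // => k _; rewrite ExcZ // Ex1 mulr0.
Qed.
Lemma lin0 : lin 0 = fun _ => 0.
by apply/funext => c; rewrite /lin big_pred0. Qed.
Lemma lw0 : lw 0 = 0. Proof. by rewrite /lw big_pred0. Qed.
Lemma linS (n : 'I_N) c : lin n.+1 c = lin n c + a n * xe n c.
by rewrite /lin sum_ltS addrC. Qed.
Lemma lwS (n : 'I_N) : lw n.+1 = lw n + cabs (a n) ^+ 2.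
by rewrite /lw sum_ltS addrC. Qed.
Lemma lin2 n : (n <= N)%N -> E (fun c => cabs (lin n c) ^+ 2) <= lw n * m.
elim: n => [_|n IH nN].
 by rewrite lin0 lw0 mul0r; under eq_Ex do rewrite cabs0 expr0n; rewrite Ex_cst.
have {}IH := IH (ltnW nN); pose n' := Ordinal nN.
have tl := tame_lin n; have ty : tamec mu (fun c => a n' * xe n' c).
 by exact: tamecZ.
have tR : tamec mu (fun c => (a n' * xe n' c) * (lin n c)^*).
 by apply: tamecM => //; exact: tamecJ.
have E0 : E (fun c => Re ((a n' * xe n' c) * (lin n c)^*)) = 0.
 have : EC (fun c => (a n' * xe n' c) * (lin n c)^*) = 0.
  rewrite (@indepC_past n') ?ExcZ ?Ex1 ?mulr0 ?mul0r //.
  - exact: tamecJ.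
  - by move=> c c' H; rewrite (xe_onlyat H).
  - by move=> c c' H; rewrite (lin_past H).
 by move=> /(congr1 Re).
have -> : lw n.+1 * m = lw n * m + 2 * 0 + cabs (a n') ^+ 2 * m.
 by rewrite (lwS n'); ring.
rewrite -E0 -(Ex2 n').
apply: (@le_trans _ _ (1 * E (fun c => cabs (lin n c) ^+ 2) +
  2 * E (fun c => Re (a n' * xe n' c * (lin n c)^*)) + cabs (a n') ^+ 2 * E (fun c => cabs (xe n' c) ^+ 2))).
 apply: le_Ex_lin3 => //.
 - by apply: tame_cabsX; exact: tame_lin.
 - by apply: tame_cabsX.
 - by case: tR.
 move=> c; rewrite (linS n') -[cabs (a n') ^+ 2 * _]exprMn -cabsM.
 move: (lin n c) (a n' * xe n' c) => [u v] [s t] /=.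
 rewrite !sqr_sqrtr ?addr_ge0 ?sqr_ge0 //; lra.
rewrite mul1r !lerD2r; apply: (le_trans IH); by rewrite Ex2.
Qed.
(** With [v] the variance so far and [w] that of the new term, the induction closes because
    [8 v w <= 8 K v w] and [3 K w^2 <= 4 K w^2]; this is where the constant [4 * K] comes from. *)
Lemma lin4 n : (n <= N)%N -> E (fun c => cabs (lin n c) ^+ 4) <= 4 * K * (lw n * m) ^+ 2.
elim: n => [_|n IH nN].
 rewrite lin0 lw0 mul0r expr0n mulr0; under eq_Ex do rewrite cabs0 expr0n.
 by rewrite Ex_cst.
have {}IH := IH (ltnW nN); pose n' := Ordinal nN; have H2 := lin2 (ltnW nN).
have tl := tame_lin n; have ty : tamec mu (fun c => a n' * xe n' c).
 by exact: tamecZ.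
have -> : E (fun c => cabs (lin n.+1 c) ^+ 4) = E (fun c => cabs (lin n c + a n' * xe n' c) ^+ 4).
 by apply: eq_Ex => c; rewrite (linS n').
have tg : tamec mu (fun c => (cabs (lin n c) ^+ 2)%:C * (lin n c)^*).
 apply: tamecM; last exact: tamecJ.
 by apply: tamec_real; exact: tame_cabsX.
apply: (le_trans (quartic_step tl ty _)).
 under eq_Exc do rewrite mulrC.
 rewrite (@indepC_past n') ?ExcZ ?Ex1 ?mulr0 ?mul0r //.
 - by move=> c c' H; rewrite (xe_onlyat H).
 - by move=> c c' H; rewrite (lin_past H).
have E2 : E (fun c => cabs (lin n c) ^+ 2 * cabs (a n' * xe n' c) ^+ 2) =
  cabs (a n') ^+ 2 * m * E (fun c => cabs (lin n c) ^+ 2).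
 under eq_Ex do rewrite mulrC.
 rewrite (@indep_past n').
 - by congr (_ * _); under eq_Ex do rewrite cabsM exprMn; rewrite ExZ // Ex2.
 - exact: tame_cabsX.
 - exact: tame_cabsX.
 - by move=> c c' H; rewrite (xe_onlyat H).
 - by move=> c c' H; rewrite (lin_past H).
have E4 : E (fun c => cabs (a n' * xe n' c) ^+ 4) <= K * (cabs (a n') ^+ 2 * m) ^+ 2.
 under eq_Ex do rewrite cabsM exprMn.
 rewrite ExZ // exprMn -exprM mulrCA ler_wpM2l ?exprn_ge0 ?cabs_ge0 //.
rewrite (lwS n') (mulrDl (lw _)) E2.
set w := cabs (a n') ^+ 2 * m in E4 *.
have w0 : 0 <= w by rewrite mulr_ge0 ?sqr_ge0 // ltW.
have v0 : 0 <= lw n * m by rewrite mulr_ge0 ?lw_ge0 // ltW.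
have : w * E (fun c => cabs (lin n c) ^+ 2) <= w * (lw n * m) by apply: ler_wpM2l.
move: E4 IH v0; move: (E _) (E _) (E _) (lw n * m) => e1 e2 e3 v.
move=> h1 h2 v0 h3.
have a1 : 0 <= (K - 1) * (v * w) by rewrite mulr_ge0 ?subr_ge0 // mulr_ge0.
have a2 : 0 <= K * w ^+ 2 by rewrite mulr_ge0 ?sqr_ge0 // (le_trans ler01).
nra.
Qed.
End Linear.

Lemma linlin (a b : 'I_N -> C) n : (n <= N)%N ->
 EC (fun c => lin a n c * lin b n c) = (eps * m)%:C * \sum_(k < N | (k < n)%N) a k * b k.
elim: n => [_|n IH nN].
 rewrite big_pred0 // mulr0 !lin0; under eq_Exc do rewrite mul0r; exact: Exc_cst.
have {}IH := IH (ltnW nN); pose n' := Ordinal nN.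
rewrite (sum_ltS _ n') mulrDr -IH.
have tl := tame_lin a n; have tl' := tame_lin b n.
pose l2 c := a n' * lin b n c + b n' * lin a n c.
have tl2 : tamec mu l2 by apply: tamecD; exact: tamecZ.
have -> : EC (fun c => lin a n.+1 c * lin b n.+1 c) =
  EC (fun c => lin a n c * lin b n c + (xe n' c * l2 c + a n' * b n' * xe n' c ^+ 2)).
 by apply: eq_Exc => c; rewrite !(linS _ n') /l2 /=; ring.
rewrite ExcD; [|exact: tamecM|]; last first.
 by apply: tamecD; [exact: tamecM|apply: tamecM; [exact: tamecC|exact: tamecX]].
rewrite ExcD; [|exact: tamecM|]; last first.
 by apply: tamecM; [exact: tamecC|exact: tamecX].
rewrite (@indepC_past n' (xe n') l2) // ?Ex1 ?mul0r ?add0r; last 2 first.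
- exact: xe_onlyat.
- by move=> c c' H; rewrite /l2 !(lin_past _ H).
rewrite ExcZ ?Exx; last exact: tamecX.
by rewrite addrC [in LHS]mulrC.
Qed.
Lemma linlinc (a b : 'I_N -> C) n : (n <= N)%N ->
 EC (fun c => lin a n c * (lin b n c)^*) = m%:C * \sum_(k < N | (k < n)%N) a k * (b k)^*.
elim: n => [_|n IH nN].
 rewrite big_pred0 // mulr0 !lin0; under eq_Exc do rewrite mul0r; exact: Exc_cst.
have {}IH := IH (ltnW nN); pose n' := Ordinal nN.
rewrite (sum_ltS _ n') mulrDr -IH.
have tl := tame_lin a n; have tl' := tame_lin b n.
pose l1 c := a n' * (lin b n c)^*.
pose l2 c := (b n')^* * lin a n c.
have tl1 : tamec mu l1 by apply: tamecM; [exact: tamecC|exact: tamecJ].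
have tl2 : tamec mu l2 by exact: tamecZ.
have tq : tamec mu (fun c => a n' * (b n')^* * (cabs (xe n' c) ^+ 2)%:C).
 by apply: tamecM; [exact: tamecC|exact: tamec_real].
have txc : tamec mu (fun c => (xe n' c)^*) by exact: tamecJ.
have -> : EC (fun c => lin a n.+1 c * (lin b n.+1 c)^*) =
  EC (fun c => lin a n c * (lin b n c)^* + (xe n' c * l1 c + ((xe n' c)^* * l2 c +
   a n' * (b n')^* * (cabs (xe n' c) ^+ 2)%:C))).
 apply: eq_Exc => c; rewrite !(linS _ n') /l1 /l2 /= -conj_mul rmorphD rmorphM /=; ring.
rewrite ExcD; [|apply: tamecM => //; exact: tamecJ|]; last first.
 by apply: tamecD; [exact: tamecM|apply: tamecD => //; exact: tamecM].
rewrite ExcD; [|exact: tamecM|]; last by apply: tamecD => //; exact: tamecM.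
rewrite ExcD //; last exact: tamecM.
rewrite (@indepC_past n' (xe n') l1) // ?Ex1 ?mul0r ?add0r; last 2 first.
- exact: xe_onlyat.
- by move=> c c' H; rewrite /l1 !(lin_past _ H).
rewrite (@indepC_past n' (fun c => (xe n' c)^*) l2) // ?Exc_conj ?Ex1 ?conjc0 ?mul0r ?add0r //; last 2 first.
- by move=> c c' H; rewrite (xe_onlyat H).
- by move=> c c' H; rewrite /l2 !(lin_past _ H).
rewrite ExcZ; last exact: tamec_real.
by rewrite Exc_real Ex2 addrC [in LHS]mulrC.
Qed.
(** Off-diagonal pairs are attached to their larger index, in view of the martingale decomposition
    of a quadratic form. *)
Lemma sum_tri (V : nmodType) (F : 'I_N -> 'I_N -> V) :
 \sum_i \sum_k F i k =
 \sum_i (F i i + \sum_(k < N | (k < i)%N) F i k + \sum_(k < N | (k < i)%N) F k i).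
rewrite !big_split /=.
have -> : \sum_(i < N) \sum_(k < N | (k < i)%N) F k i = \sum_(k < N) \sum_(i < N | (k < i)%N) F k i.
 by rewrite (exchange_big_dep predT).
rewrite -!big_split /=; apply: eq_bigr => i _.
rewrite (bigD1 i) //= -addrA; congr (_ + _).
rewrite (bigID (fun k : 'I_N => (k < i)%N)) /=; congr (_ + _); apply: eq_bigl => k.
- by rewrite andbC; case: ltngtP => //= H; apply/eqP => E'; rewrite E' ltnn in H.
- by rewrite -leqNgt [in RHS]ltn_neqAle eq_sym.
Qed.

Section Quadratic.
Variable B : 'M[C]_N.

Definition xi n c : C := (cabs (xe n c) ^+ 2 - m)%:C.
Definition Lr (n : 'I_N) c := lin (fun k => B n k) n c.
Definition Lc (n : 'I_N) c := (lin (fun k => (B k n)^*) n c)^*.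
(** The part of [ip x (B x) - \tr B / M] whose largest row index is [n]. Given the rows before [n]
    its mean is zero, so the partial sums [Dq] form a martingale. *)
Definition yq (n : 'I_N) c := B n n * xi n c + (xe n c)^* * Lr n c + xe n c * Lc n c.
Definition Dq k c := \sum_(i < N | (i < k)%N) yq i c.
Definition wq (n : 'I_N) : R :=
 cabs (B n n) ^+ 2 + lw (fun k => B n k) n + lw (fun k => (B k n)^*) n.
Definition Wq k : R := \sum_(i < N | (i < k)%N) wq i.

Lemma LcE n c : Lc n c = \sum_(k < N | (k < n)%N) B k n * (xe k c)^*.
rewrite /Lc /lin rmorph_sum; apply: eq_bigr => k _.
by rewrite /= rmorphM /= conjcK.
Qed.
Lemma ip_quad (A : 'M[C]_N) (u v : 'cV[C]_N) :
 ip u (A *m v) = \sum_i \sum_k (u i 0)^* * (A i k * v k 0).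
by rewrite ipE; apply: eq_bigr => i _; rewrite [(A *m v) i 0]mxE mulr_sumr. Qed.
Lemma col_xe i c : col j (entmx c) i 0 = xe i c.
by rewrite /xe mxE. Qed.
Lemma DqN c : Dq N c = ip (col j (entmx c)) (B *m col j (entmx c)) - \tr B * m%:C.
rewrite ip_quad sum_tri /mxtrace mulr_suml -sumrB /Dq sum_ltN; apply: eq_bigr => i _.
rewrite /yq LcE /Lr /lin !mulr_sumr /xi rmorphB /= -conj_mul col_xe.
under [X in _ = _ + X + _ - _]eq_bigr do rewrite col_xe mulrA (mulrC _ (B _ _)) -mulrA.
under [X in _ = _ + _ + X - _]eq_bigr do rewrite col_xe.
under [X in _ + X + _ = _]eq_bigr do rewrite mulrCA.
under [X in _ + _ + X = _]eq_bigr do rewrite mulrA mulrC (mulrC (xe i c)).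
by ring.
Qed.
Lemma WqN : Wq N = \sum_i \sum_k cabs (B i k) ^+ 2.
rewrite sum_tri /Wq sum_ltN; apply: eq_bigr => i _; rewrite /wq /lw; congr (_ + _).
by apply: eq_bigr => k _; rewrite cabs_conj.
Qed.
Lemma tame_xi n : tamec mu (xi n).
by apply: tamec_real; apply: tameB => //; exact: tameC. Qed.
Lemma tame_Lr n : tamec mu (Lr n). Proof. exact: tame_lin. Qed.
Lemma tame_Lc n : tamec mu (Lc n). Proof. by apply: tamecJ; exact: tame_lin. Qed.
Lemma txc n : tamec mu (fun c => (xe n c)^*). Proof. exact: tamecJ. Qed.
Hint Resolve tame_xi tame_Lr tame_Lc txc : core.

Lemma tame_yq n : tamec mu (yq n).
apply: tamecD; last exact: tamecM (tx n) (tame_Lc n).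
by apply: tamecD; [exact: tamecM (tamecC _ _) (tame_xi n)|exact: tamecM (txc n) (tame_Lr n)].
Qed.
Lemma tame_Dq n : tamec mu (Dq n).
by apply: tamec_sum => i; exact: tame_yq. Qed.
Hint Resolve tame_yq tame_Dq : core.

Lemma Lr_past (n : 'I_N) : past n (Lr n). Proof. exact: lin_past. Qed.
Lemma Lc_past (n : 'I_N) : past n (Lc n).
by move=> c c' H; rewrite /Lc (lin_past _ H). Qed.
Lemma xi_onlyat n : onlyat n (xi n).
by move=> c c' H; rewrite /xi (xe_onlyat H). Qed.
Lemma Dq_past n : past n (Dq n).
move=> c c' H; apply: eq_bigr => i ni; rewrite /yq.
have H' : forall k : 'I_N, (k < i)%N -> c k j = c' k j.
 by move=> k ki; apply: H; exact: ltn_trans ki ni.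
by rewrite (Lr_past H') (Lc_past H') /xi (xe_onlyat (H i ni)).
Qed.
Lemma Dq0 : Dq 0 = fun _ => 0.
by apply/funext => c; rewrite /Dq big_pred0. Qed.
Lemma DqS (n : 'I_N) c : Dq n.+1 c = Dq n c + yq n c.
by rewrite /Dq sum_ltS addrC. Qed.
Lemma WqS (n : 'I_N) : Wq n.+1 = Wq n + wq n.
by rewrite /Wq sum_ltS addrC. Qed.
Lemma wq_ge0 n : 0 <= wq n.
by rewrite /wq !addr_ge0 ?sqr_ge0 ?lw_ge0. Qed.
Lemma Wq_ge0 k : 0 <= Wq k.
by apply: sumr_ge0 => i _; exact: wq_ge0. Qed.
Lemma xi_mean n : EC (xi n) = 0.
by rewrite Exc_real ExB ?Ex2 ?Ex_cst ?subrr //; exact: tameC. Qed.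
Lemma yq_mean (n : 'I_N) (f : EntT R N M -> C) : tamec mu f -> past n f ->
 EC (fun c => yq n c * f c) = 0.
move=> tf pf.
have t1 : tamec mu (fun c => B n n * f c) by exact: tamecZ.
have t2 : tamec mu (fun c => Lr n c * f c) by exact: tamecM.
have t3 : tamec mu (fun c => Lc n c * f c) by exact: tamecM.
have -> : EC (fun c => yq n c * f c) = EC (fun c => xi n c * (B n n * f c) +
  ((xe n c)^* * (Lr n c * f c) + xe n c * (Lc n c * f c))).
 by apply: eq_Exc => c; rewrite /yq; ring.
have u1 := tamecM (tame_xi n) t1; have u2 := tamecM (txc n) t2; have u3 := tamecM (tx n) t3.
rewrite (ExcD u1 (tamecD u2 u3)) (ExcD u2 u3).
rewrite (@indepC_past n (xi n)) // ?xi_mean ?mul0r ?add0r; last 2 first.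
- exact: xi_onlyat.
- by move=> c c' H; rewrite (pf _ _ H).
rewrite (@indepC_past n (fun c => (xe n c)^*)) // ?Exc_conj ?Ex1 ?conjc0 ?mul0r ?add0r //; last 2 first.
- by move=> c c' H; rewrite (xe_onlyat H).
- by move=> c c' H; rewrite (pf _ _ H) (Lr_past H).
rewrite (@indepC_past n (xe n)) // ?Ex1 ?mul0r //.
- exact: xe_onlyat.
- by move=> c c' H; rewrite (pf _ _ H) (Lc_past H).
Qed.
Lemma xi2 n : E (fun c => cabs (xi n c) ^+ 2) <= K * m ^+ 2.
have -> : E (fun c => cabs (xi n c) ^+ 2) = E (fun c => cabs (xe n c) ^+ 4 - (2 * m * cabs (xe n c) ^+ 2 - m ^+ 2)).
 apply: eq_Ex => c; rewrite /xi cabs_real real_normK ?num_real //.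
 by rewrite pow4; ring.
have tA : tame mu (fun c => 2 * m * cabs (xe n c) ^+ 2) := tameZ _ (tax n 2).
have tB := tameC mu (m ^+ 2).
rewrite (ExB (tax n 4) (tameB tA tB)) (ExB tA tB) (ExZ _ (tax n 2)) Ex_cst Ex2.
have := Ex4 n; have : 0 <= m ^+ 2 by exact: sqr_ge0.
by move: (E _) => e; nra.
Qed.
Lemma xi4 n : E (fun c => cabs (xi n c) ^+ 4) <= 16 * K * m ^+ 4.
apply: (@le_trans _ _ (8 * E (fun c => cabs (xe n c) ^+ 8) + 0 * E (fun=> 0) + 8 * E (fun => m ^+ 4))).
 apply: le_Ex_lin3; [exact: tame_cabsX|by []|exact: tameC|exact: tameC|].
 move=> c; rewrite /xi cabs_real mul0r addr0.
 rewrite pow4 real_normK ?num_real // pow8 (pow4 m).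
 set a := cabs (xe n c) ^+ 2; rewrite (pow4 a).
 have h1 : (a - m) ^+ 2 <= 2 * (a ^+ 2 + m ^+ 2) by have := sqr_ge0 (a + m); nra.
 apply: (@le_trans _ _ ((2 * (a ^+ 2 + m ^+ 2)) ^+ 2)).
  by rewrite lerXn2r ?nnegrE ?sqr_ge0 // mulr_ge0 // addr_ge0 // sqr_ge0.
 have := sqr_ge0 (a ^+ 2 - m ^+ 2).
 move: (a ^+ 2) (m ^+ 2) => u v; nra.
rewrite !Ex_cst mulr0 addr0; have := Ex8 n.
have : m ^+ 4 <= K * m ^+ 4 by rewrite ler_peMl // exprn_ge0 // ltW.
by move: (E _) => e; lra.
Qed.
Lemma Lr4 (n : 'I_N) : E (fun c => cabs (Lr n c) ^+ 4) <= 4 * K * (lw (fun k => B n k) n * m) ^+ 2.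
by apply: lin4; exact: ltnW (ltn_ord n). Qed.
Lemma Lc4 (n : 'I_N) : E (fun c => cabs (Lc n c) ^+ 4) <= 4 * K * (lw (fun k => (B k n)^*) n * m) ^+ 2.
under eq_Ex do rewrite /Lc cabs_conj.
by apply: lin4; exact: ltnW (ltn_ord n).
Qed.

Hint Resolve tame_cabsX : core.

Lemma E_sqsq (f g : EntT R N M -> C) (x y : R) : tamec mu f -> tamec mu g -> 0 <= x -> 0 <= y ->
 E (fun c => cabs (f c) ^+ 4) <= x ^+ 2 -> E (fun c => cabs (g c) ^+ 4) <= y ^+ 2 ->
 E (fun c => cabs (f c) ^+ 2 * cabs (g c) ^+ 2) <= x * y.
move=> tf tg x0 y0 Hx Hy.
rewrite -(@ler_pXn2r _ 2) ?nnegrE ?mulr_ge0 //; last first.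
 by apply: Ex_ge0 => c; rewrite mulr_ge0 ?sqr_ge0.
apply: (le_trans (Ex_CS (tame_cabsX 2 tf) (tame_cabsX 2 tg))); rewrite exprMn.
have e f' : E (fun t => (cabs (f' t) ^+ 2) ^+ 2) = E (fun t => cabs (f' t) ^+ 4).
 by apply: eq_Ex => t; rewrite -exprM.
rewrite !e; apply: ler_pM => //; by apply: Ex_ge0 => c; rewrite exprn_ge0 ?cabs_ge0.
Qed.
(** Induction by [quartic_step], with [W] the squared Frobenius mass used so far and [w] that of the
    new row and column. The step rests on [8 * 216 <= 2 * 36 ^ 2] and [3 * 432 <= 36 ^ 2], which
    fixes the constant. *)
Lemma quad4_sec n : (n <= N)%N -> E (fun c => cabs (Dq n c) ^+ 4) <= (36 * K * (Wq n * m ^+ 2)) ^+ 2.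
elim: n => [_|n IH nN].
 by rewrite Dq0; under eq_Ex do rewrite cabs0 expr0n; rewrite Ex_cst sqr_ge0.
have {}IH := IH (ltnW nN); pose n' := Ordinal nN.
have -> : E (fun c => cabs (Dq n.+1 c) ^+ 4) = E (fun c => cabs (Dq n c + yq n' c) ^+ 4).
 by apply: eq_Ex => c; rewrite (DqS n').
have tg : tamec mu (fun c => (cabs (Dq n c) ^+ 2)%:C * (Dq n c)^*).
 by apply: tamecM; [apply: tamec_real; exact: tame_cabsX|exact: tamecJ].
apply: (le_trans (quartic_step (tame_Dq n) (tame_yq n') _)).
 under eq_Exc do rewrite mulrC.
 by apply: yq_mean => // c c' H; rewrite (Dq_past H).
set a2 := cabs (B n' n') ^+ 2; set l1 := lw (fun k => B n' k) n'; set l2 := lw (fun k => (B k n')^*) n'.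
set W := Wq n * m ^+ 2 in IH *.
have [l10 l20 a20] : [/\ 0 <= l1, 0 <= l2 & 0 <= a2] by split; [exact: lw_ge0|exact: lw_ge0|exact: sqr_ge0].
have K0 : 0 <= K by exact: le_trans ler01 K1.
have m00 := ltW m0.
have m2 : 0 <= m ^+ 2 by exact: sqr_ge0.
have W0 : 0 <= W by rewrite mulr_ge0 ?Wq_ge0.
have KW : 0 <= 36 * K * W by rewrite mulr_ge0 // mulr_ge0.
have D2 : E (fun c => cabs (Dq n c) ^+ 2) <= 36 * K * W.
 have H1 : E (fun _ => cabs (1 : C) ^+ 4) <= 1 ^+ 2 by rewrite Ex_cst cabs1 !expr1n.
 have := E_sqsq (tame_Dq n) (tamecC mu 1) KW ler01 IH H1; rewrite mulr1.
 by under eq_Ex do rewrite cabs1 expr1n mulr1.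
have DL (L : 'I_N -> EntT R N M -> C) l : tamec mu (L n') -> 0 <= l ->
  E (fun c => cabs (L n' c) ^+ 4) <= 4 * K * (l * m) ^+ 2 ->
  E (fun c => cabs (Dq n c) ^+ 2 * cabs (L n' c) ^+ 2) <= 72 * K ^+ 2 * (W * (l * m)).
 move=> tL l0 HL; have := @E_sqsq (Dq n) (L n') (36 * K * W) (2 * K * (l * m)) (tame_Dq n) tL.
 rewrite (_ : 36 * K * _ * _ = 72 * K ^+ 2 * (W * (l * m))); last by ring.
 apply=> //; first by rewrite mulr_ge0 // mulr_ge0.
 have : K * (l * m) ^+ 2 <= K * (K * (l * m) ^+ 2) by rewrite ler_wpM2l // ler_peMl // sqr_ge0.
 by move: HL; lra.
have X2 f : tame mu f -> past n f -> E (fun c => cabs (xe n' c) ^+ 2 * f c) = m * E f.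
 by move=> tf pf; rewrite (@indep_past n') ?Ex2 // => c c' H; rewrite (xe_onlyat H).
have XL L l : tamec mu L -> past n L -> E (fun c => cabs (L c) ^+ 4) <= 4 * K * (l * m) ^+ 2 ->
  E (fun c => cabs (xe n' c) ^+ 4 * cabs (L c) ^+ 4) <= K * m ^+ 2 * (4 * K * (l * m) ^+ 2).
 move=> tL pL HL; rewrite (@indep_past n') //; [|exact: tame_cabsX|by move=> c c' H; rewrite (xe_onlyat H)|by move=> c c' H; rewrite (pL _ _ H)].
 by apply: ler_pM => //; try exact: Ex4; apply: Ex_ge0 => c; rewrite exprn_ge0 ?cabs_ge0.
have XI2 : E (fun c => cabs (xi n' c) ^+ 2 * cabs (Dq n c) ^+ 2) <= K * m ^+ 2 * (36 * K * W).
 rewrite (@indep_past n') //; [|exact: tame_cabsX|exact: tame_cabsX|by move=> c c' H; rewrite (xi_onlyat H)|by move=> c c' H; rewrite (Dq_past H)].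
 by apply: ler_pM => //; try exact: xi2; apply: Ex_ge0 => c; exact: sqr_ge0.
have y2le c : cabs (yq n' c) ^+ 2 <= 3 * (a2 * cabs (xi n' c) ^+ 2) +
  (3 * (cabs (xe n' c) ^+ 2 * cabs (Lr n' c) ^+ 2) + 3 * (cabs (xe n' c) ^+ 2 * cabs (Lc n' c) ^+ 2)).
 have P x y := mulr_ge0 (cabs_ge0 x) (cabs_ge0 y).
 rewrite -!exprMn; apply: sq_add3; rewrite ?P ?cabs_ge0 // /yq -addrA.
 apply: (le_trans (cabsD _ _)); rewrite cabsM lerD2l.
 by apply: (le_trans (cabsD _ _)); rewrite !cabsM cabs_conj.
have tDL (L : EntT R N M -> C) : tamec mu L -> tame mu (fun c => cabs (Dq n c) ^+ 2 * cabs (L c) ^+ 2).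
 by move=> tL; apply: tameM; exact: tame_cabsX.
have Y2 : E (fun c => cabs (Dq n c) ^+ 2 * cabs (yq n' c) ^+ 2) <= 216 * K ^+ 2 * (W * (wq n' * m ^+ 2)).
 apply: (@le_trans _ _ (3 * a2 * E (fun c => cabs (xi n' c) ^+ 2 * cabs (Dq n c) ^+ 2)
   + 3 * E (fun c => cabs (xe n' c) ^+ 2 * (cabs (Dq n c) ^+ 2 * cabs (Lr n' c) ^+ 2))
   + 3 * E (fun c => cabs (xe n' c) ^+ 2 * (cabs (Dq n c) ^+ 2 * cabs (Lc n' c) ^+ 2)))).
  apply: le_Ex_lin3; first exact: tDL; try by apply: tameM => //; first [exact: tDL|exact: tame_cabsX].
  by move=> c; have := ler_wpM2l (sqr_ge0 (cabs (Dq n c))) (y2le c); lra.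
 rewrite !X2; try exact: tDL; last 2 first.
 - by move=> c c' H; rewrite (Dq_past H) (Lc_past (n := n') H).
 - by move=> c c' H; rewrite (Dq_past H) (Lr_past (n := n') H).
 have h1 := ler_wpM2l m00 (DL _ _ (tame_Lr n') l10 (Lr4 n')).
 have h2 := ler_wpM2l m00 (DL _ _ (tame_Lc n') l20 (Lc4 n')); have h3 := ler_wpM2l a20 XI2.
 have : 0 <= K ^+ 2 * (W * (a2 * m ^+ 2)) by rewrite mulr_ge0 ?sqr_ge0 // mulr_ge0 // mulr_ge0.
 by move: h1 h2 h3; rewrite /wq -/a2 -/l1 -/l2; move: (E _) (E _) (E _) => e1 e2 e3; lra.
have Y4 : E (fun c => cabs (yq n' c) ^+ 4) <= 432 * K ^+ 2 * (wq n' * m ^+ 2) ^+ 2.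
 apply: (@le_trans _ _ (27 * a2 ^+ 2 * E (fun c => cabs (xi n' c) ^+ 4)
   + 27 * E (fun c => cabs (xe n' c) ^+ 4 * cabs (Lr n' c) ^+ 4)
   + 27 * E (fun c => cabs (xe n' c) ^+ 4 * cabs (Lc n' c) ^+ 4))).
  apply: le_Ex_lin3; try exact: tame_cabsX; try by apply: tameM => //; exact: tame_cabsX.
  move=> c; rewrite !(pow4 (cabs _)); have P (x y : C) : 0 <= 3 * (cabs x ^+ 2 * cabs y ^+ 2) by apply: mulr_ge0 => //; apply: mulr_ge0; exact: sqr_ge0.
  have p0 : 0 <= 3 * (a2 * cabs (xi n' c) ^+ 2) by apply: mulr_ge0 => //; apply: mulr_ge0 => //; exact: sqr_ge0.
  by have := sq_add3 (sqr_ge0 _) p0 (P _ _) (P _ _) (y2le c); rewrite !exprMn; lra.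
 have h1 := XL _ l1 (tame_Lr n') (Lr_past (n := n')) (Lr4 n'); have h2 := XL _ l2 (tame_Lc n') (Lc_past (n := n')) (Lc4 n').
 have h3 := ler_wpM2l (sqr_ge0 a2) (xi4 n').
 have k2 : 0 <= K ^+ 2 by exact: sqr_ge0.
 have h4 : (a2 * m ^+ 2) ^+ 2 * K <= (a2 * m ^+ 2) ^+ 2 * K ^+ 2 by rewrite ler_wpM2l ?sqr_ge0 // expr2 ler_peMr.
 have q x y : 0 <= x -> 0 <= y -> 0 <= K ^+ 2 * (x * m ^+ 2 * (y * m ^+ 2)) by move=> *; rewrite !mulr_ge0.
 move: h1 h2 h3 h4 (q _ _ l10 l10) (q _ _ l20 l20) (q _ _ a20 l10) (q _ _ a20 l20) (q _ _ l10 l20).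
 rewrite /wq -/a2 -/l1 -/l2 (pow4 m); clearbody a2; rewrite !exprMn.
 by move: (m ^+ 2) (E _) (E _) (E _) => mm e1 e2 e3; lra.
rewrite (WqS n') (mulrDl (Wq _)) -/W; have w20 : 0 <= wq n' * m ^+ 2 by rewrite mulr_ge0 ?wq_ge0.
move: IH Y2 Y4 W0 w20; move: (E _) (E _) (E _) (wq n' * m ^+ 2) => e1 e2 e3 w g1 g2 g3 V0 w0.
have : 0 <= K ^+ 2 * (W * w) by rewrite mulr_ge0 ?sqr_ge0 // mulr_ge0.
have -> : (36 * K * (W + w)) ^+ 2 = (36 * K * W) ^+ 2 + 2592 * (K ^+ 2 * (W * w)) + 1296 * K ^+ 2 * w ^+ 2 by ring.
lra.
Qed.
Definition qf c : C := ip (col j (entmx c)) (B *m col j (entmx c)).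

Lemma quad4 : E (fun c => cabs (qf c - \tr B * m%:C) ^+ 4) <=
 (36 * K * ((\sum_i \sum_k cabs (B i k) ^+ 2) * m ^+ 2)) ^+ 2.
rewrite -WqN; apply: le_trans (quad4_sec (leqnn N)).
by apply: le_of_eq; apply: eq_Ex => c; rewrite DqN.
Qed.
Lemma quad_mean : EC qf = \tr B * m%:C.
have -> : EC qf = EC (fun c => Dq N c + \tr B * m%:C).
 by apply: eq_Exc => c; rewrite DqN subrK.
rewrite ExcD // ?Exc_cst; last exact: tamecC.
rewrite Exc_sum // big1 ?add0r // => i _.
have := @yq_mean i (fun _ => 1) (tamecC _ _); under eq_Exc do rewrite mulr1.
by apply.
Qed.
(** The fourth cumulant of the entry: the subtracted term is [2 / M ^+ 2] for complex and
    [3 / M ^+ 2] for real entries. *)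
Definition kap (n : 'I_N) : R := E (fun c => cabs (xe n c) ^+ 4) - (2 + eps ^+ 2) * m ^+ 2.

Lemma yq2 (n : 'I_N) : EC (fun c => yq n c ^+ 2) =
 B n n ^+ 2 * (E (fun c => cabs (xe n c) ^+ 4) - m ^+ 2)%:C
 + (eps * m)%:C ^+ 2 * (\sum_(k < N | (k < n)%N) B n k ^+ 2 + \sum_(k < N | (k < n)%N) B k n ^+ 2)
 + 2 * m%:C ^+ 2 * (\sum_(k < N | (k < n)%N) B n k * B k n).
have nN : (n <= N)%N by exact: ltnW (ltn_ord n).
pose f1 c := xi n c ^+ 2; pose f2 c := (xe n c)^* ^+ 2; pose f3 c := xe n c ^+ 2.
pose f4 c := xi n c * (xe n c)^*; pose f5 c := xi n c * xe n c; pose f6 c := (cabs (xe n c) ^+ 2)%:C : C.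
have E' : EC (fun c => yq n c ^+ 2) = EC (fun c => B n n ^+ 2 * f1 c + (f2 c * (Lr n c ^+ 2) +
  (f3 c * Lc n c ^+ 2 + (f4 c * (2 * B n n * Lr n c) + (f5 c * (2 * B n n * Lc n c) + f6 c * (2 * (Lr n c * Lc n c))))))).
 by apply: eq_Exc => c; rewrite /yq /f1 /f2 /f3 /f4 /f5 /f6 -conj_mul; ring.
have t1 : tamec mu f1 by exact: tamecX.
have t2 : tamec mu f2 by exact: (tamecX 2 (txc n)).
have t3 : tamec mu f3 by exact: (tamecX 2 (tx n)).
have t4 : tamec mu f4 by exact: tamecM (tame_xi n) (txc n).
have t5 : tamec mu f5 by exact: tamecM (tame_xi n) (tx n).
have t6 : tamec mu f6 by exact: tamec_real.
have s2 := tamecX 2 (tame_Lr n).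
have s3 := tamecX 2 (tame_Lc n).
have s4 := tamecM (tamecC mu (2 * B n n)) (tame_Lr n).
have s5 := tamecM (tamecC mu (2 * B n n)) (tame_Lc n).
have sLL := tamecM (tame_Lr n) (tame_Lc n).
have s6 : tamec mu (fun c => 2 * (Lr n c * Lc n c)).
 exact: tamecM (tamecC mu 2) sLL.
have q1 : tamec mu (fun c => B n n ^+ 2 * f1 c) by exact: tamecZ.
have q2 := tamecM t2 s2; have q3 := tamecM t3 s3; have q4 := tamecM t4 s4; have q5 := tamecM t5 s5.
have q6 := tamecM t6 s6.
have r5 := tamecD q5 q6; have r4 := tamecD q4 r5; have r3 := tamecD q3 r4; have r2 := tamecD q2 r3.
rewrite E' (ExcD q1 r2) (ExcD q2 r3) (ExcD q3 r4) (ExcD q4 r5) (ExcD q5 q6) ExcZ //.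
have o2 : onlyat n f2 by move=> c c' H; rewrite /f2 (xe_onlyat H).
have o3 : onlyat n f3 by move=> c c' H; rewrite /f3 (xe_onlyat H).
have o4 : onlyat n f4 by move=> c c' H; rewrite /f4 /xi (xe_onlyat H).
have o5 : onlyat n f5 by move=> c c' H; rewrite /f5 /xi (xe_onlyat H).
have o6 : onlyat n f6 by move=> c c' H; rewrite /f6 (xe_onlyat H).
have p2 : past n (fun c => Lr n c ^+ 2) by move=> c c' H; rewrite (Lr_past H).
have p3 : past n (fun c => Lc n c ^+ 2) by move=> c c' H; rewrite (Lc_past H).
have p4 : past n (fun c => 2 * B n n * Lr n c) by move=> c c' H; rewrite (Lr_past H).
have p5 : past n (fun c => 2 * B n n * Lc n c) by move=> c c' H; rewrite (Lc_past H).
have p6 : past n (fun c => 2 * (Lr n c * Lc n c)) by move=> c c' H; rewrite (Lr_past H) (Lc_past H).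
rewrite (indepC_past t2 s2 o2 p2) (indepC_past t3 s3 o3 p3) (indepC_past t4 s4 o4 p4).
rewrite (indepC_past t5 s5 o5 p5) (indepC_past t6 s6 o6 p6).
have ELr : EC (Lr n) = 0 by exact: lin_mean.
have ELc : EC (Lc n) = 0 by rewrite /Lc Exc_conj ?lin_mean ?conjc0 //; exact: tame_lin.
rewrite (ExcZ _ (tame_Lr n)) (ExcZ _ (tame_Lc n)) ELr ELc !mulr0 !add0r.
have -> : EC f1 = (E (fun c => cabs (xe n c) ^+ 4) - m ^+ 2)%:C.
 have -> : EC f1 = EC (fun c => (cabs (xe n c) ^+ 4 - (2 * m * cabs (xe n c) ^+ 2 - m ^+ 2))%:C).
  by apply: eq_Exc => c; rewrite /f1 /xi -rmorphXn /=; congr (_%:C); rewrite pow4; ring.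
 have tA : tame mu (fun c => 2 * m * cabs (xe n c) ^+ 2) := tameZ _ (tax n 2).
 have tB := tameC mu (m ^+ 2).
 rewrite Exc_real (ExB (tax n 4) (tameB tA tB)) (ExB tA tB) (ExZ _ (tax n 2)) Ex_cst Ex2.
 by congr (_%:C); ring.
have -> : EC f3 = (eps * m)%:C by exact: Exx.
have -> : EC f2 = (eps * m)%:C.
 have -> : EC f2 = EC (fun c => (f3 c)^*) by apply: eq_Exc => c; rewrite /f2 /f3 rmorphXn.
 by rewrite Exc_conj // Exx conjc_real.
have -> : EC f6 = m%:C by rewrite /f6 Exc_real Ex2.
have -> : EC (fun c => Lr n c ^+ 2) = (eps * m)%:C * \sum_(k < N | (k < n)%N) B n k ^+ 2.
 under eq_Exc do rewrite expr2; rewrite linlin //.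
have -> : EC (fun c => Lc n c ^+ 2) = (eps * m)%:C * \sum_(k < N | (k < n)%N) B k n ^+ 2.
 have -> : EC (fun c => Lc n c ^+ 2) = EC (fun c =>
   ((lin (fun k => (B k n)^*) n c * lin (fun k => (B k n)^*) n c)^*)%C).
  by apply: eq_Exc => c; rewrite /Lc rmorphM /= expr2.
 rewrite Exc_conj; last by apply: tamecM; exact: tame_lin.
 rewrite linlin // cconj_scale; congr (_ * _); rewrite rmorph_sum.
 by apply: eq_bigr => k _; exact: conj_conj_sq.
have -> : EC (fun c => 2 * (Lr n c * Lc n c)) = 2 * (m%:C * \sum_(k < N | (k < n)%N) B n k * B k n).
 rewrite (ExcZ _ sLL).
 congr (_ * _); rewrite linlinc //; congr (_ * _); apply: eq_bigr => k _.
 by congr (_ * _); exact: conjcK.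
by ring.
Qed.
(** The square is without modulus. Orthogonality of the martingale differences reduces it to [yq2].
    Beyond second moments the law enters only through the fourth cumulants, and this is why four
    matching moments suffice for the comparison. *)
Lemma quad2 : EC (fun c => (qf c - \tr B * m%:C) ^+ 2) =
 \sum_n B n n ^+ 2 * (kap n)%:C + (m ^+ 2)%:C * (\tr (B *m B) + (eps ^+ 2)%:C * \sum_i \sum_k B i k ^+ 2).
have -> : EC (fun c => (qf c - \tr B * m%:C) ^+ 2) = EC (fun c => Dq N c ^+ 2).
 by apply: eq_Exc => c; rewrite DqN.
have H k : (k <= N)%N -> EC (fun c => Dq k c ^+ 2) = \sum_(n < N | (n < k)%N) EC (fun c => yq n c ^+ 2).
 elim: k => [_|k IH kN].
  by rewrite Dq0 big_pred0 //; under eq_Exc do rewrite expr0n; exact: Exc_cst.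
 pose k' := Ordinal kN; rewrite (sum_ltS _ k') -IH; last exact: ltnW.
 have tD2 : tamec mu (fun c => 2 * Dq k c) by exact: tamecZ.
 have -> : EC (fun c => Dq k.+1 c ^+ 2) = EC (fun c => yq k' c ^+ 2 + (Dq k c ^+ 2 + yq k' c * (2 * Dq k c))).
  by apply: eq_Exc => c; rewrite (DqS k') /=; ring.
 rewrite ExcD; [|exact: tamecX|by apply: tamecD; [exact: tamecX|exact: tamecM]].
 rewrite ExcD; [|exact: tamecX|exact: tamecM].
 by rewrite yq_mean ?addr0 // => c c' H; rewrite (Dq_past H).
rewrite H // sum_ltN; under eq_bigr do rewrite yq2.
have -> : \tr (B *m B) = \sum_i \sum_k B i k * B k i.
 by apply: eq_bigr => i _; rewrite mxE.
rewrite !sum_tri mulrDr !mulr_sumr -!big_split /=; apply: eq_bigr => n _.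
have -> : \sum_(k < N | (k < n)%N) B k n * B n k = \sum_(k < N | (k < n)%N) B n k * B k n.
 by apply: eq_bigr => k _; rewrite mulrC.
have -> : (kap n)%:C = (E (fun c => cabs (xe n c) ^+ 4) - m ^+ 2)%:C - (1 + eps%:C ^+ 2) * m%:C ^+ 2.
 by rewrite /kap !(expr2 (_%:C)); apply: eqcP => /=; ring.
rewrite (rmorphM (real_complex R)) !(rmorphXn (real_complex R)) /=.
by ring.
Qed.

End Quadratic.

(** Apply [quad4] to the rank-one matrix [u *m adjmx u], whose quadratic form is the squared modulus
    of the linear form. The constant exceeds [8 * 36 ^ 2 + 8 = 10376]. *)
Lemma lin8 (u : 'cV[C]_N) :
 E (fun c => cabs (ip (col j (entmx c)) u) ^+ 8) <= 10400 * K ^+ 2 * (nv u * m) ^+ 4.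
pose B := u *m adjmx u.
have qfE c : qf B c = (cabs (ip (col j (entmx c)) u) ^+ 2)%:C.
 rewrite /qf /B -mulmxA [adjmx u *m _]mx11_scalar -/(ip u _) mul_mx_scalar ipZr.
 by rewrite -(ip_conj (col j (entmx c)) u) mulrC conj_mul.
have trB : \tr B = (nv u)%:C by rewrite /B mxtrace_mulC /mxtrace big_ord1 -/(ip u u) ipuu.
have frB : \sum_i \sum_k cabs (B i k) ^+ 2 = nv u ^+ 2.
 rewrite expr2 /nv mulr_suml; apply: eq_bigr => i _; rewrite mulr_sumr; apply: eq_bigr => k _.
 by rewrite /B mxE big_ord1 adjmxE cabsM cabs_conj exprMn.
have tl : tamec mu (fun c => ip (col j (entmx c)) u).
 rewrite (_ : (fun c => _) = fun c => \sum_i (xe i c)^* * u i 0); last first.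
  by apply/funext => c; rewrite ipE; apply: eq_bigr => i _; rewrite col_xe.
 by apply: tamec_sum => i; apply: tamecM; [exact: tamecJ|exact: tamecC].
have tq : tamec mu (qf B).
 rewrite (_ : qf B = fun c => (cabs (ip (col j (entmx c)) u) ^+ 2)%:C); last exact/funext.
 by apply: tamec_real; exact: tame_cabsX.
have tD : tamec mu (fun c => qf B c - \tr B * m%:C) by apply: tamecB => //; exact: tamecC.
have n0 : 0 <= nv u * m by rewrite mulr_ge0 ?nv_ge0 // ltW.
have H4 := quad4 B; rewrite frB in H4.
apply: (@le_trans _ _ (8 * E (fun c => cabs (qf B c - \tr B * m%:C) ^+ 4) + 0 * E (fun=> 0) + 8 * E (fun => (nv u * m) ^+ 4))).
 apply: le_Ex_lin3; [exact: tame_cabsX|exact: tame_cabsX|exact: tameC|exact: tameC|].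
 move=> c; rewrite mul0r addr0.
 have -> : qf B c - \tr B * m%:C = (cabs (ip (col j (entmx c)) u) ^+ 2 - nv u * m)%:C.
  by rewrite qfE trB; apply: eqcP => /=; ring.
 rewrite cabs_real.
 rewrite pow8; set a := cabs (ip (col j (entmx c)) u) ^+ 2.
 set b := nv u * m in n0 *; rewrite (pow4 a) (pow4 b) (pow4 `|_|) real_normK ?num_real //.
 have h1 : a ^+ 2 <= 2 * ((a - b) ^+ 2 + b ^+ 2) by have := sqr_ge0 (a - 2 * b); nra.
 apply: (@le_trans _ _ ((2 * ((a - b) ^+ 2 + b ^+ 2)) ^+ 2)).
  by rewrite lerXn2r ?nnegrE ?sqr_ge0 // mulr_ge0 // addr_ge0 // sqr_ge0.
 by have := sqr_ge0 ((a - b) ^+ 2 - b ^+ 2); move: ((a - b) ^+ 2) (b ^+ 2) => p q; nra.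
rewrite !Ex_cst mulr0 addr0.
have -> : (nv u * m) ^+ 4 = ((nv u * m) ^+ 2) ^+ 2 by rewrite -exprM.
move: H4; rewrite -[nv u ^+ 2 * _]exprMn.
have : 0 <= ((nv u * m) ^+ 2) ^+ 2 by exact: sqr_ge0.
have : 1 <= K ^+ 2 by rewrite expr2 (le_trans K1) // ler_peMr // (le_trans ler01).
set q := (nv u * m) ^+ 2; move=> k2 V0.
have -> : (36 * K * q) ^+ 2 = 1296 * (K ^+ 2 * q ^+ 2) by ring.
have : q ^+ 2 <= K ^+ 2 * q ^+ 2 by rewrite ler_peMl.
move=> h1 h2; lra.
Qed.

End ColumnMoments.

(** * The local law *)

Section MarchenkoPasturEquation.
Variable R : realType.
Local Notation C := R[i].

(* The self-consistent equation satisfied by the Stieltjes transform [s] of the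
  Marchenko-Pastur law of parameter [dd], and the sign condition selecting
  the right branch. *)
Definition mpsol (dd : R) (z s : C) :=
 (1 + dd%:C * s) * (z * s + 1) = s /\ 0 <= Im z * Im (z * (dd%:C * s)).

Lemma Im_sign_lb (z w : C) : Im z != 0 -> 0 <= Im z * Im w -> `|Im z| <= cabs (z + w).
move=> z0 H; apply: le_trans (le_Im_cabs _); rewrite cImD.
rewrite -(@ler_pXn2r _ 2) ?nnegrE // !real_normK ?num_real // sqrrD.
by rewrite -addrA lerDl addr_ge0 ?sqr_ge0 // mulr2n addr_ge0.
Qed.

Variables (dd : R) (z s : C) (h : R).
Hypotheses (z0 : Im z != 0) (Hs : mpsol dd z s).
Hypotheses (Hz : `|Im z|^-1 <= h) (Hzc : cabs z <= h).
Let a := dd%:C * s.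
Let tau := (1 + a)^-1.

Lemma h_gt0 : 0 < h.
by apply: lt_le_trans Hz; rewrite invr_gt0 normr_gt0. Qed.
Lemma Imz_ge : h^-1 <= `|Im z|.
by rewrite -[`|_|]invrK lef_pV2 // posrE ?h_gt0 // invr_gt0 normr_gt0. Qed.
Lemma one_plus_a_lb : `|Im z| <= cabs z * cabs (1 + a).
by rewrite -cabsM mulrDr mulr1; apply: Im_sign_lb => //; case: Hs. Qed.
Lemma inv_lb (w : C) : `|Im z| <= cabs z * cabs w -> cabs w^-1 <= h ^+ 2.
move=> H; have zp : 0 < `|Im z| by rewrite normr_gt0.
have w0 : 0 < cabs w.
 rewrite lt_neqAle cabs_ge0 andbT eq_sym; apply/eqP => E; move: H.
 by rewrite E mulr0 leNgt zp.
rewrite cabsV -[_^-1]mul1r ler_pdivrMr //.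
apply: (@le_trans _ _ (h * `|Im z|)); first by rewrite -ler_pdivrMr // mul1r.
rewrite expr2 -mulrA; apply: ler_wpM2l; first exact: ltW h_gt0.
by apply: (le_trans H); rewrite ler_wpM2r ?cabs_ge0.
Qed.
Lemma one_plus_a_neq0 : 1 + a != 0.
rewrite -cabs_eq0; apply/eqP => E; have := one_plus_a_lb.
by rewrite E mulr0 leNgt normr_gt0 z0.
Qed.
Lemma cabs_tau : cabs tau <= h ^+ 2.
by apply: inv_lb; exact: one_plus_a_lb. Qed.
Lemma tau_s : tau * s = z * s + 1.
case: Hs => + _; rewrite -/a => E; rewrite -[in LHS]E mulrA /tau mulVf ?mul1r //.
exact: one_plus_a_neq0.
Qed.
Lemma tau_a : z * a + dd%:C - 1 = - tau.
have n0 := one_plus_a_neq0.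
have E : z * a + dd%:C = tau * a by rewrite /a [RHS]mulrCA tau_s; ring.
by rewrite E /tau; field.
Qed.
Lemma Im_tau : Im z * Im tau <= 0.
have -> : tau = - (z * a) - (dd%:C - 1) by rewrite -[tau]opprK -tau_a; ring.
rewrite cImD !cImN [Im (dd%:C - 1)]/= subr0 oppr0 addr0 mulrN oppr_le0.
by case: Hs.
Qed.
(** Stability factor: the quadratic polynomial with root [a], evaluated at another point [A], equals
    [(A - a) * Rfun A] by [mpoly_factor]. *)
Definition Rfun (A : C) : C := z * A + z - tau.

(** Both [z * A] and [- tau] have imaginary parts of the sign of [Im z], so nothing cancels against
    [z]. The bound is uniform in such [A], which makes the comparison of [A] with [a] direct at each
    single [z]. *)
Lemma Rfun_lb (A : C) : 0 <= Im z * Im (z * A) -> h^-1 <= cabs (Rfun A).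
move=> HA; apply: (le_trans Imz_ge); rewrite (_ : Rfun A = z + (z * A - tau)); last by rewrite /Rfun; ring.
apply: Im_sign_lb => //.
by rewrite cImD cImN mulrDr mulrN addr_ge0 // oppr_ge0 Im_tau.
Qed.
Lemma Rfun_inv (A : C) : 0 <= Im z * Im (z * A) -> cabs (Rfun A)^-1 <= h.
move=> /Rfun_lb H; rewrite cabsV -[h]invrK lef_pV2 // posrE ?invr_gt0 ?h_gt0 //.
by apply: lt_le_trans H; rewrite invr_gt0 h_gt0.
Qed.
Lemma mpoly_factor (A : C) : (1 + A) * (z * A + dd%:C - 1) + 1 = (A - a) * Rfun A.
have n0 := one_plus_a_neq0.
have : (1 + a) * (z * a + dd%:C - 1) + 1 = 0.
 by rewrite tau_a /tau mulrN mulfV // addNr.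
move=> E; rewrite -[LHS]subr0 -E /Rfun -[- tau]tau_a; ring.
Qed.
Lemma z_minus_tau : (z - tau) * s = -1.
by rewrite mulrBl tau_s; ring. Qed.

End MarchenkoPasturEquation.

Lemma le_8D (R : realType) (x y a b c d : R) : x <= a -> y <= b -> a <= c -> b <= c -> 16 * c <= d -> 8 * (x + y) <= d.
by move=> *; lra. Qed.
Lemma mean_sq (R : realType) (M : nat) (t : 'I_M -> R) : (0 < M)%N ->
 (M%:R^-1 * \sum_j t j) ^+ 2 <= M%:R^-1 * \sum_j t j ^+ 2.
move=> M0; have Mp : (0 : R) < M%:R by rewrite ltr0n.
have := cauchy_schwarz_sum t (fun _ => 1).
under eq_bigr do rewrite mulr1.
under [X in _ * X]eq_bigr do rewrite expr1n.
rewrite sumr_const card_ord => H; rewrite exprMn expr2 -mulrA.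
apply: ler_wpM2l; first by rewrite invr_ge0 ltW.
by rewrite ler_pdivrMl // mulrC.
Qed.
Lemma mean_pow4 (R : realType) (M : nat) (t : 'I_M -> R) : (0 < M)%N ->
 (M%:R^-1 * \sum_j t j) ^+ 4 <= M%:R^-1 * \sum_j t j ^+ 4.
move=> M0; rewrite pow4; under [X in _ <= _ * X]eq_bigr do rewrite pow4.
apply: le_trans (mean_sq _ M0).
by rewrite lerXn2r ?nnegrE ?sqr_ge0 ?mean_sq // mulr_ge0 ?invr_ge0 ?sumr_ge0 // => j _; rewrite sqr_ge0.
Qed.
Lemma add_pow4_le (R : realType) (x y : R) : (x + y) ^+ 4 <= 8 * (x ^+ 4 + y ^+ 4).
rewrite !pow4; have : (x + y) ^+ 2 <= 2 * (x ^+ 2 + y ^+ 2) by have := sqr_ge0 (x - y); nra.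
move=> H; apply: (@le_trans _ _ ((2 * (x ^+ 2 + y ^+ 2)) ^+ 2)).
 by rewrite lerXn2r ?nnegrE ?sqr_ge0 // mulr_ge0 // addr_ge0 // sqr_ge0.
by have := sqr_ge0 (x ^+ 2 - y ^+ 2); nra.
Qed.
Lemma pow4_pull (R : realType) (x y z : R) : (x ^+ 2 * (y + z)) ^+ 4 = x ^+ 8 * (y + z) ^+ 4.
by ring. Qed.
(** One inequality that lets [h] absorb the numerical constants: for [1 <= K] it yields
    [36 * K <= h] and [16 <= h]. The number is that of [lin8]. *)
Definition dominates (R : realType) (K h : R) := 10400 * K ^+ 2 <= h.

Section Laws.
Variables (R : realType) (N M : nat).
Local Notation C := R[i].
Variables (mu : mxlaw R N M) (K eps h : R).
Hypothesis Hg : goodlaw mu K eps.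
Local Notation E := (Ex mu).
Local Notation EC := (Exc mu).
Local Notation m := (M%:R^-1 : R).
Local Notation dd := (N%:R / M%:R : R).
Hypotheses (HK : dominates K h) (HN : N%:R <= h * M%:R).
Implicit Types (c : EntT R N M) (j : 'I_M).

Let M0 : (0 < M)%N. Proof. by case: Hg. Qed.
Let Mp : (0 : R) < M%:R. Proof. by rewrite ltr0n. Qed.
Let m0 : 0 < m. Proof. by rewrite invr_gt0. Qed.
Let m1 : m <= 1. Proof. by rewrite invf_le1 // ler1n. Qed.
Let K1 : 1 <= K. Proof. by case: Hg. Qed.
Let K2 : 1 <= K ^+ 2. Proof. by rewrite expr_ge1 // (le_trans ler01). Qed.
Let h16 : 16 <= h.
have H : 10400 <= h by apply: le_trans HK; rewrite ler_peMr ?ler0n.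
by move: H; lra.
Qed.
Let h1 : 1 <= h. Proof. by move: h16; lra. Qed.
Let h0 : 0 <= h. Proof. by move: h16; lra. Qed.
Let hK : 36 * K <= h.
have H : K <= K ^+ 2 by rewrite expr2 ler_peMr // (le_trans ler01).
by move: HK K1 H; rewrite /dominates; lra.
Qed.
Let hX_ge0 n : 0 <= h ^+ n. Proof. exact: exprn_ge0. Qed.
Let hX_le n k : (n <= k)%N -> h ^+ n <= h ^+ k. Proof. by move=> nk; apply: ler_weXn2l. Qed.
Lemma tamemx_ent : tamemx mu (fun c => entmx c).
by move=> i j; case: Hg => _ _ _ /(_ i j)[]. Qed.
Lemma tamemx_col j : tamemx mu (fun c => col j (entmx c)).
by move=> i k; under eq_fun do rewrite mxE; exact: tamemx_ent. Qed.
Lemma mfmx_zcol j : mfmx (fun c => zcol j (entmx c)).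
move=> i k; under eq_fun do rewrite mxE.
case: eqP => _; first exact: mfcC.
by apply: tamec_mfc; exact: tamemx_ent.
Qed.
Lemma tamemx_G z : Im z != 0 -> tamemx mu (fun c => Rs (entmx c) z).
by move=> z0; apply: tamemx_Rs => //; apply: tamemx_mf; exact: tamemx_ent. Qed.
Lemma tamemx_Gj z j : Im z != 0 -> tamemx mu (fun c => Rs (zcol j (entmx c)) z).
by move=> z0; apply: tamemx_Rs => //; exact: mfmx_zcol. Qed.
Definition colS j : 'I_N -> 'I_M -> bool := fun _ k => k == j.

Lemma col_mix j (x y : Ent R N M) : col j (entmx (mix (colS j) x y)) = col j (entmx x).
by apply/matrixP => i k; rewrite !mxE /mix /colS eqxx. Qed.
Lemma zcol_mix j (x y : Ent R N M) : zcol j (entmx (mix (colS j) x y)) = zcol j (entmx y).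
by apply/matrixP => i k; rewrite !mxE /mix /colS; case: eqP. Qed.

(* Conditioning on all columns but the j-th one. *)
Lemma Ex_col_le j (F : EntT R N M -> R) (f : 'cV[C]_N -> 'M[C]_(N, M) -> R) (B : R) :
 (forall c, F c = f (col j (entmx c)) (zcol j (entmx c))) ->
 (forall c, 0 <= F c) -> tame mu F ->
 (forall Y, tame mu (fun x => f (col j (entmx x)) Y)) ->
 (forall Y, E (fun x => f (col j (entmx x)) Y) <= B) -> E F <= B.
move=> FE F0 tF tf Hf; case: Hg => -[p Hp] _ _ _.
have e y x : F (mix (colS j) x y) = f (col j (entmx x)) (zcol j (entmx y)).
 by rewrite FE col_mix zcol_mix.
apply: (Ex_mix_le Hp (S := colS j)) => // y.
- by under eq_fun do rewrite e; exact: tf.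
- by under eq_Ex do rewrite e; exact: Hf.
Qed.
Lemma Exc_col_eq j (F H : EntT R N M -> C) (f : 'cV[C]_N -> 'M[C]_(N, M) -> C) (H' : 'M[C]_(N, M) -> C) :
 (forall c, F c = f (col j (entmx c)) (zcol j (entmx c))) ->
 (forall c, H c = H' (zcol j (entmx c))) ->
 tamec mu F -> tamec mu H ->
 (forall Y, tamec mu (fun x => f (col j (entmx x)) Y)) ->
 (forall Y, EC (fun x => f (col j (entmx x)) Y) = H' Y) -> EC F = EC H.
move=> FE HE tF tH tf Hf; case: Hg => -[p Hp] _ _ _.
have e y x : F (mix (colS j) x y) = f (col j (entmx x)) (zcol j (entmx y)).
 by rewrite FE col_mix zcol_mix.
apply: (Exc_mix_eq Hp (S := colS j)) => // y.
- by under eq_fun do rewrite e; exact: tf.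
- by under eq_Exc do rewrite e; rewrite HE; exact: Hf.
Qed.
Lemma tame_qform j (B : 'M[C]_N) (v : C) n :
 tame mu (fun c => cabs (ip (col j (entmx c)) (B *m col j (entmx c)) - v) ^+ n).
apply: tame_cabsX; apply: tamecB; last exact: tamecC.
apply: tamec_ip; first exact: tamemx_col.
by apply: tamemxM; [exact: tamemxC|exact: tamemx_col].
Qed.
Lemma opb_quad4 j (B : 'M[C]_N) k : opb B k ->
 E (fun c => cabs (ip (col j (entmx c)) (B *m col j (entmx c)) - \tr B * m%:C) ^+ 4)
 <= (h ^+ 2 * k ^+ 2) ^+ 2 * m ^+ 2.
move=> oB; apply: (le_trans (quad4 Hg j B)); rewrite -exprMn.
have k0 : 0 <= k by case: oB.
have F := opb_fro oB.
rewrite lerXn2r ?nnegrE //.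
- rewrite mulr_ge0 ?mulr_ge0 ?ler0n ?sqr_ge0 ?(le_trans ler01 K1) //.
 by apply: sumr_ge0 => i _; apply: sumr_ge0 => l _; exact: sqr_ge0.
- by rewrite !mulr_ge0 ?sqr_ge0 // ltW.
have F2 : (\sum_i \sum_l cabs (B i l) ^+ 2) * m <= h * k ^+ 2.
 rewrite ler_pdivrMr //; apply: (le_trans F).
 by rewrite mulrAC ler_wpM2r ?sqr_ge0.
move: F2; set S := \sum_i _ => F2.
have S0 : 0 <= S * m.
 rewrite mulr_ge0 ?(ltW m0) //.
 by apply: sumr_ge0 => i _; apply: sumr_ge0 => l _; exact: sqr_ge0.
have -> : 36 * K * (S * m ^+ 2) = 36 * K * (S * m) * m by ring.
have -> : h ^+ 2 * k ^+ 2 * m = h * (h * k ^+ 2) * m by ring.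
apply: ler_wpM2r; first exact: ltW.
by apply: ler_pM => //; rewrite mulr_ge0 ?ler0n ?(le_trans ler01 K1).
Qed.
Lemma nv_lin8 j (u : 'cV[C]_N) k : nv u <= k ->
 E (fun c => cabs (ip (col j (entmx c)) u) ^+ 8) <= h * k ^+ 4 * m ^+ 4.
move=> uk; apply: (le_trans (lin8 Hg j u)); have -> : h * k ^+ 4 * m ^+ 4 = h * (k * m) ^+ 4 by ring.
apply: ler_pM.
- by rewrite mulr_ge0 ?ler0n ?sqr_ge0.
- by rewrite exprn_ge0 // mulr_ge0 ?nv_ge0 // ltW.
- exact: HK.
- by rewrite lerXn2r ?nnegrE ?mulr_ge0 ?nv_ge0 ?(ltW m0) ?(le_trans (nv_ge0 u)) // ler_wpM2r // ltW.
Qed.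

Section AtZ.
Variables (z s : C).
Hypotheses (z0 : Im z != 0) (Hz : `|Im z|^-1 <= h) (Hzc : cabs z <= h).
Hypotheses (Hs : mpsol dd z s) (Hsc : cabs s <= h).
Local Notation a := (dd%:C * s).
Local Notation tau := ((1 + a)^-1).
Local Opaque Rs.

Definition Gf c := Rs (entmx c) z.
Definition Gjf j c := Rs (zcol j (entmx c)) z.
Definition xf j c : 'cV[C]_N := col j (entmx c).
(** Normalised by [M] rather than [N], so that the limit is [a = dd * s]. Below, [Df] and [D2f] are
    the centred quadratic forms of the reduced resolvent and of its square. *)
Definition Af c : C := \tr (Gf c) * m%:C.
Definition Ajf j c : C := \tr (Gjf j c) * m%:C.
Definition qf_ j c : C := ip (xf j c) (Gjf j c *m xf j c).
Definition Df j c : C := qf_ j c - Ajf j c.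
Definition D2f j c : C := ip (xf j c) (Gjf j c *m Gjf j c *m xf j c) - \tr (Gjf j c *m Gjf j c) * m%:C.

Lemma opb_h (Y : 'M[C]_(N, M)) : opb (Rs Y z) h.
have [k0 H] := Rs_opb z0 Y; split => // u; apply: (le_trans (H u)).
by rewrite ler_wpM2r ?nv_ge0 // lerXn2r ?nnegrE.
Qed.
Let tG := tamemx_G z0.
Let tGj j := tamemx_Gj j z0.
Let tx := tamemx_col.

Lemma tame_qf_ j : tamec mu (qf_ j).
by apply: tamec_ip; [exact: tx|apply: tamemxM; [exact: tGj|exact: tx]]. Qed.
Lemma tame_Ajf j : tamec mu (Ajf j).
by apply: tamecM; [apply: tamec_tr; exact: tGj|exact: tamecC]. Qed.
Lemma tame_Af : tamec mu Af.
by apply: tamecM; [apply: tamec_tr; exact: tG|exact: tamecC]. Qed.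
Lemma tame_Df j : tamec mu (Df j).
by apply: tamecB; [exact: tame_qf_|exact: tame_Ajf]. Qed.
Lemma tame_D2f j : tamec mu (D2f j).
have t2 := tamemxM (tGj j) (tGj j).
apply: tamecB; first by apply: tamec_ip; [exact: tx|apply: tamemxM => //; exact: tx].
by apply: tamecM; [exact: tamec_tr|exact: tamecC].
Qed.
Lemma den_f j c : 1 + qf_ j c != 0. Proof. exact: den_neq0. Qed.
Lemma inv_den_f j c : cabs (1 + qf_ j c)^-1 <= h ^+ 2.
apply: (inv_lb z0 Hz Hzc); exact: (Im_den z0 (zcol j (entmx c)) (xf j c)). Qed.
Lemma ImM_A (Y : 'M[C]_(N, M)) : 0 <= Im z * Im (z * (\tr (Rs Y z) * m%:C)).
by apply: ImM_tr_Rs => //; exact: ltW. Qed.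
Lemma one_plus_Aj_lb (Y : 'M[C]_(N, M)) : cabs (1 + \tr (Rs Y z) * m%:C)^-1 <= h ^+ 2.
apply: (inv_lb z0 Hz Hzc); rewrite -cabsM mulrDr mulr1; apply: Im_sign_lb => //; exact: ImM_A.
Qed.
Lemma one_plus_Aj_neq0 (Y : 'M[C]_(N, M)) : 1 + \tr (Rs Y z) * m%:C != 0.
rewrite -cabs_eq0; apply/eqP => E0.
have : `|Im z| <= cabs (z * (1 + \tr (Rs Y z) * m%:C)).
 by rewrite mulrDr mulr1; apply: Im_sign_lb => //; exact: ImM_A.
by rewrite cabsM E0 mulr0 leNgt normr_gt0 z0.
Qed.
Lemma E_D4 j : E (fun c => cabs (Df j c) ^+ 4) <= h ^+ 8 * m ^+ 2.
apply: (@Ex_col_le j _ (fun x Y => cabs (ip x (Rs Y z *m x) - \tr (Rs Y z) * m%:C) ^+ 4)) => //.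
- by move=> c; rewrite exprn_ge0 ?cabs_ge0.
- by apply: tame_cabsX; exact: tame_Df.
- by move=> Y; exact: tame_qform.
- move=> Y; apply: (le_trans (opb_quad4 j (opb_h Y))).
 by rewrite -exprD -exprM.
Qed.
Lemma E_D24 j : E (fun c => cabs (D2f j c) ^+ 4) <= h ^+ 12 * m ^+ 2.
apply: (@Ex_col_le j _ (fun x Y => cabs (ip x (Rs Y z *m Rs Y z *m x) - \tr (Rs Y z *m Rs Y z) * m%:C) ^+ 4)) => //.
- by move=> c; rewrite exprn_ge0 ?cabs_ge0.
- by apply: tame_cabsX; exact: tame_D2f.
- by move=> Y; exact: tame_qform.
- move=> Y; apply: (le_trans (opb_quad4 j (opbM (opb_h Y) (opb_h Y)))).
 by rewrite -!expr2 -!exprM -exprD -exprM.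
Qed.
Lemma tr2_le j c : cabs (\tr (Gjf j c *m Gjf j c) * m%:C) <= h ^+ 3.
have H := opb_tr (opbM (opb_h (zcol j (entmx c))) (opb_h (zcol j (entmx c)))).
rewrite cabsM cabs_ge0r ?(ltW m0) // ler_pdivrMr //; apply: (le_trans H).
by rewrite exprS -expr2 mulrAC ler_wpM2r ?sqr_ge0.
Qed.
Lemma A_sub_Aj j c : Ajf j c - Af c =
 m%:C * (D2f j c + \tr (Gjf j c *m Gjf j c) * m%:C) / (1 + qf_ j c).
rewrite /D2f subrK /Ajf /Af /Gf (tr_Rs_sm (entmx c) j z0) /qf_ /Gjf /xf.
by have := den_f j c; rewrite /qf_ /Gjf /xf; move: (m%:C) => mm n0; field.
Qed.
Lemma A_sub_Aj_le j c : cabs (Ajf j c - Af c) <= m * (h ^+ 2 * (cabs (D2f j c) + h ^+ 3)).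
rewrite A_sub_Aj -mulrA cabsM cabs_ge0r ?(ltW m0) // ler_wpM2l ?(ltW m0) //.
rewrite cabsM mulrC; apply: ler_pM; rewrite ?cabs_ge0 //; first exact: inv_den_f.
by apply: (le_trans (cabsD _ _)); rewrite lerD2l tr2_le.
Qed.
Lemma E_AAj4 j : E (fun c => cabs (Ajf j c - Af c) ^+ 4) <= h ^+ 21 * m ^+ 4.
apply: (@le_trans _ _ (8 * h ^+ 8 * m ^+ 4 * E (fun c => cabs (D2f j c) ^+ 4) + 0 * E (fun=> 0)
  + 8 * h ^+ 20 * m ^+ 4 * E (fun=> 1))).
 have tA : tamec mu (fun c => Ajf j c - Af c) by apply: tamecB; [exact: tame_Ajf|exact: tame_Af].
 apply: le_Ex_lin3.
 - exact: tame_cabsX.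
 - by apply: tame_cabsX; exact: tame_D2f.
 - exact: tameC.
 - exact: tameC.
 move=> c; rewrite mulr0 addr0 mulr1.
 apply: (@le_trans _ _ ((m * (h ^+ 2 * (cabs (D2f j c) + h ^+ 3))) ^+ 4)).
  rewrite lerXn2r ?nnegrE ?cabs_ge0 ?A_sub_Aj_le //.
  by rewrite !mulr_ge0 ?addr_ge0 ?cabs_ge0 ?(ltW m0).
 have -> : (m * (h ^+ 2 * (cabs (D2f j c) + h ^+ 3))) ^+ 4 = m ^+ 4 * h ^+ 8 * (cabs (D2f j c) + h ^+ 3) ^+ 4 by ring.
 have := ler_wpM2l (mulr_ge0 (exprn_ge0 4 (ltW m0)) (hX_ge0 8)) (add_pow4_le (cabs (D2f j c)) (h ^+ 3)).
 have -> : (h ^+ 3) ^+ 4 = h ^+ 12 by rewrite -exprM.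
 have -> : h ^+ 20 = h ^+ 8 * h ^+ 12 by rewrite -exprD.
 by lra.
rewrite !Ex_cst mulr0 addr0 mulr1.
have m40 : 0 <= m ^+ 4 by rewrite exprn_ge0 // ltW.
have H1 : h ^+ 8 * E (fun c => cabs (D2f j c) ^+ 4) <= h ^+ 20.
 have -> : h ^+ 20 = h ^+ 8 * h ^+ 12 by rewrite -exprD.
 apply: ler_wpM2l => //; apply: (le_trans (E_D24 j)).
 by rewrite ler_piMr // expr_le1 // ltW.
have H2 : 16 * h ^+ 20 <= h ^+ 21 by rewrite (exprS h 20) ler_wpM2r //; move: h16; lra.
move: (ler_wpM2l m40 H1) (ler_wpM2l m40 H2); move: (E _) => x1; lra.
Qed.
(** [Af] almost solves the quadratic equation: after inserting the column expansion of the trace,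
    the defect of column [j] is the fluctuation [Df j] plus the rank-one change [Ajf j - Af]. *)
Lemma PA_sum c : (Af c - a) * Rfun dd z s (Af c) =
 m%:C * \sum_j (Df j c + (Ajf j c - Af c)) / (1 + qf_ j c).
rewrite -mpoly_factor //.
have zA : z * Af c = m%:C * \sum_j (1 - (1 + qf_ j c)^-1) - dd%:C.
 rewrite /Af mulrA mulz_tr_Rs // mulrBl mulrC; congr (_ - _).
 by rewrite rmorphM /= rmorph_nat.
have mM : m%:C * M%:R = 1 :> C.
 by rewrite -(rmorph_nat (real_complex R)) -rmorphM /= mulVf // gt_eqF.
have S1 : m%:C * \sum_(j < M) (1 : C) = 1 by rewrite sumr_const card_ord mM.
rewrite zA subrK -[X in _ - X]S1 -mulrBr -sumrB mulrCA -[X in _ + X]S1 -mulrDr; congr (_ * _).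
rewrite mulr_sumr -big_split; apply: eq_bigr => j _ /=.
by have n0 := den_f j c; rewrite /Df; field.
Qed.
(** Divide [PA_sum] by the stability factor and use convexity of the fourth power on the average
    over the columns. *)
Lemma E_A4 : E (fun c => cabs (Af c - a) ^+ 4) <= h ^+ 34 * m ^+ 2.
have tVa : tamec mu (fun c => Af c - a) by apply: tamecB; [exact: tame_Af|exact: tamecC].
have tAA j : tamec mu (fun c => Ajf j c - Af c) by apply: tamecB; [exact: tame_Ajf|exact: tame_Af].
pose g j c := 8 * (cabs (Df j c) ^+ 4 + cabs (Ajf j c - Af c) ^+ 4).
have tg j : tame mu (g j).
 apply: tameZ; apply: tameD; apply: tame_cabsX => //; exact: tame_Df.
have H c : cabs (Af c - a) ^+ 4 <= h ^+ 12 * m * \sum_j g j c.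
 have RI : cabs (Rfun dd z s (Af c))^-1 <= h by apply: Rfun_inv => //; exact: ImM_A.
 have Rn0 : Rfun dd z s (Af c) != 0.
  rewrite -cabs_eq0; apply/eqP => E0.
  have := @Rfun_lb _ _ _ _ _ z0 Hs Hz _ (ImM_A (entmx c)); rewrite E0 leNgt invr_gt0.
  by rewrite (lt_le_trans ltr01 h1).
 have -> : Af c - a = (m%:C * \sum_j (Df j c + (Ajf j c - Af c)) / (1 + qf_ j c)) / Rfun dd z s (Af c).
  by rewrite -PA_sum mulfK.
 have B1 : cabs (m%:C * \sum_j (Df j c + (Ajf j c - Af c)) / (1 + qf_ j c)) <=
   m * \sum_j (h ^+ 2 * (cabs (Df j c) + cabs (Ajf j c - Af c))).
  rewrite cabsM cabs_ge0r ?(ltW m0) // ler_wpM2l ?(ltW m0) //.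
  apply: (le_trans (cabs_sum _ _ _)); apply: ler_sum => j _.
  rewrite cabsM mulrC; apply: ler_pM; rewrite ?cabs_ge0 ?inv_den_f //; exact: cabsD.
 have B2 := mean_pow4 (fun j => h ^+ 2 * (cabs (Df j c) + cabs (Ajf j c - Af c))) M0.
 rewrite cabsM exprMn.
 apply: (@le_trans _ _ ((m * \sum_j (h ^+ 2 * (cabs (Df j c) + cabs (Ajf j c - Af c)))) ^+ 4 * h ^+ 4)).
  apply: ler_pM; rewrite ?exprn_ge0 ?cabs_ge0 //.
  - by rewrite lerXn2r ?nnegrE ?cabs_ge0 // (le_trans _ B1) ?cabs_ge0.
  - by rewrite lerXn2r ?nnegrE ?cabs_ge0.
 rewrite mulrC; set S := \sum_j g j c.
 have -> : h ^+ 12 * m * S = h ^+ 4 * (m * (h ^+ 8 * S)) by ring.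
 apply: (ler_wpM2l (hX_ge0 4)); apply: (le_trans B2); apply: (ler_wpM2l (ltW m0)).
 rewrite /S mulr_sumr; apply: ler_sum => j _.
 rewrite pow4_pull.
 apply: (ler_wpM2l (hX_ge0 8)); exact: add_pow4_le.
apply: (@le_trans _ _ (h ^+ 12 * m * \sum_j E (g j))).
 rewrite -Ex_sum // -ExZ; last exact: tame_sum.
 apply: le_Ex => //; first exact: tame_cabsX.
 by apply: tameZ; exact: tame_sum.
have Hg' j : E (g j) <= h ^+ 22 * m ^+ 2.
 rewrite /g ExZ; last by apply: tameD; apply: tame_cabsX => //; exact: tame_Df.
 rewrite ExD; [|by apply: tame_cabsX; exact: tame_Df|exact: tame_cabsX].
 have e1 := E_D4 j; have e2 := E_AAj4 j.
 have m20 : 0 <= m ^+ 2 by exact: sqr_ge0.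
 have e3 : h ^+ 8 * m ^+ 2 <= h ^+ 21 * m ^+ 2 by rewrite ler_wpM2r // hX_le.
 have e4 : h ^+ 21 * m ^+ 4 <= h ^+ 21 * m ^+ 2.
  rewrite ler_wpM2l // pow4 expr2 ler_piMr // expr_le1 // ltW //.
 have e5 : 16 * (h ^+ 21 * m ^+ 2) <= h ^+ 22 * m ^+ 2.
  by rewrite (exprS h 21) -mulrA ler_wpM2r ?mulr_ge0 //; move: h16; lra.
 exact: le_8D e1 e2 e3 e4 e5.
have : \sum_(j < M) E (g j) <= M%:R * (h ^+ 22 * m ^+ 2).
 rewrite mulr_natl -[X in _ *+ X]card_ord -sumr_const; exact: ler_sum.
move=> /(ler_wpM2l (mulr_ge0 (hX_ge0 12) (ltW m0))) /le_trans; apply.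
rewrite -mulrA (mulrA m) mulVf ?gt_eqF // mul1r mulrA -exprD; exact: lexx.
Qed.
Lemma E_Aj4 j : E (fun c => cabs (Ajf j c - a) ^+ 4) <= h ^+ 35 * m ^+ 2.
have tVa : tamec mu (fun c => Af c - a) by apply: tamecB; [exact: tame_Af|exact: tamecC].
have tVj : tamec mu (fun c => Ajf j c - a) by apply: tamecB; [exact: tame_Ajf|exact: tamecC].
have tAA : tamec mu (fun c => Ajf j c - Af c) by apply: tamecB; [exact: tame_Ajf|exact: tame_Af].
apply: (@le_trans _ _ (8 * E (fun c => cabs (Ajf j c - Af c) ^+ 4) + 8 * E (fun c => cabs (Af c - a) ^+ 4)
  + 0 * E (fun=> 0))).
 apply: le_Ex_lin3.
 - exact: (tame_cabsX 4 tVj).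
 - exact: (tame_cabsX 4 tAA).
 - exact: (tame_cabsX 4 tVa).
 - exact: tameC.
 move=> c; rewrite mul0r addr0 -mulrDr; apply: le_trans (add_pow4_le _ _).
 rewrite lerXn2r ?nnegrE ?addr_ge0 ?cabs_ge0 //.
 by rewrite -(subrKA (Af c) (Ajf j c) (- a)) cabsD.
rewrite Ex_cst mulr0 addr0; have e1 := E_AAj4 j; have e2 := E_A4.
have m20 : 0 <= m ^+ 2 by exact: sqr_ge0.
have e3 : h ^+ 21 * m ^+ 4 <= h ^+ 34 * m ^+ 2.
 apply: ler_pM; rewrite ?exprn_ge0 ?(ltW m0) ?hX_le //.
 by rewrite pow4 expr2 ler_piMr // expr_le1 // ltW.
have e5 : 16 * (h ^+ 34 * m ^+ 2) <= h ^+ 35 * m ^+ 2.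
 by rewrite (exprS h 34) -mulrA ler_wpM2r ?mulr_ge0 //; move: h16; lra.
move: e1 e2 e3 e5; move: (E _) => x1; move: (E _) => x2; lra.
Qed.

End AtZ.
End Laws.

(** * Power counting and control variables *)

Section PowerBounds.
Variable R : realType.
Local Notation C := R[i].

(* Bookkeeping of crude error bounds: [h] is large, [rho] small and [w >= 1] a
  random control variable. *)
Definition obd (h rho w : R) (k p q : nat) (x : C) := cabs x <= h ^+ k * rho ^+ p * w ^+ q.

Variables (h rho w : R).
Hypotheses (h2 : 2 <= h) (rho0 : 0 <= rho) (rho1 : rho <= 1) (w1 : 1 <= w).
Local Notation bd := (obd h rho w).

Let h1 : 1 <= h. Proof. by apply: le_trans h2; rewrite ler1n. Qed.
Let h0 : 0 <= h. Proof. exact: le_trans h1. Qed.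
Let w0 : 0 <= w. Proof. exact: le_trans w1. Qed.
Lemma bdW k p q k' p' q' x : bd k p q x -> (k <= k')%N -> (p' <= p)%N -> (q <= q')%N ->
 bd k' p' q' x.
move=> H kk pp qq; apply: (le_trans H).
apply: ler_pM; rewrite ?mulr_ge0 ?exprn_ge0 //; last exact: ler_weXn2l.
by apply: ler_pM; rewrite ?exprn_ge0 //; [exact: ler_weXn2l|exact: ler_wiXn2l].
Qed.
Lemma bdM k p q k' p' q' x y : bd k p q x -> bd k' p' q' y ->
 bd (k + k') (p + p') (q + q') (x * y).
move=> H H'; rewrite /obd cabsM !exprD.
have -> : h ^+ k * h ^+ k' * (rho ^+ p * rho ^+ p') * (w ^+ q * w ^+ q') =
 (h ^+ k * rho ^+ p * w ^+ q) * (h ^+ k' * rho ^+ p' * w ^+ q') by ring.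
by apply: ler_pM; rewrite ?cabs_ge0.
Qed.
(** A sum costs one more power of [h], since [2 <= h] absorbs the factor two; [rho] and [w] take the
    worse of their two exponents. *)
Lemma bdD k p q k' p' q' x y : bd k p q x -> bd k' p' q' y ->
 bd (maxn k k').+1 (minn p p') (maxn q q') (x + y).
move=> H H'.
have := bdW H (leq_maxl k k') (geq_minl p p') (leq_maxl q q').
have := bdW H' (leq_maxr k k') (geq_minr p p') (leq_maxr q q').
rewrite /obd => B B'; apply: (le_trans (cabsD _ _)); apply: (le_trans (lerD B' B)).
rewrite exprS -!mulrA -mulr2n -[X in X <= _]mulr_natl; apply: ler_wpM2r => //.
by rewrite !mulr_ge0 ?exprn_ge0.
Qed.
Lemma bdN k p q x : bd k p q x -> bd k p q (- x).
by rewrite /obd cabsN. Qed.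
Lemma bdC k p q x : bd k p q x -> bd k p q (x^*)%C.
by rewrite /obd cabs_conj. Qed.
Lemma bd_cst k x : cabs x <= h ^+ k -> bd k 0 0 x.
by rewrite /obd !expr0 !mulr1. Qed.
Lemma bd_rho p : bd 0 p 0 (rho ^+ p)%:C.
by rewrite /obd !expr0 mulr1 mul1r cabs_ge0r ?exprn_ge0. Qed.
End PowerBounds.

Section RootControl.
Variable R : realType.
Implicit Types (Q x rho : R).

(** The eighth root of a control quantity [Q] serves as [w]: an expression of degree at most 8 in
    [w] then has its mean bounded through that of [Q]. *)
Definition root8 Q := Num.sqrt (Num.sqrt (Num.sqrt Q)).

Lemma root8K Q : 0 <= Q -> root8 Q ^+ 8 = Q.
by move=> Q0; rewrite pow8 pow4 /root8 !sqr_sqrtr ?sqrtr_ge0. Qed.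
Lemma root8_ge1 Q : 1 <= Q -> 1 <= root8 Q.
have s1 x : 1 <= x -> 1 <= Num.sqrt x by move=> x1; rewrite -[X in X <= _]sqrtr1 ler_wsqrtr.
by move=> H; rewrite /root8 !s1.
Qed.
Lemma root8_le8 Q x rho : 0 <= Q -> 0 < rho -> 0 <= x -> x ^+ 8 / rho ^+ 16 <= Q -> x <= rho ^+ 2 * root8 Q.
move=> Q0 r0 x0 H; have r0' := ltW r0.
rewrite -(@ler_pXn2r _ 8) ?nnegrE ?mulr_ge0 ?exprn_ge0 ?sqrtr_ge0 //.
by rewrite exprMn root8K // -exprM mulrC -ler_pdivrMr ?exprn_gt0.
Qed.
Lemma root8_le4 Q x rho : 0 <= Q -> 0 < rho -> 0 <= x -> x ^+ 4 / rho ^+ 8 <= Q ->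
 x <= rho ^+ 2 * root8 Q ^+ 2.
move=> Q0 r0 x0 H; have r0' := ltW r0.
rewrite -(@ler_pXn2r _ 4) ?nnegrE ?mulr_ge0 ?exprn_ge0 ?sqrtr_ge0 //.
by rewrite exprMn -!exprM root8K // mulrC -ler_pdivrMr ?exprn_gt0.
Qed.
End RootControl.

Lemma sum37 (R : realType) (x y p q : R) :
 x <= p + p + p -> y <= p + p + p + p -> 1 <= p -> 8 * p <= q -> x + y + 1 <= q.
by lra. Qed.
Lemma terms7 (R : realType) (x1 x2 x3 x4 x5 x6 x7 : R) : 0 <= x1 -> 0 <= x2 -> 0 <= x3 ->
 0 <= x4 -> 0 <= x5 -> 0 <= x6 -> 0 <= x7 ->
 let Q := 1 + (x1 + x2 + x3) + (x4 + x5 + x6 + x7) in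
 [/\ 1 <= Q, [/\ x1 <= Q, x2 <= Q & x3 <= Q] & [/\ x4 <= Q, x5 <= Q, x6 <= Q & x7 <= Q]].
by move=> H1 H2 H3 H4 H5 H6 H7 Q; split; [|split|split]; rewrite /Q; lra. Qed.
Lemma amgm_half (R : realType) (t u v : R) : 0 < t -> u * v <= t / 2 * u ^+ 2 + t^-1 / 2 * v ^+ 2.
move=> t0; have n0 : t != 0 by rewrite gt_eqF.
have -> : t / 2 * u ^+ 2 + t^-1 / 2 * v ^+ 2 = u * v + t / 2 * (u - v / t) ^+ 2 by field.
by rewrite lerDl mulr_ge0 ?sqr_ge0 // divr_ge0 // ltW.
Qed.
Lemma sq_le_2sq (R : realType) (x u v : R) : 0 <= x -> x <= u + v -> x ^+ 2 <= 2 * u ^+ 2 + 2 * v ^+ 2.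
move=> x0 H; apply: (@le_trans _ _ ((u + v) ^+ 2)).
 by rewrite lerXn2r ?nnegrE // (le_trans x0).
by have := sqr_ge0 (u - v); nra.
Qed.
Lemma lin_half (R : realType) (u a b c : R) :
 u <= a + u / 2 + b / 2 -> a <= b -> 16 * b <= c -> 0 <= b -> u <= c.
by lra. Qed.
Lemma lin_two (R : realType) (u v a b c : R) :
 u <= a -> v <= b -> b <= a -> 16 * a <= c -> 0 <= a -> 2 * v + 2 * u <= c.
by lra. Qed.
Lemma conj_split (R : realType) (u v t x y : R[i]) :
 u * (t * x + y) = v * t * x + ((u - v) * t * x + u * y).
by ring. Qed.
Lemma quotient_split (R : realType) (p q d A V z : R[i]) : 1 + A != 0 -> 1 + (A + d) != 0 ->
 p * ((d + q) / (1 + (A + d)) - z * V ^+ 2) = (p + q^*%C) / (1 + A) * d +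
 (- q^*%C * (d / (1 + A)) - p * (d * d) * ((1 + A)^-1 * (1 + (A + d))^-1)
  + p * q * (1 + (A + d))^-1 - z * (p * (V * V))).
by move: (q^*%C) => r n1 n2; field; rewrite n1 n2. Qed.
Lemma mean_split (R : realType) (d d2 A a V m t2 z : R[i]) :
 1 + A != 0 -> 1 + (A + d) != 0 -> 1 + a != 0 ->
 let tau := (1 + a)^-1 in let i := (1 + (A + d))^-1 in
 (d + m * (d2 + t2) * i) * i - z * V ^+ 2 = (1 + A)^-1 * d +
 (- (d * d) * ((1 + A)^-1 * (i - tau) + tau * - (tau * (A - a) * (1 + A)^-1))
  + (m * d2) * (i * i) + (m * t2) * ((i - tau) * (i + tau)) - z * (V * V)
  + (tau ^+ 2 * m * t2 - tau ^+ 2 * d ^+ 2)).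
by move=> n1 n2 n3 tau i; rewrite /tau /i; field; rewrite n1 n2 n3. Qed.
Lemma err_split (R : realType) (x t m f q e k u v : R[i]) :
 x + t * (m * f - (q + (1 + e) * m * f)) =
 x - t * (e * m * (f - u) + (q - v * k)) - t * (e * m * u + k * v).
by ring. Qed.
Lemma dominates_36 (R : realType) (K h : R) : dominates K h -> 1 <= K -> 36 * K <= h.
move=> HK K1; have H : K <= K ^+ 2 by rewrite expr2 ler_peMr // (le_trans ler01).
by move: HK K1 H; rewrite /dominates; lra.
Qed.
Lemma sum_const_le (R : realType) (k : nat) (F : 'I_k -> R) (B : R) : (forall i, F i <= B) -> \sum_i F i <= k%:R * B.
by move=> H; rewrite -[X in X%:R * _](card_ord k) mulr_natl -sumr_const; exact: ler_sum.
Qed.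

(** * Isotropic law and the mean of the trace *)

Section Laws2.
Variables (R : realType) (N M : nat).
Local Notation C := R[i].
Variables (mu : mxlaw R N M) (K eps h : R).
Hypothesis Hg : goodlaw mu K eps.
Local Notation E := (Ex mu).
Local Notation EC := (Exc mu).
Local Notation m := (M%:R^-1 : R).
Local Notation dd := (N%:R / M%:R : R).
Hypotheses (HK : dominates K h) (HN : N%:R <= h * M%:R).
Implicit Types (c : EntT R N M) (j : 'I_M).

Let M0 : (0 < M)%N. Proof. by case: Hg. Qed.
Let Mp : (0 : R) < M%:R. Proof. by rewrite ltr0n. Qed.
Let m0 : 0 < m. Proof. by rewrite invr_gt0. Qed.
Let m1 : m <= 1. Proof. by rewrite invf_le1 // ler1n. Qed.
Let K1 : 1 <= K. Proof. by case: Hg. Qed.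
Let K2 : 1 <= K ^+ 2. Proof. by rewrite expr_ge1 // (le_trans ler01). Qed.
Let h16 : 16 <= h.
have H : 10400 <= h by apply: le_trans HK; rewrite ler_peMr ?ler0n.
by move: H; lra.
Qed.
Let h2 : 2 <= h. Proof. by move: h16; lra. Qed.
Let h1 : 1 <= h. Proof. by move: h16; lra. Qed.
Let h0 : 0 <= h. Proof. by move: h16; lra. Qed.
Let hX_ge0 n : 0 <= h ^+ n. Proof. exact: exprn_ge0. Qed.
Let hX_le n k : (n <= k)%N -> h ^+ n <= h ^+ k. Proof. by move=> nk; apply: ler_weXn2l. Qed.
Let hXS n k : (k <= 16)%N -> k%:R * h ^+ n <= h ^+ n.+1.
by move=> k16; rewrite exprS ler_wpM2r //; apply: le_trans h16; rewrite ler_nat.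
Qed.
(** [M] to the power [-1/4]. Typical fluctuations have size [rho ^+ 2]; [rho] itself is the step of
    the difference quotient [T2f], where it balances fluctuation against discretisation. *)
Definition rho : R := Num.sqrt (Num.sqrt m).

Lemma rhoE : rho = Num.sqrt (Num.sqrt m). Proof. by []. Qed.
Lemma rho4 : rho ^+ 4 = m.
by rewrite pow4 /rho !sqr_sqrtr ?sqrtr_ge0 // ltW. Qed.
Lemma rho_gt0 : 0 < rho. Proof. by rewrite /rho !sqrtr_gt0. Qed.
Let rho0 : 0 <= rho. Proof. exact: ltW rho_gt0. Qed.
Lemma rho_le1 : rho <= 1.
have s1 x : x <= 1 -> Num.sqrt x <= 1 :> R by move=> x1; rewrite -sqrtr1 ler_wsqrtr.
by rewrite /rho !s1.
Qed.

Section AtZ2.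
Variables (z s : C).
Hypotheses (z0 : Im z != 0) (Hz : `|Im z|^-1 <= h) (Hzc : cabs z <= h).
Hypotheses (Hs : mpsol dd z s) (Hsc : cabs s <= h).
Local Notation a := (dd%:C * s).
Local Notation tau := ((1 + a)^-1).
Local Opaque Rs.
Local Notation Df := (Df z).
Local Notation D2f := (D2f z).
Local Notation Af := (Af z).
Local Notation Ajf := (Ajf z).
Local Notation Gf := (Gf z).
Local Notation Gjf := (Gjf z).
Local Notation qf_ := (qf_ z).

Section Vec.
Variable b : 'cV[C]_N.
Hypothesis Hb : nv b <= 1.

Definition L0f j c := ip b (xf j c).
Definition L1f j c := ip (xf j c) (Gjf j c *m b).
Definition L2f j c := ip b (Gjf j c *m xf j c).

(** Every random quantity attached to column [j], raised to the power for which a moment bound is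
    available and divided by its typical size. The leading 1 makes [wf] at least 1. *)
Definition Qf j c : R :=
 1 + (cabs (L0f j c) ^+ 8 + cabs (L1f j c) ^+ 8 + cabs (L2f j c) ^+ 8) / m ^+ 4
  + (cabs (Df j c) ^+ 4 + cabs (D2f j c) ^+ 4 + cabs (Af c - a) ^+ 4 + cabs (Ajf j c - a) ^+ 4) / m ^+ 2.

Lemma tame_L0f j : tamec mu (L0f j).
by apply: tamec_ip; [exact: tamemxC|exact: (tamemx_col Hg)]. Qed.
Lemma tame_L1f j : tamec mu (L1f j).
apply: tamec_ip; first exact: (tamemx_col Hg).
by apply: tamemxM; [exact: (tamemx_Gj Hg)|exact: tamemxC].
Qed.
Lemma tame_L2f j : tamec mu (L2f j).
apply: tamec_ip; first exact: tamemxC.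
by apply: tamemxM; [exact: (tamemx_Gj Hg)|exact: (tamemx_col Hg)].
Qed.
Let tD j : tamec mu (Df j). Proof. exact: (tame_Df Hg). Qed.
Let tD2 j : tamec mu (D2f j). Proof. exact: (tame_D2f Hg). Qed.
Let tV0 : tamec mu (fun c => Af c - a). Proof. by apply: tamecB; [exact: (tame_Af Hg)|exact: tamecC]. Qed.
Let tVj j : tamec mu (fun c => Ajf j c - a). Proof. by apply: tamecB; [exact: (tame_Ajf Hg)|exact: tamecC]. Qed.
Lemma E_L0 j : E (fun c => cabs (L0f j c) ^+ 8) <= h ^+ 35 * m ^+ 4.
have -> : E (fun c => cabs (L0f j c) ^+ 8) = E (fun c => cabs (ip (xf j c) b) ^+ 8).
 by apply: eq_Ex => c; rewrite /L0f -[ip b _]ip_conj cabs_conj.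
apply: (le_trans (nv_lin8 Hg HK j Hb)).
by rewrite expr1n mulr1 ler_wpM2r ?exprn_ge0 ?(ltW m0) // -[X in X <= _]expr1 hX_le.
Qed.
Lemma nv_Rs_b (Y : 'M[C]_(N, M)) : nv (Rs Y z *m b) <= h ^+ 2.
have [_ H] := opb_h Hg HK z0 Hz Y.
by apply: (le_trans (H b)); rewrite ler_piMr // sqr_ge0.
Qed.
Lemma nv_adjRs_b (Y : 'M[C]_(N, M)) : nv (adjmx (Rs Y z) *m b) <= h ^+ 2.
rewrite Rs_adj //.
have z0' : Im (z^*)%C != 0 by rewrite cIm_conj oppr_eq0.
have Hz' : `|Im (z^*)%C|^-1 <= h by rewrite cIm_conj normrN.
have [_ H] := opb_h Hg HK z0' Hz' Y.
by apply: (le_trans (H b)); rewrite ler_piMr // sqr_ge0.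
Qed.
Let lin_le : h * (h ^+ 2) ^+ 4 * m ^+ 4 <= h ^+ 35 * m ^+ 4.
by rewrite -exprM -exprS ler_wpM2r ?exprn_ge0 ?(ltW m0) ?hX_le. Qed.
Lemma E_L1 j : E (fun c => cabs (L1f j c) ^+ 8) <= h ^+ 35 * m ^+ 4.
apply: le_trans lin_le.
apply: (Ex_col_le Hg (j := j) (f := fun x Y => cabs (ip x (Rs Y z *m b)) ^+ 8)) => //.
- by move=> c; rewrite exprn_ge0 ?cabs_ge0.
- by apply: tame_cabsX; exact: tame_L1f.
- move=> Y; apply: tame_cabsX; apply: tamec_ip; [exact: (tamemx_col Hg)|exact: tamemxC].
- by move=> Y; apply: (nv_lin8 Hg HK j); exact: nv_Rs_b.
Qed.
Lemma E_L2 j : E (fun c => cabs (L2f j c) ^+ 8) <= h ^+ 35 * m ^+ 4.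
apply: le_trans lin_le.
apply: (Ex_col_le Hg (j := j) (f := fun x Y => cabs (ip b (Rs Y z *m x)) ^+ 8)) => //.
- by move=> c; rewrite exprn_ge0 ?cabs_ge0.
- by apply: tame_cabsX; exact: tame_L2f.
- move=> Y; apply: tame_cabsX; apply: tamec_ip; first exact: tamemxC.
 by apply: tamemxM; [exact: tamemxC|exact: (tamemx_col Hg)].
- move=> Y.
 have -> : E (fun x => cabs (ip b (Rs Y z *m col j (entmx x))) ^+ 8) =
      E (fun x => cabs (ip (col j (entmx x)) (adjmx (Rs Y z) *m b)) ^+ 8).
  by apply: eq_Ex => c; rewrite ip_adj -ip_conj cabs_conj.
 by apply: (nv_lin8 Hg HK j); exact: nv_adjRs_b.
Qed.
Lemma tame_Qf j : tame mu (Qf j).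
have t8 F : tamec mu F -> tame mu (fun c => cabs (F c) ^+ 8) by move=> t; exact: tame_cabsX _ t.
have t4 F : tamec mu F -> tame mu (fun c => cabs (F c) ^+ 4) by move=> t; exact: tame_cabsX _ t.
rewrite /Qf; apply: tameD; first (apply: tameD; first exact: tameC).
- apply: tameM; last exact: tameC.
 exact: (tameD (tameD (t8 _ (tame_L0f j)) (t8 _ (tame_L1f j))) (t8 _ (tame_L2f j))).
- apply: tameM; last exact: tameC.
 exact: (tameD (tameD (tameD (t4 _ (tD j)) (t4 _ (tD2 j))) (t4 _ tV0)) (t4 _ (tVj j))).
Qed.
Lemma E_Qf j : E (Qf j) <= h ^+ 36.
have t8 F : tamec mu F -> tame mu (fun c => cabs (F c) ^+ 8) by move=> t; exact: tame_cabsX _ t.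
have t4 F : tamec mu F -> tame mu (fun c => cabs (F c) ^+ 4) by move=> t; exact: tame_cabsX _ t.
have T1 := tameD (tameD (t8 _ (tame_L0f j)) (t8 _ (tame_L1f j))) (t8 _ (tame_L2f j)).
have T2 := tameD (tameD (tameD (t4 _ (tD j)) (t4 _ (tD2 j))) (t4 _ tV0)) (t4 _ (tVj j)).
have i4 : 0 < m ^+ 4 by rewrite exprn_gt0.
have i2 : 0 < m ^+ 2 by rewrite exprn_gt0.
have -> : E (Qf j) = (m ^+ 4)^-1 * E (fun c => cabs (L0f j c) ^+ 8 + cabs (L1f j c) ^+ 8 + cabs (L2f j c) ^+ 8)
  + (m ^+ 2)^-1 * E (fun c => cabs (Df j c) ^+ 4 + cabs (D2f j c) ^+ 4 + cabs (Af c - a) ^+ 4 + cabs (Ajf j c - a) ^+ 4)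
  + 1 * E (fun=> 1).
 have [_ <-] := Ex_lin3 (m ^+ 4)^-1 (m ^+ 2)^-1 1 T1 T2 (tameC mu 1).
 by apply: eq_Ex => c; rewrite /Qf mulr1 [RHS]addrC [RHS]addrA; congr (_ + _ + _); exact: mulrC.
rewrite Ex_cst mulr1.
have T1a := tameD (t8 _ (tame_L0f j)) (t8 _ (tame_L1f j)).
have T2a := tameD (t4 _ (tD j)) (t4 _ (tD2 j)); have T2b := tameD T2a (t4 _ tV0).
rewrite (ExD T1a (t8 _ (tame_L2f j))) (ExD (t8 _ (tame_L0f j)) (t8 _ (tame_L1f j))).
rewrite (ExD T2b (t4 _ (tVj j))) (ExD T2a (t4 _ tV0)) (ExD (t4 _ (tD j)) (t4 _ (tD2 j))).
have e0 := E_L0 j; have e1 := E_L1 j; have e2 := E_L2 j.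
have u n (x : R) : (n <= 35)%N -> x <= h ^+ n * m ^+ 2 -> x <= h ^+ 35 * m ^+ 2.
 by move=> n35 /le_trans; apply; rewrite ler_wpM2r ?hX_le // ltW.
have e3 : E (fun c => cabs (Df j c) ^+ 4) <= h ^+ 35 * m ^+ 2 by apply: (u 8) => //; apply: (E_D4 Hg HK).
have e4 : E (fun c => cabs (D2f j c) ^+ 4) <= h ^+ 35 * m ^+ 2 by apply: (u 12) => //; apply: (E_D24 Hg HK).
have e5 : E (fun c => cabs (Af c - a) ^+ 4) <= h ^+ 35 * m ^+ 2 by apply: (u 34) => //; apply: (E_A4 Hg HK).
have e6 : E (fun c => cabs (Ajf j c - a) ^+ 4) <= h ^+ 35 * m ^+ 2 by apply: (E_Aj4 Hg HK).
have p35 : 1 <= h ^+ 35 by rewrite expr_ge1.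
have q1 : (m ^+ 4)^-1 * (h ^+ 35 * m ^+ 4) = h ^+ 35 by rewrite mulrC mulfK ?gt_eqF.
have q2 : (m ^+ 2)^-1 * (h ^+ 35 * m ^+ 2) = h ^+ 35 by rewrite mulrC mulfK ?gt_eqF.
have j4 : 0 <= (m ^+ 4)^-1 by rewrite invr_ge0 ltW.
have j2 : 0 <= (m ^+ 2)^-1 by rewrite invr_ge0 ltW.
have H1 := ler_wpM2l j4 (lerD (lerD e0 e1) e2).
have H2 := ler_wpM2l j2 (lerD (lerD (lerD e3 e4) e5) e6).
rewrite !mulrDr q1 in H1; rewrite !mulrDr q2 in H2.
rewrite !mulrDr; apply: (sum37 H1 H2 p35); exact: (@hXS 35 8).
Qed.
Definition wf j c := root8 (Qf j c).

Lemma Qf_terms j c :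
 [/\ 1 <= Qf j c,
   [/\ cabs (L0f j c) ^+ 8 / rho ^+ 16 <= Qf j c, cabs (L1f j c) ^+ 8 / rho ^+ 16 <= Qf j c
    & cabs (L2f j c) ^+ 8 / rho ^+ 16 <= Qf j c] &
   [/\ cabs (Df j c) ^+ 4 / rho ^+ 8 <= Qf j c, cabs (D2f j c) ^+ 4 / rho ^+ 8 <= Qf j c,
    cabs (Af c - a) ^+ 4 / rho ^+ 8 <= Qf j c & cabs (Ajf j c - a) ^+ 4 / rho ^+ 8 <= Qf j c]].
have -> : rho ^+ 16 = m ^+ 4 by rewrite -rho4 -exprM.
have -> : rho ^+ 8 = m ^+ 2 by rewrite -rho4 -exprM.
have p8 (x : C) : 0 <= cabs x ^+ 8 / m ^+ 4 by rewrite divr_ge0 ?exprn_ge0 ?cabs_ge0 ?(ltW m0).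
have p4 (x : C) : 0 <= cabs x ^+ 4 / m ^+ 2 by rewrite divr_ge0 ?exprn_ge0 ?cabs_ge0 ?(ltW m0).
rewrite /Qf !mulrDl.
exact: (terms7 (p8 (L0f j c)) (p8 (L1f j c)) (p8 (L2f j c)) (p4 (Df j c)) (p4 (D2f j c)) (p4 (Af c - a)) (p4 (Ajf j c - a))).
Qed.
Lemma wf8 j c : wf j c ^+ 8 = Qf j c.
by apply: root8K; case: (Qf_terms j c) => + _ _; apply: le_trans. Qed.
Lemma wf_ge1 j c : 1 <= wf j c.
by apply: root8_ge1; case: (Qf_terms j c). Qed.

Local Notation bdw j c := (obd h rho (wf j c)).

Lemma bd_basic j c :
 [/\ bdw j c 0 2 1 (L0f j c), bdw j c 0 2 1 (L1f j c) & bdw j c 0 2 1 (L2f j c)] /\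
 [/\ bdw j c 0 2 2 (Df j c), bdw j c 0 2 2 (D2f j c),
   bdw j c 0 2 2 (Af c - a) & bdw j c 0 2 2 (Ajf j c - a)].
have [Q1 [H0 H1 H2] [H3 H4 H5 H6]] := Qf_terms j c.
have Q0 : 0 <= Qf j c by apply: le_trans Q1.
by split; split; rewrite /obd expr0 mul1r ?expr1;
 [exact: root8_le8 Q0 rho_gt0 (cabs_ge0 _) H0|exact: root8_le8 Q0 rho_gt0 (cabs_ge0 _) H1
 |exact: root8_le8 Q0 rho_gt0 (cabs_ge0 _) H2|exact: root8_le4 Q0 rho_gt0 (cabs_ge0 _) H3
 |exact: root8_le4 Q0 rho_gt0 (cabs_ge0 _) H4|exact: root8_le4 Q0 rho_gt0 (cabs_ge0 _) H5
 |exact: root8_le4 Q0 rho_gt0 (cabs_ge0 _) H6].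
Qed.
Lemma bd_csts j c :
 [/\ bdw j c 1 0 0 z, bdw j c 1 0 0 s, bdw j c 2 0 0 a & bdw j c 2 0 0 tau] /\
 [/\ bdw j c 2 0 0 (1 + qf_ j c)^-1, bdw j c 2 0 0 (1 + Ajf j c)^-1,
   bdw j c 3 0 0 (\tr (Gjf j c *m Gjf j c) * m%:C) & bdw j c 0 4 0 (m%:C)].
split; split; try (by rewrite -rho4; apply: bd_rho).
all: apply: bd_cst; rewrite ?expr1 ?cabs_tau //.
- rewrite cabsM cabs_ge0r ?divr_ge0 //; apply: ler_pM; rewrite ?cabs_ge0 ?divr_ge0 //.
 by rewrite ler_pdivrMr.
- exact: (cabs_tau z0 Hs Hz Hzc).
- exact: (inv_den_f z0 Hz Hzc).
- exact: (one_plus_Aj_lb z0 Hz Hzc).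
- exact: (tr2_le Hg HK HN z0 Hz).
Qed.
(** As [wf ^+ 8 = Qf], a bound of degree at most 8 in [wf] is dominated by a multiple of [Qf], whose
    mean is at most [h ^+ 36]. *)
Lemma Ex_bd j (F : EntT R N M -> C) k p q : (q <= 8)%N -> tamec mu F ->
 (forall c, bdw j c k p q (F c)) -> E (fun c => cabs (F c)) <= h ^+ (k + 36) * rho ^+ p.
move=> q8 tF H.
apply: (@le_trans _ _ (E (fun c => h ^+ k * rho ^+ p * Qf j c))).
 apply: le_Ex; [exact: tamec_cabs|exact: tameZ _ (tame_Qf j)|move=> c].
 by have := bdW h2 rho0 rho_le1 (wf_ge1 j c) (H c) (leqnn k) (leqnn p) q8; rewrite /obd wf8.
rewrite ExZ; last exact: tame_Qf.
rewrite exprD mulrAC; apply: ler_wpM2r; first exact: exprn_ge0.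
by apply: ler_wpM2l => //; exact: E_Qf.
Qed.
Lemma bd_AjA j c : bdw j c 6 4 2 (Ajf j c - Af c).
have [[_ _ _ _] [B1 _ B3 B4]] := bd_csts j c; have [_ [_ B6 _ _]] := bd_basic j c.
have w1 := wf_ge1 j c.
rewrite (A_sub_Aj z0).
by apply: (bdW h2 rho0 rho_le1 w1 (bdM (bdM B4 (bdD h2 rho0 rho_le1 w1 B6 B3)) B1)).
Qed.
Definition Yf c : C := ip b (Gf c *m b) - s.
Definition Yjf j c : C := ip b (Gjf j c *m b) - s.

Lemma tame_Yf : tamec mu Yf.
apply: tamecB; last exact: tamecC.
apply: tamec_ip; first exact: tamemxC.
by apply: tamemxM; [exact: (tamemx_G Hg)|exact: tamemxC].
Qed.
Lemma tame_Yjf j : tamec mu (Yjf j).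
apply: tamecB; last exact: tamecC.
apply: tamec_ip; first exact: tamemxC.
by apply: tamemxM; [exact: (tamemx_Gj Hg)|exact: tamemxC].
Qed.
Lemma Yf_sub j c : Yjf j c - Yf c = L2f j c * L1f j c / (1 + qf_ j c).
by rewrite /Yf /Yjf /Gf (ip_Rs_sm (entmx c) j z0) /L2f /L1f /qf_ /Gjf /xf opprB addrA subrK opprB addrC subrK. Qed.
Lemma cabs_ipGb (Y : 'M[C]_(N, M)) : cabs (ip b (Rs Y z *m b)) <= h.
rewrite -(@ler_pXn2r _ 2) ?nnegrE ?cabs_ge0 //; apply: (le_trans (cabs_ip _ _)).
rewrite -[X in _ <= X]mul1r; apply: ler_pM; rewrite ?nv_ge0 //; exact: nv_Rs_b.
Qed.
(** The leading term of the expansion of [Yf]: a quadratic form in column [j], centred given the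
    other columns. The smaller terms are collected in [z2f]. *)
Definition z1f j c : C := L0f j c * L1f j c - m%:C * ip b (Gjf j c *m b).
Definition z2f j c : C := L0f j c * L1f j c * ((1 + qf_ j c)^-1 - tau) + tau * m%:C * (Yjf j c - Yf c).

Lemma mM : m%:C * M%:R = 1 :> C.
by rewrite -(rmorph_nat (real_complex R)) -rmorphM /= mulVf // gt_eqF. Qed.
(** In the column expansion of [z * ip b (G b)], the quantity [tau * ip b (G b)] is distributed
    evenly over the [M] columns; [(z - tau) * s = -1] removes the deterministic part. *)
Lemma Yf_sum c : ip b b = 1 -> (z - tau) * Yf c = \sum_j (tau * z1f j c + z2f j c).
move=> bb; have e1 := z_minus_tau z0 Hs.
have e2 := mulz_ip_Rs (entmx c) b z0; rewrite bb in e2.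
have -> : (z - tau) * Yf c = z * ip b (Gf c *m b) - tau * ip b (Gf c *m b) + 1.
 by rewrite /Yf mulrBr e1 mulrBl; ring.
rewrite /Gf e2.
set g := ip b (Rs (entmx c) z *m b).
have -> : tau * g = \sum_(j < M) (tau * m%:C * g).
 have aux (t u v g' : C) : u * v = 1 -> t * g' = t * u * g' * v.
  by move=> e; rewrite -[LHS]mulr1 -e; ring.
 by rewrite sumr_const card_ord -[RHS]mulr_natr; exact: aux mM.
rewrite addrAC subrK -sumrB; apply: eq_bigr => j _.
have aux (l i y g' : C) : l * i - tau * m%:C * g' = tau * (l - m%:C * y) + (l * (i - tau) + tau * m%:C * (y - s - (g' - s))).
 by ring.
exact: aux.
Qed.
Lemma z1f_mean j (F : EntT R N M -> C) (F' : 'M[C]_(N, M) -> C) :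
 (forall c, F c = F' (zcol j (entmx c))) -> tamec mu F ->
 EC (fun c => F c * z1f j c) = 0.
move=> FE tF.
have tz : tamec mu (z1f j).
 apply: tamecB; first exact: (tamecM (tame_L0f j) (tame_L1f j)).
 apply: tamecM; first exact: tamecC.
 apply: tamec_ip; first exact: tamemxC.
 by apply: tamemxM; [exact: (tamemx_Gj Hg)|exact: tamemxC].
have qfE (Y : 'M[C]_(N, M)) x : ip b (col j (entmx x)) * ip (col j (entmx x)) (Rs Y z *m b) =
  qf j (Rs Y z *m b *m adjmx b) x.
 rewrite /qf -(mulmxA _ (adjmx b)) [adjmx b *m _]mx11_scalar -/(ip b _).
 by rewrite mul_mx_scalar ipZr.
have tq (B : 'M[C]_N) : tamec mu (qf j B).
 apply: tamec_ip; first exact: (tamemx_col Hg).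
 by apply: tamemxM; [exact: tamemxC|exact: (tamemx_col Hg)].
have -> : 0 = EC (fun _ => 0) by rewrite Exc_cst.
apply: (Exc_col_eq Hg (j := j) (H' := fun _ => 0)
 (f := fun x Y => F' Y * (ip b x * ip x (Rs Y z *m b) - m%:C * ip b (Rs Y z *m b)))).
- by move=> c; rewrite FE.
- by [].
- exact: tamecM.
- exact: tamecC.
- move=> Y; apply: tamecM; first exact: tamecC.
 under eq_fun do rewrite qfE.
 by apply: tamecB; [exact: tq|exact: tamecC].
move=> Y; rewrite ExcZ; last first.
 under eq_fun do rewrite qfE.
 by apply: tamecB; [exact: tq|exact: tamecC].
under eq_Exc do rewrite qfE.
rewrite ExcB ?Exc_cst //; [|exact: tamecC].
rewrite (quad_mean Hg) mxtrace_mulC /mxtrace big_ord1 -/(ip b _).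
by rewrite [ip b _ * _]mulrC subrr mulr0.
Qed.
Lemma bd_iso j c :
 [/\ True, bdw j c 2 4 2 (Yjf j c - Yf c), bdw j c 2 4 2 (z1f j c) & bdw j c 6 6 4 (z2f j c)].
have [[_ _ _ Bt] [Bq _ _ Bm]] := bd_csts j c.
have [[B0 B1 B2] [BD _ _ BV]] := bd_basic j c.
have w1 := wf_ge1 j c; have W := bdW h2 rho0 rho_le1 w1; have A := bdD h2 rho0 rho_le1 w1.
have BY : bdw j c 2 4 2 (Yjf j c - Yf c).
 by rewrite Yf_sub; exact: (W _ _ _ _ _ _ _ (bdM (bdM B2 B1) Bq)).
split => //.
- have Bg : bdw j c 1 0 0 (ip b (Gjf j c *m b)) by apply: bd_cst; rewrite expr1; exact: cabs_ipGb.
 exact: (W _ _ _ _ _ _ _ (A _ _ _ _ _ _ _ _ (bdM B0 B1) (bdN (bdM Bm Bg)))).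
- rewrite /z2f; have -> : (1 + qf_ j c)^-1 - tau = - (tau * (Df j c + (Ajf j c - a)) / (1 + qf_ j c)).
  have n1 := den_f z0 j c; have n2 := one_plus_a_neq0 z0 Hs.
  rewrite /Df; move: n1 n2; move: (qf_ j c) (Ajf j c) (dd%:C * s) => u v t n1 n2.
  by field; rewrite n1 n2.
 have E1 := bdM (bdM B0 B1) (bdN (bdM (bdM Bt (A _ _ _ _ _ _ _ _ BD BV)) Bq)).
 have E2 := bdM (bdM Bt Bm) BY.
 exact: (W _ _ _ _ _ _ _ (A _ _ _ _ _ _ _ _ E1 E2)).
Qed.
(** Test [Yf_sum] against the conjugate of [U = (z - tau) * Yf]. In the [z1f] term [U] is replaced
    by [Uj], which does not see column [j], so that the term has mean zero; the price of the
    replacement is [X1]. *)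
Lemma E_iso_sq : ip b b = 1 -> E (fun c => cabs (Yf c) ^+ 2) <= h ^+ 51 * m.
move=> bb; pose U c := (z - tau) * Yf c; pose Uj j c := (z - tau) * Yjf j c.
have tU : tamec mu U by apply: tamecM; [exact: tamecC|exact: tame_Yf].
have tUj j : tamec mu (Uj j) by apply: tamecM; [exact: tamecC|exact: tame_Yjf].
have tU2 : tame mu (fun c => cabs (U c) ^+ 2) by exact: tame_cabsX _ tU.
have tL j := tamecM (tame_L0f j) (tame_L1f j).
have tz1 j : tamec mu (z1f j).
 apply: tamecB; first exact: tL.
 apply: tamecM; first exact: tamecC.
 apply: tamec_ip; first exact: tamemxC.
 by apply: tamemxM; [exact: (tamemx_Gj Hg)|exact: tamemxC].
have tY j := tamecB (tame_Yjf j) tame_Yf.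
have tD1 j : tamec mu (fun c => (1 + qf_ j c)^-1).
 apply: (@tamec_bnd _ _ _ _ _ (h ^+ 2)); last by move=> c; exact: (inv_den_f z0 Hz Hzc).
 by apply: mfcV; apply: mfcD; [exact: mfcC|exact: tamec_mfc (tame_qf_ Hg z0 j)].
have tz2 j : tamec mu (z2f j).
 apply: tamecD; first exact: (tamecM (tL j) (tamecB (tD1 j) (tamecC mu tau))).
 exact: (tamecZ (tau * m%:C) (tY j)).
have tF1 j : tamec mu (fun c => ((Uj j c)^*)%C * tau * z1f j c).
 exact: (tamecM (tamecM (tamecJ (tUj j)) (tamecC mu tau)) (tz1 j)).
pose X1 j c := ((U c - Uj j c)^*)%C * tau * z1f j c.
have tX1 j : tamec mu (X1 j).
 exact: (tamecM (tamecM (tamecJ (tamecB tU (tUj j))) (tamecC mu tau)) (tz1 j)).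
have tX2 j : tamec mu (fun c => ((U c)^*)%C * z2f j c) by exact: (tamecM (tamecJ tU) (tz2 j)).
have t22 j : tame mu (fun c => cabs (z2f j c ^+ 2)) by exact: (tamec_cabs (tamecX 2 (tz2 j))).
have HX1 j : E (fun c => cabs (X1 j c)) <= h ^+ 46 * m ^+ 2.
 rewrite (_ : m ^+ 2 = rho ^+ 8); last by rewrite -rho4 -exprM.
 apply: (@Ex_bd j (X1 j) 10 8 4 isT (tX1 j)) => c.
 have [[Bz _ _ Bt] _] := bd_csts j c; have [_ BY B1 _] := bd_iso j c.
 have w1 := wf_ge1 j c; have W := bdW h2 rho0 rho_le1 w1; have A := bdD h2 rho0 rho_le1 w1.
 have BU : bdw j c 5 4 2 (U c - Uj j c).
  have -> : U c - Uj j c = - ((z - tau) * (Yjf j c - Yf c)) by rewrite /U /Uj; ring.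
  exact: (W _ _ _ _ _ _ _ (bdN (bdM (A _ _ _ _ _ _ _ _ Bz (bdN Bt)) BY))).
 exact: (W _ _ _ _ _ _ _ (bdM (bdM (bdC BU) Bt) B1)).
have H22 j : E (fun c => cabs (z2f j c ^+ 2)) <= h ^+ 48 * m ^+ 3.
 rewrite (_ : m ^+ 3 = rho ^+ 12); last by rewrite -rho4 -exprM.
 apply: (@Ex_bd j _ 12 12 8 isT (tamecX 2 (tz2 j))) => c.
  have [_ _ _ B2] := bd_iso j c; rewrite expr2; exact: (bdM B2 B2).
have key j : cabs (EC (fun c => ((U c)^*)%C * (tau * z1f j c + z2f j c))) <=
  h ^+ 46 * m ^+ 2 + (m / 2) * E (fun c => cabs (U c) ^+ 2) + h ^+ 48 * m ^+ 2 / 2.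
 have -> : EC (fun c => ((U c)^*)%C * (tau * z1f j c + z2f j c)) =
   EC (fun c => X1 j c + ((U c)^*)%C * z2f j c).
  have -> : EC (fun c => ((U c)^*)%C * (tau * z1f j c + z2f j c)) =
    EC (fun c => ((Uj j c)^*)%C * tau * z1f j c + (X1 j c + ((U c)^*)%C * z2f j c)).
   by apply: eq_Exc => c; rewrite /X1 rmorphB; exact: conj_split.
  rewrite (ExcD (tF1 j) (tamecD (tX1 j) (tX2 j))).
  rewrite (@z1f_mean j _ (fun Y => (((z - tau) * (ip b (Rs Y z *m b) - s))^*)%C * tau)
   (fun=> erefl) (tamecM (tamecJ (tUj j)) (tamecC mu tau))) add0r //.
 apply: (le_trans (cabs_Exc (tamecD (tX1 j) (tX2 j)))).
 (* With the weight [m] in the arithmetic-geometric inequality, the sum over the [M] columns gives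
    back only half of the second moment of [U], which is absorbed on the left. *)
 apply: (@le_trans _ _ (1 * E (fun c => cabs (X1 j c)) + (m / 2) * E (fun c => cabs (U c) ^+ 2)
   + (m^-1 / 2) * E (fun c => cabs (z2f j c ^+ 2)))).
  apply: (le_Ex_lin3 (tamec_cabs (tamecD (tX1 j) (tX2 j))) (tamec_cabs (tX1 j)) tU2 (t22 j)).
  move=> c; apply: (le_trans (cabsD _ _)); rewrite mul1r -addrA; apply: lerD => //.
  rewrite cabsM cabs_conj cabsX.
  by exact: amgm_half.
 apply: lerD; first by rewrite mul1r; apply: lerD.
 have i2 : 0 <= m^-1 / 2 by rewrite divr_ge0 ?invr_ge0 ?(ltW m0).
 apply: (le_trans (ler_wpM2l i2 (H22 j))); apply: le_of_eq.
 have mn : (M%:R : R) != 0 by rewrite gt_eqF.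
 by field.
have S : E (fun c => cabs (U c) ^+ 2) <= M%:R * (h ^+ 46 * m ^+ 2 + (m / 2) * E (fun c => cabs (U c) ^+ 2) + h ^+ 48 * m ^+ 2 / 2).
 have t1 j : tamec mu (fun c => ((U c)^*)%C * (tau * z1f j c + z2f j c)).
  exact: (tamecM (tamecJ tU) (tamecD (tamecZ tau (tz1 j)) (tz2 j))).
 have e : (E (fun c => cabs (U c) ^+ 2))%:C = \sum_j EC (fun c => ((U c)^*)%C * (tau * z1f j c + z2f j c)).
  rewrite -Exc_sum // -Exc_real; apply: eq_Exc => c.
  by rewrite -conj_mul mulrC -mulr_sumr -Yf_sum.
 have Ep : 0 <= E (fun c => cabs (U c) ^+ 2) by apply: Ex_ge0 => c; exact: sqr_ge0.
 rewrite -[X in X <= _](cabs_ge0r Ep) e.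
 apply: (le_trans (cabs_sum _ _ _)).
 exact: sum_const_le.
have HU : E (fun c => cabs (U c) ^+ 2) <= h ^+ 49 * m.
 have e1 : M%:R * m = 1 by rewrite mulfV ?gt_eqF.
 move: S; move: (E _) => u S.
 have {S} : u <= h ^+ 46 * m + u / 2 + h ^+ 48 * m / 2.
  move: S; have -> : M%:R * (h ^+ 46 * m ^+ 2 + m / 2 * u + h ^+ 48 * m ^+ 2 / 2) =
   (M%:R * m) * (h ^+ 46 * m + u / 2 + h ^+ 48 * m / 2) by ring.
  by rewrite e1 mul1r.
 have h46 : h ^+ 46 * m <= h ^+ 48 * m by rewrite ler_wpM2r ?(ltW m0) ?hX_le.
 have h49 : 16 * (h ^+ 48 * m) <= h ^+ 49 * m by rewrite mulrA ler_wpM2r ?(ltW m0) ?(@hXS 48 16).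
 have p48 : 0 <= h ^+ 48 * m by rewrite mulr_ge0 ?(ltW m0).
 by move=> S'; exact: lin_half S' h46 h49 p48.
have -> : E (fun c => cabs (Yf c) ^+ 2) = E (fun c => cabs s ^+ 2 * cabs (U c) ^+ 2).
 apply: eq_Ex => c; rewrite -exprMn -cabsM /U mulrA [s * _]mulrC (z_minus_tau z0 Hs).
 by rewrite mulN1r cabsN.
rewrite ExZ // (_ : 51 = 2 + 49)%N // exprD -mulrA; apply: ler_pM => //.
- exact: sqr_ge0.
- by apply: Ex_ge0 => c; exact: sqr_ge0.
- by rewrite lerXn2r ?nnegrE ?cabs_ge0.
Qed.
Lemma E_isoj_sq j : ip b b = 1 -> E (fun c => cabs (Yjf j c) ^+ 2) <= h ^+ 52 * m.
move=> bb; have H1 := E_iso_sq bb.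
have tY := tamecB (tame_Yjf j) tame_Yf.
have H2 : E (fun c => cabs ((Yjf j c - Yf c) ^+ 2)) <= h ^+ 40 * m ^+ 2.
 rewrite (_ : m ^+ 2 = rho ^+ 8); last by rewrite -rho4 -exprM.
 apply: (@Ex_bd j _ 4 8 4 isT (tamecX 2 tY)) => c.
 by have [_ B _ _] := bd_iso j c; rewrite expr2; exact: (bdM B B).
apply: (@le_trans _ _ (2 * E (fun c => cabs ((Yjf j c - Yf c) ^+ 2)) + 2 * E (fun c => cabs (Yf c) ^+ 2) + 0 * E (fun=> 0))).
 apply: (le_Ex_lin3 (tame_cabsX 2 (tame_Yjf j)) (tamec_cabs (tamecX 2 tY))
  (tame_cabsX 2 tame_Yf) (tameC mu 0)).
 move=> c; rewrite mul0r addr0 cabsX.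
 have := cabsD (Yjf j c - Yf c) (Yf c); rewrite subrK.
 by apply: sq_le_2sq; exact: cabs_ge0.
rewrite mul0r addr0.
have h1' : h ^+ 40 * m ^+ 2 <= h ^+ 51 * m.
 apply: ler_pM; rewrite ?sqr_ge0 ?hX_le //; first by rewrite expr2 ler_piMr // ltW.
have h52 : 16 * (h ^+ 51 * m) <= h ^+ 52 * m by rewrite mulrA ler_wpM2r ?(ltW m0) ?(@hXS 51 16).
have p51 : 0 <= h ^+ 51 * m by rewrite mulr_ge0 ?(ltW m0).
exact: lin_two H1 H2 h1' h52 p51.
Qed.

End Vec.

(** Statements on the trace involve no test vector: with [b = 0] the linear forms in [Qf] vanish and
    the control variables of the vector case can be reused. *)
Definition nullv : 'cV[C]_N := 0.
Lemma nv_null : nv nullv <= 1.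
by rewrite /nv big1 // => i _; rewrite mxE cabs0 expr0n. Qed.

Local Notation b0 := nullv.
Local Notation bdw j c := (obd h rho (wf b0 j c)).
Let tD j : tamec mu (Df j). Proof. exact: (tame_Df Hg). Qed.
Let tD2 j : tamec mu (D2f j). Proof. exact: (tame_D2f Hg). Qed.
Let tV0 : tamec mu (fun c => Af c - a). Proof. by apply: tamecB; [exact: (tame_Af Hg)|exact: tamecC]. Qed.
Let tVj j : tamec mu (fun c => Ajf j c - a). Proof. by apply: tamecB; [exact: (tame_Ajf Hg)|exact: tamecC]. Qed.
Let tAA j : tamec mu (fun c => Ajf j c - Af c). Proof. by apply: tamecB; [exact: (tame_Ajf Hg)|exact: (tame_Af Hg)]. Qed.
Let tiq j : tamec mu (fun c => (1 + qf_ j c)^-1).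
apply: (@tamec_bnd _ _ _ _ _ (h ^+ 2)); last by move=> c; exact: (inv_den_f z0 Hz Hzc).
by apply: mfcV; apply: mfcD; [exact: mfcC|exact: tamec_mfc (tame_qf_ Hg z0 j)].
Qed.
Let tiA j : tamec mu (fun c => (1 + Ajf j c)^-1).
apply: (@tamec_bnd _ _ _ _ _ (h ^+ 2)); last by move=> c; exact: (one_plus_Aj_lb z0 Hz Hzc).
by apply: mfcV; apply: mfcD; [exact: mfcC|exact: tamec_mfc (tame_Ajf Hg z0 j)].
Qed.
Lemma Df_mean j (F : EntT R N M -> C) (F' : 'M[C]_(N, M) -> C) :
 (forall c, F c = F' (zcol j (entmx c))) -> tamec mu F -> EC (fun c => F c * Df j c) = 0.
move=> FE tF.
have tq (B : 'M[C]_N) : tamec mu (qf j B).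
 apply: tamec_ip; first exact: (tamemx_col Hg).
 by apply: tamemxM; [exact: tamemxC|exact: (tamemx_col Hg)].
have -> : 0 = EC (fun _ => 0) by rewrite Exc_cst.
apply: (Exc_col_eq Hg (j := j) (H' := fun _ => 0)
 (f := fun x Y => F' Y * (ip x (Rs Y z *m x) - \tr (Rs Y z) * m%:C))).
- by move=> c; rewrite FE.
- by [].
- exact: (tamecM tF (tD j)).
- exact: tamecC.
- by move=> Y; exact: (tamecZ _ (tamecB (tq (Rs Y z)) (tamecC mu _))).
move=> Y; rewrite (ExcZ _ (tamecB (tq (Rs Y z)) (tamecC mu _))).
by rewrite (ExcB (tq (Rs Y z)) (tamecC mu _)) (quad_mean Hg) Exc_cst subrr mulr0.
Qed.
Definition R0 := Rfun dd z s a.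

(** Summand of the equation for [Af - a] after linearisation at [a]: the stability factor is the
    constant [R0], and the quadratic remainder of the polynomial sits on the right. *)
Definition Sj j c : C := (Df j c + (Ajf j c - Af c)) / (1 + qf_ j c) - z * (Af c - a) ^+ 2.

Lemma R0V0 c : R0 * (Af c - a) = m%:C * \sum_j Sj j c.
have e := PA_sum Hg z0 Hs c.
have -> : R0 * (Af c - a) = (Af c - a) * Rfun dd z s (Af c) - z * (Af c - a) ^+ 2.
 by rewrite /R0 /Rfun; ring.
rewrite e sumrB mulrBr; congr (_ - _).
by rewrite sumr_const card_ord -[X in m%:C * X]mulr_natr mulrA mulrAC mM mul1r.
Qed.
Lemma inv_sub_tau j c : (1 + qf_ j c)^-1 - tau = - (tau * (Df j c + (Ajf j c - a)) / (1 + qf_ j c)).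
have n1 := den_f z0 j c; have n2 := one_plus_a_neq0 z0 Hs.
rewrite /Df; move: n1 n2; move: (qf_ j c) (Ajf j c) (dd%:C * s) => u v t n1 n2.
by field; rewrite n1 n2.
Qed.
Lemma bd_iq j c : bdw j c 5 2 2 ((1 + qf_ j c)^-1 - tau).
have [[_ _ _ Bt] [Bq _ _ Bm]] := bd_csts b0 j c.
have [_ [BD _ _ BV]] := bd_basic b0 j c.
have w1 := wf_ge1 b0 j c; have W := bdW h2 rho0 rho_le1 w1; have A := bdD h2 rho0 rho_le1 w1.
rewrite inv_sub_tau.
exact: (W _ _ _ _ _ _ _ (bdN (bdM (bdM Bt (A _ _ _ _ _ _ _ _ BD BV)) Bq))).
Qed.
Lemma one_plus_Ajf_neq0 j c : 1 + Ajf j c != 0.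
exact: one_plus_Aj_neq0. Qed.
(** Testing against the conjugate of [Af - a], as in [E_iso_sq], gains a factor [rho ^+ 2] over what
    [E_A4] gives. The gain is essential: in the mean, the quadratic error [z * (Af - a) ^+ 2] gets
    multiplied by [M], that is by [rho ^- 4]. *)
Lemma E_V0_sq : E (fun c => cabs (Af c - a) ^+ 2) <= h ^+ 49 * rho ^+ 6.
pose X j c := - ((Ajf j c - Af c)^*)%C * (Df j c / (1 + Ajf j c))
 - (Af c - a)^*%C * (Df j c * Df j c) * ((1 + Ajf j c)^-1 * (1 + qf_ j c)^-1)
 + (Af c - a)^*%C * (Ajf j c - Af c) * (1 + qf_ j c)^-1
 - z * ((Af c - a)^*%C * ((Af c - a) * (Af c - a))).
have SX j c : (Af c - a)^*%C * Sj j c = (Ajf j c - a)^*%C / (1 + Ajf j c) * Df j c + X j c.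
 have n1 := den_f z0 j c; have n2 := one_plus_Ajf_neq0 j c.
 have -> : (Ajf j c - a)^*%C = (Af c - a)^*%C + (Ajf j c - Af c)^*%C by rewrite -rmorphD [in RHS]addrC subrKA.
 have e : qf_ j c = Ajf j c + Df j c by rewrite /Df addrC subrK.
 by rewrite /X /Sj; rewrite e in n1 *; exact: quotient_split.
have tX j : tamec mu (X j).
 have cV := tamecJ tV0; have cA := tamecJ (tAA j).
 apply: tamecB; first apply: tamecD; first apply: tamecB.
 - exact: (tamecM (tamecN cA) (tamecM (tD j) (tiA j))).
 - exact: (tamecM (tamecM cV (tamecM (tD j) (tD j))) (tamecM (tiA j) (tiq j))).
 - exact: (tamecM (tamecM cV (tAA j)) (tiq j)).
 - exact: (tamecZ z (tamecM cV (tamecM tV0 tV0))).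
have BX j c : bdw j c 12 6 6 (X j c).
 have [[Bz _ _ Bt] [Bq BA _ Bm]] := bd_csts b0 j c.
 have [_ [BD _ BV0 BV]] := bd_basic b0 j c; have BAA := bd_AjA b0 j c.
 have w1 := wf_ge1 b0 j c; have W := bdW h2 rho0 rho_le1 w1; have A := bdD h2 rho0 rho_le1 w1.
 apply: (W _ _ _ _ _ _ _ (A _ _ _ _ _ _ _ _ (A _ _ _ _ _ _ _ _ (A _ _ _ _ _ _ _ _
  (bdM (bdN (bdC BAA)) (bdM BD BA)) (bdN (bdM (bdM (bdC BV0) (bdM BD BD)) (bdM BA Bq))))
  (bdM (bdM (bdC BV0) BAA) Bq)) (bdN (bdM Bz (bdM (bdC BV0) (bdM BV0 BV0)))))) => //.
have tS j : tamec mu (fun c => (Af c - a)^*%C * Sj j c).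
 under eq_fun do rewrite SX.
 exact: (tamecD (tamecM (tamecM (tamecJ (tVj j)) (tiA j)) (tD j)) (tX j)).
have key j : cabs (EC (fun c => (Af c - a)^*%C * Sj j c)) <= h ^+ 48 * rho ^+ 6.
 under eq_Exc do rewrite SX.
 have t1 := tamecM (tamecJ (tVj j)) (tiA j).
 rewrite (ExcD (tamecM t1 (tD j)) (tX j)).
 rewrite (@Df_mean j _ (fun Y => (\tr (Rs Y z) * m%:C - a)^*%C / (1 + \tr (Rs Y z) * m%:C)) (fun=> erefl) t1) add0r.
 by apply: (le_trans (cabs_Exc (tX j))); apply: (@Ex_bd b0 nv_null j (X j) 12 6 6 isT (tX j)) => c; exact: BX.
have e : R0 * (E (fun c => cabs (Af c - a) ^+ 2))%:C = m%:C * \sum_j EC (fun c => (Af c - a)^*%C * Sj j c).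
 rewrite -Exc_sum // -ExcZ; last exact: tamec_sum.
 rewrite -Exc_real -ExcZ; last by apply: tamec_real; exact: tame_cabsX _ tV0.
 by apply: eq_Exc => c; rewrite -conj_mul mulrA R0V0 -mulr_sumr [RHS]mulrCA mulrC.
have Ep : 0 <= E (fun c => cabs (Af c - a) ^+ 2) by apply: Ex_ge0 => c; exact: sqr_ge0.
have R0n : cabs R0^-1 <= h.
 apply: (Rfun_inv z0 Hs Hz); have [_ H] := Hs; exact: H.
have R00 : R0 != 0.
 have := @Rfun_lb _ _ _ _ _ z0 Hs Hz a; case: Hs => _ Hs' /(_ Hs') H.
 rewrite -cabs_gt0; apply: lt_le_trans H; rewrite invr_gt0; exact: lt_le_trans ltr01 h1.
rewrite -[X in X <= _](cabs_ge0r Ep) -[X in cabs X](mulKf R00) e cabsM (exprS h 48) -mulrA.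
apply: ler_pM; rewrite ?cabs_ge0 //.
rewrite cabsM cabs_ge0r ?(ltW m0) // ler_pdivrMl //.
apply: (le_trans (cabs_sum _ _ _)).
exact: sum_const_le.
Qed.

Hypothesis Heps : eps = 0 \/ eps = 1.

Lemma kap_le j n : `|kap mu eps j n| <= h * m ^+ 2.
case: (Hg) => _ _ _ /(_ n j)[_ _ _ _ [+ _]].
have e : Ex mu (fun c => cabs (entmx c n j) ^+ 4) = Ex mu (fun c => cabs (xe j n c) ^+ 4) by [].
rewrite e /kap -exprVn; have : 0 <= Ex mu (fun c => cabs (xe j n c) ^+ 4).
 by apply: Ex_ge0 => c; rewrite exprn_ge0 ?cabs_ge0.
move: (Ex _ _) => x x0 xK; have m20 : 0 <= m ^+ 2 by exact: sqr_ge0.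
have hK' : 36 * K <= h := dominates_36 HK K1.
have Hx : 36 * x <= h * m ^+ 2.
 apply: (@le_trans _ _ (36 * K * m ^+ 2)); last exact: ler_wpM2r.
 by rewrite -mulrA; apply: ler_wpM2l.
have Hm : 16 * m ^+ 2 <= h * m ^+ 2 by apply: ler_wpM2r.
have e3 : 2 * m ^+ 2 <= (2 + eps ^+ 2) * m ^+ 2 <= 3 * m ^+ 2.
 by case: Heps => ->; apply/andP; split; rewrite ?expr0n ?expr1n /=; apply: ler_wpM2r => //; lra.
move: e3 => /andP[]; move: x0 Hx Hm m20; move: ((2 + eps ^+ 2) * m ^+ 2) (h * m ^+ 2) (m ^+ 2) => u v w x0 Hx Hm m20 e1 e2.
rewrite ler_norml; apply/andP; split; lra.
Qed.
Definition Kap : R := \sum_j \sum_n kap mu eps j n.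

Definition tr2f j c := \tr (Gjf j c *m Gjf j c) * m%:C.
Lemma tame_tr2f j : tamec mu (tr2f j).
have t := tamemx_Gj Hg j z0.
exact: (tamecM (tamec_tr (tamemxM t t)) (tamecC mu _)).
Qed.

(** The deterministic approximation of [tr2f], supplied later by [T2f]. The symmetry assumed next
    for [eps = 1] comes from the resolvent of a real matrix being symmetric. *)
Variable T2 : C.
Hypothesis HT2 : forall j, E (fun c => cabs (tr2f j c - T2)) <= h ^+ 37 * rho.
Hypothesis Hsym : eps = 1 -> forall j,
 EC (fun c => \sum_i \sum_k Gjf j c i k ^+ 2) = EC (fun c => \tr (Gjf j c *m Gjf j c)).

(** A diagonal entry is [ip b (G b)] for a basis vector [b], so the isotropic bound applies; the
    arithmetic-geometric inequality with weight [rho ^+ 2] passes from the second moment to the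
    first. *)
Lemma E_diag j n : cabs (EC (fun c => Gjf j c n n ^+ 2) - s ^+ 2) <= h ^+ 55 * rho ^+ 2.
pose b : 'cV[C]_N := delta_mx n 0.
have bb : ip b b = 1 by rewrite ipuu nv_delta.
have Hb : nv b <= 1 by rewrite nv_delta.
have tY := tame_Yjf b j.
have YE c : Gjf j c n n = Yjf b j c + s by rewrite /Yjf ip_delta subrK.
have tG : tamec mu (fun c => Gjf j c n n) := tamemx_Gj Hg j z0 n n.
have tt : tamec mu (fun c => Yjf b j c * (Gjf j c n n + s)) by exact: (tamecM tY (tamecD tG (tamecC mu s))).
have -> : EC (fun c => Gjf j c n n ^+ 2) - s ^+ 2 = EC (fun c => Yjf b j c * (Gjf j c n n + s)).
 rewrite -[X in _ - X](Exc_cst mu) -ExcB; [|exact: tamecX|exact: tamecC].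
 by apply: eq_Exc => c; rewrite YE; ring.
apply: (le_trans (cabs_Exc tt)).
have H1 := E_isoj_sq Hb j bb.
have r2 : 0 < rho ^+ 2 by rewrite exprn_gt0 ?rho_gt0.
have Gb c : cabs (Gjf j c n n + s) <= 2 * h.
 apply: (le_trans (cabsD _ _)); rewrite mulr_natl mulr2n lerD //.
 by apply: opb_entry; exact: (opb_h Hg HK z0 Hz).
apply: (@le_trans _ _ (h * rho ^+ 2 * E (fun=> 1) + h / rho ^+ 2 * E (fun c => cabs (Yjf b j c) ^+ 2) + 0 * E (fun=> 1))).
 apply: (le_Ex_lin3 (tamec_cabs tt) (tameC mu 1) (tame_cabsX 2 tY) (tameC mu 1)) => c.
 rewrite mul0r addr0 mulr1 cabsM.
 apply: (@le_trans _ _ (cabs (Yjf b j c) * (2 * h))); first by rewrite ler_wpM2l ?cabs_ge0.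
 have := @amgm_half _ (rho ^+ 2) 1 (cabs (Yjf b j c)) r2.
 rewrite mul1r expr1n mulr1; move: (cabs _) => y; set r := rho ^+ 2 => H.
 have := ler_wpM2l (mulr_ge0 (ler0n _ 2) h0) H.
 have -> : 2 * h * (r / 2 + r^-1 / 2 * y ^+ 2) = h * r + h / r * y ^+ 2 by field; rewrite gt_eqF.
 by rewrite [y * _]mulrC.
rewrite mul0r addr0 Ex_cst mulr1.
have H2 : h / rho ^+ 2 * E (fun c => cabs (Yjf b j c) ^+ 2) <= h ^+ 53 * rho ^+ 2.
 apply: (@le_trans _ _ (h / rho ^+ 2 * (h ^+ 52 * m))).
  by rewrite ler_wpM2l // divr_ge0 // ltW.
 by rewrite (exprS h 52) -[X in _ * (_ * X)]rho4 (exprD rho 2 2); apply: le_of_eq; field; rewrite gt_eqF ?rho_gt0.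
have H3 : h * rho ^+ 2 <= h ^+ 53 * rho ^+ 2 by rewrite ler_wpM2r ?(ltW r2) // -[X in X <= _]expr1 hX_le.
have H4 : 2 * (h ^+ 53 * rho ^+ 2) <= h ^+ 54 * rho ^+ 2 by rewrite mulrA ler_wpM2r ?(ltW r2) ?(@hXS 53 2).
have H5 : h ^+ 54 * rho ^+ 2 <= h ^+ 55 * rho ^+ 2 by rewrite ler_wpM2r ?(ltW r2) ?hX_le.
by apply: (le_trans _ H5); apply: (le_trans _ H4); rewrite mulr_natl mulr2n; exact: lerD.
Qed.
Lemma EC_D2 j : EC (fun c => Df j c ^+ 2) =
 \sum_n EC (fun c => Gjf j c n n ^+ 2) * (kap mu eps j n)%:C
  + (1 + eps)%:C * m%:C * EC (tr2f j).
have tG n k : tamec mu (fun c => Gjf j c n k) := tamemx_Gj Hg j z0 n k.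
have t2 := tame_tr2f j.
have tG2 n k : tamec mu (fun c => Gjf j c n k ^+ 2) by exact: tamecX.
have tsum1 : tamec mu (fun c => \sum_n Gjf j c n n ^+ 2 * (kap mu eps j n)%:C).
 by apply: tamec_sum => n; exact: (tamecM (tG2 n n) (tamecC mu _)).
have tsum2 : tamec mu (fun c => \sum_i \sum_k Gjf j c i k ^+ 2).
 by apply: tamec_sum => i; apply: tamec_sum => k; exact: tG2.
have ttr : tamec mu (fun c => \tr (Gjf j c *m Gjf j c)).
 have t := tamemx_Gj Hg j z0; exact: tamec_tr (tamemxM t t).
pose H c := \sum_n Gjf j c n n ^+ 2 * (kap mu eps j n)%:C + (m ^+ 2)%:C * (\tr (Gjf j c *m Gjf j c) + (eps ^+ 2)%:C * \sum_i \sum_k Gjf j c i k ^+ 2).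
have tH : tamec mu H.
 exact: (tamecD tsum1 (tamecZ _ (tamecD ttr (tamecZ _ tsum2)))).
have tq (B : 'M[C]_N) : tamec mu (qf j B).
 apply: tamec_ip; first exact: (tamemx_col Hg).
 by apply: tamemxM; [exact: tamemxC|exact: (tamemx_col Hg)].
rewrite (_ : EC (fun c => Df j c ^+ 2) = EC H); last first.
 apply: (Exc_col_eq Hg (j := j) (f := fun x Y => (ip x (Rs Y z *m x) - \tr (Rs Y z) * m%:C) ^+ 2)
  (H' := fun Y => \sum_n (Rs Y z) n n ^+ 2 * (kap mu eps j n)%:C + (m ^+ 2)%:C * (\tr (Rs Y z *m Rs Y z) + (eps ^+ 2)%:C * \sum_i \sum_k (Rs Y z) i k ^+ 2))).
 - by [].
 - by [].
 - exact: tamecX 2 (tD j).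
 - exact: tH.
 - by move=> Y; exact: tamecX 2 (tamecB (tq (Rs Y z)) (tamecC mu _)).
 - by move=> Y; exact: (quad2 Hg).
rewrite /H (ExcD tsum1 (tamecZ _ (tamecD ttr (tamecZ _ tsum2)))).
rewrite (ExcZ _ (tamecD ttr (tamecZ _ tsum2))) (ExcD ttr (tamecZ _ tsum2)).
rewrite (ExcZ _ tsum2) Exc_sum; last by move=> n; exact: (tamecM (tG2 n n) (tamecC mu _)).
congr (_ + _).
 apply: eq_bigr => n _; rewrite mulrC -ExcZ //; by apply: eq_Exc => c; rewrite mulrC.
have -> : EC (tr2f j) = m%:C * EC (fun c => \tr (Gjf j c *m Gjf j c)).
 by rewrite -ExcZ //; apply: eq_Exc => c; rewrite /tr2f mulrC.
rewrite rmorphXn /=; case: Heps => e.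
 by rewrite e expr0n /= mul0r !addr0 mul1r mulrA expr2.
by rewrite (Hsym e) e expr1n; ring.
Qed.
(** Expand [1 / (1 + q)] to second order: the terms linear in [Df] are centred, and the mean of
    [Df ^+ 2] is [EC_D2]. The outcome identifies [E \tr G - N s]: a term of order one, explicit in
    [s], [T2] and the cumulants, up to [O(rho)] and powers of [h]. *)
Lemma E_mean_shift : cabs (M%:R%:C * (R0 * EC (fun c => Af c - a)) + tau ^+ 2 * (eps%:C * T2 + Kap%:C * s ^+ 2)) <= h ^+ 63 * rho.
pose V2 c := z * ((Af c - a) * (Af c - a)); have tV2 : tamec mu V2 by exact: (tamecZ z (tamecM tV0 tV0)).
pose X j c := - (Df j c * Df j c) * ((1 + Ajf j c)^-1 * ((1 + qf_ j c)^-1 - tau) + tau * - (tau * (Ajf j c - a) * (1 + Ajf j c)^-1))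
 + (m%:C * D2f j c) * ((1 + qf_ j c)^-1 * (1 + qf_ j c)^-1)
 + (m%:C * tr2f j c) * (((1 + qf_ j c)^-1 - tau) * ((1 + qf_ j c)^-1 + tau))
 - V2 c.
have SX j c : Sj j c = (1 + Ajf j c)^-1 * Df j c + (X j c + (tau ^+ 2 * m%:C * tr2f j c - tau ^+ 2 * Df j c ^+ 2)).
 have n1 := den_f z0 j c; have n2 := one_plus_Ajf_neq0 j c; have n3 := one_plus_a_neq0 z0 Hs.
 have e : qf_ j c = Ajf j c + Df j c by rewrite /Df addrC subrK.
 rewrite /X /Sj (A_sub_Aj z0) -/(tr2f j c); rewrite e in n1 *; exact: mean_split.
have tX j : tamec mu (X j).
 have ct := tamecC mu tau; have cm := tamecC mu (m%:C).
 apply: tamecB; first apply: tamecD; first apply: tamecD.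
 - apply: (tamecM (tamecN (tamecM (tD j) (tD j)))).
  apply: (tamecD (tamecM (tiA j) (tamecB (tiq j) ct))).
  exact: (tamecM ct (tamecN (tamecM (tamecM ct (tVj j)) (tiA j)))).
 - exact: (tamecM (tamecM cm (tD2 j)) (tamecM (tiq j) (tiq j))).
 - exact: (tamecM (tamecM cm (tame_tr2f j)) (tamecM (tamecB (tiq j) ct) (tamecD (tiq j) ct))).
 - exact: tV2.
have BX0 j c : bdw j c 15 6 6 (X j c + V2 c).
 have [[Bz _ _ Bt] [Bq BA Btr Bm]] := bd_csts b0 j c.
 have [_ [BD BD2 BV0 BV]] := bd_basic b0 j c; have Biq := bd_iq j c.
 have w1 := wf_ge1 b0 j c; have W := bdW h2 rho0 rho_le1 w1; have A := bdD h2 rho0 rho_le1 w1.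
 rewrite /X /V2 subrK.
 apply: (W _ _ _ _ _ _ _ (A _ _ _ _ _ _ _ _ (A _ _ _ _ _ _ _ _
  (bdM (bdN (bdM BD BD)) (A _ _ _ _ _ _ _ _ (bdM BA Biq) (bdM Bt (bdN (bdM (bdM Bt BV) BA)))))
  (bdM (bdM Bm BD2) (bdM Bq Bq))) (bdM (bdM Bm Btr) (bdM Biq (A _ _ _ _ _ _ _ _ Bq Bt))))) => //.
have tX0 j : tamec mu (fun c => X j c + V2 c).
 exact: (tamecD (tX j) tV2).
have EX j : cabs (EC (X j)) <= h ^+ 52 * rho ^+ 6.
 have -> : EC (X j) = EC (fun c => X j c + V2 c) - EC V2.
  rewrite -(ExcB (tX0 j) tV2).
  by apply: eq_Exc => c; rewrite addrK.
 apply: (le_trans (cabsB _ _)).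
 have e1 : cabs (EC (fun c => X j c + V2 c)) <= h ^+ 51 * rho ^+ 6.
  by apply: (le_trans (cabs_Exc (tX0 j))); apply: (@Ex_bd b0 nv_null j _ 15 6 6 isT (tX0 j)) => c; exact: BX0.
 have e2 : cabs (EC V2) <= h ^+ 50 * rho ^+ 6.
  rewrite (ExcZ _ (tamecM tV0 tV0)) cabsM (exprS h 49) -mulrA.
  apply: ler_pM; rewrite ?cabs_ge0 //.
  apply: (le_trans (cabs_Exc (tamecM tV0 tV0))); apply: le_trans E_V0_sq.
  by apply: le_of_eq; apply: eq_Ex => c; rewrite cabsM expr2.
 have r6 : 0 <= rho ^+ 6 by rewrite exprn_ge0.
 have e3 : h ^+ 50 * rho ^+ 6 <= h ^+ 51 * rho ^+ 6 by rewrite ler_wpM2r ?hX_le.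
 have e4 : 2 * (h ^+ 51 * rho ^+ 6) <= h ^+ 52 * rho ^+ 6 by rewrite mulrA ler_wpM2r ?(@hXS 51 2).
 apply: (le_trans (lerD e1 (le_trans e2 e3))); by rewrite -mulr2n -[X in X <= _]mulr_natl.
have ESj j : EC (Sj j) = EC (X j) + tau ^+ 2 * (m%:C * EC (tr2f j) - EC (fun c => Df j c ^+ 2)).
 have tD2' := tamecX 2 (tD j).
 have t3 := tamecB (tamecZ (tau ^+ 2 * m%:C) (tame_tr2f j)) (tamecZ (tau ^+ 2) tD2').
 under eq_Exc do rewrite SX.
 rewrite (ExcD (tamecM (tiA j) (tD j)) (tamecD (tX j) t3)) (ExcD (tX j) t3).
 rewrite (@Df_mean j _ (fun Y => (1 + \tr (Rs Y z) * m%:C)^-1) (fun=> erefl) (tiA j)) add0r.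
 rewrite (ExcB (tamecZ (tau ^+ 2 * m%:C) (tame_tr2f j)) (tamecZ (tau ^+ 2) tD2')).
 by rewrite (ExcZ _ (tame_tr2f j)) (ExcZ _ tD2') mulrBr mulrA.
pose err j := EC (X j) - tau ^+ 2 * (eps%:C * m%:C * (EC (tr2f j) - T2) + \sum_n (EC (fun c => Gjf j c n n ^+ 2) - s ^+ 2) * (kap mu eps j n)%:C).
have Serr j : EC (Sj j) = err j - tau ^+ 2 * (eps%:C * m%:C * T2 + (\sum_n kap mu eps j n)%:C * s ^+ 2).
 have k1 : \sum_n (EC (fun c => Gjf j c n n ^+ 2) - s ^+ 2) * (kap mu eps j n)%:C =
   \sum_n EC (fun c => Gjf j c n n ^+ 2) * (kap mu eps j n)%:C - s ^+ 2 * (\sum_n kap mu eps j n)%:C.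
  by rewrite rmorph_sum mulr_sumr -sumrB; apply: eq_bigr => n _; rewrite mulrBl.
 rewrite ESj EC_D2 /err k1 rmorphD rmorph1.
 exact: err_split.
have -> : M%:R%:C * (R0 * EC (fun c => Af c - a)) = \sum_j EC (Sj j).
 rewrite -Exc_sum; last first.
  move=> j; apply: (tamecB (tamecM (tamecD (tD j) (tAA j)) (tiq j))).
  exact: (tamecZ z (tamecX 2 tV0)).
 rewrite -(ExcZ _ tV0) -(ExcZ _ (tamecZ R0 tV0)); apply: eq_Exc => c.
 by rewrite R0V0 mulrA rmorph_nat [X in X * _]mulrC mM mul1r.
under eq_bigr do rewrite Serr.
have k2 : \sum_(j < M) (eps%:C * m%:C * T2 + (\sum_n kap mu eps j n)%:C * s ^+ 2) = eps%:C * T2 + Kap%:C * s ^+ 2.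
 rewrite big_split; congr (_ + _); last by rewrite /Kap rmorph_sum mulr_suml.
 by rewrite sumr_const card_ord -[LHS]mulr_natr mulrAC -(mulrA eps%:C) mM mulr1.
rewrite sumrB -mulr_sumr k2.
rewrite subrK; apply: (le_trans (cabs_sum _ _ _)).
have r0 : 0 <= rho := rho0.
have err_le j : cabs (err j) <= h ^+ 63 * (rho * m).
 have q1 : cabs (tau ^+ 2) <= h ^+ 4.
  by rewrite cabsX (exprM h 2 2) lerXn2r ?nnegrE ?cabs_ge0 //; exact: (cabs_tau z0 Hs Hz Hzc).
 have q2 : cabs (eps%:C * m%:C * (EC (tr2f j) - T2)) <= h ^+ 37 * (rho * m).
  have e1 : cabs (eps%:C) <= 1 by rewrite cabs_real; case: Heps => ->; rewrite ?normr0 ?normr1.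
  have e2 : cabs (EC (tr2f j) - T2) <= h ^+ 37 * rho.
   rewrite -[X in _ - X](Exc_cst mu) -(ExcB (tame_tr2f j) (tamecC mu T2)).
   exact: le_trans (cabs_Exc (tamecB (tame_tr2f j) (tamecC mu T2))) (HT2 j).
  rewrite !cabsM (cabs_ge0r (ltW m0)) mulrAC mulrA; apply: ler_wpM2r; first exact: ltW.
  by rewrite -[X in _ <= X]mul1r; apply: ler_pM; rewrite ?cabs_ge0.
 have q3 : cabs (\sum_n (EC (fun c => Gjf j c n n ^+ 2) - s ^+ 2) * (kap mu eps j n)%:C) <= h ^+ 57 * (rho * m).
  apply: (le_trans (cabs_sum _ _ _)).
  apply: (@le_trans _ _ (N%:R * (h ^+ 55 * rho ^+ 2 * (h * m ^+ 2)))).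
   apply: sum_const_le => n; rewrite cabsM cabs_real.
   by apply: ler_pM; rewrite ?cabs_ge0 ?E_diag ?kap_le.
  have -> : N%:R * (h ^+ 55 * rho ^+ 2 * (h * m ^+ 2)) = (N%:R * m) * (h ^+ 56 * (rho ^+ 2 * m)) by rewrite (exprS h 55); ring.
  rewrite (exprS h 56) -(mulrA h); apply: ler_pM; rewrite ?mulr_ge0 ?exprn_ge0 ?(ltW m0) //.
   by rewrite ler_pdivrMr.
  by apply: ler_wpM2l => //; rewrite ler_wpM2r ?(ltW m0) // expr2 ler_piMr ?rho_le1.
 have rm : 0 <= rho * m by rewrite mulr_ge0 ?(ltW m0).
 have q4 : rho ^+ 6 <= rho * m.
  rewrite (_ : 6 = 2 + 4)%N // exprD rho4 ler_wpM2r ?(ltW m0) //.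
  by rewrite expr2 ler_piMr ?rho_le1.
 have up k : (k <= 60)%N -> h ^+ k * (rho * m) <= h ^+ 60 * (rho * m) by move=> k60; rewrite ler_wpM2r ?hX_le.
 apply: (le_trans (cabsB _ _)).
 have s1 : cabs (EC (X j)) <= h ^+ 60 * (rho * m).
  by apply: (le_trans (EX j)); apply: (@le_trans _ _ (h ^+ 52 * (rho * m))); [exact: ler_wpM2l|exact: up].
 have s3 : cabs (tau ^+ 2 * (eps%:C * m%:C * (EC (tr2f j) - T2) + \sum_n (EC (fun c => Gjf j c n n ^+ 2) - s ^+ 2) * (kap mu eps j n)%:C)) <= 2 * (h ^+ 4 * (h ^+ 57 * (rho * m))).
  rewrite cabsM mulrCA; apply: ler_pM; rewrite ?cabs_ge0 //.
  apply: (le_trans (cabsD _ _)).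
  have q2' : cabs (eps%:C * m%:C * (EC (tr2f j) - T2)) <= h ^+ 57 * (rho * m).
   by apply: (le_trans q2); rewrite ler_wpM2r ?hX_le.
  by apply: (le_trans (lerD q2' q3)); rewrite -mulr2n -[X in X <= _]mulr_natl.
 apply: (le_trans (lerD s1 s3)).
 have u1 : h ^+ 4 * (h ^+ 57 * (rho * m)) = h ^+ 61 * (rho * m) by rewrite mulrA -exprD.
 rewrite u1.
 have u2 : 2 * (h ^+ 61 * (rho * m)) <= h ^+ 62 * (rho * m) by rewrite mulrA ler_wpM2r ?(@hXS 61 2).
 have u3 : 2 * (h ^+ 62 * (rho * m)) <= h ^+ 63 * (rho * m) by rewrite mulrA ler_wpM2r ?(@hXS 62 2).
 have u4 : h ^+ 60 * (rho * m) <= h ^+ 62 * (rho * m) by rewrite ler_wpM2r ?hX_le.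
 apply: (le_trans (lerD u4 u2)); apply: le_trans u3; by rewrite -mulr2n -[X in X <= _]mulr_natl.
apply: (le_trans (sum_const_le err_le)).
by rewrite mulrCA [rho * m]mulrC (mulrA M%:R) mulfV ?gt_eqF // mul1r.
Qed.

End AtZ2.
End Laws2.

Lemma Rs_diff (R : realType) N M (Y : 'M[R[i]]_(N, M)) z z' : Im z != 0 -> Im z' != 0 ->
 Rs Y z' - Rs Y z = (z' - z) *: (Rs Y z *m Rs Y z').
move=> z0 z0'.
have e : shifted Y z - shifted Y z' = (z' - z)%:M.
 by apply/matrixP => i j; rewrite !mxE mulrnBl; ring.
rewrite scalemxAl -mul_mx_scalar -e mulmxBr mul_Rs_shifted // mulmxBl mul1mx.
by rewrite -mulmxA mul_shifted_Rs // mulmx1.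
Qed.
Lemma Rs_symm (R : realType) N M (Y : 'M[R[i]]_(N, M)) z : Im z != 0 ->
 (forall i j, Im (Y i j) = 0) -> (Rs Y z)^T = Rs Y z.
move=> z0 Yr; rewrite /Rs trmx_inv /shifted raddfB /= tr_scalar_mx trmx_mul.
suff [-> ->] : (adjmx Y)^T = Y /\ Y^T = adjmx Y by [].
have cY i j : ((Y i j)^*)%C = Y i j by apply: eqcP; rewrite ?cRe_conj ?cIm_conj ?Yr ?oppr0.
by split; apply/matrixP => i j; rewrite !mxE cY.
Qed.

(** * Real entries, recovered almost surely from the second moments *)

Section RealEntries.
Variables (R : realType) (N M : nat).
Local Notation C := R[i].
Variables (mu : mxlaw R N M) (K : R).
Hypothesis Hg : goodlaw mu K 1.

(** For [eps = 1] the second moments say [E (Re x)^2 - E (Im x)^2 = E |x|^2], hence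
    [E (Im x)^2 = 0]. *)
Lemma Im_entry_ae i j : {ae mu, forall c, Im (entmx c i j) = 0}.
case: (Hg) => _ M0 _ /(_ i j)[tx _ e1 e2 _].
have tI : tame mu (fun c => Im (entmx c i j)) by case: tx.
have tR : tame mu (fun c => Re (entmx c i j)) by case: tx.
have E0 : Ex mu (fun c => Im (entmx c i j) ^+ 2) = 0.
 have e3 : Ex mu (fun c => Re (entmx c i j) ^+ 2 - Im (entmx c i j) ^+ 2) = M%:R^-1.
  have := congr1 Re e2; rewrite /Exc /= mul1r => <-; apply: eq_Ex => c.
  by rewrite expr2 cReM -!expr2.
 have e4 : Ex mu (fun c => Re (entmx c i j) ^+ 2 + Im (entmx c i j) ^+ 2) = M%:R^-1.
  by rewrite -e1; apply: eq_Ex => c; rewrite cabs_sq.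
 rewrite (ExB (tameX 2 tR) (tameX 2 tI)) in e3; rewrite (ExD (tameX 2 tR) (tameX 2 tI)) in e4.
 by move: e3 e4; move: (Ex _ _) (Ex _ _) => u v; lra.
have tI2 := tame_integrable (tameX 2 tI).
have mI : measurable_fun setT (fun c : EntT R N M => (Im (entmx c i j) ^+ 2)%:E).
 by case: (tameX 2 tI) => mI _; exact/measurable_EFinP.
have : (\int[mu]_c `|(Im (entmx c i j) ^+ 2)%:E| = 0)%E.
 under eq_integral do rewrite gee0_abs ?lee_fin ?sqr_ge0 //.
 rewrite -[LHS]fineK; first by move: E0; rewrite /Ex /Rintegral => ->.
 exact: integrable_fin_num.
move=> /(ae_eq_integral_abs _ measurableT mI); apply: (@filterS _ _ (ae_filter_ringOfSetsType mu)) => c /(_ I) /= [] /eqP.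
by rewrite expf_eq0 => /andP[_ /eqP].
Qed.
Lemma Im_entries_ae : {ae mu, forall c, forall i j, Im (entmx c i j) = 0}.
have H i : {ae mu, forall c, forall j, Im (entmx c i j) = 0}.
 exact: (@filter_forall _ _ (fun j c => Im (entmx c i j) = 0) _ (ae_filter_ringOfSetsType mu) (fun j => Im_entry_ae i j)).
exact: (@filter_forall _ _ (fun i c => forall j, Im (entmx c i j) = 0) _ (ae_filter_ringOfSetsType mu) H).
Qed.
Lemma eq_Ex_real (f g : EntT R N M -> R) : tame mu f -> tame mu g ->
 (forall c, (forall i j, Im (entmx c i j) = 0) -> f c = g c) -> Ex mu f = Ex mu g.
move=> [mf _] [mg _] H; rewrite /Ex /Rintegral; congr fine.
apply: ae_eq_integral => //; [exact/measurable_EFinP|exact/measurable_EFinP|].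
apply: (@filterS _ _ (ae_filter_ringOfSetsType mu) _ _ _ Im_entries_ae) => c cr _ /=; congr EFin; exact: H.
Qed.
Lemma Hsym_real z j : Im z != 0 ->
 Exc mu (fun c => \sum_i \sum_k Gjf z j c i k ^+ 2) = Exc mu (fun c => \tr (Gjf z j c *m Gjf z j c)).
move=> z0; have tG i k : tamec mu (fun c => Gjf z j c i k) := tamemx_Gj Hg j z0 i k.
have [t1r t1i] : tamec mu (fun c => \sum_i \sum_k Gjf z j c i k ^+ 2).
 by apply: tamec_sum => i; apply: tamec_sum => k; exact: tamecX.
have [t2r t2i] : tamec mu (fun c => \tr (Gjf z j c *m Gjf z j c)).
 have t := tamemx_Gj Hg j z0; exact: tamec_tr (tamemxM t t).
have e c : (forall i k, Im (entmx c i k) = 0) ->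
  \sum_i \sum_k Gjf z j c i k ^+ 2 = \tr (Gjf z j c *m Gjf z j c).
 move=> cr; rewrite /mxtrace; apply: eq_bigr => i _; rewrite mxE; apply: eq_bigr => k _.
 rewrite expr2; congr (_ * _); rewrite /Gjf -[in RHS](@Rs_symm _ _ _ (zcol j (entmx c)) z) ?mxE //.
 by move=> i' j'; rewrite mxE; case: ifP.
by rewrite /Exc; congr (_ +i* _); apply: eq_Ex_real => // c /e ->.
Qed.

End RealEntries.

Lemma lin_three (R : realType) (x y t a b : R) :
 x <= a -> y <= a -> t <= a -> 16 * a <= b -> 0 <= a -> x + y + t <= b.
by lra. Qed.
Lemma shift_split (F : fieldType) (f d x r : F) : r != 0 -> f - d / r = f - x + (r * x - d) / r.
by move=> r0; field. Qed.

Section Laws3.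
Variables (R : realType) (N M : nat).
Local Notation C := R[i].
Variables (mu : mxlaw R N M) (K eps h : R).
Hypothesis Hg : goodlaw mu K eps.
Local Notation E := (Ex mu).
Local Notation EC := (Exc mu).
Local Notation m := (M%:R^-1 : R).
Local Notation dd := (N%:R / M%:R : R).
Hypotheses (HK : dominates K h) (HN : N%:R <= h * M%:R).
Hypothesis Heps : eps = 0 \/ eps = 1.
Local Notation rho := (rho R M).
Local Opaque Rs.

Let M0 : (0 < M)%N. Proof. by case: Hg. Qed.
Let m0 : 0 < m. Proof. by rewrite invr_gt0 ltr0n. Qed.
Let K1 : 1 <= K. Proof. by case: Hg. Qed.
Lemma Kap_le : `|Kap mu eps| <= 4 * K * dd.
have H j n : `|kap mu eps j n| <= 4 * K * m ^+ 2.
 case: (Hg) => _ _ _ /(_ n j)[_ _ _ _ [+ _]].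
 have e : Ex mu (fun c => cabs (entmx c n j) ^+ 4) = Ex mu (fun c => cabs (xe j n c) ^+ 4) by [].
 rewrite e /kap -exprVn; have : 0 <= Ex mu (fun c => cabs (xe j n c) ^+ 4).
  by apply: Ex_ge0 => c; rewrite exprn_ge0 ?cabs_ge0.
 move: (Ex _ _) => x x0 xK; have m20 : 0 <= m ^+ 2 by exact: sqr_ge0.
 have Hm : m ^+ 2 <= K * m ^+ 2 by rewrite ler_peMl.
 have e3 : 2 * m ^+ 2 <= (2 + eps ^+ 2) * m ^+ 2 <= 3 * m ^+ 2.
  by case: Heps => ->; apply/andP; split; rewrite ?expr0n ?expr1n /=; apply: ler_wpM2r => //; lra.
 rewrite -mulrA; move: e3 => /andP[]; move: x0 xK Hm m20.
 move: ((2 + eps ^+ 2) * m ^+ 2) (K * m ^+ 2) (m ^+ 2) => u v w x0 Hx Hm m20 e1 e2.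
 by rewrite ler_norml; apply/andP; split; lra.
apply: (le_trans (ler_norm_sum _ _ _)).
apply: (@le_trans _ _ (M%:R * (N%:R * (4 * K * m ^+ 2)))).
 apply: sum_const_le => j; apply: (le_trans (ler_norm_sum _ _ _)); apply: sum_const_le => n; exact: H.
have mn : (M%:R : R) != 0 by rewrite gt_eqF // ltr0n.
by apply: le_of_eq; field.
Qed.

Variables (z s s' : C).
Let z' := z + rho%:C.
Hypotheses (z0 : Im z != 0) (Hz : `|Im z|^-1 <= h) (Hzc : cabs z <= h) (Hzc' : cabs z' <= h).
Hypotheses (Hs : mpsol dd z s) (Hsc : cabs s <= h) (Hs' : mpsol dd z' s') (Hsc' : cabs s' <= h).
(** The normalised trace of [G *m G] is the derivative of [Af] in [z]; its limit is taken as a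
    difference quotient of [dd * s] with step [rho]. *)
Definition T2f : C := (dd%:C * s' - dd%:C * s) / rho%:C.

Let Imz' : Im z' = Im z. Proof. by rewrite /z' cImD cIm_real addr0. Qed.
Let z0' : Im z' != 0. Proof. by rewrite Imz'. Qed.
Let Hz' : `|Im z'|^-1 <= h. Proof. by rewrite Imz'. Qed.
(** [Ajf] is known up to [rho ^+ 2] at both points, which costs [rho] after division by the step; by
    the resolvent identity the discretisation costs [rho] as well. *)
Lemma E_tr2 j : E (fun c => cabs (tr2f z j c - T2f)) <= h ^+ 37 * rho.
have h1 : 1 <= h.
 have := dominates_36 HK K1; have := K1; lra.
have h16 : 16 <= h.
 have := dominates_36 HK K1; have := K1; lra.
have h0 : 0 <= h := le_trans ler01 h1.
have r0 : 0 < rho := rho_gt0 Hg.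
have rn : rho%:C != 0 :> C by rewrite -cabs_eq0 cabs_real normr_eq0 gt_eqF.
have tV : tamec mu (fun c => Ajf z j c - dd%:C * s) by apply: tamecB; [exact: (tame_Ajf Hg)|exact: tamecC].
have tV' : tamec mu (fun c => Ajf z' j c - dd%:C * s') by apply: tamecB; [exact: (tame_Ajf Hg)|exact: tamecC].
have e1 : E (fun c => cabs (Ajf z j c - dd%:C * s)) <= h ^+ 36 * rho ^+ 2.
 apply: (Ex_bd Hg HK HN z0 Hz Hzc Hs (nv_null R N) (j := j) (k := 0) (p := 2) (q := 2) isT tV) => c.
 by have [_ [_ _ _ B]] := bd_basic h Hg z s (nullv R N) j c.
have e2 : E (fun c => cabs (Ajf z' j c - dd%:C * s')) <= h ^+ 36 * rho ^+ 2.
 apply: (Ex_bd Hg HK HN z0' Hz' Hzc' Hs' (nv_null R N) (j := j) (k := 0) (p := 2) (q := 2) isT tV') => c.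
 by have [_ [_ _ _ B]] := bd_basic h Hg z' s' (nullv R N) j c.
have tt := tame_tr2f Hg z0 j.
apply: (@le_trans _ _ (rho^-1 * E (fun c => cabs (Ajf z j c - dd%:C * s)) + rho^-1 * E (fun c => cabs (Ajf z' j c - dd%:C * s')) + h ^+ 4 * rho * E (fun=> 1))).
 apply: (le_Ex_lin3 (tamec_cabs (tamecB tt (tamecC mu _))) (tamec_cabs tV) (tamec_cabs tV') (tameC mu 1)) => c.
 set Y := zcol j (entmx c).
 have D : Ajf z' j c - Ajf z j c = rho%:C * (\tr (Rs Y z *m Rs Y z') * m%:C).
  rewrite /Ajf /Gjf -/Y -mulrBl -raddfB /= Rs_diff // mxtraceZ /z' addrC addKr mulrA //.
 have F : tr2f z j c - \tr (Rs Y z *m Rs Y z') * m%:C = - rho%:C * (\tr (Rs Y z *m (Rs Y z *m Rs Y z')) * m%:C).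
  rewrite /tr2f /Gjf -/Y -mulrBl -raddfB /= -mulmxBr -opprB Rs_diff // /z' addrC addKr.
  by rewrite mulmxN raddfN /= -scalemxAr mxtraceZ !mulNr mulrA.
 have -> : tr2f z j c - T2f = - rho%:C * (\tr (Rs Y z *m (Rs Y z *m Rs Y z')) * m%:C)
   + ((Ajf z' j c - dd%:C * s') - (Ajf z j c - dd%:C * s)) / rho%:C.
  rewrite -F /T2f (_ : (Ajf z' j c - _) - _ = (Ajf z' j c - Ajf z j c) - (dd%:C * s' - dd%:C * s)); last by ring.
  rewrite D; exact: (shift_split _ _ _ rn).
 apply: (le_trans (cabsD _ _)); rewrite addrC mulr1.
 apply: lerD.
  rewrite cabsM cabsV (cabs_ge0r (ltW r0)) mulrC -mulrDr ler_wpM2l ?invr_ge0 ?(ltW r0) //.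
  by rewrite [X in _ <= X]addrC; exact: cabsB.
 rewrite cabsM cabsN (cabs_ge0r (ltW r0)) mulrC; apply: ler_wpM2r; first exact: ltW.
 have o := opb_h Hg HK z0 Hz Y; have o' := opb_h Hg HK z0' Hz' Y.
 rewrite cabsM (cabs_ge0r (ltW m0)) ler_pdivrMr ?ltr0n //.
 apply: (le_trans (opb_tr (opbM o (opbM o o')))).
 have -> : h ^+ 4 * M%:R = (h * M%:R) * (h * (h * h)) by ring.
 by apply: ler_wpM2r HN; rewrite !mulr_ge0.
rewrite Ex_cst mulr1.
have q1 u : u <= h ^+ 36 * rho ^+ 2 -> rho^-1 * u <= h ^+ 36 * rho.
 by move=> H; rewrite ler_pdivrMl // mulrCA -expr2.
have q2 : h ^+ 4 * rho <= h ^+ 36 * rho by rewrite ler_wpM2r ?(ltW r0) // ler_weXn2l.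
have q3 : 16 * (h ^+ 36 * rho) <= h ^+ 37 * rho.
 by rewrite mulrA ler_wpM2r ?(ltW r0) // (exprS h 36) ler_wpM2r ?exprn_ge0.
have q4 : 0 <= h ^+ 36 * rho by rewrite mulr_ge0 ?exprn_ge0 ?(ltW r0).
move: (q1 _ e1) (q1 _ e2) q2 q3 q4; exact: lin_three.
Qed.
Lemma E_mean_shift' :
 cabs (M%:R%:C * (R0 N M z s * EC (fun c => Af z c - dd%:C * s))
  + (1 + dd%:C * s)^-1 ^+ 2 * (eps%:C * T2f + (Kap mu eps)%:C * s ^+ 2)) <= h ^+ 63 * rho.
apply: (E_mean_shift Hg HK HN z0 Hz Hzc Hs Hsc Heps E_tr2) => e j.
by move: Hg; rewrite e => Hg1; exact: (Hsym_real Hg1).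
Qed.

End Laws3.

(** * The Marchenko-Pastur law *)

Lemma integrable_cst_seg (R : realType) (a b c : R) : (@lebesgue_measure R).-integrable `[a, b] (EFin \o fun=> c).
by apply: continuous_compact_integrable; [exact: segment_compact|apply: continuous_subspaceT => x; exact: cvg_cst]. Qed.

Section ComplexIntegral.
Context d (T : measurableType d) (R : realType).
Variable mu : {measure set T -> \bar R}.
Local Notation C := R[i].
Implicit Types (D : set T) (f g : T -> C).

Definition cintegrable D f :=
 mu.-integrable D (EFin \o (fun x => Re (f x))) /\ mu.-integrable D (EFin \o (fun x => Im (f x))).
Definition cI D f : C := Rintegral mu D (fun x => Re (f x)) +i* Rintegral mu D (fun x => Im (f x)).

Lemma eq_cI D f g : (forall x, D x -> f x = g x) -> cI D f = cI D g.
by move=> H; rewrite /cI; congr (_ +i* _); apply: eq_Rintegral => x; rewrite inE => /H ->. Qed.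
Lemma eq_integrable_R D (u v : T -> R) : measurable D -> (forall x, D x -> u x = v x) ->
 mu.-integrable D (EFin \o u) -> mu.-integrable D (EFin \o v).
by move=> mD H; apply: eq_integrable => // x; rewrite inE => Dx /=; rewrite H. Qed.
Lemma integrable_lin2 D (a b : R) (u v : T -> R) : measurable D ->
 mu.-integrable D (EFin \o u) -> mu.-integrable D (EFin \o v) ->
 mu.-integrable D (EFin \o (fun x => a * u x + b * v x)) /\
 Rintegral mu D (fun x => a * u x + b * v x) = a * Rintegral mu D u + b * Rintegral mu D v.
move=> mD iu iv.
have ia : mu.-integrable D (EFin \o (fun x => a * u x)) by exact: (integrableZl mD a iu).
have ib : mu.-integrable D (EFin \o (fun x => b * v x)) by exact: (integrableZl mD b iv).
split; first exact: (integrableD mD ia ib).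
by rewrite (RintegralD mD ia ib) !RintegralZl.
Qed.
Lemma cID D f g : measurable D -> cintegrable D f -> cintegrable D g ->
 cintegrable D (fun x => f x + g x) /\ cI D (fun x => f x + g x) = cI D f + cI D g.
move=> mD [f1 f2] [g1 g2].
have [i1 e1] := integrable_lin2 1 1 mD f1 g1; have [i2 e2] := integrable_lin2 1 1 mD f2 g2.
have E1 x : 1 * Re (f x) + 1 * Re (g x) = Re (f x + g x) by rewrite !mul1r cReD.
have E2 x : 1 * Im (f x) + 1 * Im (g x) = Im (f x + g x) by rewrite !mul1r cImD.
rewrite (funext E1) in i1 e1; rewrite (funext E2) in i2 e2.
by split => //; rewrite /cI e1 e2 !mul1r.
Qed.
Lemma cIZ D (c : C) f : measurable D -> cintegrable D f ->
 cintegrable D (fun x => c * f x) /\ cI D (fun x => c * f x) = c * cI D f.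
move=> mD [f1 f2].
have [i1 e1] := integrable_lin2 (Re c) (- Im c) mD f1 f2.
have [i2 e2] := integrable_lin2 (Im c) (Re c) mD f1 f2.
have E1 x : Re c * Re (f x) + - Im c * Im (f x) = Re (c * f x) by rewrite cReM mulNr.
have E2 x : Im c * Re (f x) + Re c * Im (f x) = Im (c * f x) by rewrite cImM addrC.
rewrite (funext E1) in i1 e1; rewrite (funext E2) in i2 e2.
split => //; rewrite /cI e1 e2; apply: eqcP; rewrite ?cReM ?cImM /=; first by rewrite mulNr.
by rewrite addrC.
Qed.
Lemma cI_sum (I : Type) (r : seq I) D (F : I -> T -> C) : measurable D ->
 (forall i, cintegrable D (F i)) ->
 cintegrable D (fun x => \sum_(i <- r) F i x) /\ cI D (fun x => \sum_(i <- r) F i x) = \sum_(i <- r) cI D (F i).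
move=> mD H; elim: r => [|i r [IH1 IH2]].
 have E x : \sum_(i <- [::]) F i x = 0 :> C by rewrite big_nil.
 split.
  by split; apply: (@eq_integrable_R D (fun=> 0) _ mD) => [x _|]; rewrite ?E //; exact: integrable0.
 by rewrite big_nil (_ : (fun x => _) = (fun=> 0)) ?funeqE // /cI /Rintegral /= !integral0.
have E x : \sum_(k <- i :: r) F k x = F i x + \sum_(k <- r) F k x by rewrite big_cons.
have [j1 j2] := cID mD (H i) IH1.
by rewrite -(funext E) in j1 j2; split => //; rewrite big_cons -IH2 -j2.
Qed.
Lemma cintegrable_real D (u : T -> R) : mu.-integrable D (EFin \o u) -> measurable D ->
 cintegrable D (fun x => (u x)%:C) /\ cI D (fun x => (u x)%:C) = (Rintegral mu D u)%:C.
move=> iu mD; split; first by split => //=; exact: integrable0.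
by rewrite /cI /=; congr (_ +i* _); rewrite /Rintegral integral0.
Qed.
(** The factor 2 comes from estimating the real and imaginary parts separately. *)
Lemma cI_le D f (B : T -> R) : measurable D -> cintegrable D f -> mu.-integrable D (EFin \o B) ->
 (forall x, D x -> cabs (f x) <= B x) -> cabs (cI D f) <= 2 * Rintegral mu D B.
move=> mD [f1 f2] iB H; apply: (le_trans (cabs_le_ReIm _)); rewrite mulr_natl mulr2n.
have aux (u : T -> R) : mu.-integrable D (EFin \o u) -> (forall x, D x -> `|u x| <= B x) ->
  `|Rintegral mu D u| <= Rintegral mu D B.
 move=> iu Hu; apply: (le_trans (le_normr_Rintegral mD iu)).
 by apply: le_Rintegral => //; exact: (integrable_norm iu).
apply: lerD; apply: aux => //= x Dx; apply: le_trans (H x Dx); [exact: le_Re_cabs|exact: le_Im_cabs].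
Qed.
Lemma cI_Im_le D f (B : T -> R) : measurable D -> cintegrable D f -> mu.-integrable D (EFin \o B) ->
 (forall x, D x -> `|Im (f x)| <= B x) -> `|Im (cI D f)| <= Rintegral mu D B.
move=> mD [f1 f2] iB H /=.
apply: (le_trans (le_normr_Rintegral mD f2)).
by apply: le_Rintegral => //; exact: (integrable_norm f2).
Qed.
Lemma cintegrable_le D f (B : T -> R) : measurable D ->
 measurable_fun D (fun x => Re (f x)) -> measurable_fun D (fun x => Im (f x)) ->
 mu.-integrable D (EFin \o B) -> (forall x, D x -> cabs (f x) <= B x) -> cintegrable D f.
move=> mD m1 m2 iB H; split; (apply: (le_integrable mD _ _ iB); first exact/measurable_EFinP).
- move=> x Dx /=; rewrite lee_fin; apply: (le_trans (le_Re_cabs _)).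
 by apply: (le_trans (H x Dx)); exact: ler_norm.
- move=> x Dx /=; rewrite lee_fin; apply: (le_trans (le_Im_cabs _)).
 by apply: (le_trans (H x Dx)); exact: ler_norm.
Qed.
End ComplexIntegral.

(** * Trigonometric integrals behind the Marchenko-Pastur law *)

Section ContinuousComplex.
Variable R : realType.
Local Notation C := R[i].
Implicit Types (f g : R -> C).

Definition ccont f := continuous (fun x => Re (f x) : R) /\ continuous (fun x => Im (f x) : R).

Lemma ccont_cst c : ccont (fun _ => c). Proof. by split => x; exact: cvg_cst. Qed.
Lemma ccont_real (u : R -> R) : continuous u -> ccont (fun x => (u x)%:C).
by move=> cu; split => x //=; exact: cvg_cst. Qed.
Lemma ccontD f g : ccont f -> ccont g -> ccont (fun x => f x + g x).
move=> [f1 f2] [g1 g2]; split => x; under eq_fun do rewrite ?cReD ?cImD; apply: cvgD;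
 [exact: f1|exact: g1|exact: f2|exact: g2].
Qed.
Lemma ccontN f : ccont f -> ccont (fun x => - f x).
move=> [f1 f2]; split => x; under eq_fun do rewrite ?cReN ?cImN; apply: cvgN; [exact: f1|exact: f2].
Qed.
Lemma ccontB f g : ccont f -> ccont g -> ccont (fun x => f x - g x).
by move=> cf cg; apply: ccontD => //; exact: ccontN. Qed.
Lemma ccontM f g : ccont f -> ccont g -> ccont (fun x => f x * g x).
move=> [f1 f2] [g1 g2]; split => x; under eq_fun do rewrite ?cReM ?cImM.
- by apply: cvgB; apply: cvgM; [exact: f1|exact: g1|exact: f2|exact: g2].
- by apply: cvgD; apply: cvgM; [exact: f1|exact: g2|exact: f2|exact: g1].
Qed.
Lemma cReV (c : C) : Re c^-1 = Re c / cabs c ^+ 2.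
by rewrite cabs_sq; case: c. Qed.
Lemma cImV (c : C) : Im c^-1 = - Im c / cabs c ^+ 2.
by rewrite cabs_sq; case: c => a b /=; rewrite mulNr. Qed.
Lemma ccontV f : ccont f -> (forall x, f x != 0) -> ccont (fun x => (f x)^-1).
move=> [f1 f2] n0.
have ca x : (cabs (f y) ^+ 2)^-1 @[y --> x] --> (cabs (f x) ^+ 2)^-1.
 apply: cvgV; first by rewrite expf_eq0 /= cabs_eq0.
 under eq_fun do rewrite cabs_sq !expr2; rewrite cabs_sq !expr2.
 by apply: cvgD; apply: cvgM; [exact: f1|exact: f1|exact: f2|exact: f2].
split => x; under eq_fun do rewrite ?cReV ?cImV.
- by apply: cvgM; [exact: f1|exact: ca].
- apply: cvgM; last exact: ca.
 by apply: cvgN; exact: f2.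
Qed.
(** The measure argument only fixes which measurable structure on the line is meant. *)
Definition mble d (T : measurableType d) (mu : {measure set T -> \bar R}) (D : set T) : Prop := measurable D.
Lemma mitv (i : interval R) : mble lebesgue_measure [set` i].
exact: measurable_itv. Qed.
Lemma ccont_integrable f (a b : R) : ccont f -> cintegrable lebesgue_measure `[a, b] f.
by move=> [f1 f2]; split; apply: continuous_compact_integrable;
 [exact: segment_compact|exact: continuous_subspaceT|exact: segment_compact|exact: continuous_subspaceT].
Qed.
Lemma Rint_cst_itv (a b c : R) : a <= b -> Rintegral lebesgue_measure `[a, b] (fun=> c) = c * (b - a).
move=> ab; rewrite Rintegral_cst //; congr (_ * _).
transitivity (fine (if (a%:E < b%:E)%E then (b%:E - a%:E)%E else 0%E)).
 by have e := lebesgue_measure_itv `[a, b]; congr fine; exact: e.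
by rewrite /= lte_fin; case: ltgtP ab => //= -> _; rewrite subrr.
Qed.
Lemma cI_bound_itv f (a b B : R) : a <= b -> ccont f -> (forall x, x \in `[a, b] -> cabs (f x) <= B) ->
 cabs (cI lebesgue_measure `[a, b] f) <= 2 * B * (b - a).
move=> ab cf H; rewrite -mulrA -Rint_cst_itv //.
apply: cI_le => //; first exact: ccont_integrable.
exact: integrable_cst_seg.
Qed.
Lemma Rint_cos (k : nat) : Rintegral lebesgue_measure `[0, pi] (fun t : R => cos (k.+1%:R * t)) = 0.
have pi0 := pi_gt0 R.
pose F (t : R) := k.+1%:R^-1 * sin (k.+1%:R * t).
have dF (t : R) : is_derive t 1 F (cos (k.+1%:R * t)).
 have kn : k.+1%:R != 0 :> R by rewrite pnatr_eq0.
 have -> : cos (k.+1%:R * t) = k.+1%:R^-1 *: (cos (k.+1%:R * t) *: (k.+1%:R *: 1)).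
  by rewrite /GRing.scale /= mulr1 mulrCA mulVf // mulr1.
 rewrite /F; apply: is_deriveZ; apply: is_derive1_comp.
have cF : continuous F by move=> t; exact/differentiable_continuous/derivable1_diffP/ex_derive.
rewrite /Rintegral (@continuous_FTC2 _ _ F) //.
- rewrite /F mulr0 sin0 mulr0 /= subr0.
 have -> : sin (k.+1%:R * pi) = 0 :> R.
  rewrite mulr_natl; elim: (k.+1) => [|n IH]; first by rewrite mulr0n sin0.
  by rewrite mulrS sinD IH sinpi mul0r mulr0 addr0.
 by rewrite mulr0.
- apply: continuous_subspaceT => t; apply: continuous_comp; last exact: continuous_cos.
 by apply: cvgM; [exact: cvg_cst|exact: cvg_id].
- split; first by move=> t _; exact: ex_derive.
 + exact: cvg_at_right_filter (cF 0).
 + exact: cvg_at_left_filter (cF pi).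
- by move=> t _; rewrite derive1E derive_val.
Qed.
Lemma sin_sin (m : nat) (t : R) : sin t * sin (m.+1%:R * t) = 2^-1 * (cos (m%:R * t) - cos (m.+2%:R * t)).
have -> : m%:R * t = m.+1%:R * t - t by rewrite -natr1 mulrDl mul1r addrK.
have -> : m.+2%:R * t = m.+1%:R * t + t by rewrite -[m.+2%:R]natr1 mulrDl mul1r.
by rewrite cosB cosD; field.
Qed.
Lemma Rint_sin_sin (m : nat) :
 Rintegral lebesgue_measure `[0, pi] (fun t : R => sin t * sin (m.+1%:R * t)) = if m is 0 then pi / 2 else 0.
have ci (k : nat) : lebesgue_measure.-integrable `[0, pi] (EFin \o (fun t : R => cos (k%:R * t))).
 apply: continuous_compact_integrable; first exact: segment_compact.
 apply: continuous_subspaceT => t; apply: continuous_comp; last exact: continuous_cos.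
 by apply: cvgM; [exact: cvg_cst|exact: cvg_id].
have [_ e] := integrable_lin2 2^-1 (- 2^-1) (mitv `[0, pi]) (ci m) (ci m.+2).
have -> : (fun t : R => sin t * sin (m.+1%:R * t)) = (fun t => 2^-1 * cos (m%:R * t) + - 2^-1 * cos (m.+2%:R * t)).
 by apply/funext => t; rewrite sin_sin; ring.
rewrite e Rint_cos mulr0 addr0; case: m {e} => [|m]; last by rewrite Rint_cos mulr0.
have -> : (fun t : R => cos (0%:R * t)) = (fun=> 1) by apply/funext => t; rewrite mul0r cos0.
by rewrite Rint_cst_itv ?pi_ge0 // mul1r subr0 mulrC.
Qed.
(** The denominator in the generating function of the Chebyshev polynomials of the second kind,
    [sin ((k + 1) t) / sin t]. *)
Definition Jden (w : C) (t : R) : C := 1 - 2 * w * (cos t)%:C + w ^+ 2.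

(** [Jden] factors as [(1 - w u) (1 - w u')] with [u] on the unit circle and [u'] its conjugate. *)
Lemma Jden_lb w t : cabs w < 1 -> (1 - cabs w) ^+ 2 <= cabs (Jden w t).
move=> w1; have e : (cos t)%:C ^+ 2 + (sin t)%:C ^+ 2 = 1 :> C.
 by rewrite -!rmorphXn -rmorphD /= cos2Dsin2.
pose u : C := cos t +i* sin t.
have uu : cabs u = 1.
 by apply/eqP; rewrite -(@eqrXn2 _ 2) ?cabs_ge0 // cabs_sq /= cos2Dsin2 expr1n.
have uc : u * (u^*)%C = 1 by rewrite conj_mul uu expr1n.
have us : u + (u^*)%C = 2 * (cos t)%:C by apply: eqcP => /=; ring.
have -> : Jden w t = (1 - w * u) * (1 - w * (u^*)%C).
 rewrite /Jden (_ : (1 - w * u) * (1 - w * (u^*)%C) = 1 - w * (u + (u^*)%C) + w ^+ 2 * (u * (u^*)%C)); last by ring.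
 by rewrite us uc; ring.
have lb (v : C) : cabs v = 1 -> 1 - cabs w <= cabs (1 - w * v).
 move=> v1; have := cabsD (1 - w * v) (w * v); rewrite subrK cabs1 cabsM v1 mulr1; lra.
rewrite expr2 cabsM; apply: ler_pM; rewrite ?subr_ge0 ?(ltW w1) ?lb ?cabs_conj //.
Qed.
Lemma Jden_neq0 w t : cabs w < 1 -> Jden w t != 0.
move=> w1; rewrite -cabs_gt0; apply: lt_le_trans (Jden_lb t w1).
by rewrite exprn_gt0 // subr_gt0.
Qed.
Lemma geometric_sin (w : C) (t : R) n :
 Jden w t * (\sum_(k < n) w ^+ k * (sin (k.+1%:R * t))%:C) =
 (sin t)%:C - w ^+ n * (sin (n.+1%:R * t))%:C + w ^+ n.+1 * (sin (n%:R * t))%:C.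
elim: n => [|n IH]; first by rewrite big_ord0 mulr0 !mul1r mul0r sin0 mulr0 addr0 subrr.
rewrite big_ord_recr /= mulrDr IH.
have -> : n.+2%:R * t = n.+1%:R * t + t by rewrite -[n.+2%:R]natr1 mulrDl mul1r.
have -> : n%:R * t = n.+1%:R * t - t by rewrite -natr1 mulrDl mul1r addrK.
rewrite !sinD sinN cosN mulrN /Jden rmorphB rmorphD !rmorphM /= !exprS.
move: (w ^+ n) (sin _)%:C (cos _)%:C (sin _)%:C (cos _)%:C => ? ? ? ? ?; ring.
Qed.
Lemma ccont_sin (k : nat) : ccont (fun t => (sin (k%:R * t))%:C).
apply: ccont_real => t; apply: continuous_comp; last exact: continuous_sin.
by apply: cvgM; [exact: cvg_cst|exact: cvg_id].
Qed.
Lemma ccont_Jden w : ccont (Jden w).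
apply: ccontD; last exact: ccont_cst.
apply: ccontB; first exact: ccont_cst.
by apply: ccontM; [exact: ccont_cst|apply: ccont_real; exact: continuous_cos].
Qed.
(** Expand [sin t / Jden w t] in the functions [sin ((k + 1) t)]: orthogonality to [sin t] keeps
    only [k = 0], which does not involve [w]. The finite expansion has a remainder [O(|w|^n)], so
    letting [n] grow concludes. *)
Lemma cI_J (w : C) : cabs w < 1 ->
 cI lebesgue_measure `[0, pi] (fun t : R => (sin t ^+ 2)%:C / Jden w t) = (pi / 2)%:C.
move=> w1; set J := cI _ _ _.
have cs : ccont (fun t => (sin t)%:C) by apply: ccont_real; exact: continuous_sin.
have cV : ccont (fun t => (Jden w t)^-1) by apply: ccontV; [exact: ccont_Jden|move=> t; exact: Jden_neq0].
have q0 : 0 < 1 - cabs w by rewrite subr_gt0.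
pose B := 2 * (2 / (1 - cabs w) ^+ 2) * (pi - 0).
have key n : cabs (J - (pi / 2)%:C) <= cabs w ^+ n * B.
 pose rem t : C := (sin t)%:C * (w ^+ n.+1 * (sin (n.+2%:R * t))%:C - w ^+ n.+2 * (sin (n.+1%:R * t))%:C) / Jden w t.
 have cr : ccont rem.
  apply: ccontM => //; apply: ccontM => //.
  by apply: ccontB; apply: ccontM; [exact: ccont_cst|exact: ccont_sin|exact: ccont_cst|exact: ccont_sin].
 pose F k t : C := w ^+ k * (sin t * sin (k.+1%:R * t))%:C.
 have cF k : ccont (F k).
  apply: ccontM; first exact: ccont_cst.
  under eq_fun do rewrite rmorphM; apply: ccontM => //; exact: ccont_sin.
 have e t : (sin t ^+ 2)%:C / Jden w t = \sum_(k < n.+1) F k t + rem t.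
  have g := geometric_sin w t n.+1; have n0 := Jden_neq0 t w1.
  have -> : \sum_(k < n.+1) F k t = (sin t)%:C * \sum_(k < n.+1) w ^+ k * (sin (k.+1%:R * t))%:C.
   by rewrite mulr_sumr; apply: eq_bigr => k _; rewrite /F rmorphM; ring.
  apply: (mulIf n0); rewrite divfK // mulrDl divfK // -mulrA [_ * Jden w t]mulrC g expr2 rmorphM /=.
  ring.
  have iF k : cintegrable lebesgue_measure `[0, pi] (F k) by exact: ccont_integrable.
 have [i1 e1] := cI_sum (index_enum 'I_n.+1) (mitv `[0, pi]) iF.
 have ir : cintegrable lebesgue_measure `[0, pi] rem by exact: ccont_integrable.
 have [_ e2] := cID (mitv `[0, pi]) i1 ir.
 have -> : J = (pi / 2)%:C + cI lebesgue_measure `[0, pi] rem.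
  transitivity (cI lebesgue_measure `[0, pi] (fun t => \sum_(k < n.+1) F k t + rem t)).
   by apply: eq_cI => t _; exact: e.
  rewrite e2 e1; congr (_ + _).
  have iss k : lebesgue_measure.-integrable `[0, pi] (EFin \o (fun t : R => sin t * sin (k.+1%:R * t))).
   apply: continuous_compact_integrable; first exact: segment_compact.
   apply: continuous_subspaceT => t; apply: cvgM; first exact: continuous_sin.
   by apply: continuous_comp; [apply: cvgM; [exact: cvg_cst|exact: cvg_id]|exact: continuous_sin].
  have Fe (k : 'I_n.+1) : cI lebesgue_measure `[0, pi] (F k) = if nat_of_ord k is 0 then (pi / 2)%:C else 0.
   have [i3 e3] := cintegrable_real (iss k) (mitv `[0, pi]).
   have [_ e4] := cIZ (w ^+ k) (mitv `[0, pi]) i3.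
   rewrite /F e4 e3 Rint_sin_sin; case: (nat_of_ord k) => [|k']; first by rewrite expr0 mul1r.
   by rewrite mulr0.
  under eq_bigr do rewrite Fe.
  by rewrite big_ord_recl /= big1 ?addr0.
 rewrite addrAC subrr add0r.
 have Bn : cabs w ^+ n * B = 2 * (cabs w ^+ n * (2 / (1 - cabs w) ^+ 2)) * (pi - 0) by rewrite /B; ring.
 rewrite Bn; apply: cI_bound_itv; [exact: pi_ge0|exact: cr|move=> t _].
 have s1 x : cabs ((sin x)%:C : C) <= 1 by rewrite cabs_real sin_max.
 rewrite /rem cabsM mulrA; apply: ler_pM; rewrite ?cabs_ge0 //; last first.
  by rewrite cabsV lef_pV2 ?posrE ?exprn_gt0 ?cabs_gt0 ?Jden_neq0 ?Jden_lb.
 rewrite cabsM -[X in _ <= X]mul1r; apply: ler_pM; rewrite ?cabs_ge0 //.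
 apply: (le_trans (cabsB _ _)); rewrite mulrDr mulr1.
 have p k x : cabs (w ^+ (n + k)%N * (sin x)%:C) <= cabs w ^+ n.
  rewrite cabsM cabsX -[X in _ <= X]mulr1; apply: ler_pM; rewrite ?exprn_ge0 ?cabs_ge0 //.
  by rewrite exprD ler_piMr ?exprn_ge0 ?cabs_ge0 // exprn_ile1 ?cabs_ge0 // ltW.
 by apply: lerD; [have := p 1%N (n.+2%:R * t); rewrite addn1|have := p 2%N (n.+1%:R * t); rewrite addn2].
have c0 : (fun n => cabs w ^+ n * B) @ \oo --> 0 * B.
 by apply: cvgM; [apply: cvg_expr; rewrite ger0_norm ?cabs_ge0|exact: cvg_cst].
rewrite mul0r in c0.
have : cabs (J - (pi / 2)%:C) <= 0.
 rewrite -(cvg_lim _ c0) //; apply: limr_ge; first by apply/cvg_ex; exists 0.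
 by apply: nearW => n; exact: key.
move=> H; apply/eqP; rewrite -subr_eq0 -cabs_eq0; apply/eqP/le_anti.
by rewrite H cabs_ge0.
Qed.

End ContinuousComplex.

(** * Total mass and Stieltjes transform by an angular substitution *)

Section MarchenkoPasturDensity.
Variable R : realType.
Local Notation C := R[i].
Local Notation leb := (@lebesgue_measure R).

Lemma max0E (y : R) : Num.max 0 y = (y + `|y|) / 2.
by case: (lerP 0 y) => H; [rewrite ger0_norm|rewrite ltr0_norm] => //; field. Qed.
Lemma mp_density_ge0 (d x : R) : 0 < d -> 0 <= mp_density d x.
by move=> d0; rewrite /mp_density mulr_ge0 ?sqrtr_ge0 // invr_ge0 !mulr_ge0 ?pi_ge0 // ltW.
Qed.
Lemma mp_density_out (d x : R) : ~ (gam_m d < x < gam_p d) -> mp_density d x = 0.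
move=> H; rewrite /mp_density max_l ?mul0r ?sqrtr0 ?mulr0 //.
have gg : gam_m d <= gam_p d.
 rewrite /gam_m /gam_p; have := sqrtr_ge0 d; nra.
case: (lerP x (gam_m d)) => H1.
 by apply: mulr_le0_ge0; rewrite ?subr_le0 ?subr_ge0 // (le_trans H1).
case: (lerP (gam_p d) x) => H2; last by case: H; rewrite H1 H2.
by apply: mulr_ge0_le0; rewrite ?subr_ge0 ?subr_le0 // ltW.
Qed.
Lemma mp_density_cont (d x : R) : x != 0 -> {for x, continuous (mp_density d : R -> R)}.
move=> x0; rewrite /mp_density; apply: cvgM; first exact: cvg_cst.
apply: (@continuous_cvg _ _ _ _ _ _ (@Num.sqrt R)); first exact: sqrt_continuous.
apply: cvgM; last first.
 apply: cvgV; first by rewrite expf_eq0.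
 exact: exprn_continuous.
rewrite max0E; under eq_fun do rewrite max0E.
have c1 : (fun y => (y - gam_m d) * (gam_p d - y)) @ x --> (x - gam_m d) * (gam_p d - x).
 by apply: cvgM; [apply: cvgB; [exact: cvg_id|exact: cvg_cst]|apply: cvgB; [exact: cvg_cst|exact: cvg_id]].
apply: cvgM; last exact: cvg_cst.
by apply: cvgD => //; exact: cvg_norm.
Qed.
Lemma measurable_mpd (d : R) : measurable_fun setT (mp_density d : R -> R).
rewrite /mp_density; apply: measurable_funM; first exact: measurable_cst.
have -> : (fun x => Num.sqrt (Num.max 0 ((x - gam_m d) * (gam_p d - x)) / x ^+ 2)) =
 (fun x => Num.sqrt (Num.max 0 ((x - gam_m d) * (gam_p d - x)) * powR (x ^+ 2) (-1))).
 by apply/funext => x; rewrite powR_inv1 // sqr_ge0.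
apply: (@measurableT_comp _ _ _ _ _ _ (@Num.sqrt R)).
 exact: continuous_measurable_fun (@sqrt_continuous R).
apply: measurable_funM.
 apply: measurable_maxr; first exact: measurable_cst.
 apply: measurable_funM.
  by apply: measurable_funB; [exact: measurable_id|exact: measurable_cst].
 by apply: measurable_funB; [exact: measurable_cst|exact: measurable_id].
have m2 : measurable_fun setT (fun x : R => x ^+ 2) by exact: exprn_measurable.
exact: (measurableT_comp (measurable_powR (-1)) m2).
Qed.

Variable d : R.
Hypothesis d0 : 0 < d.
Let q := Num.sqrt d.
Let q0 : 0 < q. Proof. by rewrite sqrtr_gt0. Qed.
Let q2 : q ^+ 2 = d. Proof. by rewrite sqr_sqrtr // ltW. Qed.
(** Parametrises the bulk by an angle, from [gam_p] at 0 down to [gam_m] at [pi]; [mpk] is the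
    density in this angle, Jacobian included. *)
Definition mpX (t : R) : R := 1 + q ^+ 2 + 2 * q * cos t.
Definition mpk (t : R) : R := 2 / pi * (sin t ^+ 2 / mpX t).

Let dX (t : R) : is_derive t 1 mpX (- (2 * q * sin t)).
have -> : - (2 * q * sin t) = 0 + (2 * q) *: (- sin t) by rewrite add0r /GRing.scale /= mulrN.
rewrite /mpX; apply: is_deriveD; apply: is_deriveZ.
Qed.
Let cX : continuous mpX.
by move=> t; exact/differentiable_continuous/derivable1_diffP/ex_derive. Qed.
Lemma mpX_sub_m t : mpX t - gam_m d = 2 * q * (1 + cos t).
by rewrite /mpX /gam_m -/q; ring. Qed.
Lemma mpX_sub_p t : gam_p d - mpX t = 2 * q * (1 - cos t).
by rewrite /mpX /gam_p -/q; ring. Qed.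
Lemma mpX_gt0 t : -1 < cos t -> 0 < mpX t.
move=> ct; have := mpX_sub_m t; rewrite /gam_m -/q => e.
have : 0 < 2 * q * (1 + cos t) by rewrite !mulr_gt0 //; lra.
have := sqr_ge0 (1 - q); lra.
Qed.
Lemma mpX_ge0 t : 0 <= mpX t.
have := mpX_sub_m t; rewrite /gam_m -/q => e.
have : 0 <= 2 * q * (1 + cos t) by rewrite !mulr_ge0 ?(ltW q0) //; have := cos_geN1 t; lra.
have := sqr_ge0 (1 - q); lra.
Qed.
Lemma mpk_ge0 t : 0 <= mpk t.
by rewrite mulr_ge0 ?divr_ge0 ?pi_ge0 ?sqr_ge0 ?mpX_ge0. Qed.
Lemma density_pullback t : -1 < cos t -> 0 <= sin t -> mp_density d (mpX t) * (2 * q * sin t) = mpk t.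
move=> ct st; have X0 := mpX_gt0 ct; have pi0 := pi_gt0 R.
have e : (mpX t - gam_m d) * (gam_p d - mpX t) = (2 * q * sin t) ^+ 2.
 by rewrite mpX_sub_m mpX_sub_p !exprMn sin2cos2; ring.
have s0 : 0 <= 2 * q * sin t by rewrite !mulr_ge0 // ltW.
rewrite /mp_density e max_r ?sqr_ge0 // -expr_div_n sqrtr_sqr ger0_norm ?divr_ge0 ?(ltW X0) //.
have qn : q != 0 by rewrite gt_eqF.
have Xn : mpX t != 0 by rewrite gt_eqF.
have pn : pi != 0 :> R by rewrite gt_eqF.
rewrite /mpk -{1}q2; move: qn Xn pn; move: q (mpX t) (@pi R) (sin t) => u v w x un vn wn.
by field; rewrite un vn wn.
Qed.
(** Angles increasing to [pi]. The substitution stops short of [pi], where [mpX] vanishes and the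
    density is singular if [d = 1]. *)
Let bb (n : nat) : R := pi * (n.+1%:R / n.+2%:R).
Let bb_itv n : 0 < bb n < pi.
have pi0 := pi_gt0 R; rewrite /bb mulr_gt0 ?divr_gt0 //= -[X in _ < X]mulr1 ltr_pM2l //.
by rewrite ltr_pdivrMr // mul1r ltr_nat.
Qed.
Let bb_nd n k : (n <= k)%N -> bb n <= bb k.
move=> nk; rewrite ler_pM2l ?pi_gt0 // ler_pdivrMr // mulrAC ler_pdivlMr //.
by rewrite -!natrM ler_nat (mulnS n.+1 k.+1) (mulnS k.+1 n.+1) (mulnC k.+1) leq_add2r ltnS.
Qed.
Let bb_cvg t : t < pi -> exists n, t <= bb n.
move=> tp; have pi0 := pi_gt0 R; have g0 : 0 < pi - t by rewrite subr_gt0.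
have [n /ltW Hn] : exists n : nat, pi / (pi - t) < n%:R.
 exists (Num.bound (pi / (pi - t))); apply: archi_boundP; by rewrite divr_ge0 // ltW.
exists n; rewrite /bb.
have -> : pi * (n.+1%:R / n.+2%:R) = pi - pi / n.+2%:R :> R.
 have n2 : n.+2%:R != 0 :> R by rewrite pnatr_eq0.
 have -> : n.+1%:R = n.+2%:R - 1 :> R by rewrite -[n.+2%:R]natr1 addrK.
 by field.
rewrite lerBrDl addrC -lerBrDl ler_pdivrMr // mulrC.
rewrite ler_pdivrMr // in Hn; apply: (le_trans Hn); apply: ler_wpM2r; first exact: ltW.
by rewrite ler_nat -addn2 leq_addr.
Qed.
Let cos_bb t n : t \in `[0, bb n] -> -1 < cos t /\ 0 <= sin t.
have /andP[b0 bp] := bb_itv n; rewrite in_itv /= => /andP[t0 tb].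
have tp : t < pi by exact: le_lt_trans bp.
split; last by apply: sin_ge0_pi; rewrite t0 ltW.
by rewrite -cospi ltr_cos // in_itv /= ?t0 ?lexx ?pi_ge0 ?(ltW tp).
Qed.
Let mpX0 : mpX 0 = gam_p d.
by rewrite /mpX cos0 /gam_p -/q; ring. Qed.
(** Substitution on each [[0, bb n]], then monotone convergence, for which [G] is taken nonnegative;
    [mp_push_bounded] reaches bounded [G] by adding a constant. *)
Lemma mp_pushforward (G : R -> R) : continuous G -> (forall x, 0 <= G x) ->
 (\int[leb]_x (mp_density d x * G x)%:E = \int[leb]_(t in `[0%R, pi]) (mpk t * G (mpX t))%:E)%E.
move=> cG G0; have pi0 := pi_gt0 R.
have mG : measurable_fun setT (G : R -> R) by exact: continuous_measurable_fun.
pose f (x : R) : R := mp_density d x * G x.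
have mf : measurable_fun setT (f : R -> R) by apply: measurable_funM => //; exact: measurable_mpd.
have f0 x : 0 <= f x by rewrite mulr_ge0 ?mp_density_ge0.
have mk : measurable_fun setT (fun t : R => mpk t * G (mpX t)).
 apply: measurable_funM; last first.
  have cGX : continuous (G \o mpX) by move=> t; apply: continuous_comp; [exact: cX|exact: cG].
  exact: continuous_measurable_fun cGX.
 have -> : mpk = (fun t => 2 / pi * (sin t ^+ 2 * powR (mpX t) (-1))).
  by apply/funext => t; rewrite /mpk powR_inv1 // mpX_ge0.
 apply: measurable_funM; first exact: measurable_cst.
 apply: measurable_funM.
  apply: measurable_funX; exact: continuous_measurable_fun (@continuous_sin R).
 exact: (measurableT_comp (measurable_powR (-1)) (continuous_measurable_fun cX)).
have g0 t : 0 <= mpk t * G (mpX t) by rewrite mulr_ge0 ?mpk_ge0.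
pose A n : set R := `[mpX (bb n), mpX 0]%classic.
pose B n : set R := `[0, bb n]%classic.
have S1 n : (\int[leb]_(x in A n) (f x)%:E = \int[leb]_(t in B n) (mpk t * G (mpX t))%:E)%E.
 have /andP[b0 bp] := bb_itv n.
 have dXE : mpX^`()%classic = (fun t => - (2 * q * sin t)) by apply/funext => t; have D := dX t; rewrite derive1E derive_val.
 have cs : continuous (fun t : R => - (2 * q * sin t)).
  by move=> t; apply: cvgN; apply: cvgM; [exact: cvg_cst|exact: continuous_sin].
 rewrite /A (@integration_by_substitution_decreasing _ mpX f 0 (bb n)) //.
 - apply: eq_integral => t; rewrite inE /= => tb; congr EFin.
  have -> : ((f \o mpX) * - mpX^`()%classic) t = f (mpX t) * - (mpX^`()%classic t) by [].
  by have [c1 c2] := cos_bb tb; rewrite dXE opprK /f mulrAC density_pullback.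
 - exact: ltW.
 - move=> x y; rewrite !in_itv /= => /andP[x0 xb] /andP[y0 yb] xy.
  rewrite /mpX ltrD2l ltr_pM2l ?mulr_gt0 // ltr_cos // in_itv /= ?x0 ?y0 /=.
   exact: le_trans yb (ltW bp).
  exact: le_trans xb (ltW bp).
 - by move=> t _; rewrite dXE; exact: cs.
 - by rewrite dXE; apply: (cvgP (- (2 * q * sin 0))); apply: cvg_at_right_filter; exact: cs.
 - by rewrite dXE; apply: (cvgP (- (2 * q * sin (bb n)))); apply: cvg_at_left_filter; exact: cs.
 - split; first by move=> t _; exact: ex_derive.
  + by apply: cvg_at_right_filter; exact: cX.
  + by apply: cvg_at_left_filter; exact: cX.
 - apply: continuous_in_subspaceT => x; rewrite inE /= in_itv /= => /andP[x1 _].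
  apply: cvgM; last exact: cG.
  apply: mp_density_cont; rewrite gt_eqF //; apply: lt_le_trans x1.
  have bi : bb n \in `[0, bb n] by rewrite in_itv /= lexx ltW.
  by have [c1 c2] := cos_bb bi; exact: mpX_gt0.
have ndA : nondecreasing_seq A.
 move=> n k nk; rewrite subsetEset => x; rewrite /A /= !in_itv /= => /andP[x1 ->]; rewrite andbT.
 apply: le_trans x1; rewrite /mpX lerD2l ler_pM2l ?mulr_gt0 // leNgt ltr_cos.
 - by rewrite -leNgt; exact: bb_nd.
 - by have /andP[? ?] := bb_itv k; rewrite in_itv /= !ltW.
 - by have /andP[? ?] := bb_itv n; rewrite in_itv /= !ltW.
have ndB : nondecreasing_seq B.
 move=> n k nk; rewrite subsetEset => x; rewrite /B /= !in_itv /= => /andP[-> xb] /=.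
 exact: le_trans xb (bb_nd nk).
have cA : (\int[leb]_(x in A n) (f x)%:E @[n --> \oo] --> \int[leb]_(x in \bigcup_n A n) (f x)%:E)%E.
 apply: ge0_nondecreasing_set_cvg_integral => //.
 - by move=> n; exact: mitv.
 - by move=> n; apply: measurable_funTS; apply/measurable_EFinP.
 - by move=> n t _; rewrite lee_fin.
have cB : (\int[leb]_(t in B n) (mpk t * G (mpX t))%:E @[n --> \oo] --> \int[leb]_(t in \bigcup_n B n) (mpk t * G (mpX t))%:E)%E.
 apply: ge0_nondecreasing_set_cvg_integral => //.
 - by move=> n; exact: mitv.
 - by move=> n; apply: measurable_funTS; apply/measurable_EFinP.
 - by move=> n t _; rewrite lee_fin.
have e : (\int[leb]_(x in \bigcup_n A n) (f x)%:E = \int[leb]_(t in \bigcup_n B n) (mpk t * G (mpX t))%:E)%E.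
 rewrite (funext S1) in cA; exact: (cvg_unique _ cA cB).
have UB : \bigcup_n B n = `[0, pi[%classic.
 apply/seteqP; split => t; rewrite /B /=.
  move=> [n _]; rewrite /= !in_itv /= => /andP[-> tb] /=.
  by have /andP[_ bp] := bb_itv n; exact: le_lt_trans tb bp.
 rewrite in_itv /= => /andP[t0 /bb_cvg [n tn]]; exists n => //=.
 by rewrite in_itv /= t0.
have UA x : (\bigcup_n A n) x \/ f x = 0.
 case: (pselect (gam_m d < x < gam_p d)) => H; last by right; rewrite /f mp_density_out // mul0r.
 left; move: H => /andP[x1 x2].
 pose y := (x - 1 - q ^+ 2) / (2 * q).
 have qq : 2 * q * y = x - 1 - q ^+ 2 by rewrite /y mulrC divfK // gt_eqF // mulr_gt0.
 have y1 : -1 < y.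
  rewrite ltr_pdivlMr ?mulr_gt0 //; move: x1; rewrite /gam_m -/q; lra.
 have y2 : y < 1.
  rewrite ltr_pdivrMr ?mulr_gt0 //; move: x2; rewrite /gam_p -/q; lra.
 have yI : -1 <= y <= 1 by rewrite !ltW.
 have [n Hn] : exists n, acos y <= bb n by apply: bb_cvg; apply: acos_ltpi; rewrite y1 ltW.
 exists n => //; rewrite /A /= in_itv /= mpX0 (ltW x2) andbT.
 have -> : x = mpX (acos y) by rewrite /mpX acosK // qq; ring.
 rewrite /mpX lerD2l ler_pM2l ?mulr_gt0 // leNgt ltr_cos -?leNgt //.
  by have /andP[? ?] := bb_itv n; rewrite in_itv /= !ltW.
 by rewrite in_itv /= acos_ge0 // acos_lepi.
transitivity (\int[leb]_(x in \bigcup_n A n) (f x)%:E)%E.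
 rewrite [RHS]integral_mkcond; apply: eq_integral => x _; rewrite patchE.
 by case: ifPn => // /negP H; case: (UA x) => [/mem_set //|]; rewrite /f => ->.
rewrite e UB integral_itv_bndo_bndc //.
by apply: measurable_funTS; apply/measurable_EFinP.
Qed.
Let cont1 : continuous (fun _ : R => 1 : R).
by move=> x; exact: cvg_cst. Qed.
Let norm1_le (x : R) : `|1 : R| <= 1.
by rewrite normr1. Qed.
Lemma measurable_mpk : measurable_fun setT (mpk : R -> R).
have -> : mpk = (fun t => 2 / pi * (sin t ^+ 2 * powR (mpX t) (-1))).
 by apply/funext => t; rewrite /mpk powR_inv1 // mpX_ge0.
apply: measurable_funM; first exact: measurable_cst.
apply: measurable_funM.
 by apply: measurable_funX; exact: continuous_measurable_fun (@continuous_sin R).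
exact: (measurableT_comp (measurable_powR (-1)) (continuous_measurable_fun cX)).
Qed.
Lemma mpk_le t : mpk t <= 2 / pi / q.
have pi0 := pi_gt0 R; rewrite /mpk; apply: ler_wpM2l; first by rewrite divr_ge0 // ltW.
have [X0|] := ltP 0 (mpX t); last first.
 move=> X0; have -> : mpX t = 0 by apply/le_anti; rewrite X0 mpX_ge0.
 by rewrite invr0 mulr0 invr_ge0 ltW.
rewrite ler_pdivrMr // mulrC ler_pdivlMr //.
have e := mpX_sub_m t; rewrite /gam_m -/q in e.
have s2 : sin t ^+ 2 = (1 - cos t) * (1 + cos t) by rewrite sin2cos2; ring.
have c1 := cos_geN1 t; have c2 := cos_le1 t.
have u : sin t ^+ 2 * q <= 2 * q * (1 + cos t).
 rewrite -subr_ge0 (_ : _ - _ = q * (1 + cos t) ^+ 2); last by rewrite s2; ring.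
 by rewrite mulr_ge0 ?sqr_ge0 // ltW.
by apply: (le_trans u); rewrite -e lerBlDr lerDl sqr_ge0.
Qed.
Lemma integrable_mpk : leb.-integrable `[0, pi] (EFin \o mpk).
apply: (@le_integrable _ _ _ leb _ (mitv `[0, pi]) _ (EFin \o (fun=> 2 / pi / q : R))).
- by apply/measurable_EFinP; apply: measurable_funTS; exact: measurable_mpk.
- by move=> t _ /=; rewrite lee_fin !ger0_norm ?mpk_ge0 ?mpk_le ?divr_ge0 ?pi_ge0 // ltW.
- exact: integrable_cst_seg.
Qed.
Lemma integrable_mp_density : leb.-integrable setT (EFin \o (mp_density d : R -> R)).
apply/integrableP; split; first by apply/measurable_EFinP; exact: measurable_mpd.
have e := @mp_pushforward (fun=> 1) cont1 (fun=> ler01).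
under eq_integral do rewrite /= ger0_norm ?mp_density_ge0 // -[mp_density _ _]mulr1.
rewrite e; have /integrableP[_] := integrable_mpk.
under eq_integral do rewrite /= ger0_norm ?mpk_ge0 //.
by under [X in _ -> (X < _)%E]eq_integral do rewrite mulr1.
Qed.
Lemma mp_push_bounded (G : R -> R) (B : R) : continuous G -> (forall x, `|G x| <= B) ->
 leb.-integrable `[0, pi] (EFin \o (fun t => mpk t * G (mpX t))) /\
 Rintegral leb setT (fun x => mp_density d x * G x) = Rintegral leb `[0, pi] (fun t => mpk t * G (mpX t)).
move=> cG GB.
have mG : measurable_fun setT (G : R -> R) by exact: continuous_measurable_fun.
have cGX : continuous (G \o mpX) by move=> t; apply: continuous_comp; [exact: cX|exact: cG].
have B0 : 0 <= B by apply: le_trans (GB 0).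
have i1 : leb.-integrable setT (EFin \o (fun x => mp_density d x * G x)).
 apply: (@le_integrable _ _ _ leb _ measurableT _ (EFin \o (fun x => B * mp_density d x))).
 - by apply/measurable_EFinP; apply: measurable_funM => //; exact: measurable_mpd.
 - move=> x _ /=; rewrite lee_fin !normrM mulrC (ger0_norm B0); apply: ler_wpM2r => //.
 - exact: (integrableZl measurableT B integrable_mp_density).
have i2 : leb.-integrable `[0, pi] (EFin \o (fun t => mpk t * G (mpX t))).
 apply: (@le_integrable _ _ _ leb _ (mitv `[0, pi]) _ (EFin \o (fun t => B * mpk t))).
 - apply/measurable_EFinP; apply: measurable_funTS; apply: measurable_funM; first exact: measurable_mpk.
  exact: continuous_measurable_fun cGX.
 - move=> x _ /=; rewrite lee_fin !normrM mulrC (ger0_norm B0); apply: ler_wpM2r => //.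
 - exact: (integrableZl (mitv `[0, pi]) B integrable_mpk).
split => //.
have e1 := @mp_pushforward (fun=> 1) cont1 (fun=> ler01).
have cGB : continuous (fun x => G x + B) by move=> x; apply: cvgD; [exact: cG|exact: cvg_cst].
have GB0 x : 0 <= G x + B by have := GB x; rewrite ler_norml => /andP[+ _]; lra.
have e2 := mp_pushforward cGB GB0.
have [_ E1] := integrable_lin2 1 B measurableT i1 integrable_mp_density.
have [_ E2] := integrable_lin2 1 B (mitv `[0, pi]) i2 integrable_mpk.
have E3 : Rintegral leb setT (mp_density d) = Rintegral leb `[0, pi] mpk.
 have E x : mp_density d x * 1 = mp_density d x by rewrite mulr1.
 have E' t : mpk t * 1 = mpk t by rewrite mulr1.
 by rewrite /Rintegral; congr fine; rewrite (funext (fun x => congr1 EFin (E x))) (funext (fun x => congr1 EFin (E' x))) in e1.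
have E4 : Rintegral leb setT (fun x => 1 * (mp_density d x * G x) + B * mp_density d x) =
  Rintegral leb `[0, pi] (fun t => 1 * (mpk t * G (mpX t)) + B * mpk t).
 have F1 x : mp_density d x * (G x + B) = 1 * (mp_density d x * G x) + B * mp_density d x by ring.
 have F2 t : mpk t * (G (mpX t) + B) = 1 * (mpk t * G (mpX t)) + B * mpk t by ring.
 rewrite (funext (fun x => congr1 EFin (F1 x))) (funext (fun x => congr1 EFin (F2 x))) in e2.
 by rewrite /Rintegral e2.
by move: E4; rewrite E1 E2 !mul1r E3 => /addIr.
Qed.
(** [mpX t] is a multiple of [Jden w t] with [w = - q] if [q < 1] and [w = - 1 / q] if [q > 1], so
    [cI_J] gives the mass [1] or [1 / d]. At [q = 1] this [w] would have modulus one; there [mpk]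
    reduces to [(1 - cos t) / pi]. *)
Lemma mp_mass_total : Rintegral leb setT (mp_density d) + mp_atom d = 1.
have pi0 := pi_gt0 R; have pn : pi != 0 :> R by rewrite gt_eqF.
have [_ e1] := @mp_push_bounded (fun=> 1) 1 cont1 norm1_le.
have E x : mp_density d x * 1 = mp_density d x by rewrite mulr1.
have E' t : mpk t * 1 = mpk t by rewrite mulr1.
rewrite (funext E) (funext E') in e1; rewrite e1.
have J (w c : R) : `|w| < 1 -> c != 0 -> (forall t, mpX t = c * (1 - 2 * w * cos t + w ^+ 2)) ->
  Rintegral leb `[0, pi] mpk = c^-1.
 move=> w1 c0 XE; have w1' : cabs (w%:C) < 1 by rewrite cabs_real.
 have D0 t : 1 - 2 * w * cos t + w ^+ 2 != 0.
  have := Jden_neq0 t w1'; apply: contra => /eqP e; apply/eqP.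
  by rewrite -(rmorph0 (real_complex R)) -e /Jden !(rmorphD, rmorphN, rmorphM, rmorph1, rmorphXn).
 have j := cI_J w1'.
 have ii : leb.-integrable `[0, pi] (EFin \o (fun t : R => sin t ^+ 2 / (1 - 2 * w * cos t + w ^+ 2))).
  have iJ : cintegrable leb `[0, pi] (fun t : R => (sin t ^+ 2)%:C / Jden w%:C t).
   apply: ccont_integrable; apply: ccontM.
    by apply: ccont_real => t; apply: cvgM; exact: continuous_sin.
   by apply: ccontV; [exact: ccont_Jden|move=> t; exact: Jden_neq0].
  case: iJ => + _; apply: eq_integrable_R; first exact: mitv.
  move=> t _; rewrite -[RHS](cRe_real); congr Re.
  by rewrite fmorph_div /=; congr (_ / _); rewrite /Jden !(rmorphD, rmorphN, rmorphM, rmorph1, rmorphXn).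
 have E1 : Rintegral leb `[0, pi] (fun t : R => sin t ^+ 2 / (1 - 2 * w * cos t + w ^+ 2)) = pi / 2.
  have [_ e3] := cintegrable_real ii (mitv `[0, pi]).
  apply: complexI; rewrite -e3 -j; apply: eq_cI => t _.
  by rewrite fmorph_div; congr (_ / _); rewrite /Jden !(rmorphD, rmorphN, rmorphM, rmorph1, rmorphXn).
 have -> : Rintegral leb `[0, pi] mpk = Rintegral leb `[0, pi] (fun t : R => (2 / pi / c) * (sin t ^+ 2 / (1 - 2 * w * cos t + w ^+ 2))).
  apply: eq_Rintegral => t _; rewrite /mpk XE; have := D0 t; move: (1 - _ + _) => D Dn.
  by rewrite invfM; ring.
 rewrite RintegralZl // E1; move: pn c0; move: (@pi R) => p pn c0.
 by field; rewrite ?pn ?c0.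
have sq1 : (q ^+ 2 < 1) = (q < 1) by rewrite expr_lt1 // ltW.
rewrite /mp_atom -q2; have [ql|qg|qe] := ltgtP q 1.
- rewrite (J (- q) 1) ?oner_eq0 ?normrN ?gtr0_norm ?invr1 //; last by move=> t; rewrite /mpX; ring.
 rewrite max_l ?addr0 // subr_le0 -[X in X <= _]invr1 lef_pV2 ?posrE ?exprn_gt0 //.
 by rewrite ltW // sq1.
- have qn : q != 0 by rewrite gt_eqF.
 rewrite (J (- q^-1) (q ^+ 2)).
 + rewrite max_r; first by ring.
  rewrite subr_ge0 -[X in _ <= X]invr1 lef_pV2 ?posrE ?exprn_gt0 //.
  by rewrite leNgt sq1 -leNgt ltW.
 + by rewrite normrN normfV gtr0_norm // invf_lt1.
 + by rewrite expf_eq0.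
 + by move=> t; rewrite /mpX; field.
- rewrite qe expr1n invr1 subrr max_l // addr0.
 have mm : measurable_fun `[0%R, pi[ (EFin \o mpk).
  by apply/measurable_EFinP; apply: measurable_funTS; exact: measurable_mpk.
 have ic : leb.-integrable `[0, pi] (EFin \o (cos : R -> R)).
  by apply: continuous_compact_integrable; [exact: segment_compact|apply: continuous_subspaceT; exact: continuous_cos].
 have i1 : leb.-integrable `[0, pi] (EFin \o (fun=> 1 : R)).
  exact: integrable_cst_seg.
 have [il El] := integrable_lin2 pi^-1 (- pi^-1) (mitv `[0, pi]) i1 ic.
 have -> : Rintegral leb `[0, pi] mpk = Rintegral leb `[0, pi] (fun t => pi^-1 * 1 + - pi^-1 * cos t).
  rewrite /Rintegral -!integral_itv_bndo_bndc //; last first.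
   by apply: measurable_funS (measurable_int leb il); [exact: mitv|exact: subset_itv_co_cc].
  congr fine; apply: eq_integral => t; rewrite inE /= in_itv /= => /andP[t0 tp]; congr EFin.
  have c1 : -1 < cos t by rewrite -cospi ltr_cos // in_itv /= ?t0 ?lexx ?pi_ge0 ?(ltW tp).
  have n1 : 1 + cos t != 0 by rewrite gt_eqF //; lra.
  rewrite /mpk /mpX qe sin2cos2 expr1n mulr1.
  have -> : 1 + 1 + 2 * 1 * cos t = 2 * (1 + cos t) by ring.
  by move: pn n1; move: (@pi R) (cos t) => p c pn n1; field; rewrite ?pn ?n1.
 rewrite El Rint_cst_itv ?pi_ge0 //.
 have Ec : Rintegral leb `[0, pi] (cos : R -> R) = 0.
  by rewrite -[RHS](Rint_cos R 0); apply: eq_Rintegral => t _; congr cos; rewrite mul1r.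
 by rewrite Ec mulr0 addr0 mul1r subr0 mulVf.
Qed.
(** The candidates for [w] are the two roots of a quadratic with product 1; if both had modulus one,
    [w + 1 / w] and hence [z] would be real. *)
Lemma joukowski (z : C) : Im z != 0 ->
 exists w : C, [/\ w != 0, cabs w < 1 & z = 1 + (q ^+ 2)%:C + q%:C * (w + w^-1)].
move=> z0; have qc : q%:C != 0 :> C by rewrite -cabs_eq0 cabs_real normr_eq0 gt_eqF.
pose u := (z - 1 - (q ^+ 2)%:C) / q%:C; pose r := sqrtc (u ^+ 2 - 4).
have zu : z = 1 + (q ^+ 2)%:C + q%:C * u by rewrite /u mulrC divfK //; ring.
have r2 : r ^+ 2 = u ^+ 2 - 4 by exact: sqr_sqrtc.
pose w1 := (u + r) / 2; pose w2 := (u - r) / 2.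
have w12 : w1 * w2 = 1.
 have -> : w1 * w2 = (u ^+ 2 - r ^+ 2) / 4 by rewrite /w1 /w2; field.
 by rewrite r2; field.
have ws : w1 + w2 = u by rewrite /w1 /w2; field.
have n12 : w1 != 0 /\ w2 != 0 by apply/andP; rewrite -negb_or -mulf_eq0 w12 oner_eq0.
case: n12 => n1 n2; have v1 : w2 = w1^-1 by rewrite -[RHS]mulr1 -w12 mulKf.
have v2 : w1 = w2^-1 by rewrite v1 invrK.
have [l1|g1|e1] := ltgtP (cabs w1) 1.
- by exists w1; split => //; rewrite zu -ws -v1.
- exists w2; split => //; first by rewrite v1 cabsV invf_lt1 // (lt_trans ltr01).
 by rewrite zu -ws -v2 [w2 + _]addrC.
- exfalso; move/eqP: z0; apply; rewrite zu -ws.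
 have -> : w2 = (w1^*)%C by apply: (mulfI n1); rewrite w12 conj_mul e1 expr1n.
 by rewrite cImD cImM (cImD w1) cIm_conj subrr mulr0 cIm_real mul0r !addr0 cImD cIm_real addr0.
Qed.
(** In terms of [w], the difference [mpX t - z] is a multiple of [Jden w t]. Partial fractions in
    [mpX t] leave the integral of [cI_J] and the mass of the density, which the atom completes to
    1. *)
Lemma mp_stieltjes_joukowski (z w : C) : Im z != 0 -> w != 0 -> cabs w < 1 ->
 z = 1 + (q ^+ 2)%:C + q%:C * (w + w^-1) -> mp_stieltjes d z = - (1 + w / q%:C) / z.
move=> z0 w0 w1 zE; have pi0 := pi_gt0 R.
have qc : q%:C != 0 :> C by rewrite -cabs_eq0 cabs_real normr_eq0 gt_eqF.
have zn : z != 0 by apply: contraNneq z0 => ->.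
have xz (x : R) : x%:C - z != 0.
 by apply: contraNneq z0 => /(congr1 Im) /=; rewrite cImD cImN /= add0r => /eqP; rewrite oppr_eq0.
have cg : ccont (fun x : R => (x%:C - z)^-1).
 apply: ccontV => //; apply: ccontB; [apply: ccont_real => x; exact: cvg_id|exact: ccont_cst].
have gB x : cabs (x%:C - z)^-1 <= `|Im z|^-1.
 rewrite cabsV lef_pV2 ?posrE ?cabs_gt0 ?normr_gt0 //.
 by have := le_Im_cabs (x%:C - z); rewrite cImD cImN /= add0r normrN.
have [iR eR] := @mp_push_bounded (fun x => Re (x%:C - z)^-1) `|Im z|^-1 cg.1 (fun x => le_trans (le_Re_cabs _) (gB x)).
have [iI eI] := @mp_push_bounded (fun x => Im (x%:C - z)^-1) `|Im z|^-1 cg.2 (fun x => le_trans (le_Im_cabs _) (gB x)).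
have Rr (r : R) (v : C) : Re (r%:C * v) = r * Re v by rewrite cReM mul0r subr0.
have Ir (r : R) (v : C) : Im (r%:C * v) = r * Im v by rewrite cImM mul0r addr0.
have i1 : cintegrable leb `[0, pi] (fun t => (mpk t)%:C * ((mpX t)%:C - z)^-1).
 by split; [apply: eq_integrable_R iR => [|t _]; [exact: mitv|rewrite Rr]
      |apply: eq_integrable_R iI => [|t _]; [exact: mitv|rewrite Ir]].
have [i2 e2] := cintegrable_real integrable_mpk (mitv `[0, pi]).
have iJ : cintegrable leb `[0, pi] (fun t : R => (sin t ^+ 2)%:C / Jden w t).
 apply: ccont_integrable; apply: ccontM.
  by apply: ccont_real => t; apply: cvgM; exact: continuous_sin.
 by apply: ccontV; [exact: ccont_Jden|move=> t; exact: Jden_neq0].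
have [i3 e3] := cIZ (- ((2 / pi)%:C * w / q%:C) / z) (mitv `[0, pi]) iJ.
have [i4 e4] := cIZ (- z^-1) (mitv `[0, pi]) i2.
have [i5 e5] := cID (mitv `[0, pi]) i3 i4.
rewrite /mp_stieltjes.
have -> : Rintegral leb setT (fun x => Re ((mp_density d x)%:C / (x%:C - z))) +i*
  Rintegral leb setT (fun x => Im ((mp_density d x)%:C / (x%:C - z))) =
  cI leb `[0, pi] (fun t => (mpk t)%:C * ((mpX t)%:C - z)^-1).
 by rewrite /cI; congr (_ +i* _); [under eq_Rintegral do rewrite Rr|under eq_Rintegral do rewrite Ir];
  rewrite ?eR ?eI; apply: eq_Rintegral => t _; rewrite ?Rr ?Ir.
have E t : (mpk t)%:C * ((mpX t)%:C - z)^-1 =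
  - ((2 / pi)%:C * w / q%:C) / z * ((sin t ^+ 2)%:C / Jden w t) + - z^-1 * (mpk t)%:C.
 have J0 := Jden_neq0 t w1; have xt := xz (mpX t).
 have XJ : w * ((mpX t)%:C - z) = - q%:C * Jden w t.
  by rewrite zE /mpX /Jden; field; rewrite w0.
 have XJ' : Jden w t = - (w / q%:C) * ((mpX t)%:C - z).
  apply: (mulfI qc); have -> : q%:C * (- (w / q%:C) * ((mpX t)%:C - z)) = - (w * ((mpX t)%:C - z)).
   by move: (_ - z) => D; field.
  by rewrite XJ; ring.
 (* If [mpX t = 0] the division in [mpk] is by zero; then [cos t = -1], so [sin t = 0] and both
    sides vanish. *)
 have [X0|Xn] := eqVneq (mpX t) 0.
  have s0 : sin t ^+ 2 = 0.
   have := mpX_sub_m t; have := mpX_sub_p t; rewrite X0 /gam_m /gam_p -/q => h1 h2.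
   have : (1 + cos t) = 0.
    have : 2 * q * (1 + cos t) + (1 - q) ^+ 2 = 0 by rewrite -h2; ring.
    have c1 := cos_geN1 t; have s1 : 0 <= 2 * q * (1 + cos t) by rewrite !mulr_ge0 ?(ltW q0) //; lra.
    have s2 := sqr_ge0 (1 - q) => h3.
    have : 2 * q * (1 + cos t) = 0 by lra.
    by move/eqP; rewrite mulf_eq0 gt_eqF ?mulr_gt0 //= => /eqP.
   move=> h3; rewrite sin2cos2; have -> : 1 - cos t ^+ 2 = (1 - cos t) * (1 + cos t) by ring.
   by rewrite h3 mulr0.
  by rewrite /mpk s0 !mul0r !mulr0 mul0r add0r.
 have Xc : (mpX t)%:C != 0 :> C by rewrite -cabs_eq0 cabs_real normr_eq0.
 have -> : (mpk t)%:C = (2 / pi)%:C * (sin t ^+ 2)%:C / (mpX t)%:C by rewrite /mpk; move: (2 / pi) => p; rewrite rmorphM fmorph_div mulrA.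
 rewrite XJ'; move: xt Xc; move: ((mpX t)%:C) ((sin t ^+ 2)%:C) ((2 / pi)%:C) => X S P xt Xc.
 field; by rewrite Xc xt qc w0 zn.
rewrite (@eq_cI _ _ _ leb `[0, pi]%classic _ _ (fun t _ => E t)) e5 e3 e4 e2 (cI_J w1).
have am : mp_atom d = 1 - Rintegral leb `[0, pi] mpk.
 rewrite -mp_mass_total addrAC; have [_ e1] := @mp_push_bounded (fun=> 1) 1 cont1 norm1_le.
 have E1 x : mp_density d x * 1 = mp_density d x by rewrite mulr1.
 have E1' t : mpk t * 1 = mpk t by rewrite mulr1.
 by rewrite (funext E1) (funext E1') in e1; rewrite e1 subrr add0r.
have -> : (2 / pi)%:C * w / q%:C = (2 / pi)%:C * (w / q%:C) by rewrite mulrA.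
have pp : (2 / pi)%:C * (pi / 2)%:C = 1 :> C.
 have pr : 2 / pi * (pi / 2) = 1 :> R.
  have pn : pi != 0 :> R by rewrite gt_eqF.
  by move: pn; move: (@pi R) => p pn; field.
 by rewrite -rmorphM pr rmorph1.
have amC : (mp_atom d)%:C = 1 - (Rintegral leb `[0, pi] mpk)%:C :> C by rewrite am rmorphB rmorph1.
rewrite amC sub0r.
have -> : - ((2 / pi)%:C * (w / q%:C)) / z * (pi / 2)%:C = - (w / q%:C) / z * ((2 / pi)%:C * (pi / 2)%:C) by ring.
rewrite pp mulr1 invrN; move: (Rintegral _ _ _) => m1; move: (m1%:C) (w / q%:C) => mm v.
field; exact: zn.
Qed.
Lemma mpsol_mp_stieltjes (z : C) : Im z != 0 -> mpsol d z (mp_stieltjes d z).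
move=> z0; have [w [w0 w1 zE]] := joukowski z0.
have qc : q%:C != 0 :> C by rewrite -cabs_eq0 cabs_real normr_eq0 gt_eqF.
have zn : z != 0 by apply: contraNneq z0 => ->.
have sE := mp_stieltjes_joukowski z0 w0 w1 zE.
have dq : d%:C = q%:C ^+ 2 :> C by rewrite -rmorphXn /= q2.
have e1 : z * mp_stieltjes d z = - (1 + w / q%:C) by rewrite sE mulrC divfK.
split.
 have -> : z * mp_stieltjes d z + 1 = - (w / q%:C) by rewrite e1; ring.
 have e2 : z = 1 + q%:C ^+ 2 + q%:C * (w + w^-1) by rewrite zE rmorphXn.
 have e3 : 1 + d%:C * mp_stieltjes d z = (1 + q%:C / w) / z.
  have e4 : z - q%:C ^+ 2 * (1 + w / q%:C) = 1 + q%:C / w by rewrite e2; field; rewrite ?w0 ?qc.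
  by rewrite sE dq -e4; field; rewrite zn.
 by rewrite e3 sE; field; rewrite qc w0 zn.
have -> : z * (d%:C * mp_stieltjes d z) = - d%:C - q%:C * w.
 by rewrite mulrCA e1 dq; field.
have -> : Im (- d%:C - q%:C * w) = - (q * Im w) by rewrite cImD !cImN cImM /=; ring.
have -> : Im z = q * (Im w * (1 - (cabs w ^+ 2)^-1)).
 have c0 : cabs w ^+ 2 != 0 by rewrite expf_eq0 cabs_eq0.
 rewrite zE cImD cImM (cImD w) cImV cIm_real cRe_real mul0r addr0 cImD cIm_real addr0.
 by rewrite add0r mulNr; ring.
have -> : q * (Im w * (1 - (cabs w ^+ 2)^-1)) * - (q * Im w) = (q * Im w) ^+ 2 * ((cabs w ^+ 2)^-1 - 1) by ring.
rewrite mulr_ge0 ?sqr_ge0 // subr_ge0 -[X in X <= _]invr1 lef_pV2 ?posrE ?ltr01 //.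
 by rewrite exprn_ile1 ?cabs_ge0 // ltW.
by rewrite exprn_gt0 // cabs_gt0.
Qed.

End MarchenkoPasturDensity.

Lemma leb_oo (R : realType) (u v : R) : u < v -> @lebesgue_measure R `]u, v[%classic = (v - u)%:E.
move=> uv; have e := lebesgue_measure_itv `]u, v[; apply: etrans; first exact: e.
by rewrite /= lte_fin uv.
Qed.
Lemma lam_arith (R : realType) (u v w B : R) :
 u <= 2 * (B * (1 - w)) -> v <= w * B -> 0 <= w * B -> u + v <= 2 * B.
by lra. Qed.
Lemma lam_arith' (R : realType) (u v w B : R) : u <= B * (1 - w) -> v <= w * B -> u + v <= B.
by lra. Qed.

(** * The Marchenko-Pastur law as a functional; bounds off the support *)

Section MarchenkoPasturFunctional.
Variable R : realType.
Local Notation C := R[i].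
Local Notation leb := (@lebesgue_measure R).
Variable d : R.
Hypothesis d0 : 0 < d.

(** The support in explicit form; [mp_support_inS] links it to the definition through masses of
    balls. *)
Definition inS (x : R) := gam_m d <= x <= gam_p d \/ x = 0 /\ 1 < d.

Definition lamok (g : R -> C) := mfc g /\ exists B, forall x, inS x -> cabs (g x) <= B.

(** Integration against the full law, atom included. Bounds on the Stieltjes transform and its
    difference quotients are read off from bounds on the kernel over the support. *)
Definition Lam (g : R -> C) : C := cI leb setT (fun x => (mp_density d x)%:C * g x) + (mp_atom d)%:C * g 0.

Lemma atom_ge0 : 0 <= mp_atom d.
by rewrite /mp_atom le_max lexx. Qed.
Lemma atom_out (x : R) : ~ inS 0 -> mp_atom d = 0.
move=> H; rewrite /mp_atom max_l // subr_le0 -[X in X <= _]invr1 lef_pV2 ?posrE //.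
by rewrite leNgt; apply/negP => d1; apply: H; right.
Qed.
Lemma density_out x : ~ inS x -> mp_density d x = 0.
by move=> H; apply: mp_density_out => /andP[h1 h2]; apply: H; left; rewrite !ltW. Qed.
Let imp := integrable_mp_density d0.
Let m0 x : 0 <= mp_density d x. Proof. exact: mp_density_ge0. Qed.
Lemma cabs_density g B x : 0 <= B -> (forall x, inS x -> cabs (g x) <= B) ->
 cabs ((mp_density d x)%:C * g x) <= B * mp_density d x.
move=> B0 H; rewrite cabsM (cabs_ge0r (m0 x)) mulrC.
have [/H h|/density_out ->] := pselect (inS x); first exact: ler_wpM2r.
by rewrite !mulr0.
Qed.
Lemma lam_int g : lamok g -> cintegrable leb setT (fun x => (mp_density d x)%:C * g x).
move=> [[m1 m2] [B H]]; pose B' := `|B|.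
have H' x : inS x -> cabs (g x) <= B' by move=> /H /le_trans; apply; exact: ler_norm.
have mm := measurable_mpd d.
apply: (@cintegrable_le _ _ _ leb setT _ (fun x => B' * mp_density d x)) => //.
- have -> : (fun x => Re ((mp_density d x)%:C * g x)) = (fun x => mp_density d x * Re (g x)).
  by apply/funext => x; rewrite cReM cIm_real mul0r subr0.
 exact: measurable_funM.
- have -> : (fun x => Im ((mp_density d x)%:C * g x)) = (fun x => mp_density d x * Im (g x)).
  by apply/funext => x; rewrite cImM cIm_real mul0r addr0.
 exact: measurable_funM.
- exact: (integrableZl measurableT B' imp).
- by move=> x _; apply: cabs_density => //; exact: normr_ge0.
Qed.
Lemma LamD f g : lamok f -> lamok g -> lamok (fun x => f x + g x) /\ Lam (fun x => f x + g x) = Lam f + Lam g.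
move=> of_ og; split.
 case: of_ og => mf [B H] [mg [B' H']]; split; first exact: mfcD.
 by exists (B + B') => x Sx; apply: (le_trans (cabsD _ _)); apply: lerD; [exact: H|exact: H'].
have [_ e] := cID measurableT (lam_int of_) (lam_int og).
rewrite /Lam mulrDr addrACA -e; congr (_ + _); apply: eq_cI => x _; exact: mulrDr.
Qed.
Lemma LamZ c g : lamok g -> lamok (fun x => c * g x) /\ Lam (fun x => c * g x) = c * Lam g.
move=> og; split.
 case: og => mg [B H]; split; first by apply: mfcM => //; exact: mfcC.
 by exists (cabs c * B) => x Sx; rewrite cabsM ler_wpM2l ?cabs_ge0 ?H.
have [_ e] := cIZ c measurableT (lam_int og).
rewrite /Lam mulrDr -e mulrCA; congr (_ + _); apply: eq_cI => x _; exact: mulrCA.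
Qed.
Lemma Lam_sum (I : Type) (r : seq I) (F : I -> R -> C) : (forall i, lamok (F i)) ->
 lamok (fun x => \sum_(i <- r) F i x) /\ Lam (fun x => \sum_(i <- r) F i x) = \sum_(i <- r) Lam (F i).
move=> H; elim: r => [|i r [IH1 IH2]].
 have -> : (fun x => \sum_(i <- [::]) F i x) = (fun=> 0 : C) by apply/funext => x; rewrite big_nil.
 have o1 : lamok (fun=> 1 : C) by split; [exact: mfcC|exists 1 => x _; rewrite cabs1].
 have [ok2 e2] := LamZ 0 o1.
 rewrite big_nil.
 have E : (fun x : R => 0 * 1 : C) = (fun=> 0) by apply/funext => x; rewrite mul0r.
 by rewrite E mul0r in ok2 e2.
have -> : (fun x => \sum_(k <- i :: r) F k x) = (fun x => F i x + \sum_(k <- r) F k x).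
 by apply/funext => x; rewrite big_cons.
by rewrite big_cons -IH2; exact: LamD.
Qed.
Lemma Rint_density B : Rintegral leb setT (fun x => B * mp_density d x) = B * (1 - mp_atom d).
by rewrite RintegralZl // -(mp_mass_total d0) addrK. Qed.
Lemma Lam_le g B : lamok g -> 0 <= B -> (forall x, inS x -> cabs (g x) <= B) -> cabs (Lam g) <= 2 * B.
move=> og B0 H; apply: (le_trans (cabsD _ _)).
have iB : leb.-integrable setT (EFin \o (fun x => B * mp_density d x)) by exact: (integrableZl measurableT B imp).
have := cI_le measurableT (lam_int og) iB (fun x _ => cabs_density x B0 H).
rewrite Rint_density => h1.
have h2 : cabs ((mp_atom d)%:C * g 0) <= mp_atom d * B.
 rewrite cabsM (cabs_ge0r atom_ge0).
 have [/H h|/(atom_out 0) ->] := pselect (inS 0); last by rewrite !mul0r.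
 by apply: ler_wpM2l => //; exact: atom_ge0.
exact: lam_arith h1 h2 (mulr_ge0 atom_ge0 B0).
Qed.
Lemma Lam_Im_le g B : lamok g -> 0 <= B -> (forall x, inS x -> `|Im (g x)| <= B) -> `|Im (Lam g)| <= B.
move=> og B0 H.
have iB : leb.-integrable setT (EFin \o (fun x => B * mp_density d x)) by exact: (integrableZl measurableT B imp).
have Hd x : setT x -> `|Im ((mp_density d x)%:C * g x)| <= B * mp_density d x.
 move=> _; rewrite cImM cIm_real mul0r addr0 normrM (ger0_norm (m0 x)) mulrC.
 have [/H h|/density_out ->] := pselect (inS x); first exact: ler_wpM2r.
 by rewrite !mulr0.
have := cI_Im_le measurableT (lam_int og) iB Hd.
rewrite Rint_density => h1.
have h2 : `|Im ((mp_atom d)%:C * g 0)| <= mp_atom d * B.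
 rewrite cImM cIm_real mul0r addr0 normrM (ger0_norm atom_ge0).
 have [/H h|/(atom_out 0) ->] := pselect (inS 0); last by rewrite !mul0r.
 by apply: ler_wpM2l => //; exact: atom_ge0.
rewrite /Lam cImD; apply: (le_trans (ler_normD _ _)); exact: lam_arith' h1 h2.
Qed.
Lemma mfc_cauchy z : mfc (fun x : R => (x%:C - z)^-1).
by apply: mfcV; apply: mfcB; [apply: mfc_real; exact: measurable_id|exact: mfcC]. Qed.
Lemma Lam_cauchy z : Lam (fun x => (x%:C - z)^-1) = mp_stieltjes d z.
by rewrite /Lam /mp_stieltjes /cI. Qed.
Lemma lamok_cauchy z del : 0 < del -> (forall x, inS x -> del <= cabs (x%:C - z)) ->
 lamok (fun x => (x%:C - z)^-1) /\ (forall x, inS x -> cabs (x%:C - z)^-1 <= del^-1).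
move=> dp H; have H' x : inS x -> cabs (x%:C - z)^-1 <= del^-1.
 by move=> /H h; rewrite cabsV lef_pV2 // posrE // (lt_le_trans dp).
by split => //; split; [exact: mfc_cauchy|exists del^-1].
Qed.
Lemma stieltjes_le z del : 0 < del -> (forall x, inS x -> del <= cabs (x%:C - z)) ->
 cabs (mp_stieltjes d z) <= 2 / del.
move=> dp H; have [ok h] := lamok_cauchy dp H.
by rewrite -Lam_cauchy; apply: Lam_le => //; rewrite invr_ge0 ltW.
Qed.
Lemma Im_cauchy (x : R) (z : C) : Im (x%:C - z)^-1 = Im z * cabs (x%:C - z)^-1 ^+ 2.
by rewrite cImV cImD cIm_real cImN add0r opprK cabsV exprVn. Qed.
Lemma stieltjes_Im_le z del : 0 < del -> (forall x, inS x -> del <= cabs (x%:C - z)) ->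
 `|Im (mp_stieltjes d z)| <= `|Im z| / del ^+ 2.
move=> dp H; have [ok h] := lamok_cauchy dp H.
rewrite -Lam_cauchy; apply: Lam_Im_le => //; first by rewrite divr_ge0 ?sqr_ge0.
move=> x Sx; rewrite Im_cauchy normrM ler_wpM2l // -exprVn ger0_norm ?sqr_ge0 //.
by rewrite lerXn2r ?nnegrE ?cabs_ge0 ?invr_ge0 ?(ltW dp) ?h.
Qed.
Lemma stieltjes_lip z z' del : 0 < del -> (forall x, inS x -> del <= cabs (x%:C - z)) ->
 (forall x, inS x -> del <= cabs (x%:C - z')) ->
 cabs (mp_stieltjes d z - mp_stieltjes d z') <= 2 * (cabs (z - z') / del ^+ 2).
move=> dp H H'; have [ok h] := lamok_cauchy dp H; have [ok' h'] := lamok_cauchy dp H'.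
have [okN eN] := LamZ (-1) ok'; have [okD eD] := LamD ok okN.
rewrite -!Lam_cauchy -[- Lam _]mulN1r -eN -eD; apply: Lam_le => //.
 by rewrite divr_ge0 ?cabs_ge0 ?sqr_ge0.
move=> x Sx; have n0 : x%:C - z != 0 by rewrite -cabs_gt0 (lt_le_trans dp) ?H.
have n0' : x%:C - z' != 0 by rewrite -cabs_gt0 (lt_le_trans dp) ?H'.
have -> : (x%:C - z)^-1 + -1 * (x%:C - z')^-1 = (z - z') * ((x%:C - z)^-1 * (x%:C - z')^-1).
 by move: n0 n0'; move: (x%:C) => X n0 n0'; field; rewrite ?n0 ?n0'.
rewrite cabsM ler_wpM2l ?cabs_ge0 // cabsM -exprVn expr2.
by apply: ler_pM; rewrite ?cabs_ge0 ?h ?h'.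
Qed.
(** The difference quotient integrates a product of two Cauchy kernels whose imaginary parts are
    proportional to [Im z]. It serves to show that [T2f] is almost real. *)
Lemma stieltjes_slope_Im z t del : 0 < del -> 0 < t -> (forall x, inS x -> del <= cabs (x%:C - z)) ->
 (forall x, inS x -> del <= cabs (x%:C - (z + t%:C))) ->
 `|Im ((mp_stieltjes d (z + t%:C) - mp_stieltjes d z) / t%:C)| <= `|Im z| * (2 / del ^+ 3).
move=> dp tp H H'; have [ok h] := lamok_cauchy dp H; have [ok' h'] := lamok_cauchy dp H'.
have tn : t%:C != 0 :> C by rewrite -cabs_eq0 cabs_real normr_eq0 gt_eqF.
have [okN eN] := LamZ (- (t%:C)^-1) ok; have [okZ eZ] := LamZ (t%:C)^-1 ok'; have [okD eD] := LamD okZ okN.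
rewrite -!Lam_cauchy mulrBl [_ / t%:C]mulrC [Lam _ / t%:C]mulrC -eZ -mulNr -eN -eD.
apply: Lam_Im_le => //; first by rewrite mulr_ge0 // divr_ge0 // exprn_ge0 // ltW.
move=> x Sx; have n0 : x%:C - z != 0 by rewrite -cabs_gt0 (lt_le_trans dp) ?H.
have n0' : x%:C - (z + t%:C) != 0 by rewrite -cabs_gt0 (lt_le_trans dp) ?H'.
have -> : (t%:C)^-1 * (x%:C - (z + t%:C))^-1 + - (t%:C)^-1 * (x%:C - z)^-1 = (x%:C - (z + t%:C))^-1 * (x%:C - z)^-1.
 by move: n0 n0' tn; move: (x%:C) (t%:C) => X T n0 n0' tn; field; rewrite ?n0 ?n0' ?tn.
have b1 : cabs (x%:C - z)^-1 <= del^-1 by exact: h.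
have b2 : cabs (x%:C - (z + t%:C))^-1 <= del^-1 by exact: h'.
rewrite cImM !Im_cauchy cImD cIm_real addr0.
move: b1 b2; set u := (x%:C - z)^-1; set v := (x%:C - (z + t%:C))^-1 => b1 b2.
have -> : Re v * (Im z * cabs u ^+ 2) + Im z * cabs v ^+ 2 * Re u = Im z * (Re v * cabs u ^+ 2 + cabs v ^+ 2 * Re u) by ring.
rewrite normrM; apply: ler_wpM2l => //; apply: (le_trans (ler_normD _ _)).
have i0 : 0 <= del^-1 by rewrite invr_ge0 ltW.
have sq (a : C) : cabs a <= del^-1 -> cabs a ^+ 2 <= del^-1 ^+ 2 by move=> aa; rewrite lerXn2r ?nnegrE ?cabs_ge0.
have re (a : C) : cabs a <= del^-1 -> `|Re a| <= del^-1 by move=> aa; exact: le_trans (le_Re_cabs _) aa.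
rewrite (normrM (Re v)) (normrM (cabs v ^+ 2)) !(ger0_norm (sqr_ge0 _)) mulr_natl mulr2n -exprVn exprS.
apply: lerD; first by apply: ler_pM; rewrite ?sqr_ge0 ?re ?sq.
by rewrite mulrC; apply: ler_pM; rewrite ?sqr_ge0 ?re ?sq.
Qed.
Lemma mp_support_inS x : inS x -> mp_support d x.
have pi0 := pi_gt0 R.
have pos (u v : R) : gam_m d < u -> v < gam_p d -> u < v -> (0 < \int[leb]_(y in `]u, v[) (mp_density d y)%:E)%E.
 move=> gu vg uv.
 have dp y : y \in `]u, v[ -> 0 < mp_density d y.
  rewrite in_itv /= => /andP[uy yv]; rewrite /mp_density mulr_gt0 ?invr_gt0 ?mulr_gt0 // sqrtr_gt0.
  have y0 : 0 < y by apply: le_lt_trans uy; apply: le_trans (ltW gu); rewrite sqr_ge0.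
  rewrite divr_gt0 ?exprn_gt0 // lt_max mulr_gt0 ?orbT // subr_gt0; first exact: lt_trans uy.
  exact: lt_trans vg.
 rewrite lt_neqAle integral_ge0 ?andbT; last by move=> y _; rewrite lee_fin.
 apply/eqP => /esym H.
 have mE : measurable_fun `]u, v[ (fun y => (mp_density d y)%:E).
  by apply: measurable_funTS; apply/measurable_EFinP; exact: measurable_mpd.
 have : (\int[leb]_(y in `]u, v[) `|(mp_density d y)%:E| = 0)%E.
  by rewrite -[RHS]H; apply: eq_integral => y _; rewrite gee0_abs // lee_fin.
 move=> /(ae_eq_integral_abs leb (mitv `]u, v[) mE) [Nn [mN Nn0 sN]].
 have sub : `]u, v[ `<=` Nn.
  move=> y yi; apply: sN => /(_ yi) /= [] /eqP; rewrite gt_eqF //; exact: dp.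
 have : (leb `]u, v[ <= leb Nn)%E by apply: le_measure => //; rewrite inE; [exact: mitv|exact: mN].
 by rewrite Nn0 leNgt => /negP; apply; have -> : leb `]u, v[ = (v - u)%:E; [exact: (leb_oo uv)|rewrite lte_fin subr_gt0].
have sub (u v : R) (A : set R) : measurable A -> `]u, v[ `<=` A -> (\int[leb]_(y in `]u, v[) (mp_density d y)%:E <= \int[leb]_(y in A) (mp_density d y)%:E)%E.
 move=> mA sA; apply: ge0_subset_integral => //.
 - by apply: measurable_funTS; apply/measurable_EFinP; exact: measurable_mpd.
 - by move=> y _; rewrite lee_fin.
have i0 (A : set R) : (0 <= \int[leb]_(y in A) (mp_density d y)%:E)%E by apply: integral_ge0 => y _; rewrite lee_fin.
move=> [/andP[x1 x2]|[-> d1]] e e0.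
- have s0 : 0 < Num.sqrt d by rewrite sqrtr_gt0.
 have gg : gam_m d < gam_p d by rewrite /gam_m /gam_p; nra.
 pose c := (gam_m d + gam_p d) / 2.
 (* The window around [x] is cut off near the two edges, so that it stays inside the open bulk and
    remains nonempty even when [x] is an edge. *)
 pose u := Num.max (gam_m d + Num.min e (gam_p d - gam_m d) / 8) (x - e / 2).
 pose v := Num.min (gam_p d - Num.min e (gam_p d - gam_m d) / 8) (x + e / 2).
 have k0 : 0 < Num.min e (gam_p d - gam_m d) by rewrite lt_min e0 subr_gt0.
 have k1 : Num.min e (gam_p d - gam_m d) <= e by rewrite ge_min lexx.
 have k2 : Num.min e (gam_p d - gam_m d) <= gam_p d - gam_m d by rewrite ge_min lexx orbT.
 have p := pos u v; rewrite /mp_mass; apply: lt_le_trans (_ : (\int[leb]_(y in `]u, v[) (mp_density d y)%:E <= _)%E).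
  move: k0 k1 k2; rewrite /u /v in p *; move: (Num.min e _) p => k p k0 k1 k2; apply: p.
  + by rewrite lt_max; apply/orP; left; lra.
  + by rewrite gt_min; apply/orP; left; lra.
  + by rewrite gt_max !lt_min; apply/andP; split; apply/andP; split; lra.
 apply: (@le_trans _ _ (\int[leb]_(y in ball x e) (mp_density d y)%:E)%E).
  apply: sub; first exact: measurable_ball.
  move=> y; rewrite /= in_itv /= gt_max lt_min => /andP[/andP[_ y1] /andP[_ y2]].
  by rewrite /ball /= ltr_norml; apply/andP; split; lra.
 by rewrite leeDl // lee_fin; case: ifP => _; rewrite ?mulr1 ?mulr0 ?atom_ge0.
- rewrite /mp_mass; apply: lt_le_trans (_ : ((mp_atom d)%:E <= _)%E).
  by rewrite lte_fin /mp_atom lt_max; apply/orP; right; rewrite subr_gt0 invf_lt1.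
 have -> : `[< ball 0 e (0 : R) >] = true by apply/asboolP; exact: ballxx.
 by rewrite mulr1 leeDr.
Qed.

End MarchenkoPasturFunctional.

(** * Spectral decomposition and absence of outliers *)

Section SpectralTheorem.
Variable R : realType.
Local Notation C := R[i].

Lemma spectral_exists n (W : 'M[C]_n) : adjmx W = W -> exists p, spectral_decomp W p.
move=> hW.
have hs : W \is hermsymmx by apply/is_hermitianmxP; rewrite expr0 scale1r -[LHS]hW.
have /orthomx_spectralP E := hermitian_normalmx hs.
have /mxOverP rr := hermitian_spectral_diag_real hs.
have uP := spectral_unitarymx W; have iP := spectral_unit W.
set P := spectralmx W in E uP iP; set sp := spectral_diag W in E rr.
have e1 : invmx P = adjmx P by rewrite invmx_unitary // map_trmx.
exists (adjmx P, map_mx (fun x => Re x) sp); split => /=.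
 by rewrite /unitary_mx adjmxK -e1 mulVmx.
rewrite adjmxK -map_mx_comp {1}E e1; congr (_ *m diag_mx _ *m _).
apply/rowP => k; rewrite !mxE /=; have := rr 0 k.
case: (sp 0 k) => a b; rewrite realE !lecE /= => H.
by have -> : b = 0 by case/orP: H => /andP[/eqP].
Qed.
(** The same choice of decomposition as in [c0], so that [c0_eig] holds by conversion. *)
Definition eigs n (W : 'M[C]_n) := xget (0, 0) (spectral_decomp W).
Definition eigv n (W : 'M[C]_n) (k : 'I_n) : R := (eigs W).2 0 k.
Definition eigw n (W : 'M[C]_n) (b : 'cV[C]_n) (k : 'I_n) : R := cabs ((adjmx (eigs W).1 *m b) k 0) ^+ 2.

Lemma c0_eig n (W : 'M[C]_n) b z : c0 W b z = \sum_k (eigw W b k)%:C * ((eigv W k)%:C - z)^-1.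
by []. Qed.

Variables (N M : nat) (Y : 'M[C]_(N, M)).
Let W := Y *m adjmx Y.

Lemma eigs_spec : spectral_decomp W (eigs W).
have [|p Hp] := @spectral_exists _ W; first by rewrite /W adjmxM adjmxK.
exact: (xgetPex (0, 0) (ex_intro _ p Hp)).
Qed.
Lemma eigw_ge0 b k : 0 <= eigw W b k. Proof. exact: sqr_ge0. Qed.
Lemma eigw_sum b : \sum_k eigw W b k = nv b.
have [u _] := eigs_spec; apply: complexI.
have -> : \sum_k eigw W b k = nv (adjmx (eigs W).1 *m b) by [].
by rewrite -!ipuu ip_adj adjmxK mulmxA u mul1mx.
Qed.
Lemma Rs_spec z : Im z != 0 ->
 Rs Y z = (eigs W).1 *m diag_mx (\row_k ((eigv W k)%:C - z)^-1) *m adjmx (eigs W).1.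
move=> z0; have [u e] := eigs_spec; set U := (eigs W).1 in u e *.
have u' : adjmx U *m U = 1%:M by apply: mulmx1C.
apply/esym/Rs_uniq => //; rewrite /shifted -/W {1}e.
have zE : z%:M = U *m (z%:M *m adjmx U) by rewrite mul_scalar_mx -scalemxAr u -mul_scalar_mx mulmx1.
rewrite {1}zE -(mulmxA U (diag_mx _)) -mulmxBr -mulmxBl.
rewrite !mulmxA -(mulmxA _ (adjmx U)) u' mulmx1.
rewrite -(mulmxA U); have -> : (diag_mx (map_mx (fun x : R => x%:C) (eigs W).2) - z%:M) *m diag_mx (\row_k ((eigv W k)%:C - z)^-1) = 1%:M.
 rewrite -diag_const_mx -raddfB /= mulmx_diag; apply/matrixP => i j; rewrite !mxE.
 have [->|] := eqVneq i j; last by rewrite mulr0n.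
 rewrite mulr1n mulfV //; apply: contraNneq z0 => /(congr1 Im).
 by rewrite cImD cImN cIm_real sub0r => /eqP; rewrite oppr_eq0.
by rewrite mulmx1.
Qed.
(** Off the real axis the dependence on the chosen decomposition disappears: [c0] is a resolvent
    form and hence measurable in the entries. *)
Lemma ip_spec b z : Im z != 0 -> ip b (Rs Y z *m b) = c0 W b z.
move=> z0; rewrite Rs_spec // -!mulmxA ip_adj.
rewrite ipE c0_eig; apply: eq_bigr => k _.
by rewrite mul_diag_mx !mxE /eigw -conj_mul mxE; ring.
Qed.
Lemma tr_spec z : Im z != 0 -> \tr (Rs Y z) = \sum_k ((eigv W k)%:C - z)^-1.
move=> z0; have [u _] := eigs_spec.
rewrite Rs_spec // mxtrace_mulC mulmxA (mulmx1C u) mul1mx mxtrace_diag.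
by apply: eq_bigr => k _; rewrite mxE.
Qed.

End SpectralTheorem.

(** * Finite differences and products of Lorentzians *)

Section PartialFractions.

(** The left side is the [m]-th finite difference of [1 / X] with step [e]; Pascal's rule gives the
    induction. Being of order [e ^+ m], it expresses the value at [j = 0] through those at
    [j = 1, ..., m]. *)
Lemma extrapolation (F : fieldType) m (X e : F) : (forall j, (j <= m)%N -> X - j%:R * e != 0) ->
 \sum_(j < m.+1) (-1) ^+ j * 'C(m, j)%:R / (X - j%:R * e) =
 (- e) ^+ m * m`!%:R / \prod_(j < m.+1) (X - j%:R * e).
elim: m X => [|m IH] X H.
 by rewrite !big_ord_recl !big_ord0 /= bin0 fact0 !expr0 !mul1r mulr1 addr0.
have H1 j : (j <= m)%N -> X - j%:R * e != 0 by move=> jm; apply: H; exact: leqW.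
have eE j : X - e - j%:R * e = X - j.+1%:R * e by rewrite -[j.+1%:R]natr1; ring.
have H2 j : (j <= m)%N -> (X - e) - j%:R * e != 0.
 by move=> jm; rewrite eE; exact: H.
have S2 : \sum_(j < m.+1) (-1) ^+ j * 'C(m, j)%:R / (X - e - j%:R * e) =
 - \sum_(j < m.+1) (-1) ^+ j.+1 * 'C(m, j)%:R / (X - j.+1%:R * e).
 rewrite -sumrN; apply: eq_bigr => j _.
 rewrite exprS mulN1r !mulNr opprK; congr (_ / _).
 by rewrite eE.
have S : \sum_(j < m.+2) (-1) ^+ j * 'C(m.+1, j)%:R / (X - j%:R * e) =
  \sum_(j < m.+1) (-1) ^+ j * 'C(m, j)%:R / (X - j%:R * e) - \sum_(j < m.+1) (-1) ^+ j * 'C(m, j)%:R / (X - e - j%:R * e).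
 rewrite S2 opprK big_ord_recl [X in _ = X + _]big_ord_recl -addrA; congr (_ + _); first by rewrite /= !bin0.
 have -> : \sum_(i < m.+1) (-1) ^+ bump 0 i * 'C(m.+1, bump 0 i)%:R / (X - (bump 0 i)%:R * e) =
  \sum_(i < m.+1) ((-1) ^+ i.+1 * 'C(m, i.+1)%:R / (X - i.+1%:R * e) + (-1) ^+ i.+1 * 'C(m, i)%:R / (X - i.+1%:R * e)).
  by apply: eq_bigr => i _; rewrite /bump /= add1n binS natrD mulrDr mulrDl.
 rewrite big_split /=; congr (_ + _).
 by rewrite big_ord_recr /= bin_small // mulr0 mul0r addr0; apply: eq_bigr => i _.
rewrite S (IH _ H1) (IH _ H2).
pose Q := \prod_(j < m) (X - j.+1%:R * e).
have P1 : \prod_(j < m.+1) (X - j%:R * e) = X * Q.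
 by rewrite big_ord_recl mul0r subr0; congr (_ * _); apply: eq_bigr => j _; rewrite /bump /= add1n.
have P2 : \prod_(j < m.+1) (X - e - j%:R * e) = Q * (X - m.+1%:R * e).
 by rewrite big_ord_recr /= eE; congr (_ * _); apply: eq_bigr => j _; exact: eE.
have P3 : \prod_(j < m.+2) (X - j%:R * e) = X * Q * (X - m.+1%:R * e) by rewrite big_ord_recr /= P1.
have X0 : X != 0 by have := H 0%N isT; rewrite mul0r subr0.
have Q0 : Q != 0 by apply/prodf_neq0 => j _; apply: H; rewrite ltnS ltnW.
have Z0 : X - m.+1%:R * e != 0 by exact: H.
rewrite P1 P2 P3 factS natrM exprS.
move: X0 Q0 Z0; move: (m`!%:R) ((- e) ^+ m) (m.+1%:R) => f g n X0 Q0 Z0.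
by field; rewrite ?X0 ?Q0 ?Z0.
Qed.
(** Two Lorentzians of different widths multiply to a combination of both, which gives the
    coefficients recursively; by homogeneity they are free of [eta] and [u]. *)
Lemma lorentz_partial_fractions (R : realFieldType) m : (0 < m)%N -> exists c : nat -> R,
 forall (eta u : R), 0 < eta -> 0 <= u ->
 \prod_(k < m) ((k.+1%:R * eta) ^+ 2 / (u + (k.+1%:R * eta) ^+ 2)) =
 \sum_(k < m) c k * ((k.+1%:R * eta) ^+ 2 / (u + (k.+1%:R * eta) ^+ 2)).
elim: m => // -[_ _|m IH _].
 by exists (fun=> 1) => eta u _ _; rewrite !big_ord_recl !big_ord0 mulr1 addr0 mul1r.
have [//|c Hc] := IH.
pose l : R := m.+2%:R.
pose s (k : nat) : R := k.+1%:R.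
exists (fun k => if k == m.+1 then - \sum_(j < m.+1) c j * (s j ^+ 2 / (l ^+ 2 - s j ^+ 2))
 else c k * (l ^+ 2 / (l ^+ 2 - s k ^+ 2))) => eta u e0 u0.
rewrite big_ord_recr /= Hc // [RHS]big_ord_recr /= eqxx mulNr mulr_suml mulr_suml -sumrB.
apply: eq_bigr => k _; rewrite ltn_eqF //.
have d0 : l ^+ 2 - s k ^+ 2 != 0.
 rewrite subr_eq0 eqf_sqr negb_or; apply/andP; split.
  by rewrite /l /s eqr_nat gtn_eqF // ltnS; exact: ltn_ord.
 by rewrite gt_eqF // (lt_trans (_ : _ < 0)) ?oppr_lt0 /l /s ?ltr0n.
have p (x : R) : 0 < x -> u + (x * eta) ^+ 2 != 0.
 by move=> x0; rewrite gt_eqF // ltr_wpDl // exprn_gt0 // mulr_gt0.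
have p1 := p (s k) (ltr0Sn _ _); have p2 := p l (ltr0Sn _ _).
rewrite -/(s k) -/l; move: d0 p1 p2; move: (c k) (s k) l => cc a b d0 p1 p2.
by field; rewrite ?d0 ?p1 ?p2.
Qed.

End PartialFractions.

Section AlmostReal.
Variable R : realType.
Local Notation C := R[i].
Variable e : R.
Hypothesis e0 : 0 <= e.

(** A single constant bounds the modulus and, with the factor [e], the imaginary part. This form
    passes to sums, products and inverses, so a rational expression in almost real numbers is almost
    real. *)
Definition AR (k : R) (x : C) := cabs x <= k /\ `|Im x| <= k * e.

Lemma AR_ge0 k x : AR k x -> 0 <= k.
by case=> H _; exact: le_trans (cabs_ge0 x) H. Qed.
Lemma ARD k l x y : AR k x -> AR l y -> AR (k + l) (x + y).
move=> [h1 h2] [h3 h4]; split; first exact: le_trans (cabsD _ _) (lerD h1 h3).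
by rewrite cImD mulrDl; exact: le_trans (ler_normD _ _) (lerD h2 h4).
Qed.
Lemma ARN k x : AR k x -> AR k (- x).
by case=> h1 h2; split; rewrite ?cabsN // cImN normrN. Qed.
Lemma ARM k l x y : AR k x -> AR l y -> AR (2 * k * l) (x * y).
move=> hx hy; have k0 := AR_ge0 hx; have l0 := AR_ge0 hy.
case: hx hy => [h1 h2] [h3 h4]; split.
 rewrite cabsM; apply: le_trans (ler_pM (cabs_ge0 _) (cabs_ge0 _) h1 h3) _.
 by rewrite -mulrA ler_peMl ?mulr_ge0 // ler1n.
rewrite cImM; apply: le_trans (ler_normD _ _) _; rewrite !normrM.
have -> : 2 * k * l * e = k * (l * e) + (k * e) * l by ring.
by apply: lerD; apply: ler_pM => //; apply: le_trans (le_Re_cabs _) _.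
Qed.
Lemma AR_real r k : `|r| <= k -> AR k r%:C.
by move=> H; split; rewrite ?cabs_real // cIm_real normr0 mulr_ge0 // (le_trans _ H). Qed.
Lemma ARV k x del : 0 < del -> del <= cabs x -> AR k x -> AR (del^-1 + k / del ^+ 2) x^-1.
move=> d0 dx hx; have k0 := AR_ge0 hx; case: hx => h1 h2.
have i1 : (cabs x)^-1 <= del^-1 by rewrite lef_pV2 // posrE (lt_le_trans d0).
have x0 : 0 < cabs x by exact: lt_le_trans dx.
split.
 by rewrite cabsV; apply: le_trans i1 _; rewrite lerDl divr_ge0 // sqr_ge0.
rewrite cImV mulNr normrN normrM normfV (ger0_norm (sqr_ge0 _)) mulrDl.
apply: le_trans (_ : k * e * (del ^+ 2)^-1 <= _).
 apply: ler_pM => //; first by rewrite invr_ge0 sqr_ge0.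
 by rewrite lef_pV2 ?posrE ?exprn_gt0 // lerXn2r // nnegrE ltW.
have -> : k * e / del ^+ 2 = k / del ^+ 2 * e by ring.
by rewrite lerDr mulr_ge0 // invr_ge0 ltW.
Qed.

End AlmostReal.

Notation gram c := (entmx c *m adjmx (entmx c)).

(** * Absence of outliers *)

Section Outliers.
Variable R : realType.
Local Notation C := R[i].

(** The left side is the squared derivative of the quadratic polynomial at its root, that is its
    discriminant, which vanishes at the two edges. *)
Lemma R0_sq (dd : R) (z s : C) : 0 <= dd -> Im z != 0 -> mpsol dd z s ->
 Rfun dd z s (dd%:C * s) ^+ 2 = (z - (gam_m dd)%:C) * (z - (gam_p dd)%:C).
move=> dd0 z0 Hs; have t := tau_a z0 Hs; case: Hs => H _.
have E : (1 + dd%:C * s) * (z * (dd%:C * s) + dd%:C) = dd%:C * s.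
 by rewrite -[RHS](congr1 (fun x => dd%:C * x) H); ring.
have q2 : (Num.sqrt dd)%:C ^+ 2 = dd%:C :> C by rewrite -rmorphXn /= sqr_sqrtr.
have gm : (gam_m dd)%:C = (1 - (Num.sqrt dd)%:C) ^+ 2 :> C by rewrite /gam_m rmorphXn rmorphB.
have gp : (gam_p dd)%:C = (1 + (Num.sqrt dd)%:C) ^+ 2 :> C by rewrite /gam_p rmorphXn rmorphD.
have -> : (z - (gam_m dd)%:C) * (z - (gam_p dd)%:C) = z ^+ 2 - 2 * z * (1 + dd%:C) + (1 - dd%:C) ^+ 2.
 by rewrite gm gp -q2; ring.
rewrite /Rfun; move: t; set a := dd%:C * s in E * => t.
have -> : z * a + z - (1 + a)^-1 = 2 * (z * a) + z + dd%:C - 1.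
 have -> : (1 + a)^-1 = - (z * a + dd%:C - 1) by rewrite t opprK.
 by ring.
have E0 : (1 + a) * (z * a + dd%:C) - a = 0 by rewrite E subrr.
by apply/eqP; rewrite -subr_eq0 -[X in _ == X](mulr0 (4 * z)) -E0; apply/eqP; ring.
Qed.
Lemma gam_inS (dd : R) : 0 < dd -> inS dd (gam_m dd) /\ inS dd (gam_p dd).
move=> d0; have q0 : 0 <= Num.sqrt dd by exact: sqrtr_ge0.
have : gam_m dd <= gam_p dd by rewrite /gam_m /gam_p; nra.
by move=> H; split; left; rewrite lexx ?H.
Qed.
(** Both edges belong to the support, so each of the two factors in [R0_sq] is at least [del]. *)
Lemma R0_lb (dd : R) (z s : C) del : 0 < dd -> 0 < del -> Im z != 0 -> mpsol dd z s ->
 (forall x, inS dd x -> del <= cabs (x%:C - z)) -> del <= cabs (Rfun dd z s (dd%:C * s)).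
move=> dd0 d0 z0 Hs H; have [i1 i2] := gam_inS dd0.
have d1 := ltW d0; rewrite -(@ler_pXn2r _ 2) ?nnegrE ?cabs_ge0 // -cabsX R0_sq //; last exact: ltW.
by rewrite cabsM expr2; apply: ler_pM => //; rewrite cabsBC; exact: H.
Qed.

Section Shift.
Variables (B del D K : R) (m : nat).
Hypotheses (del0 : 0 < del) (B0 : m%:R <= B) (K1 : 1 <= K).

(** Constants for [AR], in this order for [z], [s], [dd * s], [tau], [T2f], the numerator of the
    mean shift, [R0] and [1 / R0]. They do not depend on [N], [M] or [h]. *)
Let kz := B.
Let ks := 2 / del + m%:R / del ^+ 2.
Let ka := 2 * D * ks.
Let kt := 2 * kz * ka + (D + 1).
Let kT := D * (2 / del ^+ 2 + m%:R * (2 / del ^+ 3)).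
Let kX := 2 * (2 * kt * kt) * (2 * 1 * kT + 2 * (4 * K * D) * (2 * ks * ks)).
Let kR := 2 * kz * ka + kz + kt.
Let kV := del^-1 + kR / del ^+ 2.
Definition shiftC := 2 * kX * kV + del^-1.

Variables (N M : nat) (mu : mxlaw R N M) (eps h : R).
Hypothesis Hg : goodlaw mu K eps.
Local Notation EC := (Exc mu).
Local Notation dd := (N%:R / M%:R : R).
Hypotheses (HK : dominates K h) (HN : N%:R <= h * M%:R) (N0 : (0 < N)%N) (HD : dd <= D).
Hypothesis Heps : eps = 0 \/ eps = 1.
Hypothesis Hrho : h ^+ 65 * rho R M <= 1.
Hypotheses (hB : B + 1 <= h) (hdel : 2 / del <= h).
Variables (z : C) (k : nat).
Hypotheses (km : (k < m)%N) (Hk : Im z = k.+1%:R * h^-1) (Hz : cabs z <= B).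
Hypothesis HS : forall x, inS dd x -> 2 * del <= cabs (x%:C - z).
Hypothesis rdel : rho R M <= del.
Local Notation s := (mp_stieltjes dd z).

Let M0 : (0 < M)%N. Proof. by case: Hg. Qed.
Let dd0 : 0 < dd. Proof. by rewrite divr_gt0 ?ltr0n. Qed.
Let h0 : 0 < h.
by apply: lt_le_trans hB; apply: (le_lt_trans (_ : 0 <= B)); rewrite ?ltrDl ?ltr01 // (le_trans _ B0) ?ler0n. Qed.
Let e0 : 0 <= h^-1. Proof. by rewrite invr_ge0 ltW. Qed.
Let r0 := rho_gt0 Hg.
Let z0 : Im z != 0. Proof. by rewrite Hk mulf_neq0 ?pnatr_eq0 // invr_eq0 gt_eqF. Qed.
Let HS1 x : inS dd x -> del <= cabs (x%:C - z).
by move=> H; apply: le_trans (HS H); rewrite ler_peMl ?ler1n // ltW. Qed.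
Let HS2 x : inS dd x -> del <= cabs (x%:C - (z + (rho R M)%:C)).
move=> H; have := HS H; have := cabsD (x%:C - (z + (rho R M)%:C)) (rho R M)%:C.
rewrite [X in _ <= _ + X]cabs_ge0r; last exact: ltW.
have -> : x%:C - (z + (rho R M)%:C) + (rho R M)%:C = x%:C - z by ring.
move=> t1 t2; have := lerB (le_trans t2 t1) rdel; rewrite addrK.
by apply: le_trans; rewrite mulr_natl mulr2n addrK.
Qed.
(** All ingredients of the mean shift would be real at a real point off the support, so at height
    [O(1/h)] its imaginary part is [O(1/h)], although the shift itself is of order one. *)
Lemma shift_Im : `|M%:R * Im (EC (fun c => Af z c - dd%:C * s))| <= shiftC * h^-1.
have Hs := mpsol_mp_stieltjes dd0 z0.
have Iz : `|Im z| <= m%:R * h^-1.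
 by rewrite Hk ger0_norm ?mulr_ge0 ?ler0n // ler_wpM2r // ler_nat.
have z0' : Im (z + (rho R M)%:C) != 0 by rewrite cImD cIm_real addr0.
have Hs' := mpsol_mp_stieltjes dd0 z0'.
have sl := stieltjes_le dd0 del0 HS1; have sl' := stieltjes_le dd0 del0 HS2.
have izh : `|Im z|^-1 <= h.
 rewrite Hk ger0_norm ?mulr_ge0 ?ler0n // invfM invrK ler_piMl //; first exact: ltW.
 by rewrite invf_le1 ?ler1n ?ltr0n.
have hz : cabs z <= h by apply: le_trans Hz (le_trans _ hB); rewrite lerDl.
have hz' : cabs (z + (rho R M)%:C) <= h.
 apply: le_trans (cabsD _ _) (le_trans _ hB); apply: lerD => //.
 by rewrite (cabs_ge0r (ltW r0)) (rho_le1 Hg).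
have main := E_mean_shift' Hg HK HN Heps z0 izh hz hz' Hs (le_trans sl hdel) Hs'.
have As : AR h^-1 ks s.
 split; first by apply: le_trans sl _; rewrite lerDl divr_ge0 ?sqr_ge0.
 apply: le_trans (stieltjes_Im_le dd0 del0 HS1) _.
 apply: le_trans (_ : m%:R * h^-1 / del ^+ 2 <= _); first by rewrite ler_wpM2r // invr_ge0 sqr_ge0.
 by rewrite mulrAC ler_wpM2r // lerDr divr_ge0 // ltW.
have Ad : AR h^-1 D dd%:C by apply: AR_real => //; rewrite ger0_norm // ltW.
have Aa := ARM Ad As.
have Az : AR h^-1 kz z by split => //; apply: le_trans Iz _; rewrite ler_wpM2r.
have Aza := ARM Az Aa.
have At : AR h^-1 kt (1 + dd%:C * s)^-1.
 rewrite -[(1 + _)^-1]opprK -(tau_a z0 Hs); apply: ARN; rewrite -addrA; apply: ARD => //.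
 apply: ARD => //; apply: ARN; have -> : (1 : C) = 1%:C by [].
 by apply: AR_real => //; rewrite normr1.
have AT : AR h^-1 kT (T2f N M s (mp_stieltjes dd (z + (rho R M)%:C))).
 have -> : T2f N M s (mp_stieltjes dd (z + (rho R M)%:C)) =
  dd%:C * ((mp_stieltjes dd (z + (rho R M)%:C) - s) / (rho R M)%:C) by rewrite /T2f; ring.
 split.
  rewrite cabsM (cabs_ge0r (ltW dd0)); apply: ler_pM; rewrite ?cabs_ge0 //.
  rewrite cabsM cabsV (cabs_ge0r (ltW r0)) ler_pdivrMr //.
  have := stieltjes_lip dd0 del0 HS2 HS1; rewrite [z + _ - z]addrAC subrr add0r (cabs_ge0r (ltW r0)) => /le_trans; apply.
  have -> : 2 * (rho R M / del ^+ 2) = 2 / del ^+ 2 * rho R M by ring.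
  rewrite ler_wpM2r ?(ltW r0) // lerDl mulr_ge0 ?ler0n // divr_ge0 ?ler0n // exprn_ge0 // ltW //.
 rewrite cImM cIm_real mul0r addr0 cRe_real normrM (ger0_norm (ltW dd0)) /kT -mulrA.
 apply: ler_pM => //.
 apply: le_trans (stieltjes_slope_Im dd0 del0 r0 HS1 HS2) _.
 have d3 : 0 <= 2 / del ^+ 3 by rewrite divr_ge0 ?exprn_ge0 // ltW.
 apply: le_trans (ler_wpM2r d3 Iz) _.
 rewrite mulrAC ler_wpM2r // lerDr divr_ge0 // sqr_ge0 //.
have AK : AR h^-1 (4 * K * D) (Kap mu eps)%:C.
 apply: AR_real => //; apply: le_trans (Kap_le Hg Heps) _; rewrite ler_wpM2l // mulr_ge0 ?ler0n //.
 by apply: le_trans K1; rewrite ler01.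
have Ae : AR h^-1 1 eps%:C by apply: AR_real => //; case: Heps => ->; rewrite ?normr0 ?normr1 ?ler01.
have AX : AR h^-1 kX ((1 + dd%:C * s)^-1 ^+ 2 * (eps%:C * T2f N M s (mp_stieltjes dd (z + (rho R M)%:C)) + (Kap mu eps)%:C * s ^+ 2)).
 by rewrite !expr2; apply: ARM (ARM At At) (ARD (ARM Ae AT) (ARM AK (ARM As As))).
have AR0 : AR h^-1 kR (R0 N M z s) by apply: ARD (ARD Aza Az) (ARN At).
have lb := R0_lb dd0 del0 z0 Hs HS1.
have AV := ARV e0 del0 lb AR0.
have AXV := ARM AX AV.
have R00 : R0 N M z s != 0 by rewrite -cabs_gt0; exact: lt_le_trans lb.
set X := (X in AR _ kX X) in AX AXV main.
set V := EC _ in main *.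
set r := R0 N M z s in lb R00 AXV main.
have VE : M%:R%:C * V = - (X * r^-1) + (M%:R%:C * (r * V) + X) * r^-1 by field.
have IV : M%:R * Im V = - Im (X * r^-1) + Im ((M%:R%:C * (r * V) + X) * r^-1).
 by rewrite -cImN -cImD -VE cImM cIm_real mul0r addr0 cRe_real.
rewrite IV; apply: le_trans (ler_normD _ _) _; rewrite normrN /shiftC [leRHS]mulrDl.
apply: lerD; first by case: AXV.
apply: le_trans (le_Im_cabs _) _; rewrite cabsM cabsV mulrC.
apply: ler_pM; rewrite ?invr_ge0 ?cabs_ge0 //; first by rewrite lef_pV2 // posrE cabs_gt0.
apply: le_trans main _; rewrite -[h^-1]mul1r ler_pdivlMr //.
apply: le_trans Hrho; rewrite mulrAC -exprSr ler_wpM2r ?(ltW r0) //.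
have h1 : 1 <= h by apply: le_trans hB; rewrite lerDr (le_trans _ B0).
exact: ler_weXn2l.
Qed.

End Shift.

(** A single Lorentzian of width [eta] has tails of size [eta ^+ 2], too large once multiplied by
    [N]. The product of [m] of them has tails of size [eta ^+ (2 * m)] and is still at least
    [2 ^- m] within distance [eta] of [E]. *)
Definition lor (m : nat) (eta E x : R) : R :=
 \prod_(k < m) ((k.+1%:R * eta) ^+ 2 / ((x - E) ^+ 2 + (k.+1%:R * eta) ^+ 2)).
Definition lorpt (eta E : R) (k : nat) : C := E +i* (k.+1%:R * eta).

Lemma lor_factor_gt0 (eta E x : R) k : 0 < eta -> 0 < (x - E) ^+ 2 + (k.+1%:R * eta) ^+ 2.
by move=> e0; rewrite ltr_wpDl ?sqr_ge0 // exprn_gt0 // mulr_gt0. Qed.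
Lemma lor_ge0 m eta E x : 0 < eta -> 0 <= lor m eta E x.
by move=> e0; apply: prodr_ge0 => k _; rewrite divr_ge0 ?sqr_ge0 // ltW // lor_factor_gt0. Qed.
Lemma lor_near m eta E x : 0 < eta -> `|x - E| <= eta -> 2^-1 ^+ m <= lor m eta E x.
move=> e0 H; rewrite -[m in leLHS]card_ord -prodr_const; apply: ler_prod => k _.
rewrite invr_ge0 ler0n /= ler_pdivlMr ?lor_factor_gt0 //.
have : (x - E) ^+ 2 <= (k.+1%:R * eta) ^+ 2.
 rewrite -(real_normK (num_real (x - E))) lerXn2r ?nnegrE ?mulr_ge0 ?ler0n ?(ltW e0) //.
 by apply: le_trans H _; rewrite ler_peMl ?ler1n // ltW.
by move: (_ ^+ 2) (_ ^+ 2) => u v; lra.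
Qed.
Lemma lor_far m eta E x del : 0 < eta -> 0 < del -> del <= `|x - E| ->
 lor m eta E x <= ((m%:R * eta / del) ^+ 2) ^+ m.
move=> e0 d0 H; rewrite -[X in _ <= _ ^+ X]card_ord -prodr_const; apply: ler_prod => k _.
rewrite divr_ge0 ?sqr_ge0 ?(ltW (lor_factor_gt0 _ _ _ e0)) //=.
rewrite expr_div_n; apply: ler_pM; rewrite ?sqr_ge0 ?invr_ge0 //.
- exact/ltW/lor_factor_gt0.
- by rewrite lerXn2r ?nnegrE ?mulr_ge0 ?ler0n ?(ltW e0) // ler_wpM2r ?(ltW e0) // ler_nat.
rewrite lef_pV2 ?posrE ?lor_factor_gt0 ?exprn_gt0 //.
apply: le_trans (_ : (x - E) ^+ 2 <= _); last by rewrite lerDl sqr_ge0.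
by rewrite -(real_normK (num_real (x - E))) lerXn2r ?nnegrE // ltW.
Qed.
Lemma cabs_lorpt (eta E x : R) k : cabs (x%:C - lorpt eta E k) ^+ 2 = (x - E) ^+ 2 + (k.+1%:R * eta) ^+ 2.
by rewrite cabs_sq cReD cReN cImD cImN cIm_real cRe_real /= sub0r sqrrN. Qed.
Lemma lor_Im m : (0 < m)%N -> exists c : nat -> R, forall eta E x, 0 < eta ->
 lor m eta E x = Im (\sum_(k < m) (c k * (k.+1%:R * eta))%:C * (x%:C - lorpt eta E k)^-1).
move=> m0; have [c H] := lorentz_partial_fractions R m0; exists c => eta E x e0.
rewrite /lor (H _ _ e0) ?sqr_ge0 // cIm_sum; apply: eq_bigr => k _.
by rewrite cImM cIm_real mul0r addr0 cRe_real Im_cauchy cabsV exprVn cabs_lorpt /=; ring.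
Qed.
(** The sum over the eigenvalues is the imaginary part of a combination of resolvent traces. Its
    mean consists of the shifts, handled by [shift_Im], and of [N] times the integral of [lor]
    against the law, handled by [lor_far]. Coefficients and shifts each carry one factor [1 / h]. *)
Lemma lor_trace (m : nat) (B del D K : R) : (0 < m)%N -> 0 < del -> m%:R <= B -> 0 <= D -> 1 <= K ->
 exists2 A : R, 0 < A &
 forall N M (mu : mxlaw R N M) (eps h E : R),
  goodlaw mu K eps -> dominates K h -> N%:R <= h * M%:R -> (0 < N)%N -> N%:R / M%:R <= D ->
  eps = 0 \/ eps = 1 -> h ^+ 65 * rho R M <= 1 -> B + 1 <= h -> 2 / del <= h -> rho R M <= del ->
  M%:R * h ^- (2 * m) <= h ^- 2 ->
  `|E| + m%:R <= B -> (forall x, inS (N%:R / M%:R) x -> 2 * del <= `|x - E|) ->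
  let F := fun c : EntT R N M => \sum_i lor m h^-1 E (eigv (gram c) i) in
  tame mu F /\ Ex mu F <= A * h ^- 2.
move=> m0 del0 B0 D0 K1; have [c Hc] := lor_Im m0.
pose S := shiftC B del D K m.
pose A := \sum_(k < m) `|c k| * k.+1%:R * `|S| + D * ((m%:R / del) ^+ 2) ^+ m.
exists (A + 1) => [|N M mu eps h E Hg HK HN N0 HD Heps Hrho hB hdel rdel Hm EB HS F].
 rewrite ltr_wpDl // addr_ge0 //; first by apply: sumr_ge0 => k _; rewrite !mulr_ge0.
 by rewrite mulr_ge0 // exprn_ge0 // sqr_ge0.
have h0 : 0 < h by apply: lt_le_trans hB; apply: (le_lt_trans (_ : 0 <= B)); rewrite ?ltrDl ?ltr01 // (le_trans _ B0) ?ler0n.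
have e0 : 0 < h^-1 by rewrite invr_gt0.
have M0 : (0 < M)%N by case: Hg.
have Mp : (0 : R) < M%:R by rewrite ltr0n.
pose z k := lorpt h^-1 E k.
have z0 k : Im (z k) != 0 by rewrite /= mulf_neq0 ?pnatr_eq0 // gt_eqF.
pose T k (w : EntT R N M) := \tr (Rs (entmx w) (z k)).
have tT k : tamec mu (T k) by exact: tamec_tr (tamemx_G Hg (z0 k)).
pose cc (k : 'I_m) := c k * (k.+1%:R * h^-1).
pose G w := \sum_(k < m) (cc k)%:C * T k w.
have FG w : F w = Im (G w).
 rewrite /F; under eq_bigr do rewrite (Hc _ _ _ e0); rewrite -cIm_sum exchange_big /=; congr (Im _).
 by apply: eq_bigr => k _; rewrite -mulr_sumr /T (tr_spec _ (z0 k)).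
have tG : tamec mu G.
 by apply: tamec_sum => k; exact: tamecZ.
have tF : tame mu F by rewrite (funext FG); case: tG.
split => //.
have -> : Ex mu F = Im (Exc mu G) by rewrite (funext FG).
have -> : Exc mu G = \sum_(k < m) (cc k)%:C * Exc mu (T k).
 rewrite Exc_sum; last by move=> k; exact: tamecZ.
 by apply: eq_bigr => k _; rewrite ExcZ.
have dd0 : 0 < N%:R / M%:R :> R by rewrite divr_gt0 ?ltr0n.
pose s k := mp_stieltjes (N%:R / M%:R) (z k).
pose V k := Exc mu (fun w => Af (z k) w - (N%:R / M%:R)%:C * s k).
have TV k : Exc mu (T k) = M%:R%:C * V k + N%:R%:C * s k.
 have tA : tamec mu (Af (z k)) := tame_Af Hg (z0 k).
 rewrite /V ExcB //; last exact: tamecC.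
 rewrite Exc_cst /Af.
 have -> : Exc mu (fun w => \tr (Gf (z k) w) * (M%:R^-1)%:C) = (M%:R^-1)%:C * Exc mu (T k).
  by rewrite -ExcZ //; apply: eq_Exc => w; rewrite mulrC.
 have M1 : M%:R%:C * (M%:R^-1)%:C = 1 :> C by rewrite -rmorphM /= divff // gt_eqF.
 rewrite (rmorphM _ N%:R) /=; move: M1; move: (Exc _ _) (s k) (_%:C) (_%:C) (_%:C) => x y b a' a M1.
 have -> : a * (a' * x - b * a' * y) + b * y = (a * a') * x - b * y * (a * a' - 1) by ring.
 by rewrite M1 subrr mulr0 subr0 mul1r.
have dS k x : inS (N%:R / M%:R) x -> 2 * del <= cabs (x%:C - z k).
 move=> H; apply: le_trans (HS _ H) _; apply: le_trans (le_Re_cabs _).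
 by rewrite cReD cReN cRe_real.
have dS1 k x : inS (N%:R / M%:R) x -> del <= cabs (x%:C - z k).
 by move=> H; apply: le_trans (dS k x H); rewrite ler_peMl ?ler1n // ltW.
have okc k : lamok (N%:R / M%:R) (fun x => (x%:C - z k)^-1) := (lamok_cauchy del0 (dS1 k)).1.
have okZ k := LamZ dd0 (cc k)%:C (okc k).
pose L x := \sum_(k < m) (cc k)%:C * (x%:C - z k)^-1.
have [okL LE] := Lam_sum dd0 (index_enum 'I_m) (fun k : 'I_m => (okZ k).1).
have LE' : Lam (N%:R / M%:R) L = \sum_(k < m) (cc k)%:C * s k.
 rewrite [LHS]LE; apply: eq_bigr => k _.
 by rewrite (okZ k).2 Lam_cauchy.
have LB : `|Im (Lam (N%:R / M%:R) L)| <= ((m%:R * h^-1 / del) ^+ 2) ^+ m.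
 apply: Lam_Im_le => // [|x Hx]; first by rewrite exprn_ge0 // sqr_ge0.
 rewrite -(Hc _ _ _ e0) ger0_norm ?lor_ge0 //; apply: lor_far => //.
 by apply: le_trans (HS _ Hx); rewrite ler_peMl ?ler1n // ltW.
have -> : \sum_(k < m) (cc k)%:C * Exc mu (T k) =
  \sum_(k < m) (cc k)%:C * (M%:R%:C * V k) + N%:R%:C * Lam (N%:R / M%:R) L.
 by rewrite LE' mulr_sumr -big_split /=; apply: eq_bigr => k _; rewrite TV; ring.
apply: le_trans (_ : A * h ^- 2 <= _); last by rewrite ler_wpM2r ?lerDl ?ler01 // invr_ge0 exprn_ge0 // ltW.
rewrite cImD mulrDl mulr_suml; apply: lerD.
 rewrite cIm_sum; apply: ler_sum => k _.
 have := shift_Im del0 B0 K1 Hg HK HN N0 HD Heps Hrho hB hdel (ltn_ord k) (erefl (Im (z k))).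
 move=> /(_ _ _ rdel) -H; have {}H : `|M%:R * Im (V k)| <= S * h^-1.
  apply: H; last by move=> x; exact: dS.
  apply: le_trans (cabs_le_ReIm _) _; apply: le_trans EB; rewrite lerD2l /= ger0_norm ?mulr_ge0 ?ler0n ?(ltW e0) //.
  apply: le_trans (_ : m%:R * h^-1 <= _); first by rewrite ler_wpM2r ?(ltW e0) // ler_nat.
  rewrite ler_piMr ?ler0n // invf_le1 //; apply: le_trans hB; rewrite lerDr (le_trans _ B0) //.
 have -> : Im ((cc k)%:C * ((M%:R)%:C * V k)) = cc k * (M%:R * Im (V k)).
  by rewrite !cImM !cIm_real !cRe_real !mul0r !addr0.
 apply: le_trans (ler_norm _) _; rewrite normrM.
 apply: le_trans (ler_wpM2l (normr_ge0 _) H) _.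
 rewrite /cc !normrM (ger0_norm (ltW e0)) (ger0_norm (ler0n _ _)).
 have -> : `|c k| * (k.+1%:R / h) * (S / h) = `|c k| * k.+1%:R / h ^+ 2 * S by rewrite expr2 invfM; ring.
 by rewrite mulrAC -!mulrA ler_wpM2l // ler_wpM2l // ler_wpM2r ?ler_norm // invr_ge0 exprn_ge0 // ltW.
rewrite cImM cIm_real mul0r addr0 cRe_real; apply: le_trans (ler_norm _) _.
rewrite normrM (ger0_norm (ler0n _ _)); apply: le_trans (ler_wpM2l (ler0n _ _) LB) _.
have -> : (m%:R / h / del) ^+ 2 ^+ m = ((m%:R / del) ^+ 2) ^+ m * h ^- (2 * m).
 by rewrite mulrAC -!exprM exprMn exprVn.
have -> : N%:R * ((m%:R / del) ^+ 2 ^+ m / h ^+ (2 * m)) = N%:R / M%:R * ((m%:R / del) ^+ 2) ^+ m * (M%:R / h ^+ (2 * m)).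
 move: (_ ^+ m) (_ ^- _) => u v; have := Mp; move: (N%:R) (M%:R) => a b b0; by field; rewrite gt_eqF.
have u0 : 0 <= ((m%:R / del) ^+ 2) ^+ m by rewrite exprn_ge0 // sqr_ge0.
apply: ler_pM => //; first by rewrite mulr_ge0 // ltW.
 by rewrite divr_ge0 ?exprn_ge0 // ltW.
by rewrite ler_wpM2r.
Qed.
(** Sum [lor] over the points of a grid of spacing [1 / h] on [[-B, B]] that are far from the
    support: about [2 B h] terms of mean [O(h^-2)] give [O(1/h)]. An eigenvalue at distance
    [3 * del] from the support is within [1 / h <= del] of such a point and makes the sum at least
    [2 ^- m]. *)
Lemma no_outliers (m : nat) (B del D K : R) : (0 < m)%N -> 0 < del -> 0 <= B -> 0 <= D -> 1 <= K ->
 exists2 A : R, 0 < A &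
 forall N M (mu : mxlaw R N M) (eps h : R),
  goodlaw mu K eps -> dominates K h -> N%:R <= h * M%:R -> (0 < N)%N -> N%:R / M%:R <= D ->
  eps = 0 \/ eps = 1 -> h ^+ 65 * rho R M <= 1 -> B + m%:R + 1 <= h -> 2 / del <= h -> rho R M <= del ->
  M%:R * h ^- (2 * m) <= h ^- 2 ->
  exists F : EntT R N M -> R, [/\ tame mu F, forall c, 0 <= F c, Ex mu F <= A / h &
   forall c, F c < 1 -> forall i, `|eigv (gram c) i| <= B ->
    exists2 x, inS (N%:R / M%:R) x & `|x - eigv (gram c) i| < 3 * del].
move=> m0 del0 B0 D0 K1.
have [|A A0 HA] := @lor_trace m (B + m%:R) del D K m0 del0 _ D0 K1; first by rewrite lerDr.
exists ((2 * B + 1) * 2 ^+ m * A) => [|N M mu eps h Hg HK HN N0 HD Heps Hrho hB hdel rdel Hm].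
 by rewrite !mulr_gt0 ?exprn_gt0 // ltr_wpDl // mulr_ge0.
have h1 : 1 <= h by apply: le_trans hB; rewrite lerDr addr_ge0.
have h0 : 0 < h by exact: lt_le_trans h1.
have e0 : 0 < h^-1 by rewrite invr_gt0.
pose ng := (Num.truncn (2 * B * h)).+1.
pose E (i : nat) : R := - B + i%:R * h^-1.
have B2 : 0 <= 2 * B * h by rewrite !mulr_ge0 // ltW.
have E_le (i : 'I_ng) : `|E i| <= B.
 have : i%:R * h^-1 <= 2 * B.
  rewrite ler_pdivrMr // (le_trans _ (_ : (Num.truncn (2 * B * h))%:R <= _)) ?ler_nat -1?ltnS //.
  by rewrite truncn_le.
 have : 0 <= i%:R * h^-1 by rewrite mulr_ge0 // ltW.
 rewrite /E ler_norml; move: (_ * h^-1) => u; lra.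
pose far (i : nat) := `[< forall x, inS (N%:R / M%:R) x -> 2 * del <= `|x - E i| >].
pose L (i : nat) (c : EntT R N M) := \sum_k lor m h^-1 (E i) (eigv (gram c) k).
have HL (i : 'I_ng) : far i -> tame mu (L i) /\ Ex mu (L i) <= A * h ^- 2.
 move=> /asboolP fi; apply: (HA _ _ _ eps) => //.
 by rewrite lerD2r.
pose L' (i : 'I_ng) c := if far i then L i c else 0.
have HL' i : tame mu (L' i) /\ Ex mu (L' i) <= A * h ^- 2.
 rewrite /L'; case: (boolP (far i)) => fi; first exact: HL.
 by rewrite (Ex_cst mu 0); split; [exact: tameC|rewrite mulr_ge0 // ?ltW // invr_gt0 exprn_gt0].
have L0 (i : nat) c : 0 <= L i c by apply: sumr_ge0 => k _; exact: lor_ge0.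
have L0' i c : 0 <= L' i c by rewrite /L'; case: ifP.
have tS : tame mu (fun c => \sum_i L' i c) by apply: tame_sum => i; exact: (HL' i).1.
(* The factor normalises the contribution of one outlier to at least 1, by [lor_near]. *)
exists (fun c => 2 ^+ m * \sum_i L' i c); split.
- exact: tameZ.
- by move=> c; rewrite mulr_ge0 ?exprn_ge0 ?sumr_ge0.
- rewrite ExZ // Ex_sum; last by move=> i; exact: (HL' i).1.
 have -> : (2 * B + 1) * 2 ^+ m * A / h = 2 ^+ m * ((2 * B + 1) * h * (A * h ^- 2)).
  by field; rewrite gt_eqF.
 rewrite ler_wpM2l ?exprn_ge0 //; apply: le_trans (sum_const_le (fun i => (HL' i).2)) _.
 rewrite ler_wpM2r ?mulr_ge0 ?(ltW A0) ?invr_ge0 ?exprn_ge0 ?(ltW h0) //.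
 by rewrite mulrDl mul1r /ng -natr1 lerD // truncn_le.
move=> c Fc i Bi; set l := eigv _ i in Bi *; apply: contrapT => nx.
pose j := Num.truncn ((l + B) * h).
have lB : 0 <= l + B <= 2 * B by move: Bi; rewrite ler_norml; lra.
have lBh : 0 <= (l + B) * h by rewrite mulr_ge0 ?(ltW h0) //; case/andP: lB.
have [j1 j2] : j%:R <= (l + B) * h /\ (l + B) * h < j%:R + 1.
 by have /andP[] := truncn_itv lBh; rewrite -natr1.
have jn : (j < ng)%N by rewrite ltnS; apply: le_truncn; rewrite ler_wpM2r ?(ltW h0) //; case/andP: lB.
have lE : `|l - E j| <= h^-1.
 have -> : l - E j = ((l + B) * h - j%:R) * h^-1 by rewrite /E; field; rewrite gt_eqF.
 by rewrite normrM (ger0_norm (ltW e0)) ler_piMl ?(ltW e0) // ger0_norm ?subr_ge0 // lerBlDl ltW.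
have hd : h^-1 <= del.
 have : h^-1 <= (2 / del)^-1 by rewrite lef_pV2 ?posrE // divr_gt0.
 by rewrite invf_div => /le_trans; apply; rewrite ler_pdivrMr // ler_peMr ?ler1n // ltW.
have fj : far j.
 apply/asboolP => x Sx; rewrite leNgt; apply/negP => xE; apply: nx; exists x => //.
 have -> : x - l = (x - E j) - (l - E j) by ring.
 apply: le_lt_trans (ler_normB _ _) _.
 by move: xE lE hd; move: (`|_|) (`|_|) h^-1 => u v w; lra.
have : 1 <= 2 ^+ m * \sum_i L' i c.
 rewrite (bigD1 (Ordinal jn)) //= {1}/L' /= fj /L (bigD1 i) //= -/l.
 apply: le_trans (_ : 2 ^+ m * lor m h^-1 (E j) l <= _).
  by rewrite -ler_pdivrMl ?exprn_gt0 // mulr1 -exprVn lor_near.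
 rewrite ler_wpM2l ?exprn_ge0 // -addrA lerDl addr_ge0 // sumr_ge0 // => k _; exact: lor_ge0.
by rewrite leNgt Fc.
Qed.

End Outliers.

(** * Curves and contour integrals *)

Section Curves.
Variable R : realType.
Local Notation C := R[i].
Implicit Types (g : R -> C) (f : C -> C) (U : set C).

Lemma ccontP g : (forall t e, 0 < e -> exists2 d, 0 < d & forall t', `|t' - t| < d -> cabs (g t' - g t) < e) ->
 ccont g.
move=> H; split=> t; apply/cvgrPdist_lt => e e0; have [d d0 Hd] := H t e e0; near=> t'.
- rewrite -cReN -cReD; apply: le_lt_trans (le_Re_cabs _) _; rewrite cabsBC; apply: Hd.
 by rewrite distrC; near: t'; exact: cvgr_dist_lt.
- rewrite -cImN -cImD; apply: le_lt_trans (le_Im_cabs _) _; rewrite cabsBC; apply: Hd.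
 by rewrite distrC; near: t'; exact: cvgr_dist_lt.
Unshelve. all: by end_near.
Qed.
Lemma ccont_eps g t e : ccont g -> 0 < e -> exists2 d, 0 < d & forall t', `|t' - t| < d -> cabs (g t' - g t) < e.
move=> [c1 c2] e0; have e2 : 0 < e / 2 by rewrite divr_gt0.
have /cvgrPdist_lt/(_ _ e2) /nbhs_ballP[d1 /= d10 H1] := c1 t.
have /cvgrPdist_lt/(_ _ e2) /nbhs_ballP[d2 /= d20 H2] := c2 t.
exists (Num.min d1 d2) => [|t' H]; first by rewrite lt_min d10.
have := H1 t'; have := H2 t'; rewrite /ball /= ![`|t - _|]distrC => h2 h1.
move: H; rewrite lt_min => /andP[/h1 k1 /h2 k2].
apply: le_lt_trans (cabs_le_ReIm _) _; rewrite !cReD !cImD !cReN !cImN [e]splitr.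
by apply: ltrD; rewrite distrC.
Qed.
(** At radius [r / 2] the terms of the series are bounded by some [T], because late consecutive
    partial sums differ by at most 2; on the disc of radius [r / 4] the series is then dominated by
    a geometric one of ratio one half. *)
Lemma analytic_lipschitz U f z : c_analytic_on U f -> U z ->
 exists2 r : R, 0 < r & exists2 K : R, 0 <= K & forall w, cabs (w - z) < r -> cabs (f w - f z) <= K * cabs (w - z).
move=> H /H [r r0 [a Ha]].
have r2 : 0 < r / 2 by rewrite divr_gt0.
pose S w k := \sum_(i < k) a i * (w - z) ^+ i.
have S0 k : S z k.+1 = a 0%N.
 rewrite /S subrr big_ord_recl mulr1; have -> : \sum_(i < k) a (lift ord0 i) * 0 ^+ lift ord0 i = 0; last by rewrite addr0.
 by apply: big1 => i _; rewrite lift0 exprS mul0r mulr0.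
have fz : f z = a 0%N.
 apply/esym/eqP; rewrite -subr_eq0 -cabs_eq0 eq_le cabs_ge0 andbT; apply/ler_addgt0Pl => e e0; rewrite addr0.
 have [|k Hk] := Ha z _ e e0; first by rewrite subrr cabs0.
 by have := Hk k.+1 (leqnSn _); rewrite -/(S z k.+1) S0 => /ltW.
pose w1 := z + (r / 2)%:C.
have w1z : w1 - z = (r / 2)%:C by rewrite /w1 addrAC subrr add0r.
have [|k0 Hk0] := Ha w1 _ 1 ltr01.
 by rewrite w1z cabs_ge0r ?(ltW r2) // ltr_pdivrMr // ltr_pMr // ltr1n.
pose T := 2 + \sum_(i < k0) cabs (a i * (r / 2)%:C ^+ i).
have T2 : 2 <= T by rewrite lerDl sumr_ge0 // => i _; exact: cabs_ge0.
have aT i : cabs (a i) * (r / 2) ^+ i <= T.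
 have -> : cabs (a i) * (r / 2) ^+ i = cabs (a i * (r / 2)%:C ^+ i).
  by rewrite cabsM cabsX cabs_ge0r // ltW.
 case: (ltnP i k0) => ik.
  rewrite /T (bigD1 (Ordinal ik)) //= addrCA lerDl addr_ge0 // sumr_ge0 // => j _; exact: cabs_ge0.
 have -> : a i * (r / 2)%:C ^+ i = (S w1 i.+1 - f w1) - (S w1 i - f w1).
  by rewrite /S big_ord_recr /= w1z; ring.
 apply: le_trans (cabsB _ _) (le_trans _ T2); rewrite -[2]/(1 + 1); apply: lerD; apply: ltW; apply: Hk0 => //.
 exact: leqW.
exists (r / 4); first by rewrite divr_gt0.
exists (T * (4 / r)) => [|w Hw]; first by rewrite mulr_ge0 ?divr_ge0 ?(ltW r0) ?(le_trans _ T2).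
apply/ler_addgt0Pl => e e0.
have [|k Hk] := Ha w _ e e0; first by apply: lt_trans Hw _; rewrite ltr_pdivrMr // ltr_pMr // ltr1n.
have {Hk} := Hk k.+1 (leqnSn _); rewrite -/(S w k.+1) => Hk.
have -> : f w - f z = - (S w k.+1 - f w) + (S w k.+1 - f z) by ring.
apply: le_trans (cabsD _ _) _; rewrite cabsN; apply: lerD; first exact: ltW.
rewrite fz /S big_ord_recl mulr1 addrAC subrr add0r.
pose q := cabs (w - z) / (r / 2).
have q2 : q <= 2^-1.
 by rewrite /q ler_pdivrMr //; apply: le_trans (ltW Hw) _; apply: le_of_eq; field.
have q0 : 0 <= q by rewrite divr_ge0 ?cabs_ge0 // ltW.
apply: le_trans (cabs_sum _ _ _) _.
apply: le_trans (_ : \sum_(i < k) T * q * 2^-1 ^+ i <= _).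
 apply: ler_sum => i _; rewrite lift0 cabsM cabsX.
 have -> : cabs (a i.+1) * cabs (w - z) ^+ i.+1 = cabs (a i.+1) * (r / 2) ^+ i.+1 * q ^+ i.+1.
  by rewrite -mulrA -exprMn /q mulrCA divff ?mulr1 // gt_eqF.
 rewrite -[T * q * _]mulrA; apply: ler_pM => //; rewrite ?mulr_ge0 ?cabs_ge0 ?exprn_ge0 ?(ltW r2) //.
 by rewrite exprS ler_wpM2l // lerXn2r // nnegrE invr_ge0.
rewrite -mulr_sumr.
have -> : T * (4 / r) * cabs (w - z) = T * q * 2 by rewrite /q; field; rewrite gt_eqF.
have Tq : 0 <= T * q by rewrite mulr_ge0 // (le_trans _ T2).
apply: ler_wpM2l => //.
have := subrX1 (2^-1 : R) k => E.
have -> : \sum_(i < k) (2^-1 : R) ^+ i = 2 * (1 - 2^-1 ^+ k) by move: E; lra.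
by rewrite ler_piMr // lerBlDr lerDl exprn_ge0 // invr_ge0.
Qed.
Lemma ccont_analytic U f g : c_analytic_on U f -> (forall t, U (g t)) -> ccont g -> ccont (fun t => f (g t)).
move=> fU gU gc; apply: ccontP => t e e0; have [r r0 [K K0 H]] := analytic_lipschitz fU (gU t).
have K1 : 0 < K + 1 by rewrite ltr_wpDl.
have [|d d0 Hd] := @ccont_eps g t (Num.min r (e / (K + 1))) gc; first by rewrite lt_min r0 divr_gt0.
exists d => // t' /Hd; rewrite lt_min => /andP[h1 h2].
apply: le_lt_trans (H _ h1) _; move: h2; rewrite ltr_pdivlMr // => h2; apply: le_lt_trans h2.
by rewrite mulrC ler_wpM2l ?cabs_ge0 // lerDl.
Qed.
Lemma ccont_bounded g : ccont g -> exists2 F, 0 <= F & forall t, 0 <= t <= 1 -> cabs (g t) <= F.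
move=> [c1 c2].
have B (u : R -> R) : continuous u -> exists2 F, 0 <= F & forall t, 0 <= t <= 1 -> `|u t| <= F.
 move=> cu; have [||c _ Hc] := @EVT_max R (fun t => `|u t|) 0 1; first exact: ler01.
  by apply: continuous_subspaceT => t; apply: continuous_comp; [exact: cu|exact: norm_continuous].
 by exists `|u c| => // t Ht; apply: Hc; rewrite in_itv.
have [F1 F10 H1] := B _ c1; have [F2 F20 H2] := B _ c2.
exists (F1 + F2) => [|t Ht]; first exact: addr_ge0.
by apply: le_trans (cabs_le_ReIm _) (lerD (H1 _ Ht) (H2 _ Ht)).
Qed.

Variables gx gy : R -> R.
Hypothesis Hc : simple_smooth_closed_curve gx gy.
Local Notation ga := (cpt gx gy).
Definition dcpt (t : R) : C := derive1 gx t +i* derive1 gy t.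

Lemma derivable_cont (u : R -> R) : (forall x, derivable u x 1) -> continuous u.
by move=> H x; apply: differentiable_continuous; apply/derivable1_diffP. Qed.
Lemma ccont_cpt : ccont ga.
have [H _ _ _] := Hc; split.
- apply: (@derivable_cont gx) => x; exact: (H 0%N x).1.
- apply: (@derivable_cont gy) => x; exact: (H 0%N x).2.
Qed.
Lemma ccont_dcpt : ccont dcpt.
have [H _ _ _] := Hc; split.
- apply: (@derivable_cont (derive1 gx)) => x; rewrite -derive1n1; exact: (H 1%N x).1.
- apply: (@derivable_cont (derive1 gy)) => x; rewrite -derive1n1; exact: (H 1%N x).2.
Qed.
Lemma cpt_mod t : exists2 t', 0 <= t' <= 1 & ga t = ga t'.
have [_ _ P _] := Hc.
have S s (n : nat) : gx (s + n%:R) = gx s /\ gy (s + n%:R) = gy s.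
 elim: n => [|n [e1 e2]]; first by rewrite addr0.
 by rewrite -natr1 addrA !(P _).1 !(P _).2.
have Z s (k : int) : ga (s + k%:~R) = ga s.
 case: k => n; first by rewrite /cpt !(S s n).1 !(S s n).2.
 have [e1 e2] := S (s + (Negz n)%:~R) n.+1.
 by rewrite /cpt -e1 -e2 NegzE rmorphN /= -pmulrn addrNK.
exists (t - (Num.floor t)%:~R); last by rewrite -rmorphN Z.
by have /andP[h1 h2] := floor_itv t; rewrite subr_ge0 h1 /= lerBlDl; rewrite rmorphD /= addrC in h2; rewrite addrC ltW.
Qed.
Lemma cpt_lipschitz : exists2 L, 0 <= L & forall s t, 0 <= s <= t -> t <= 1 -> cabs (ga t - ga s) <= L * (t - s).
have [H _ _ _] := Hc; have [D D0 HD] := ccont_bounded ccont_dcpt.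
have B (u : R -> R) : (forall x, derivable u x 1) -> (forall t, 0 <= t <= 1 -> `|derive1 u t| <= D) ->
  forall s t, 0 <= s <= t -> t <= 1 -> `|u t - u s| <= D * (t - s).
 move=> du Du s t /andP[s0 st] t1.
 have [||c ci ->] := @MVT_segment R u (derive1 u) s t st.
 - by move=> x _; rewrite derive1E; apply: derivableP.
 - by apply: continuous_subspaceT; exact: derivable_cont.
 rewrite normrM (ger0_norm (_ : 0 <= t - s)) ?subr_ge0 // ler_wpM2r ?subr_ge0 //; apply: Du.
 by move: ci; rewrite in_itv /= => /andP[? ?]; rewrite (le_trans s0) // (le_trans _ t1).
exists (2 * D) => [|s t st t1]; first by rewrite mulr_ge0.
apply: le_trans (cabs_le_ReIm _) _; rewrite mulr_natl mulrDl /=.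
apply: lerD.
- exact: (B gx (fun x => (H 0%N x).1) (fun x hx => le_trans (le_Re_cabs (dcpt x)) (HD _ hx)) _ _ st t1).
- exact: (B gy (fun x => (H 0%N x).2) (fun x hx => le_trans (le_Im_cabs (dcpt x)) (HD _ hx)) _ _ st t1).
Qed.
Lemma cpt_bounded : exists2 G, 0 <= G & forall t, cabs (ga t) <= G.
have [G G0 H] := ccont_bounded ccont_cpt; exists G => // t.
by have [t' ht ->] := cpt_mod t; exact: H.
Qed.
Lemma ccont_phi U f : c_analytic_on U f -> ctrace gx gy `<=` U -> ccont (fun t => f (ga t) * dcpt t).
move=> fU HU; apply: ccontM ccont_dcpt; apply: ccont_analytic fU _ ccont_cpt => t.
by apply: HU; have [t' ht ->] := cpt_mod t; exists t'.
Qed.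

End Curves.

(** * Extrapolation of the resolvent difference from nodes off the real axis *)

Section ResolventDifference.
Variable R : realType.
Local Notation C := R[i].
Variables (N M : nat) (Y : 'M[C]_(N, M)) (b : 'cV[C]_N) (d : R).
Hypotheses (d0 : 0 < d) (Hb : nv b = 1).
Let W := Y *m adjmx Y.

Definition kf (z : C) : C := c0 W b z - mp_stieltjes d z.

(** Both halves of [kf] integrate the Cauchy kernel against a probability measure, one on the
    eigenvalues and one on the support, so a combination that is small at these points stays small.
    The first half costs 1 and the second 2. *)
Lemma kf_lin (I : Type) (r : seq I) (c : I -> C) (z : I -> C) (del e : R) : 0 < del ->
 (forall i x, inS d x -> del <= cabs (x%:C - z i)) -> 0 <= e ->
 (forall x, inS d x \/ (exists k, x = eigv W k) -> cabs (\sum_(i <- r) c i * (x%:C - z i)^-1) <= e) ->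
 cabs (\sum_(i <- r) c i * kf (z i)) <= 3 * e.
move=> del0 Hz e0 H.
have okc i := (lamok_cauchy del0 (Hz i)).1.
have okZ i := LamZ d0 (c i) (okc i).
have [okL LE] := Lam_sum d0 r (fun i => (okZ i).1).
have -> : \sum_(i <- r) c i * kf (z i) =
  \sum_k (eigw W b k)%:C * \sum_(i <- r) c i * ((eigv W k)%:C - z i)^-1
  - Lam d (fun x => \sum_(i <- r) c i * (x%:C - z i)^-1).
 rewrite [Lam _ _]LE.
 under [X in _ - X]eq_bigr do rewrite (okZ _).2 Lam_cauchy.
 under [X in X - _]eq_bigr do rewrite mulr_sumr.
 rewrite exchange_big /= -sumrB; apply: eq_bigr => i _.
 rewrite /kf mulrBr c0_eig mulr_sumr; congr (_ - _); apply: eq_bigr => k _; exact: mulrCA.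
apply: le_trans (cabsB _ _) _.
have -> : 3 * e = e + 2 * e by ring.
apply: lerD; last by apply: Lam_le => // x Sx; apply: H; left.
apply: le_trans (cabs_sum _ _ _) _.
rewrite -[e]mul1r -{1}Hb -(eigw_sum Y b) mulr_suml; apply: ler_sum => k _.
rewrite cabsM cabs_ge0r ?eigw_ge0 // ler_wpM2l ?eigw_ge0 //.
by apply: H; right; exists k.
Qed.
Lemma kf_lip z z' del : 0 < del ->
 (forall x, inS d x \/ (exists k, x = eigv W k) -> del <= cabs (x%:C - z) /\ del <= cabs (x%:C - z')) ->
 cabs (kf z - kf z') <= 3 * (cabs (z - z') / del ^+ 2).
move=> del0 H.
have := @kf_lin bool [:: true; false] (fun i => if i then 1 else -1) (fun i => if i then z else z') del
 (cabs (z - z') / del ^+ 2) del0.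
rewrite !big_cons big_nil addr0 mul1r mulN1r; apply.
- by move=> i x Sx; have [] := H x (or_introl Sx); case: i.
- by rewrite divr_ge0 ?cabs_ge0 ?sqr_ge0.
move=> x Sx; have [h h'] := H x Sx; rewrite !big_cons big_nil addr0 mul1r mulN1r.
have n0 : x%:C - z != 0 by rewrite -cabs_gt0 (lt_le_trans del0).
have n0' : x%:C - z' != 0 by rewrite -cabs_gt0 (lt_le_trans del0).
have -> : (x%:C - z)^-1 - (x%:C - z')^-1 = (z - z') * ((x%:C - z)^-1 * (x%:C - z')^-1).
 by move: n0 n0'; move: (x%:C) => X n0 n0'; field; rewrite ?n0 ?n0'.
rewrite cabsM ler_wpM2l ?cabs_ge0 // cabsM -exprVn expr2 !cabsV.
by apply: ler_pM; rewrite ?invr_ge0 ?cabs_ge0 // lef_pV2 // posrE ?cabs_gt0.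
Qed.
(** A vertical step away from the real axis, upwards if [Im z = 0]: it brings the point closer to no
    real number, and every node reached has height at least [eta]. *)
Definition vstep (eta : R) (z : C) : C := 0 +i* (if 0 <= Im z then eta else - eta).
Definition excoef (m j : nat) : C := (-1) ^+ j * 'C(m, j.+1)%:R.

Lemma cabs_vstep (eta : R) z : 0 <= eta -> cabs (vstep eta z) = eta.
move=> e0; have -> : vstep eta z = 'i * (if 0 <= Im z then eta else - eta)%:C.
 by apply: eqcP; rewrite ?cReM ?cImM /=; ring.
rewrite cabsM cabs_real; have -> : cabs ('i : C) = 1 by rewrite /Normc.normc /= expr0n expr1n add0r sqrtr1.
by rewrite mul1r; case: ifP; rewrite ?normrN ger0_norm.
Qed.
Lemma Im_vstep (eta : R) z (j : nat) : Im (z + j%:R * vstep eta z) = Im z + j%:R * (if 0 <= Im z then eta else - eta).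
have -> : (j%:R : C) = (j%:R : R)%:C by rewrite rmorph_nat.
by rewrite cImD cImM cIm_real mul0r addr0 cRe_real.
Qed.
Lemma vstep_away (eta : R) z (x : R) j : 0 <= eta -> cabs (x%:C - z) <= cabs (x%:C - (z + j%:R * vstep eta z)).
move=> e0; rewrite -(@ler_pXn2r _ 2) ?nnegrE ?cabs_ge0 // !cabs_sq.
have -> : Re (x%:C - (z + j%:R * vstep eta z)) = Re (x%:C - z).
 have -> : (j%:R : C) = (j%:R : R)%:C by rewrite rmorph_nat.
 by rewrite !cReD !cReN cReD cReM cIm_real mul0r subr0 /= mulr0 addr0.
rewrite lerD2l !cImD !cImN !cIm_real !sub0r !sqrrN Im_vstep.
have : 0 <= j%:R * eta by rewrite mulr_ge0.
case: ifP => [|/negbT]; rewrite -?ltNge => h1 h2; nra.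
Qed.
Lemma Im_vstep_ge (eta : R) z j : 0 <= eta -> eta <= `|Im (z + j.+1%:R * vstep eta z)|.
move=> e0; rewrite Im_vstep.
have : eta <= j.+1%:R * eta by rewrite ler_peMl // ler1n.
case: ifP => [|/negbT]; rewrite -?ltNge => h1 h2.
 by rewrite ger0_norm; lra.
by rewrite ler0_norm; lra.
Qed.
(** Solve the identity [extrapolation] for its term [j = 0]; by [vstep_away] each factor of the
    product is at least [del]. *)
Lemma cauchy_extrapolation (m : nat) (eta : R) z (x : R) del : 0 < del -> 0 <= eta -> del <= cabs (x%:C - z) ->
 cabs ((x%:C - z)^-1 - \sum_(j < m) excoef m j * (x%:C - (z + j.+1%:R * vstep eta z))^-1)
  <= m`!%:R * eta ^+ m / del ^+ m.+1.
move=> del0 e0 H; set e := vstep eta z.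
have A j : del <= cabs (x%:C - z - j%:R * e).
 by apply: le_trans H _; have := vstep_away z x j e0; rewrite opprD addrA.
have N0 j : x%:C - z - j%:R * e != 0 by rewrite -cabs_gt0 (lt_le_trans del0).
have := @extrapolation _ m (x%:C - z) e (fun j _ => N0 j).
move=> E; have {}E : (x%:C - z)^-1 + \sum_(j < m) (-1) ^+ lift ord0 j * 'C(m, lift ord0 j)%:R / (x%:C - z - (lift ord0 j : nat)%:R * e) =
  (- e) ^+ m * m`!%:R / \prod_(j < m.+1) (x%:C - z - j%:R * e).
 by rewrite -E [RHS]big_ord_recl mul0r subr0 expr0 bin0 !mul1r.
have -> : (x%:C - z)^-1 - \sum_(j < m) excoef m j * (x%:C - (z + j.+1%:R * e))^-1 =
 (- e) ^+ m * m`!%:R / \prod_(j < m.+1) (x%:C - z - j%:R * e).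
 rewrite -E; congr (_ + _); rewrite -sumrN; apply: eq_bigr => j _.
 by rewrite lift0 /excoef exprS opprD addrA; ring.
rewrite !cabsM cabsX cabsN cabs_natr (cabs_vstep _ e0) cabsV [eta ^+ m * _]mulrC.
rewrite ler_wpM2l ?mulr_ge0 ?exprn_ge0 //.
have -> : cabs (\prod_(j < m.+1) (x%:C - z - j%:R * e)) = \prod_(j < m.+1) cabs (x%:C - z - j%:R * e).
 by elim/big_rec2: _ => [|j u v _ <-]; rewrite ?cabs1 ?cabsM.
rewrite lef_pV2 ?posrE ?exprn_gt0 //; last by apply: prodr_gt0 => j _; rewrite cabs_gt0.
by rewrite -[m.+1 in leLHS]card_ord -prodr_const; apply: ler_prod => j _; rewrite ltW //=.
Qed.
Lemma kf_extrapolation (m : nat) (eta : R) z del : 0 < del -> 0 <= eta ->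
 (forall x, inS d x \/ (exists k, x = eigv W k) -> del <= cabs (x%:C - z)) ->
 cabs (kf z - \sum_(j < m) excoef m j * kf (z + j.+1%:R * vstep eta z)) <= 3 * (m`!%:R * eta ^+ m / del ^+ m.+1).
move=> del0 e0 H.
(* [None] stands for the point [z] and [Some j] for the nodes, which turns the difference into one
   combination for [kf_lin]. *)
pose c (i : option 'I_m) : C := if i is Some j then - excoef m j else 1.
pose zz (i : option 'I_m) : C := if i is Some j then z + j.+1%:R * vstep eta z else z.
have S (F : C -> C) : \sum_(i <- None :: [seq Some j | j <- index_enum 'I_m]) c i * F (zz i) =
  F z - \sum_(j < m) excoef m j * F (z + j.+1%:R * vstep eta z).
 by rewrite big_cons big_map mul1r -sumrN; congr (_ + _); apply: eq_bigr => j _; rewrite mulNr.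
rewrite -(S kf); apply: (kf_lin del0).
- move=> [j|] x Sx /=; last by apply: H; left.
 by apply: le_trans (vstep_away _ _ _ e0); apply: H; left.
- by rewrite divr_ge0 ?mulr_ge0 ?exprn_ge0 // ltW.
move=> x Sx; rewrite (S (fun w => (x%:C - w)^-1)).
by apply: cauchy_extrapolation => //; exact: H.
Qed.

End ResolventDifference.

Lemma norm_i2pi (R : realType) : cabs (((2 * pi)%:C * 'i)^-1 : R[i]) <= 1.
have p2 : (2 : R) <= 2 * pi by have := pi_ge2 R; lra.
rewrite cabsV cabsM cabs_ge0r; last exact: le_trans p2.
have -> : cabs ('i : R[i]) = 1 by rewrite /Normc.normc /= expr0n expr1n add0r sqrtr1.
by rewrite mulr1 invf_le1 ?(lt_le_trans _ p2) // (le_trans _ p2) // ler1n.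
Qed.

(** * Quadrature of the contour integrals *)

Section ContourApproximation.
Variable R : realType.
Local Notation C := R[i].
Local Notation leb := (@lebesgue_measure R).
Variables (gx gy : R -> R) (f : C -> C).
Local Notation ga := (cpt gx gy).
Local Notation phi := (fun t => f (ga t) * dcpt gx gy t).
Variables (F L : R).
Hypotheses (cga : ccont ga) (cphi : ccont phi).
Hypotheses (F0 : 0 <= F) (HF : forall t, 0 <= t <= 1 -> cabs (phi t) <= F).
Hypotheses (L0 : 0 <= L) (HL : forall s t, 0 <= s <= t -> t <= 1 -> cabs (ga t - ga s) <= L * (t - s)).
Variables (M m : nat) (eta : R).
Hypotheses (M0 : (0 < M)%N) (eta0 : 0 <= eta).

Definition tagz (r : nat) : C := ga (r%:R / M%:R).
(** Indices up to [M] included are used later: half-open cells inside [[0, 1]] alone would miss the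
    endpoint [t = 1]. *)
Definition cell (r : nat) : set R := `[r%:R / M%:R, r.+1%:R / M%:R[.
(** The weight integrates [phi] exactly over the cell; only the resolvent difference is frozen at
    the tag, so the error depends on [phi] through its supremum alone. *)
Definition cellw (r : nat) : C := cI leb `[0, 1] (fun t => phi t * (\1_(cell r) t)%:C).
Definition quadz (p : 'I_M.+1 * 'I_m) : C := tagz p.1 + p.2.+1%:R * vstep eta (tagz p.1).
Definition quada (p : 'I_M.+1 * 'I_m) : C := ((2 * pi)%:C * 'i)^-1 * cellw p.1 * excoef R m p.2.

Let Mp : (0 : R) < M%:R. Proof. by rewrite ltr0n. Qed.
Let ucst (c : R) : leb.-integrable `[0, 1] (EFin \o fun=> c).
exact: integrable_cst_seg. Qed.
Let mcell r : measurable (cell r). Proof. exact: mitv. Qed.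
Lemma mfc_phi : mfc phi.
by case: cphi => c1 c2; split; exact: continuous_measurable_fun. Qed.
Lemma mfc_cell r : mfc (fun t => phi t * (\1_(cell r) t)%:C).
by apply: mfcM mfc_phi (mfc_real _); exact: measurable_indic. Qed.
Lemma int_cell r : cintegrable leb `[0, 1] (fun t => phi t * (\1_(cell r) t)%:C).
have [m1 m2] := mfc_cell r.
apply: (cintegrable_le (mitv `[0, 1]) (measurable_funTS m1) (measurable_funTS m2) (ucst F)).
move=> t; rewrite /= in_itv /= => /HF H; rewrite cabsM; apply: le_trans H.
by rewrite ler_piMr ?cabs_ge0 // cabs_real indicE; case: (_ \in _); rewrite ?normr0 ?normr1.
Qed.
Lemma cell_ind t (G : nat -> C) : 0 <= t <= 1 ->
 exists2 r : 'I_M.+1, r%:R / M%:R <= t <= r.+1%:R / M%:R &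
  \sum_(s < M.+1) G s * (\1_(cell s) t)%:C = G r.
move=> /andP[t0 t1]; have tM : 0 <= t * M%:R by rewrite mulr_ge0 // ltW.
have /andP[k1 k2] := truncn_itv tM; set k := Num.truncn _ in k1 k2.
have kM : (k < M.+1)%N by rewrite -(ltr_nat R) (le_lt_trans k1) // (le_lt_trans (ler_piMl (ltW Mp) t1)) // ltr_nat.
exists (Ordinal kM) => /=; first by rewrite ler_pdivrMr // k1 ler_pdivlMr // ltW.
rewrite (bigD1 (Ordinal kM)) //= big1 ?addr0 => [|s sk].
 rewrite indicE mem_set ?mulr1 // /cell /= in_itv /= ler_pdivrMr // k1 ltr_pdivlMr //.
rewrite indicE memNset ?mulr0 // /cell /= in_itv /= ler_pdivrMr // ltr_pdivlMr // => /andP[s1 s2].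
case/negP: sk; apply/eqP/val_inj => /=; apply/eqP; rewrite eqn_leq -ltnS -(ltr_nat R) (le_lt_trans s1) //=.
by rewrite -ltnS -(ltr_nat R) (le_lt_trans k1).
Qed.
Lemma cellw_le r : cabs (cellw r) <= 2 * (F / M%:R).
have iI : leb.-integrable `[0, 1] (EFin \o (\1_(cell r) : R -> R)).
 apply: (le_integrable (mitv _) _ _ (ucst 1)).
  by apply: measurable_funTS; apply/measurable_EFinP; apply: measurable_indic; exact: mitv.
 move=> t _; rewrite /= lee_fin normr1 indicE; by case: (_ \in _); rewrite ?normr0 ?normr1.
have iB : leb.-integrable `[0, 1] (EFin \o (fun t => F * \1_(cell r) t)).
 have [i1 _] := integrable_lin2 F 0 (mitv _) iI iI.
 by apply: (eq_integrable_R (mitv _) _ i1) => t _; rewrite mul0r addr0.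
apply: le_trans (cI_le (mitv _) (int_cell r) iB _) _.
 move=> t; rewrite /= in_itv /= => /HF H; rewrite cabsM cabs_real; apply: ler_pM; rewrite ?cabs_ge0 //.
 by rewrite indicE; case: (_ \in _); rewrite ?normr0 ?normr1.
rewrite ler_wpM2l //.
rewrite RintegralZl //; apply: ler_wpM2l => //.
rewrite /Rintegral integral_indic //; last exact: mitv.
have cl : leb (cell r) = (M%:R^-1)%:E.
 have -> : leb (cell r) = ((r.+1%:R / M%:R)%:E - (r%:R / M%:R)%:E)%E.
  rewrite /cell lebesgue_measure_itv /= lte_fin ltr_pM2r ?invr_gt0 // ltr_nat ltnSn //.
 by rewrite -EFinB -mulrBl -natr1 addrAC subrr add0r mul1r.
have le : (leb (cell r `&` `[0%R, 1%R]) <= (M%:R^-1)%:E)%E.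
 by rewrite -cl; apply: le_measure; [rewrite inE; apply: measurableI; [exact: mitv|exact: mitv]|rewrite inE; exact: mitv|exact: subIsetl].
rewrite -[leRHS]/(fine (M%:R^-1)%:E); apply: fine_le => //.
by rewrite ge0_fin_numE //; apply: le_lt_trans le _; exact: ltry.
Qed.
(** Cell weights are [O(1 / M)] and binomial coefficients add up to at most [2 ^+ m]: the number of
    nodes grows with [M] while the total weight stays bounded. *)
Lemma quada_sum : \sum_p cabs (quada p) <= 4 * F * 2 ^+ m.
have H (p : 'I_M.+1 * 'I_m) : cabs (quada p) <= 2 * (F / M%:R) * 'C(m, p.2.+1)%:R.
 rewrite /quada /excoef !cabsM cabsX cabsN cabs1 expr1n mul1r cabs_natr.
 rewrite ler_wpM2r // -[leRHS]mul1r; apply: ler_pM; rewrite ?cabs_ge0 ?cellw_le //; exact: norm_i2pi.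
apply: le_trans (ler_sum _ (fun p _ => H p)) _.
rewrite -(pair_bigA _ (fun (r : 'I_M.+1) (j : 'I_m) => 2 * (F / M%:R) * 'C(m, j.+1)%:R)) /=.
have B : \sum_(j < m) ('C(m, j.+1)%:R : R) <= 2 ^+ m.
 have -> : (2 : R) ^+ m = \sum_(j < m.+1) ('C(m, j)%:R : R).
  rewrite -natr_sum -natrX; congr (_%:R); rewrite (expnDn 1 1 m); apply: eq_bigr => j _.
  by rewrite !exp1n !muln1.
 by rewrite big_ord_recl lerDr.
apply: le_trans (sum_const_le (B := 2 * (F / M%:R) * 2 ^+ m) _) _ => [r|].
 by rewrite -mulr_sumr ler_wpM2l // mulr_ge0 // divr_ge0.
have -> : M.+1%:R * (2 * (F / M%:R) * 2 ^+ m) = 2 * F * (M.+1%:R / M%:R) * 2 ^+ m by ring.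
rewrite ler_wpM2r ?exprn_ge0 //; have -> : 4 * F = 2 * F * 2 by ring.
by rewrite ler_wpM2l ?mulr_ge0 // ler_pdivrMr // -natrM ler_nat mul2n -addnn -addn1 leq_add2l.
Qed.

Section Approx.
Variables (N : nat) (Y : 'M[C]_(N, M)) (b : 'cV[C]_N) (del : R).
Hypotheses (N0 : (0 < N)%N) (Hb : nv b = 1) (del0 : 0 < del).
Local Notation dd := (N%:R / M%:R : R).
Let W := Y *m adjmx Y.
Hypothesis Hsep : forall x t, inS dd x \/ (exists k, x = eigv W k) -> del <= cabs (x%:C - ga t).
Local Notation kk := (kf Y b dd).

Let dd0 : 0 < dd. Proof. by rewrite divr_gt0 ?ltr0n. Qed.
Lemma ccont_kf : ccont (fun t => kk (ga t)).
apply: ccontP => t e e0; have e1 : 0 < e * del ^+ 2 / 3 by rewrite divr_gt0 // mulr_gt0 // exprn_gt0.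
have [a a0 Ha] := ccont_eps t cga e1; exists a => // t' /Ha H.
apply: le_lt_trans (kf_lip dd0 Hb del0 _) _; first by move=> x Hx; split; exact: Hsep.
by rewrite mulrA ltr_pdivrMr ?exprn_gt0 // mulrC -ltr_pdivlMr.
Qed.
(** Freezing the contour point costs [L / M] and extrapolating costs [eta ^+ m]; both have to beat
    the prefactor [sqrt M]. *)
Lemma quad_approx : cabs (Ifun M W b gx gy f - (Num.sqrt (M%:R : R))%:C * \sum_p quada p * kk (quadz p)) <=
 Num.sqrt M%:R * (2 * (F * (3 * (L / M%:R / del ^+ 2) + 3 * (m`!%:R * eta ^+ m / del ^+ m.+1)))).
set B := 3 * (L / M%:R / del ^+ 2) + 3 * (m`!%:R * eta ^+ m / del ^+ m.+1).
set w := (((2 * pi)%:C * 'i)^-1 : C).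
pose K (r : nat) := \sum_(j < m) excoef R m j * kk (tagz r + j.+1%:R * vstep eta (tagz r)).
have int_r (r : 'I_M.+1) := cIZ (K r) (mitv `[0, 1]) (int_cell r).
have [iS eS] := cI_sum (index_enum 'I_M.+1) (mitv `[0, 1]) (fun r : 'I_M.+1 => (int_r r).1).
have cJ : ccont (fun t => phi t * kk (ga t)) by exact: ccontM cphi ccont_kf.
have iJ := ccont_integrable 0 1 cJ.
have [iN eN] := cIZ (-1) (mitv `[0, 1]) iS.
have [iD eD] := cID (mitv `[0, 1]) iJ iN.
have eDS := etrans eD (congr1 (fun u => _ + u) (etrans eN (etrans (congr1 (fun u => -1 * u) eS) (mulN1r _)))).
have -> : Ifun M W b gx gy f - (Num.sqrt (M%:R : R))%:C * \sum_p quada p * kk (quadz p) =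
  (Num.sqrt (M%:R : R))%:C * (w * cI leb `[0, 1] (fun t => phi t * kk (ga t) +
   -1 * (\sum_(r < M.+1) K r * (phi t * (\1_(cell r) t)%:C)))).
 rewrite eDS mulrBr mulrBr; congr (_ - _).
  rewrite mulrA; congr (_ * _).
  rewrite /contour_int; apply: (@eq_cI _ _ R leb `[0, 1]) => t _; rewrite /kf /dcpt; ring.
 congr (_ * _); rewrite mulr_sumr -(pair_bigA _ (fun r j => quada (r, j) * kk (quadz (r, j)))) /=.
 apply: eq_bigr => r _; rewrite (int_r r).2 -/(cellw r) /K mulr_suml mulr_sumr; apply: eq_bigr => j _.
 by rewrite /quada -/w; ring.
rewrite cabsM cabs_ge0r ?sqrtr_ge0 // ler_wpM2l ?sqrtr_ge0 // cabsM -[leRHS]mul1r.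
apply: ler_pM; rewrite ?cabs_ge0 ?norm_i2pi //.
have -> : F * B = Rintegral leb `[0, 1] (fun=> F * B) by rewrite Rint_cst_itv // subr0 mulr1.
apply: cI_le (mitv _) iD (ucst _) _ => t; rewrite /= in_itv /= => Ht.
have [r /andP[r1 r2] e] := cell_ind K Ht.
have -> : phi t * kk (ga t) + -1 * (\sum_(r < M.+1) K r * (phi t * (\1_(cell r) t)%:C)) = phi t * (kk (ga t) - K r).
 have -> : \sum_(r < M.+1) K r * (phi t * (\1_(cell r) t)%:C) = phi t * K r.
  rewrite -e mulr_sumr; apply: eq_bigr => s _; exact: mulrCA.
 by move: (f _ * _) (kk _) (K r) => u v w'; ring.
rewrite cabsM; apply: ler_pM; rewrite ?cabs_ge0 ?HF //.
have -> : kk (ga t) - K r = (kk (ga t) - kk (tagz r)) + (kk (tagz r) - K r) by ring.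
apply: le_trans (cabsD _ _) _; apply: lerD.
 apply: le_trans (kf_lip dd0 Hb del0 _) _; first by move=> x Hx; split; exact: Hsep.
 rewrite ler_wpM2l // ler_wpM2r ?invr_ge0 ?exprn_ge0 ?(ltW del0) //.
 have /andP[t0 t1] := Ht; have r0 : 0 <= r%:R / M%:R :> R by rewrite divr_ge0.
 apply: le_trans (HL _ t1) _; first by rewrite r0.
 by rewrite ler_wpM2l // lerBlDl; move: r2; rewrite -natr1 mulrDl mul1r.
by apply: (kf_extrapolation dd0 Hb m del0 eta0) => x Hx; exact: Hsep.
Qed.

End Approx.
End ContourApproximation.

(** * Comparison of the increments *)

Lemma weighted_sq (R : realType) (I : finType) (a v : I -> R) : (forall i, 0 <= a i) ->
 (\sum_i a i * v i) ^+ 2 <= (\sum_i a i) * \sum_i a i * v i ^+ 2.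
move=> a0; have := cauchy_schwarz_sum (fun i => Num.sqrt (a i)) (fun i => Num.sqrt (a i) * v i).
have e i : Num.sqrt (a i) ^+ 2 = a i by rewrite sqr_sqrtr.
congr (_ <= _ * _).
- by congr (_ ^+ 2); apply: eq_bigr => i _; rewrite mulrA -expr2 e.
- by apply: eq_bigr => i _; rewrite e.
- by apply: eq_bigr => i _; rewrite exprMn e.
Qed.
Lemma ip_rank1 (R : realType) N (G : 'M[R[i]]_N) (b x : 'cV[R[i]]_N) :
 ip b (G *m x) * ip x (G *m b) = ip x ((G *m b *m (adjmx b *m G)) *m x).
rewrite /ip -!mulmxA !mulmxA -(mulmxA (adjmx x *m G *m b)) -(mulmxA (adjmx x *m G *m b)).
by rewrite mulrC [RHS]mxE big_ord1 -mulmxA.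
Qed.
Lemma inv_expand (F : fieldType) (A D : F) : 1 + A != 0 -> 1 + (A + D) != 0 ->
 let t := (1 + A)^-1 in
 (1 + (A + D))^-1 = t - t * D * (1 + (A + D))^-1 /\
 (1 + (A + D))^-1 = t - t ^+ 2 * D + t ^+ 2 * D ^+ 2 * (1 + (A + D))^-1.
by move=> h1 h2 /=; split; field; rewrite ?h1 ?h2. Qed.
Lemma node_terms (R : realDomainType) (u v w : R) : 0 <= u -> 0 <= v -> 0 <= w ->
 [/\ 1 <= 1 + (u + v) + w, u <= 1 + (u + v) + w, v <= 1 + (u + v) + w & w <= 1 + (u + v) + w].
by move=> hu hv hw; split; lra. Qed.
Lemma Ex_node d (T : measurableType d) (R : realType) (P : probability T R) (f g k : T -> R) (a b : R) :
 tame P f -> tame P g -> tame P k ->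
 tame P (fun t => 1 + (f t + g t) / a + k t / b) /\
 Ex P (fun t => 1 + (f t + g t) / a + k t / b) = 1 + (Ex P f + Ex P g) / a + Ex P k / b.
move=> tf tg tk.
have q1 := tameZ a^-1 (tameD tf tg); have q2 := tameZ b^-1 tk; have q3 := tameD (tameC P 1) q1.
have E : (fun t => 1 + (f t + g t) / a + k t / b) = (fun t => 1 + a^-1 * (f t + g t) + b^-1 * k t).
 by apply: funext => t; rewrite [_ / a]mulrC [_ / b]mulrC.
rewrite E; split; first exact: tameD.
rewrite (ExD q3 q2) (ExD (tameC P 1) q1) Ex_cst !ExZ // ?ExD //; last exact: tameD.
by rewrite [_ / a]mulrC [_ / b]mulrC.
Qed.
Lemma node_sum (R : realDomainType) (h : R) (k : nat) (x y : R) : 16 <= h ->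
 x <= h ^+ k.+1 + h ^+ k.+1 -> y <= h ^+ k -> 1 + x + y <= h ^+ k.+3.
move=> h16 hx hy; have h1 : 1 <= h by apply: le_trans h16; rewrite ler1n.
have p8 : 1 <= h ^+ k by exact: exprn_ege1.
have p9 : h ^+ k <= h ^+ k.+1 by exact: ler_weXn2l.
have : 16 * h ^+ k.+1 <= h ^+ k.+2 by rewrite [h ^+ k.+2]exprS ler_wpM2r // exprn_ge0 // (le_trans _ h1).
have : h ^+ k.+2 <= h ^+ k.+3 by exact: ler_weXn2l.
move: hx hy p8 p9; move: (h ^+ k) (h ^+ k.+1) (h ^+ k.+2) (h ^+ k.+3) => u v w s; lra.
Qed.
Lemma node_final (R : realFieldType) (h : R) (k : nat) (m u v w : R) : 16 <= h -> 0 < m ->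
 u <= h ^+ k.+1 * m ^+ 4 -> v <= h ^+ k.+1 * m ^+ 4 -> w <= h ^+ k * m ^+ 2 ->
 1 + (u + v) / m ^+ 4 + w / m ^+ 2 <= h ^+ k.+3.
move=> h16 m0 hu hv hw; apply: node_sum => //.
 by rewrite ler_pdivrMr ?exprn_gt0 // mulrDl; exact: lerD.
by rewrite ler_pdivrMr ?exprn_gt0.
Qed.
Lemma two_mul_le (R : realDomainType) (x y : R) : 2 * (x * y) <= x ^+ 2 + y ^+ 2.
have := sqr_ge0 (x - y); have -> : (x - y) ^+ 2 = x ^+ 2 + y ^+ 2 - 2 * (x * y) by ring.
by rewrite subr_ge0.
Qed.
Lemma cube_le (R : realDomainType) (h x y z : R) : 1 <= h -> 0 <= x -> x ^+ 2 <= h * y -> y ^+ 2 <= h * z ->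
 x ^+ 3 <= 1 + h ^+ 3 * z.
move=> h1 x0 xy yz; have h0 : 0 <= h by exact: le_trans h1.
apply: le_trans (_ : 1 + x ^+ 4 <= _).
 have [x1|x1] := leP x 1; first by apply: le_trans (exprn_ile1 _ x0 x1) _; rewrite lerDl exprn_ge0.
 by apply: le_trans (ler_weXn2l (ltW x1) (_ : (3 <= 4)%N)) _ => //; rewrite lerDr.
rewrite lerD2l (exprM x 2 2); apply: le_trans (_ : (h * y) ^+ 2 <= _).
 by rewrite lerXn2r // ?nnegrE ?sqr_ge0 // (le_trans _ xy) // sqr_ge0.
rewrite exprMn (exprSr h 2) -mulrA ler_wpM2l // exprn_ge0 //.
Qed.

Section OneColumn.
Variables (R : realType) (N M : nat).
Local Notation C := R[i].
Variables (K eps h : R).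
Hypotheses (HK : dominates K h) (HN : N%:R <= h * M%:R) (K1 : 1 <= K).
Local Notation m := (M%:R^-1 : R).
Local Notation rho := (rho R M).
Variable j : 'I_M.
Variables (Y : 'M[C]_(N, M)) (b : 'cV[C]_N).
Hypothesis Hb : nv b <= 1.
Local Notation xc := (fun c : EntT R N M => col j (entmx c)).
Implicit Types (x : 'cV[C]_N).
Local Opaque Rs.

Let h16 : 16 <= h.
apply: le_trans HK; have : 1 <= K ^+ 2 by rewrite exprn_ege1.
by move: (K ^+ 2) => k; lra.
Qed.
Let h1 : 1 <= h. Proof. by apply: le_trans h16; rewrite ler1n. Qed.
Let h0 : 0 <= h. Proof. exact: le_trans h1. Qed.
Let M0 : (0 < M)%N. Proof. by case: M j => // -[]. Qed.
Let m0 : 0 < m. Proof. by rewrite invr_gt0 ltr0n. Qed.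
Let r0 : 0 < rho. Proof. by rewrite rhoE !sqrtr_gt0. Qed.
Let rr := ltW r0.

Section Node.
Variable z : C.
Hypotheses (z0 : Im z != 0) (Hz : `|Im z|^-1 <= h) (Hzc : cabs z <= h).
Local Notation G := (Rs Y z).
Definition n_q x := ip x (G *m x).
Definition n_l1 x := ip x (G *m b).
Definition n_l2 x := ip b (G *m x).
Definition n_A : C := \tr G * m%:C.
Definition n_D x := n_q x - n_A.
(** The counterpart of [Qf] for one node, with the other columns [Y] frozen. *)
Definition n_Q x : R := 1 + (cabs (n_l1 x) ^+ 8 + cabs (n_l2 x) ^+ 8) / m ^+ 4 + cabs (n_D x) ^+ 4 / m ^+ 2.
Definition n_w x := root8 (n_Q x).

Lemma n_Q_terms x : [/\ 1 <= n_Q x, cabs (n_l1 x) ^+ 8 / rho ^+ 16 <= n_Q x,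
 cabs (n_l2 x) ^+ 8 / rho ^+ 16 <= n_Q x & cabs (n_D x) ^+ 4 / rho ^+ 8 <= n_Q x].
have e4 : rho ^+ 16 = m ^+ 4 by rewrite (exprM _ 4 4) rho4.
have e2 : rho ^+ 8 = m ^+ 2 by rewrite (exprM _ 4 2) rho4.
rewrite e4 e2 /n_Q mulrDl.
have a1 : 0 <= cabs (n_l1 x) ^+ 8 / m ^+ 4 by rewrite divr_ge0 ?exprn_ge0 ?cabs_ge0 // ltW.
have a2 : 0 <= cabs (n_l2 x) ^+ 8 / m ^+ 4 by rewrite divr_ge0 ?exprn_ge0 ?cabs_ge0 // ltW.
have a3 : 0 <= cabs (n_D x) ^+ 4 / m ^+ 2 by rewrite divr_ge0 ?exprn_ge0 ?cabs_ge0 // ltW.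
exact: node_terms.
Qed.
Lemma n_w8 x : n_w x ^+ 8 = n_Q x.
by have [q _ _ _] := n_Q_terms x; rewrite root8K // (le_trans _ q). Qed.
Lemma n_w_ge1 x : 1 <= n_w x.
by have [q _ _ _] := n_Q_terms x; exact: root8_ge1. Qed.
Lemma n_basic x : [/\ cabs (n_l1 x) <= rho ^+ 2 * n_w x, cabs (n_l2 x) <= rho ^+ 2 * n_w x
 & cabs (n_D x) <= rho ^+ 2 * n_w x ^+ 2].
have [q h2 h3 h4] := n_Q_terms x; have q0 : 0 <= n_Q x by exact: le_trans q.
split; [exact: (root8_le8 q0 r0 (cabs_ge0 _) h2)|exact: (root8_le8 q0 r0 (cabs_ge0 _) h3)|].
exact: (root8_le4 q0 r0 (cabs_ge0 _) h4).
Qed.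
Lemma n_inv x : cabs (1 + n_q x)^-1 <= h ^+ 2 /\ cabs (1 + n_A)^-1 <= h ^+ 2.
split; last exact: one_plus_Aj_lb.
by apply: (inv_lb z0 Hz Hzc); exact: Im_den.
Qed.
Lemma n_neq0 x : 1 + n_A != 0 /\ 1 + (n_A + n_D x) != 0.
split; first exact: one_plus_Aj_neq0.
by rewrite /n_D [n_A + _]addrC subrK; exact: den_neq0.
Qed.

Section Law.
Variable mu : mxlaw R N M.
Hypothesis Hg : goodlaw mu K eps.

Lemma tame_n_l1 : tamec mu (fun c => n_l1 (xc c)).
by apply: tamec_ip; [exact: (tamemx_col Hg)|exact: tamemxC]. Qed.
Lemma tame_n_l2 : tamec mu (fun c => n_l2 (xc c)).
apply: tamec_ip; first exact: tamemxC.
by apply: tamemxM; [exact: tamemxC|exact: (tamemx_col Hg)].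
Qed.
Lemma tame_n_q : tamec mu (fun c => n_q (xc c)).
apply: tamec_ip; first exact: (tamemx_col Hg).
by apply: tamemxM; [exact: tamemxC|exact: (tamemx_col Hg)].
Qed.
Lemma tame_n_D : tamec mu (fun c => n_D (xc c)).
by apply: tamecB; [exact: tame_n_q|exact: tamecC]. Qed.
Lemma tame_n_inv : tamec mu (fun c => (1 + n_q (xc c))^-1).
apply: (@tamec_bnd _ _ _ _ _ (h ^+ 2)); last by move=> c; case: (n_inv (xc c)).
by apply: mfcV; apply: mfcD; [exact: mfcC|exact: tamec_mfc tame_n_q].
Qed.
Lemma tame_n_Q : tame mu (fun c => n_Q (xc c)).
have t (f : EntT R N M -> C) k : tamec mu f -> tame mu (fun c => cabs (f c) ^+ k).
 by move=> tf; exact: tame_cabsX.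
exact: (Ex_node (m ^+ 4) (m ^+ 2) (t _ 8 tame_n_l1) (t _ 8 tame_n_l2) (t _ 4 tame_n_D)).1.
Qed.
Lemma E_n_Q : Ex mu (fun c => n_Q (xc c)) <= h ^+ 11.
have t (f : EntT R N M -> C) k : tamec mu f -> tame mu (fun c => cabs (f c) ^+ k).
 by move=> tf; exact: tame_cabsX.
have b1 : Ex mu (fun c => cabs (n_l1 (xc c)) ^+ 8) <= h ^+ 9 * m ^+ 4.
 by apply: le_trans (nv_lin8 Hg HK j (nv_Rs_b Hg HK z0 Hz Hb Y)) _; rewrite -exprM -exprS.
have b2 : Ex mu (fun c => cabs (n_l2 (xc c)) ^+ 8) <= h ^+ 9 * m ^+ 4.
 have -> : Ex mu (fun c => cabs (n_l2 (xc c)) ^+ 8) = Ex mu (fun c => cabs (ip (xc c) (adjmx (Rs Y z) *m b)) ^+ 8).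
  by apply: eq_Ex => c; rewrite /n_l2 ip_adj -ip_conj cabs_conj.
 by apply: le_trans (nv_lin8 Hg HK j (nv_adjRs_b Hg HK z0 Hz Hb Y)) _; rewrite -exprM -exprS.
have b3 : Ex mu (fun c => cabs (n_D (xc c)) ^+ 4) <= h ^+ 8 * m ^+ 2.
 by apply: le_trans (opb_quad4 Hg HK HN j (opb_h Hg HK z0 Hz Y)) _; rewrite -exprD -exprM.
have E := (Ex_node (m ^+ 4) (m ^+ 2) (t _ 8 tame_n_l1) (t _ 8 tame_n_l2) (t _ 4 tame_n_D)).2.
rewrite [leLHS]E; exact: (@node_final _ h 8 _ _ _ _ h16 m0 b1 b2 b3).
Qed.

End Law.
End Node.

(* Quadratic forms in the column: their first two moments only involve the
  moments of order at most four of the entries. *)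
Inductive LQ : (EntT R N M -> C) -> Prop :=
| LQ_qf B : LQ (qf j B)
| LQ_add f g : LQ f -> LQ g -> LQ (fun c => f c + g c)
| LQ_scale a f : LQ f -> LQ (fun c => a * f c).

Lemma qf_conj (B : 'M[C]_N) (c : EntT R N M) : ((qf j B c)^*)%C = qf j (adjmx B) c.
by rewrite /qf ip_conj [RHS]ip_adj adjmxK. Qed.
Lemma LQ_ext f g : LQ f -> f =1 g -> LQ g.
by move=> H /funext <-. Qed.
Lemma LQ_conj f : LQ f -> LQ (fun c => ((f c)^*)%C).
elim=> [B|u v _ IHu _ IHv|a u _ IH].
- by apply: LQ_ext (LQ_qf (adjmx B)) _ => c; rewrite qf_conj.
- by apply: LQ_ext (LQ_add IHu IHv) _ => c; rewrite rmorphD.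
- by apply: LQ_ext (LQ_scale (a^*)%C IH) _ => c; rewrite rmorphM.
Qed.
Lemma LQ_sum (I : Type) (r : seq I) (F : I -> EntT R N M -> C) : (forall i, LQ (F i)) ->
 LQ (fun c => \sum_(i <- r) F i c).
move=> H; elim: r => [|i r IH].
 by apply: LQ_ext (LQ_scale 0 (LQ_qf 0)) _ => c; rewrite big_nil mul0r.
by apply: LQ_ext (LQ_add (H i) IH) _ => c; rewrite big_cons.
Qed.

Variables mu nu : mxlaw R N M.
Hypotheses (Hmu : goodlaw mu K eps) (Hnu : goodlaw nu K eps).
Hypothesis Hkap : forall n, kap mu eps j n = kap nu eps j n.

Definition matched f := [/\ tamec mu f, tamec nu f & Exc mu f = Exc nu f].

Lemma matchedD f g : matched f -> matched g -> matched (fun c => f c + g c).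
by move=> [a1 a2 a3] [b1 b2 b3]; split; [exact: tamecD|exact: tamecD|rewrite !ExcD // a3 b3]. Qed.
Lemma matchedZ a f : matched f -> matched (fun c => a * f c).
by move=> [a1 a2 a3]; split; [apply: tamecM => //; exact: tamecC|apply: tamecM => //; exact: tamecC|rewrite !ExcZ // a3].
Qed.
Lemma matched_conj f : matched f -> matched (fun c => ((f c)^*)%C).
by move=> [a1 a2 a3]; split; [exact: tamecJ|exact: tamecJ|rewrite !Exc_conj // a3]. Qed.
Lemma matched_ext f g : matched f -> f =1 g -> matched g.
by move=> H /funext <-. Qed.
Lemma matched_sum (I : Type) (r : seq I) (F : I -> EntT R N M -> C) : (forall i, matched (F i)) ->
 matched (fun c => \sum_(i <- r) F i c).
move=> H; elim: r => [|i r IH].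
 have -> : (fun c => \sum_(i <- [::]) F i c) = fun=> 0 by apply: funext => c; rewrite big_nil.
 by split; [exact: tamecC|exact: tamecC|rewrite !Exc_cst].
by apply: matched_ext (matchedD (H i) IH) _ => c; rewrite big_cons.
Qed.
Lemma tame_qf (la : mxlaw R N M) B : goodlaw la K eps -> tamec la (qf j B).
move=> Hl; apply: tamec_ip; first exact: (tamemx_col Hl).
by apply: tamemxM; [exact: tamemxC|exact: (tamemx_col Hl)].
Qed.
Lemma matched_qf B : matched (qf j B).
by split; [exact: tame_qf|exact: tame_qf|rewrite (quad_mean Hmu) (quad_mean Hnu)]. Qed.
(** By [quad2] the second moment is determined by [eps] and the cumulants [kap], which agree for the
    two laws. *)
Lemma matched_qf2 B : matched (fun c => qf j B c * qf j B c).
have [t1 t2 e] := matched_qf B.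
have q (la : mxlaw R N M) : goodlaw la K eps -> (forall n, kap la eps j n = kap mu eps j n) -> Exc la (fun c => qf j B c * qf j B c) =
  \sum_n B n n ^+ 2 * (kap mu eps j n)%:C + ((m ^+ 2)%:C * (\tr (B *m B) + (eps ^+ 2)%:C * \sum_i \sum_k B i k ^+ 2))
  + 2 * (\tr B * m%:C) * Exc la (qf j B) - (\tr B * m%:C) ^+ 2.
 move=> Hl kl; have tq := tame_qf B Hl.
 have := quad2 Hl j B; rewrite (eq_bigr (fun n => B n n ^+ 2 * (kap mu eps j n)%:C)) => [<-|n _]; last by rewrite kl.
 have td := tamecB tq (tamecC la (\tr B * m%:C)).
 rewrite -ExcZ // -(Exc_cst la ((\tr B * m%:C) ^+ 2)) -ExcD; first last.
 - by exact: tamecZ.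
 - exact: tamecX.
 rewrite -ExcB; first by apply: eq_Exc => c; ring.
 - by apply: tamecD; [exact: tamecX|apply: tamecM => //; exact: tamecC].
 - exact: tamecC.
split; [exact: tamecM|exact: tamecM|].
by rewrite (q mu) // (q nu) // e.
Qed.
Lemma matched_LQ f : LQ f -> matched f.
by elim=> [B|u v _ IHu _ IHv|a u _ IH]; [exact: matched_qf|exact: matchedD|exact: matchedZ].
Qed.
(** Polarisation reduces a product of two quadratic forms to squares of quadratic forms. *)
Lemma matched_LQ2 f g : LQ f -> LQ g -> matched (fun c => f c * g c).
elim=> [B|u v _ IHu _ IHv|a u _ IH] Hg'.
- elim: Hg' => [B'|u v _ IHu _ IHv|a u _ IH].
 + have qD B1 B2 c : qf j (B1 + B2) c = qf j B1 c + qf j B2 c by rewrite /qf mulmxDl ipDr.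
  apply: matched_ext (matchedZ 2^-1 (matchedD (matched_qf2 (B + B'))
    (matchedZ (-1) (matchedD (matched_qf2 B) (matched_qf2 B'))))) _ => c.
  by rewrite qD; field.
 + by apply: matched_ext (matchedD IHu IHv) _ => c; rewrite mulrDr.
 + by apply: matched_ext (matchedZ a IH) _ => c; rewrite mulrCA.
- by apply: matched_ext (matchedD (IHu Hg') (IHv Hg')) _ => c; rewrite mulrDl.
- by apply: matched_ext (matchedZ a (IH Hg')) _ => c; rewrite mulrA.
Qed.

Variables (J : finType) (z : J -> C) (al : J -> R).
Hypotheses (z0 : forall i, Im (z i) != 0) (Hz : forall i, `|Im (z i)|^-1 <= h) (Hzc : forall i, cabs (z i) <= h).
Hypotheses (al0 : forall i, 0 <= al i) (Hal : \sum_i al i <= h).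
(** Control variable for a weighted sum over nodes. Being linear over the nodes, its mean is
    governed by the total weight, however many nodes there are. *)
Definition wsum (p : nat) (c : EntT R N M) : R := \sum_i al i * n_w (z i) (xc c) ^+ p.

Lemma wsum_ge0 p c : 0 <= wsum p c.
by apply: sumr_ge0 => i _; rewrite mulr_ge0 // exprn_ge0 // (le_trans _ (n_w_ge1 _ _)). Qed.
Lemma wsum_le p q c : (p <= q)%N -> wsum p c <= wsum q c.
by move=> pq; apply: ler_sum => i _; rewrite ler_wpM2l // ler_weXn2l // n_w_ge1. Qed.
Lemma wsum_sq p c : wsum p c ^+ 2 <= h * wsum (2 * p) c.
apply: le_trans (weighted_sq _ al0) _.
have -> : \sum_i al i * (n_w (z i) (xc c) ^+ p) ^+ 2 = wsum (2 * p) c.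
 by apply: eq_bigr => i _; rewrite -exprM mulnC.
by rewrite ler_wpM2r // wsum_ge0.
Qed.
Lemma wsum8 (la : mxlaw R N M) : goodlaw la K eps -> tame la (wsum 8) /\ Ex la (wsum 8) <= h ^+ 12.
move=> Hl; have t i : tame la (fun c => al i * n_w (z i) (xc c) ^+ 8).
 by under eq_fun do rewrite n_w8; exact: tameZ (tame_n_Q (z i) Hl).
split; first exact: tame_sum.
rewrite Ex_sum //; apply: le_trans (_ : \sum_i al i * h ^+ 11 <= _).
 apply: ler_sum => i _; under eq_Ex do rewrite n_w8.
 by rewrite ExZ; [rewrite ler_wpM2l // (E_n_Q (z0 i) (Hz i) Hl)|exact: tame_n_Q].
by rewrite -mulr_suml [h ^+ 12]exprS ler_wpM2r // exprn_ge0.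
Qed.
(** Expansion of an increment of size [rho ^+ 4]: [f0] is a quadratic form and [f1] the next order,
    each order gaining [rho ^+ 2]. After scaling by [sqrt M = rho ^- 2], the mismatch of the first
    two moments and the third moment itself are of order [rho ^+ 6], which beats the number
    [M = rho ^- 4] of columns. *)
Definition appx (f : EntT R N M -> C) : Prop := [/\ tamec mu f, tamec nu f,
 forall c, cabs (f c) <= h ^+ 2 * rho ^+ 4 * wsum 2 c &
 exists f0 f1, [/\ LQ f0, matched f1,
  forall c, cabs (f0 c) <= h ^+ 2 * rho ^+ 4 * wsum 2 c,
  forall c, cabs (f c - f0 c) <= h ^+ 4 * rho ^+ 6 * wsum 4 c &
  forall c, cabs (f c - f0 c - f1 c) <= h ^+ 6 * rho ^+ 8 * wsum 6 c]].

Definition dcol (a : J -> C) (c : EntT R N M) : C :=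
 \sum_i a i * (n_l2 (z i) (xc c) * n_l1 (z i) (xc c) / (1 + n_q (z i) (xc c))).

Lemma cabs_wsum (a F : J -> C) (k : R) p c : (forall i, cabs (a i) <= al i) ->
 (forall i, cabs (F i) <= k * n_w (z i) (xc c) ^+ p) -> cabs (\sum_i a i * F i) <= k * wsum p c.
move=> Ha HF; apply: le_trans (cabs_sum _ _ _) _; rewrite /wsum mulr_sumr; apply: ler_sum => i _.
by rewrite cabsM mulrCA; apply: ler_pM; rewrite ?cabs_ge0.
Qed.
Lemma cabs_mul_le (x y : C) (u v : R) : cabs x <= u -> cabs y <= v -> cabs (x * y) <= u * v.
by move=> *; rewrite cabsM; apply: ler_pM; rewrite ?cabs_ge0. Qed.
Lemma n_l21_qf i c : n_l2 (z i) (xc c) * n_l1 (z i) (xc c) =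
 qf j (Rs Y (z i) *m b *m (adjmx b *m Rs Y (z i))) c.
exact: ip_rank1. Qed.
Lemma appx_dcol (a : J -> C) : (forall i, cabs (a i) <= al i) -> appx (dcol a).
move=> Ha.
pose F i c := n_l2 (z i) (xc c) * n_l1 (z i) (xc c).
pose V i c := (1 + n_q (z i) (xc c))^-1.
pose t i := (1 + n_A (z i))^-1.
pose D i c := n_D (z i) (xc c).
have tl la : goodlaw la K eps -> tamec la (dcol a).
 move=> Hl; apply: tamec_sum => i; apply: tamecM; first exact: tamecC.
 apply: tamecM; last exact: (tame_n_inv (z0 i) (Hz i) (Hzc i) Hl).
 by apply: tamecM; [exact: tame_n_l2|exact: tame_n_l1].
have hF i c : cabs (F i c) <= rho ^+ 4 * n_w (z i) (xc c) ^+ 2.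
 have [h1' h2' _] := n_basic (z i) (xc c); apply: le_trans (cabs_mul_le h2' h1') _.
 by rewrite mulrACA -exprD -expr2.
have hD i c : cabs (D i c) <= rho ^+ 2 * n_w (z i) (xc c) ^+ 2 by case: (n_basic (z i) (xc c)).
have hV i c : cabs (V i c) <= h ^+ 2 by case: (n_inv (z0 i) (Hz i) (Hzc i) (xc c)).
have ht i : cabs (t i) <= h ^+ 2 by case: (n_inv (z0 i) (Hz i) (Hzc i) 0).
have VE i c : V i c = t i - t i * D i c * V i c /\ V i c = t i - t i ^+ 2 * D i c + t i ^+ 2 * D i c ^+ 2 * V i c.
 have [n1 n2] := n_neq0 (z0 i) (xc c); have := inv_expand n1 n2.
 by rewrite /V /D /t /n_D [n_A _ + _]addrC subrK.
have fE c : dcol a c = \sum_i a i * (F i c * V i c) by [].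
split; [exact: tl|exact: tl| |].
 move=> c; rewrite fE; apply: cabs_wsum => // i; apply: le_trans (cabs_mul_le (hF i c) (hV i c)) _.
 by rewrite mulrAC [rho ^+ 4 * _]mulrC.
exists (fun c => \sum_i a i * (t i * F i c)), (fun c => \sum_i a i * (- t i ^+ 2 * (F i c * D i c))); split.
- by apply: LQ_sum => i; apply: LQ_scale; apply: LQ_scale; apply: LQ_ext (LQ_qf _) _ => c; apply/esym/n_l21_qf.
- apply: matched_sum => i; apply: matchedZ; apply: matchedZ.
 apply: matched_ext (matchedD (matched_LQ2 (LQ_qf (Rs Y (z i) *m b *m (adjmx b *m Rs Y (z i)))) (LQ_qf (Rs Y (z i))))
   (matchedZ (- n_A (z i)) (matched_qf (Rs Y (z i) *m b *m (adjmx b *m Rs Y (z i)))))) _ => c.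
 by rewrite -n_l21_qf /F /D /n_D /n_q /qf; ring.
- move=> c; apply: cabs_wsum => // i; apply: le_trans (cabs_mul_le (ht i) (hF i c)) _.
 by rewrite mulrA.
- move=> c; rewrite fE -sumrB.
 have -> : \sum_i (a i * (F i c * V i c) - a i * (t i * F i c)) = \sum_i a i * - (t i * D i c * V i c * F i c).
  by apply: eq_bigr => i _; rewrite {1}(VE i c).1; ring.
 apply: cabs_wsum => // i; rewrite cabsN.
 apply: le_trans (cabs_mul_le (cabs_mul_le (cabs_mul_le (ht i) (hD i c)) (hV i c)) (hF i c)) _.
 by apply: le_of_eq; ring.
move=> c; rewrite fE -!sumrB.
have -> : \sum_i (a i * (F i c * V i c) - a i * (t i * F i c) - a i * (- t i ^+ 2 * (F i c * D i c))) =
  \sum_i a i * (t i ^+ 2 * D i c ^+ 2 * V i c * F i c).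
 by apply: eq_bigr => i _; rewrite {1}(VE i c).2; ring.
apply: cabs_wsum => // i; rewrite !expr2.
apply: le_trans (cabs_mul_le (cabs_mul_le (cabs_mul_le (cabs_mul_le (ht i) (ht i)) (cabs_mul_le (hD i c) (hD i c))) (hV i c)) (hF i c)) _.
by apply: le_of_eq; ring.
Qed.
Lemma cabs_conj_comb (be ga x : C) (k : R) : cabs be + cabs ga <= 1 -> cabs x <= k ->
 cabs (be * x + ga * (x^*)%C) <= k.
move=> H xk; apply: le_trans (cabsD _ _) _; rewrite !cabsM cabs_conj -mulrDl; apply: le_trans xk.
by rewrite ler_piMl ?cabs_ge0.
Qed.
Lemma appx_conj_comb (be ga : C) f : cabs be + cabs ga <= 1 -> appx f ->
 appx (fun c => be * f c + ga * ((f c)^*)%C).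
move=> H [t1 t2 b0 [f0 [f1 [l0 m1 b1 b2 b3]]]].
have tt la : tamec la f -> tamec la (fun c => be * f c + ga * ((f c)^*)%C).
 move=> tf; apply: tamecD; (apply: tamecM; first exact: tamecC) => //; exact: tamecJ.
split; [exact: tt|exact: tt|by move=> c; apply: cabs_conj_comb|].
exists (fun c => be * f0 c + ga * ((f0 c)^*)%C), (fun c => be * f1 c + ga * ((f1 c)^*)%C); split.
- by apply: LQ_add; apply: LQ_scale => //; exact: LQ_conj.
- by apply: matchedD; apply: matchedZ => //; exact: matched_conj.
- by move=> c; apply: cabs_conj_comb.
- move=> c; rewrite (_ : _ - _ = be * (f c - f0 c) + ga * ((f c - f0 c)^*)%C); first exact: cabs_conj_comb.
 by rewrite rmorphB /=; ring.
- move=> c; rewrite (_ : _ - _ = be * (f c - f0 c - f1 c) + ga * ((f c - f0 c - f1 c)^*)%C); first exact: cabs_conj_comb.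
 by rewrite !rmorphB /=; ring.
Qed.
Lemma appx_Re f : appx f -> appx (fun c => (Re (f c))%:C).
move=> H; have c2 : cabs (2^-1 : C) = 2^-1 by rewrite cabsV -[2 in LHS]/(2%:R) cabs_natr.
have -> : (fun c => (Re (f c))%:C) = (fun c => 2^-1 * f c + 2^-1 * ((f c)^*)%C).
 apply: funext => c; rewrite -mulrDr; apply: (canRL (mulKf _)); first by rewrite pnatr_eq0.
 by case: (f c) => x y; apply: eqcP; rewrite ?cReD ?cImD ?cReM ?cImM /=; ring.
by apply: appx_conj_comb => //; rewrite c2; lra.
Qed.
Lemma appx_Im f : appx f -> appx (fun c => (Im (f c))%:C).
move=> H; have c2 : cabs (2^-1 : C) = 2^-1 by rewrite cabsV -[2 in LHS]/(2%:R) cabs_natr.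
have ci : cabs ('i : C) = 1 by rewrite /Normc.normc /= expr0n expr1n add0r sqrtr1.
have -> : (fun c => (Im (f c))%:C) = (fun c => - 'i * 2^-1 * f c + 'i * 2^-1 * ((f c)^*)%C).
 apply: funext => c; have -> : - 'i * 2^-1 * f c + 'i * 2^-1 * ((f c)^*)%C = 2^-1 * ('i * ((f c)^*%C - f c)) by ring.
 apply: (canRL (mulKf _)); first by rewrite pnatr_eq0.
 by case: (f c) => x y; apply: eqcP; rewrite ?cReM ?cImM /=; ring.
by apply: appx_conj_comb => //; rewrite !cabsM cabsN ci c2; lra.
Qed.
Lemma E_wsum_le (la : mxlaw R N M) f k p : goodlaw la K eps -> tamec la f -> (p <= 8)%N -> 0 <= k ->
 (forall c, cabs (f c) <= k * wsum p c) -> cabs (Exc la f) <= k * h ^+ 12.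
move=> Hl tf p8 k0 H; have [tw ew] := wsum8 Hl.
apply: le_trans (cabs_Exc tf) _; apply: le_trans (_ : Ex la (fun c => k * wsum 8 c) <= _).
 apply: le_Ex; [exact: tamec_cabs|exact: tameZ|move=> c].
 by apply: le_trans (H c) _; rewrite ler_wpM2l // wsum_le.
by rewrite ExZ // ler_wpM2l.
Qed.
Lemma match1 f : appx f -> cabs (Exc mu f - Exc nu f) <= 2 * h ^+ 18 * rho ^+ 8.
move=> [t1 t2 _ [f0 [f1 [l0 [s1 s2 e1] _ _ b3]]]].
have [u1 u2 e0] := matched_LQ l0.
have k0 : 0 <= h ^+ 6 * rho ^+ 8 by rewrite mulr_ge0 // exprn_ge0.
have S la : goodlaw la K eps -> tamec la f -> tamec la f0 -> tamec la f1 ->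
  cabs (Exc la f - Exc la f0 - Exc la f1) <= h ^+ 6 * rho ^+ 8 * h ^+ 12.
 move=> Hl tf tf0 tf1; rewrite -!ExcB //; last exact: tamecB.
 by apply: (@E_wsum_le la _ _ 6) => //; apply: tamecB => //; exact: tamecB.
have -> : Exc mu f - Exc nu f = (Exc mu f - Exc mu f0 - Exc mu f1) - (Exc nu f - Exc nu f0 - Exc nu f1).
 by rewrite e0 e1; ring.
apply: le_trans (cabsB _ _) _; apply: le_trans (lerD (S mu Hmu t1 u1 s1) (S nu Hnu t2 u2 s2)) _.
by apply: le_of_eq; rewrite (exprD h 6 12); ring.
Qed.
(** [f0 * g0] is a product of two quadratic forms, hence of matching mean, and it differs from
    [f * g] by [O(rho ^+ 10)]. *)
Lemma match2 f g : appx f -> appx g -> cabs (Exc mu (fun c => f c * g c) - Exc nu (fun c => f c * g c)) <= 4 * h ^+ 19 * rho ^+ 10.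
move=> [t1 t2 b0 [f0 [f1 [l0 _ b1 b2 _]]]] [t1' t2' b0' [g0 [g1 [l0' _ b1' b2' _]]]].
have [u1 u2 e0] := matched_LQ2 l0 l0'.
have k0 : 0 <= 2 * h ^+ 7 * rho ^+ 10 by rewrite !mulr_ge0 // exprn_ge0.
have B c : cabs (f c * g c - f0 c * g0 c) <= 2 * h ^+ 7 * rho ^+ 10 * wsum 8 c.
 have -> : f c * g c - f0 c * g0 c = f0 c * (g c - g0 c) + (f c - f0 c) * g c by ring.
 apply: le_trans (cabsD _ _) _.
 apply: le_trans (lerD (cabs_mul_le (b1 c) (b2' c)) (cabs_mul_le (b2 c) (b0' c))) _.
 have q2 := wsum_sq 2 c; have q4 := wsum_sq 4 c; have q42 := @wsum_le 4 8 c isT.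
 have am := two_mul_le (wsum 2 c) (wsum 4 c).
 have -> : h ^+ 2 * rho ^+ 4 * wsum 2 c * (h ^+ 4 * rho ^+ 6 * wsum 4 c) + h ^+ 4 * rho ^+ 6 * wsum 4 c * (h ^+ 2 * rho ^+ 4 * wsum 2 c) =
  h ^+ 6 * rho ^+ 10 * (2 * (wsum 2 c * wsum 4 c)) by ring.
 have -> : 2 * h ^+ 7 * rho ^+ 10 * wsum 8 c = h ^+ 6 * rho ^+ 10 * (h * wsum 8 c + h * wsum 8 c) by ring.
 rewrite ler_wpM2l ?mulr_ge0 ?exprn_ge0 //; apply: le_trans am _.
 apply: lerD => //; apply: le_trans q2 _; by rewrite ler_wpM2l.
have S la : goodlaw la K eps -> tamec la f -> tamec la g -> tamec la (fun c => f0 c * g0 c) ->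
  cabs (Exc la (fun c => f c * g c) - Exc la (fun c => f0 c * g0 c)) <= 2 * h ^+ 7 * rho ^+ 10 * h ^+ 12.
 move=> Hl tf tg tfg; have tp := tamecM tf tg; rewrite -ExcB //.
 by apply: (@E_wsum_le la _ _ 8) => //; exact: tamecB.
have -> : Exc mu (fun c => f c * g c) - Exc nu (fun c => f c * g c) =
 (Exc mu (fun c => f c * g c) - Exc mu (fun c => f0 c * g0 c)) - (Exc nu (fun c => f c * g c) - Exc nu (fun c => f0 c * g0 c)).
 by rewrite e0; ring.
apply: le_trans (cabsB _ _) _; apply: le_trans (lerD (S mu Hmu t1 t1' u1) (S nu Hnu t2 t2' u2)) _.
by apply: le_of_eq; rewrite (exprD h 7 12); ring.
Qed.
(** [cube_le] trades the cube of [wsum 2] for a multiple of [wsum 8], whose mean is known. *)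
Lemma third_moment (la : mxlaw R N M) f : goodlaw la K eps -> tamec la f -> appx f ->
 Ex la (fun c => cabs (f c) ^+ 3) <= h ^+ 22 * rho ^+ 12.
move=> Hl tf [_ _ b0 _]; have [t8 e8] := wsum8 Hl.
have k0 : 0 <= h ^+ 6 * rho ^+ 12 by rewrite mulr_ge0 // exprn_ge0.
have tt : tame la (fun c => 1 + h ^+ 3 * wsum 8 c) by apply: tameD; [exact: tameC|exact: tameZ].
apply: le_trans (_ : Ex la (fun c => h ^+ 6 * rho ^+ 12 * (1 + h ^+ 3 * wsum 8 c)) <= _).
 apply: le_Ex; [exact: tame_cabsX 3 tf|exact: tameZ|move=> c].
 have q2 := wsum_sq 2 c; have q4 := wsum_sq 4 c.
 apply: le_trans (_ : (h ^+ 2 * rho ^+ 4 * wsum 2 c) ^+ 3 <= _).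
  by rewrite lerXn2r ?nnegrE ?cabs_ge0 // (le_trans _ (b0 c)) ?cabs_ge0.
 have -> : (h ^+ 2 * rho ^+ 4 * wsum 2 c) ^+ 3 = h ^+ 6 * rho ^+ 12 * wsum 2 c ^+ 3 by ring.
 rewrite ler_wpM2l //; exact: (cube_le h1 (wsum_ge0 _ _) q2 q4).
rewrite ExZ // ExD; [|exact: tameC|exact: tameZ].
rewrite Ex_cst ExZ //.
have -> : h ^+ 22 * rho ^+ 12 = h ^+ 6 * rho ^+ 12 * h ^+ 16 by rewrite (exprD h 6 16); ring.
rewrite ler_wpM2l //; apply: le_trans (lerD (lexx 1) (ler_wpM2l (exprn_ge0 3 h0) e8)) _.
rewrite -exprD; have p : 1 <= h ^+ 15 by exact: exprn_ege1.
rewrite [h ^+ 16]exprS; apply: le_trans (_ : 2 * h ^+ 15 <= _); first by rewrite mulr_natl mulr2n lerD2r.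
by rewrite ler_wpM2r ?exprn_ge0 // (le_trans _ h16) // ler_nat.
Qed.

End OneColumn.

(** * Taylor expansions and column replacement *)

Section OneDimensionalTaylor.
Variable R : realType.
Implicit Types g : R -> R.

Lemma is_derive_ext g f (a b t : R) : is_derive t (1 : R) g a -> g =1 f -> a = b -> is_derive t (1 : R) f b.
by move=> H /funext <- <-. Qed.
Lemma mvt01 g g' (B : R) : (forall s : R, is_derive s (1 : R) g (g' s)) -> (forall s, 0 <= s <= 1 -> `|g' s| <= B) ->
 forall s, 0 <= s <= 1 -> `|g s - g 0| <= B.
move=> Hg HB s /andP[s0 s1].
have B0 : 0 <= B by apply: le_trans (HB 0 _); rewrite ?lexx ?ler01.
have [|c ci ->] := @MVT_segment R g g' 0 s s0.
 by apply: continuous_subspaceT => x; apply/differentiable_continuous/derivable1_diffP; case: (Hg x).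
move: ci; rewrite in_itv /= => /andP[c0 cs].
rewrite subr0 normrM (ger0_norm s0) -[leRHS]mulr1; apply: ler_pM => //.
by apply: HB; rewrite c0 (le_trans cs).
Qed.
Lemma taylor1 g g1 g2 (B : R) : (forall s : R, is_derive s (1 : R) g (g1 s)) -> (forall s : R, is_derive s (1 : R) g1 (g2 s)) ->
 (forall s, 0 <= s <= 1 -> `|g2 s| <= B) -> forall s, 0 <= s <= 1 -> `|g s - g 0 - s * g1 0| <= B.
move=> H0 H1 HB s Hs; have := @mvt01 (fun s => g s - s * g1 0) (fun s => g1 s - g1 0) B.
move=> /(_ _ _ s Hs); rewrite mul0r subr0 addrAC; apply.
- move=> t; have := is_deriveB (H0 t) (is_deriveM (is_derive_id t 1) (is_derive_cst (g1 0) t 1)).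
 by move/is_derive_ext; apply=> //; rewrite scaler0 add0r /GRing.scale /= mulr1.
- by move=> t; exact: mvt01 H1 HB t.
Qed.
Lemma taylor2 g g1 g2 g3 (B : R) : (forall s : R, is_derive s (1 : R) g (g1 s)) -> (forall s : R, is_derive s (1 : R) g1 (g2 s)) ->
 (forall s : R, is_derive s (1 : R) g2 (g3 s)) ->
 (forall s, 0 <= s <= 1 -> `|g3 s| <= B) -> `|g 1 - g 0 - g1 0 - 2^-1 * g2 0| <= B.
move=> H0 H1 H2 HB; have := @mvt01 (fun s => g s - s * g1 0 - s ^+ 2 * (2^-1 * g2 0)) (fun s => g1 s - g1 0 - s * g2 0) B.
move=> /(_ _ _ 1); rewrite !mul0r !mul1r expr1n expr0n /= mul0r mul1r !subr0 ler01 lexx.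
have -> : g 1 - g1 0 - 2^-1 * g2 0 - g 0 = g 1 - g 0 - g1 0 - 2^-1 * g2 0 by ring.
apply => //.
- move=> t; have := is_deriveB (is_deriveB (H0 t) (is_deriveM (is_derive_id t 1) (is_derive_cst (g1 0) t 1)))
  (is_deriveM (is_deriveX 2 (is_derive_id t 1)) (is_derive_cst (2^-1 * g2 0) t 1)).
 move/is_derive_ext; apply=> //; rewrite /GRing.scale /= /cst.
 by field.
- by move=> t Ht; have := taylor1 H1 H2 HB Ht.
Qed.

End OneDimensionalTaylor.

(** * Smooth truncation by a sine *)

Section TruncationFunction.
Variable R : realType.
Variable K : R.
Hypothesis K1 : 1 <= K.

(** The test function is controlled on boxes only, and [psi] keeps every argument inside one: it is
    bounded by [K], has bounded derivatives, and differs from the identity by at most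
    [|x| ^+ 3 / K ^+ 2]. *)
Definition psi (x : R) : R := K * sin (x / K).

Let K0 : 0 < K. Proof. exact: lt_le_trans K1. Qed.
Let Kn : K != 0. Proof. by rewrite gt_eqF. Qed.
Lemma psi_bound x : `|psi x| <= K.
rewrite normrM (ger0_norm (ltW K0)) ler_piMr ?(ltW K0) //.
by rewrite ler_norml sin_geN1 sin_le1.
Qed.
Lemma norm_sin_le1 (x : R) : `|sin x| <= 1. Proof. by rewrite ler_norml sin_geN1 sin_le1. Qed.
Lemma norm_cos_le1 (x : R) : `|cos x| <= 1. Proof. by rewrite ler_norml cos_geN1 cos_le1. Qed.

Section Line.
Variables v de : R.
Let arg (s : R) := (v + s * de) / K.
Let darg s : is_derive (s : R) (1 : R) arg (de / K).
have := is_deriveM (is_deriveD (is_derive_cst v s 1) (is_deriveM (is_derive_id s 1) (is_derive_cst de s 1))) (is_derive_cst K^-1 s 1).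
by move/is_derive_ext; apply=> //; rewrite /GRing.scale /= /cst; ring.
Qed.
Lemma psi_line1 s : is_derive (s : R) (1 : R) (fun s : R => psi (v + s * de)) (de * cos (arg s)).
have := is_deriveM (is_derive_cst K s 1) (is_derive1_comp (is_derive_sin (arg s)) (darg s)).
by move/is_derive_ext; apply=> //; rewrite /GRing.scale /= /cst; field.
Qed.
Lemma psi_line2 s : is_derive (s : R) (1 : R) (fun s : R => de * cos (arg s)) (- (de ^+ 2 * (sin (arg s) / K))).
have := is_deriveM (is_derive_cst de s 1) (is_derive1_comp (is_derive_cos (arg s)) (darg s)).
by move/is_derive_ext; apply=> //; rewrite /GRing.scale /= /cst; field.
Qed.
Lemma psi_line3 s : is_derive (s : R) (1 : R) (fun s : R => - (de ^+ 2 * (sin (arg s) / K))) (- (de ^+ 3 * (cos (arg s) / K ^+ 2))).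
have := is_deriveM (is_derive_cst (- de ^+ 2 / K) s 1) (is_derive1_comp (is_derive_sin (arg s)) (darg s)).
move/is_derive_ext; apply=> [t|]; rewrite /GRing.scale /= /cst; last by field.
by change (- de ^+ 2 / K * sin (arg t) = - (de ^+ 2 * (sin (arg t) / K))); field.
Qed.
Lemma psi_third s : `|- (de ^+ 3 * (cos (arg s) / K ^+ 2))| <= `|de| ^+ 3 / K ^+ 2.
have p : 0 <= (K ^+ 2)^-1 by rewrite invr_ge0 exprn_ge0 // ltW.
rewrite normrN normrM normrX normrM (ger0_norm p) ler_wpM2l ?exprn_ge0 // ler_piMl //.
exact: norm_cos_le1.
Qed.

End Line.

Lemma psi_taylor (v de : R) : let D := psi (v + de) - psi v in
 [/\ `|D| <= `|de|, `|D - de * cos (v / K)| <= `|de| ^+ 2 &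
   `|D - de * cos (v / K) + 2^-1 * (de ^+ 2 * (sin (v / K) / K))| <= `|de| ^+ 3].
have iK : K^-1 <= 1 by rewrite invf_le1.
have iK0 : 0 <= K^-1 by rewrite invr_ge0 ltW.
move=> D; have i01 : 0 <= (1 : R) <= 1 by rewrite ler01 lexx.
have e0 : v + 0 * de = v by rewrite mul0r addr0.
have e1 : v + 1 * de = v + de by rewrite mul1r.
split.
- have := mvt01 (B := `|de|) (psi_line1 v de) _ i01; rewrite e0 e1; apply => s _.
 by rewrite normrM ler_piMr // norm_cos_le1.
- have := taylor1 (B := `|de| ^+ 2) (psi_line1 v de) (psi_line2 v de) _ i01; rewrite e0 e1 mul1r; apply => s _.
 rewrite normrN normrM normrX normrM (ger0_norm iK0) ler_piMr ?exprn_ge0 //.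
 by rewrite -[leRHS]mulr1; apply: ler_pM => //; exact: norm_sin_le1.
- have := taylor2 (B := `|de| ^+ 3) (psi_line1 v de) (psi_line2 v de) (psi_line3 v de).
 rewrite e0 e1 mulrN opprK; apply => s _; apply: le_trans (psi_third v de s) _.
 by rewrite ler_piMr ?exprn_ge0 // invf_le1 ?exprn_gt0 // exprn_ege1.
Qed.
Lemma psi_id x : `|psi x - x| <= `|x| ^+ 3 / K ^+ 2.
have := taylor2 (B := `|x| ^+ 3 / K ^+ 2) (psi_line1 0 x) (psi_line2 0 x) (psi_line3 0 x).
rewrite mul0r addr0 mul1r add0r mul0r /psi mul0r sin0 cos0 !(mulr0, mul0r, subr0, mulr1, oppr0); apply => s _.
exact: psi_third.
Qed.

End TruncationFunction.

Lemma succn_sq n : (1 + n + n ^ 2 <= n.+1 ^ 2)%N.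
by rewrite -!mulnn mulSn mulnS add1n leq_add2l leq_addl. Qed.
Lemma succn_cube n : (1 + n ^ 3 + n ^ 2 + n <= n.+1 ^ 3)%N.
have -> : (1 + n ^ 3 + n ^ 2 + n = 1 + n + n ^ 2 + n * n ^ 2)%N by rewrite -expnS; ring.
by rewrite [(n.+1 ^ 3)%N]expnS mulSn leq_add ?succn_sq // leq_mul2l leq_exp2r // leqnSn orbT.
Qed.

(** * Taylor expansion along coordinate directions *)

Section TaylorOnBox.
Variables (R : realType) (p : nat).
Local Notation V := 'rV[R]_p.
Local Notation e_ k := (delta_mx 0 k : V).

Lemma line_is_derive (F : V -> R) (k : 'I_p) (v : V) (de s : R) : (forall x, derivable F x (e_ k)) ->
 is_derive (s : R) (1 : R) (fun s : R => F (v + (s * de) *: e_ k)) (de * derive F (v + (s * de) *: e_ k) (e_ k)).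
move=> dF.
have L (t : R) : is_derive t (1 : R) (fun t => F (v + t *: e_ k)) (derive F (v + t *: e_ k) (e_ k)).
 have E : (fun h : R => h^-1 *: (((fun t => F (v + t *: e_ k)) \o shift t) (h *: 1) - F (v + t *: e_ k))) =
      (fun h : R => h^-1 *: ((F \o shift (v + t *: e_ k)) (h *: e_ k) - F (v + t *: e_ k))).
  apply: funext => h /=; congr (_ *: (F _ - _)).
  by rewrite /shift /= [h *: 1]mulr1 scalerDl addrCA addrA addrC addrA.
 split; first by rewrite /derivable E; exact: dF.
 by rewrite /derive E.
have Hl : is_derive s (1 : R) (fun s : R => s * de) de.
 by have := is_deriveM (is_derive_id s 1) (is_derive_cst de s 1); move/is_derive_ext; apply=> //; rewrite /GRing.scale /= /cst; ring.
have := @is_derive1_comp _ _ (fun s : R => s * de) s _ _ (L (s * de)) Hl.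
by move/is_derive_ext; apply=> //; rewrite /GRing.scale /= /cst; ring.
Qed.

Variables (Phi : V -> R) (D : seq 'I_p -> V -> R) (B K : R).
Hypothesis D0 : D [::] = Phi.
Hypothesis Hder : forall ks k x, (size ks < 3)%N -> derivable (D ks) x (e_ k) /\ D (k :: ks) x = derive (D ks) x (e_ k).
Definition box (x : V) := forall k, `|x 0 k| <= K.
Hypothesis HB : forall ks x, (1 <= size ks <= 3)%N -> box x -> `|D ks x| <= B.

Variables (u de : 'I_p -> R) (d : R).
Hypotheses (ub : forall k, `|u k| <= K) (udb : forall k, `|u k + de k| <= K) (dd : forall k, `|de k| <= d).

(** Coordinates are changed one at a time, so each segment is parallel to an axis and the derivative
    along it is one of the iterated partial derivatives [D]. *)
Definition mid (n : nat) : V := \row_k (if (k < n)%N then u k + de k else u k).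

Lemma mid_seg (n : 'I_p) s : 0 <= s <= 1 -> box (mid n + (s * de n) *: e_ n).
move=> /andP[s0 s1] k; rewrite !mxE eqxx /= eq_sym.
have [->|kn] := eqVneq k n; last first.
 by rewrite mulr0 addr0; case: ifP => _; [exact: udb|exact: ub].
rewrite ltnn mulr1; have -> : u n + s * de n = (1 - s) * u n + s * (u n + de n) by ring.
apply: le_trans (ler_normD _ _) _; rewrite !normrM (ger0_norm s0) ger0_norm ?subr_ge0 //.
have -> : K = (1 - s) * K + s * K by ring.
by apply: lerD; rewrite ler_wpM2l // subr_ge0.
Qed.
Lemma midS (n : 'I_p) : mid n.+1 = mid n + (1 * de n) *: e_ n.
apply/rowP => k; rewrite !mxE eqxx /= mul1r ltnS eq_sym.
have [->|kn] := eqVneq k n; first by rewrite leqnn ltnn mulr1.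
by rewrite mulr0 addr0 leq_eqVlt (inj_eq val_inj) (negPf kn).
Qed.
Let B0 : (0 < p)%N -> 0 <= B.
move=> p0; have k : 'I_p := Ordinal p0.
by apply: le_trans (HB (ks := [:: k]) (x := \row_k u k) isT _); rewrite ?normr_ge0 // => i; rewrite mxE.
Qed.
Let ln ks (n : 'I_p) s : (size ks < 3)%N ->
 is_derive (s : R) (1 : R) (fun s : R => D ks (mid n + (s * de n) *: e_ n)) (de n * D (n :: ks) (mid n + (s * de n) *: e_ n)).
move=> sk; rewrite (Hder n _ sk).2; apply: line_is_derive => x; exact: (Hder n x sk).1.
Qed.
Let ln2 ks (n : 'I_p) (q : nat) s : (size ks < 3)%N ->
 is_derive (s : R) (1 : R) (fun s : R => de n ^+ q * D ks (mid n + (s * de n) *: e_ n)) (de n ^+ q.+1 * D (n :: ks) (mid n + (s * de n) *: e_ n)).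
move=> sk; have := is_deriveM (is_derive_cst (de n ^+ q) s 1) (ln n s sk).
by move/is_derive_ext; apply=> //; rewrite scaler0 addr0 /GRing.scale /= exprSr mulrA.
Qed.
Lemma bnd_line ks (n : 'I_p) q s : (1 <= size ks <= 3)%N -> 0 <= s <= 1 ->
 `|de n ^+ q * D ks (mid n + (s * de n) *: e_ n)| <= d ^+ q * B.
move=> sk Hs; rewrite normrM normrX; apply: ler_pM; rewrite ?exprn_ge0 //.
 by rewrite lerXn2r // ?nnegrE // (le_trans _ (dd n)).
by apply: HB => //; exact: mid_seg.
Qed.
Lemma step0 ks (n : 'I_p) : (size ks <= 2)%N -> `|D ks (mid n.+1) - D ks (mid n)| <= B * d.
move=> sk; rewrite [B * _]mulrC; have := @mvt01 R _ _ (d ^+ 1 * B) (fun s => ln2 n 0 s (_ : size ks < 3)%N).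
move=> /(_ sk _ 1); rewrite !expr0 !mul1r midS mul0r scale0r addr0 mul1r expr1; apply.
 by move=> s Hs; have := @bnd_line (n :: ks) n 1 s; rewrite expr1; apply.
by rewrite ler01 lexx.
Qed.
Lemma step1 ks (n : 'I_p) : (size ks <= 1)%N -> `|D ks (mid n.+1) - D ks (mid n) - de n * D (n :: ks) (mid n)| <= B * d ^+ 2.
move=> sk; have sk2 : (size ks < 3)%N by exact: leq_ltn_trans sk _.
have sk3 : (size (n :: ks) < 3)%N by [].
rewrite [B * _]mulrC; have := @taylor1 R _ _ _ (d ^+ 2 * B) (fun s => ln2 n 0 s sk2) (fun s => ln2 n 1 s sk3).
move=> /(_ _ 1); rewrite !expr0 !mul1r midS mul0r scale0r addr0 mul1r expr1; apply.
 by move=> s Hs; apply: (@bnd_line [:: n, n & ks] n 2).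
by rewrite ler01 lexx.
Qed.
Lemma step2 (n : 'I_p) : `|Phi (mid n.+1) - Phi (mid n) - de n * D [:: n] (mid n) - 2^-1 * (de n ^+ 2 * D [:: n; n] (mid n))| <= B * d ^+ 3.
rewrite [B * _]mulrC; have := @taylor2 R _ _ _ _ (d ^+ 3 * B) (fun s => ln2 n 0 s (isT : size [::] < 3)%N)
 (fun s => ln2 n 1 s (isT : size [:: n] < 3)%N) (fun s => ln2 n 2 s (isT : size [:: n; n] < 3)%N).
rewrite !expr0 !mul1r D0 midS mul0r scale0r addr0 mul1r expr1; apply.
by move=> s Hs; apply: (@bnd_line [:: n; n; n] n 3).
Qed.
Let u0 : V := \row_k u k.
Let mid0 : mid 0 = u0. Proof. by apply/rowP => k; rewrite !mxE. Qed.
Let midp : mid p = \row_k (u k + de k). Proof. by apply/rowP => k; rewrite !mxE ltn_ord. Qed.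
Lemma expand0 ks (n : nat) : (n <= p)%N -> (size ks <= 2)%N -> `|D ks (mid n) - D ks u0| <= n%:R * (B * d).
move=> np sk; elim: n np => [|n IH] np; first by rewrite mid0 subrr normr0 mul0r.
rewrite -natr1 mulrDl mul1r -(subrKA (D ks (mid n))) addrC; apply: le_trans (ler_normD _ _) _.
by apply: lerD; [exact: IH (ltnW np)|exact: (step0 (Ordinal np))].
Qed.
Lemma expand1 ks (n : nat) : (n <= p)%N -> (size ks <= 1)%N ->
 `|D ks (mid n) - D ks u0 - \sum_(k < p | (k < n)%N) de k * D (k :: ks) u0| <= (n ^ 2)%:R * (B * d ^+ 2).
move=> np sk; elim: n np => [|n IH] np.
 by rewrite mid0 subrr big_pred0 // subr0 normr0 mul0r.
have p0 : (0 < p)%N by exact: leq_trans np.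
have Bd : 0 <= B * d ^+ 2 by rewrite mulr_ge0 ?B0 // sqr_ge0.
pose k := Ordinal np; rewrite (sum_ltS _ k).
have s1 := step1 k sk; have h0 := IH (ltnW np).
have s0 := @expand0 (k :: ks) n (ltnW np) sk.
have -> : D ks (mid n.+1) - D ks u0 - (de k * D (k :: ks) u0 + \sum_(i < p | (i < k)%N) de i * D (i :: ks) u0) =
 (D ks (mid k.+1) - D ks (mid k) - de k * D (k :: ks) (mid k)) +
 (D ks (mid n) - D ks u0 - \sum_(i < p | (i < n)%N) de i * D (i :: ks) u0) + de k * (D (k :: ks) (mid n) - D (k :: ks) u0).
 by rewrite /=; ring.
apply: le_trans (ler_normD _ _) _; apply: le_trans (lerD (le_trans (ler_normD _ _) (lerD s1 h0)) _) _.
 rewrite normrM; apply: ler_pM (dd k) s0; by rewrite normr_ge0.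
have -> : B * d ^+ 2 + (n ^ 2)%:R * (B * d ^+ 2) + d * (n%:R * (B * d)) = (1 + n + n ^ 2)%:R * (B * d ^+ 2).
 by rewrite !natrD; ring.
by rewrite ler_wpM2r // ler_nat succn_sq.
Qed.
(** Changing the coordinates in increasing order meets each pair [k < l] once, hence the triangular
    form; the diagonal carries the Taylor factor one half. *)
Definition c2 (k l : 'I_p) : R := if (k < l)%N then D [:: k; l] u0 else if k == l then 2^-1 * D [:: k; k] u0 else 0.

Lemma expand2 (n : nat) : (n <= p)%N ->
 `|Phi (mid n) - Phi u0 - \sum_(k < p | (k < n)%N) de k * D [:: k] u0
   - \sum_(l < p | (l < n)%N) \sum_(k < p) de k * de l * c2 k l| <= (n ^ 3)%:R * (B * d ^+ 3).
elim: n => [|n IH] np.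
 by rewrite mid0 subrr !big_pred0 // !subr0 normr0 mul0r.
have p0 : (0 < p)%N by exact: leq_trans np.
pose k := Ordinal np; rewrite !(sum_ltS _ k).
have d0 : 0 <= d by apply: le_trans (dd k).
have Bd : 0 <= B * d ^+ 3 by rewrite mulr_ge0 ?B0 // exprn_ge0.
have s2 := step2 k; have h0 := IH (ltnW np).
have s1 := @expand1 [:: k] n (ltnW np) isT.
have s0 := @expand0 [:: k; k] n (ltnW np) isT.
have E2 : \sum_(i < p) de i * de k * c2 i k = de k * (\sum_(i < p | (i < n)%N) de i * D [:: i; k] u0) + 2^-1 * (de k ^+ 2 * D [:: k; k] u0).
 rewrite (bigD1 k) //= {1}/c2 ltnn eqxx addrC mulr_sumr; congr (_ + _); last by ring.
 rewrite [RHS]big_mkcond [LHS]big_mkcond; apply: eq_bigr => i _.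
 rewrite /c2; have [->|ik] := eqVneq i k; first by rewrite /= ltnn.
 by rewrite /=; case: ifP => _; rewrite ?mulr0 //; ring.
rewrite E2.
set S1 := \sum_(i < p | (i < k)%N) de i * D [:: i] u0.
set S2 := \sum_(i < p | (i < k)%N) \sum_(k0 < p) _.
set S3 := \sum_(i < p | (i < n)%N) de i * D [:: i; k] u0 in s1 *.
have -> : Phi (mid n.+1) - Phi u0 - (de k * D [:: k] u0 + S1) - (de k * S3 + 2^-1 * (de k ^+ 2 * D [:: k; k] u0) + S2) =
 (Phi (mid k.+1) - Phi (mid k) - de k * D [:: k] (mid k) - 2^-1 * (de k ^+ 2 * D [:: k; k] (mid k))) +
 (Phi (mid n) - Phi u0 - S1 - S2) + de k * (D [:: k] (mid n) - D [:: k] u0 - S3)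
 + 2^-1 * de k ^+ 2 * (D [:: k; k] (mid n) - D [:: k; k] u0) by rewrite /=; ring.
have q1 : `|de k * (D [:: k] (mid n) - D [:: k] u0 - S3)| <= d * ((n ^ 2)%:R * (B * d ^+ 2)).
 by rewrite normrM; apply: ler_pM (dd k) s1.
have q2 : `|2^-1 * de k ^+ 2 * (D [:: k; k] (mid n) - D [:: k; k] u0)| <= d ^+ 2 * (n%:R * (B * d)).
 rewrite normrM; apply: ler_pM s0; rewrite ?normr_ge0 // normrM normrX (ger0_norm (_ : 0 <= 2^-1)) ?invr_ge0 //.
 apply: le_trans (_ : `|de k| ^+ 2 <= _); first by rewrite ler_piMl ?exprn_ge0 // invf_le1 ?ltr0n // ler1n.
 by rewrite lerXn2r ?nnegrE.
apply: le_trans (ler_normD _ _) _; apply: le_trans (lerD (le_trans (ler_normD _ _) (lerD (le_trans (ler_normD _ _) (lerD s2 h0)) q1)) q2) _.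
have -> : B * d ^+ 3 + (n ^ 3)%:R * (B * d ^+ 3) + d * ((n ^ 2)%:R * (B * d ^+ 2)) + d ^+ 2 * (n%:R * (B * d)) =
 (1 + n ^ 3 + n ^ 2 + n)%:R * (B * d ^+ 3) by rewrite !natrD; ring.
by rewrite ler_wpM2r // ler_nat succn_cube.
Qed.

End TaylorOnBox.

Section DiscretizedMeasurability.
Context d (T : measurableType d) (R : realType).

Lemma measurable_countable_factor (I : countType) (N : T -> I) (g : I -> R) :
 (forall i, measurable (N @^-1` [set i])) -> measurable_fun setT (fun t => g (N t)).
move=> mN _ B mB; rewrite setTI.
pose F n : set T := if unpickle n is Some i then (if `[< B (g i) >] then N @^-1` [set i] else set0) else set0.
have -> : (fun t => g (N t)) @^-1` B = \bigcup_n F n.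
 apply/seteqP; split => [t Bt|t [n _]]; last first.
  rewrite /F; case: (unpickle n) => // i; case: asboolP => // Bi.
  by move=> /= e; rewrite e.
 exists (pickle (N t)) => //; rewrite /F pickleK; case: asboolP => //.
apply: bigcupT_measurable => n; rewrite /F; case: (unpickle n) => [i|]; last exact: measurable0.
by case: asboolP => _; [exact: mN|exact: measurable0].
Qed.
Lemma measurable_truncn_fiber (u : T -> R) k : measurable_fun setT u -> (forall t, 0 <= u t) ->
 measurable ((fun t => Num.truncn (u t)) @^-1` [set k]).
move=> mu u0.
have -> : (fun t => Num.truncn (u t)) @^-1` [set k] = u @^-1` `[k%:R, k.+1%:R[.
 apply/seteqP; split => t /=; rewrite in_itv /=; first by move=> <-; exact: truncn_itv.
 by move=> H; exact: truncn_def.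
by rewrite -[X in measurable X]setTI; apply: mu => //; exact: measurable_itv.
Qed.
(** Rounding the arguments down to a grid of mesh [1 / (j + 1)] gives functions with countably many
    values; they converge pointwise by the Lipschitz bound. The grid starts at [- K], so rounding
    stays inside the box. *)
Lemma measurable_lipschitz_comp p (Phi : 'rV[R]_p -> R) (K C : R) (u : 'I_p -> T -> R) :
 (forall (x y : 'rV[R]_p) e, (forall k, `|x 0 k| <= K) -> (forall k, `|y 0 k| <= K) -> (forall k, `|x 0 k - y 0 k| <= e) ->
   `|Phi x - Phi y| <= C * e) ->
 (forall k, measurable_fun setT (u k)) -> (forall k t, `|u k t| <= K) ->
 measurable_fun setT (fun t => Phi (\row_k u k t)).
move=> HP mu uK.
pose tr (j : nat) k t : nat := Num.truncn ((u k t + K) * j.+1%:R).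
pose w (j : nat) (i : {ffun 'I_p -> nat}) : 'rV[R]_p := \row_k (- K + (i k)%:R / j.+1%:R).
have a0 j k t : 0 <= (u k t + K) * j.+1%:R.
 by rewrite mulr_ge0 //; have := uK k t; rewrite ler_norml; lra.
apply: (measurable_fun_cvg (h := fun j t => Phi (w j [ffun k => tr j k t]))).
 move=> j; apply: (@measurable_countable_factor {ffun 'I_p -> nat} (fun t => [ffun k => tr j k t]) (fun i => Phi (w j i))) => i.
 have -> : (fun t => [ffun k => tr j k t]) @^-1` [set i] = \bigcap_(k in [set: 'I_p]) ((tr j k) @^-1` [set i k]).
  apply/seteqP; split => [t /= <- k _|t H] /=; first by rewrite ffunE.
  by apply/ffunP => k; rewrite ffunE; exact: H.
 apply: fin_bigcap_measurable => // k _; apply: measurable_truncn_fiber => //.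
 by apply: measurable_funM; [apply: measurable_funD => //; exact: measurable_cst|exact: measurable_cst].
move=> t _.
have tl j k : (tr j k t)%:R <= (u k t + K) * j.+1%:R < (tr j k t)%:R + 1.
 by have := truncn_itv (a0 j k t); rewrite -[(Num.truncn _).+1%:R]natr1.
have B j : `|Phi (w j [ffun k => tr j k t]) - Phi (\row_k u k t)| <= C * j.+1%:R^-1.
 have bnd k : - K <= - K + (tr j k t)%:R / j.+1%:R <= u k t /\ u k t - (- K + (tr j k t)%:R / j.+1%:R) <= j.+1%:R^-1.
  have j0 : (0 : R) < j.+1%:R by rewrite ltr0n.
  have /andP[h1 h2] := tl j k; split.
   by rewrite lerDl divr_ge0 //= addrC -lerBrDr opprK ler_pdivrMr.
  have -> : u k t - (- K + (tr j k t)%:R / j.+1%:R) = ((u k t + K) * j.+1%:R - (tr j k t)%:R) / j.+1%:R.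
   by field; rewrite gt_eqF.
  by rewrite ler_pdivrMr // mulVf ?gt_eqF // lerBlDl ltW.
 apply: HP => k; rewrite !mxE ?ffunE.
 - have [/andP[h1 h2] _] := bnd k; have := uK k t; rewrite !ler_norml h1 /= => /andP[_ h3]; exact: le_trans h3.
 - exact: uK.
 - have [/andP[h1 h2] h3] := bnd k; rewrite distrC ger0_norm ?subr_ge0 //.
apply/cvgrPdist_le => e e0; exists (Num.truncn (`|C| / e)) => // j /= nj.
rewrite distrC; apply: le_trans (B j) _; rewrite ler_pdivrMr ?ltr0n // mulrC -ler_pdivrMr //.
apply: le_trans (_ : `|C| / e <= _); first by rewrite ler_wpM2r ?ler_norm // invr_ge0 ltW.
by apply: ltW; rewrite -truncn_le_nat.
Qed.

End DiscretizedMeasurability.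

(** [d] is the largest [|f k|], or 0 for an empty family; bounding its cube by the sum makes a
    remainder in [d ^+ 3] integrable term by term. *)
Lemma max_cube (R : realType) (p : nat) (f : 'I_p -> R) :
 exists d, [/\ 0 <= d, forall k, `|f k| <= d & d ^+ 3 <= \sum_k `|f k| ^+ 3].
have H (s : seq 'I_p) : exists d, [/\ 0 <= d, forall k, k \in s -> `|f k| <= d & d ^+ 3 <= \sum_(k <- s) `|f k| ^+ 3].
 elim: s => [|a s [d [d0 Hd Hs]]]; first by exists 0; rewrite lexx big_nil expr0n.
 have s0 : 0 <= \sum_(k <- s) `|f k| ^+ 3 by apply: sumr_ge0 => k _; exact: exprn_ge0.
 have [ad|da] := leP `|f a| d.
  exists d; split => // [k|]; first by rewrite inE => /orP[/eqP->|/Hd].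
  by rewrite big_cons; apply: le_trans Hs _; rewrite lerDr exprn_ge0.
 exists `|f a|; split => // [k|]; last by rewrite big_cons lerDl.
 by rewrite inE => /orP[/eqP->|/Hd h] //; exact: le_trans h (ltW da).
have [d [d0 Hd Hs]] := H (index_enum 'I_p); exists d; split => // k.
by apply: Hd; rewrite mem_index_enum.
Qed.
Lemma product_expand (R : realType) (x y a b d : R) : `|x - a| <= d ^+ 2 -> `|y - b| <= d ^+ 2 -> `|y| <= d -> `|a| <= d ->
 `|x * y - a * b| <= 2 * d ^+ 3.
move=> h1 h2 h3 h4; have -> : x * y - a * b = (x - a) * y + a * (y - b) by ring.
apply: le_trans (ler_normD _ _) _; rewrite !normrM.
have -> : 2 * d ^+ 3 = d ^+ 2 * d + d * d ^+ 2 by ring.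
by apply: lerD; apply: ler_pM.
Qed.
Lemma sumB_le (R : realType) k (F G : 'I_k -> R) e : (forall i, `|F i - G i| <= e) -> `|\sum_i F i - \sum_i G i| <= k%:R * e.
by move=> H; rewrite -sumrB; apply: le_trans (ler_norm_sum _ _ _) _; exact: sum_const_le. Qed.
Lemma normM_le1 (R : realType) (x y B : R) : `|x| <= B -> `|y| <= 1 -> `|x * y| <= B.
by move=> xB y1; rewrite normrM -[leRHS]mulr1 ler_pM. Qed.

Section SmoothExpansion.
Variables (R : realType) (p : nat).
Local Notation V := 'rV[R]_p.
Local Notation e_ k := (delta_mx 0 k : V).
Variables (Phi : V -> R) (D : seq 'I_p -> V -> R) (B K : R).
Hypothesis D0 : D [::] = Phi.
Hypothesis Hder : forall ks k x, (size ks < 3)%N -> derivable (D ks) x (e_ k) /\ D (k :: ks) x = derive (D ks) x (e_ k).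
Hypothesis HB : forall ks x, (1 <= size ks <= 3)%N -> box K x -> `|D ks x| <= B.
Hypotheses (K1 : 1 <= K) (B0 : 0 <= B).

Definition expC : R := (p ^ 3 + p + 2 * p ^ 2)%:R.

Lemma lipschitz_box (x y : V) e : (forall k, `|x 0 k| <= K) -> (forall k, `|y 0 k| <= K) ->
 (forall k, `|x 0 k - y 0 k| <= e) -> `|Phi x - Phi y| <= (p%:R * B) * e.
move=> xK yK xy; have := @expand0 R p D B K Hder HB (fun k => y 0 k) (fun k => x 0 k - y 0 k) e yK.
move=> /(_ _ xy [::] p (leqnn _) isT); rewrite D0 /mid.
have -> : \row_k (if (k < p)%N then y 0 k + (x 0 k - y 0 k) else y 0 k) = x.
 by apply/rowP => k; rewrite mxE ltn_ord addrC subrK.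
have -> : \row_k y 0 k = y by apply/rowP => k; rewrite mxE.
by rewrite mulrA; apply => k; rewrite addrC subrK.
Qed.
(** The coefficients are those of the composition with [psi] at [v]: cosines from its first
    derivative and, on the diagonal, sines from its second. They depend on [v] alone and hence not
    on the increment, which is what conditioning on the other columns requires. *)
Lemma smooth_expand (v : 'I_p -> R) : exists c al be, [/\ (forall k, `|al k| <= B), (forall k l, `|be k l| <= 2 * B) &
 forall de : 'I_p -> R, `|Phi (\row_k psi K (v k + de k)) - (c + \sum_k al k * de k + \sum_l \sum_k be k l * (de k * de l))|
  <= expC * B * \sum_k `|de k| ^+ 3].
pose u k := psi K (v k); pose u0 : V := \row_k u k.
pose cs k := cos (v k / K); pose sn k := sin (v k / K) / K.
pose cc k l := c2 D u k l.
have uK k : `|u k| <= K by exact: psi_bound.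
have u0K : box K u0 by move=> k; rewrite mxE.
have cs1 k : `|cs k| <= 1 by exact: norm_cos_le1.
have sn1 k : `|sn k| <= 1.
 apply: normM_le1 => //; first exact: norm_sin_le1.
 by rewrite ger0_norm ?invr_ge0 ?invf_le1 ?(lt_le_trans ltr01) // (le_trans _ K1).
have D1 k : `|D [:: k] u0| <= B by exact: HB.
have h12 : `|2^-1 : R| <= 1 by rewrite ger0_norm ?invr_ge0 // invf_le1 ?ltr0n // ler1n.
have ccB k l : `|cc k l| <= B.
 rewrite /cc /c2; case: ifP => _; first exact: HB.
 case: eqP => _; last by rewrite normr0.
 by rewrite normrM -[leRHS]mul1r; apply: ler_pM => //; exact: HB.
exists (Phi u0), (fun k => D [:: k] u0 * cs k), (fun k l => cc k l * (cs k * cs l) - (k == l)%:R * (2^-1 * sn k * D [:: k] u0)).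
split => [k|k l|de].
- exact: normM_le1.
- apply: le_trans (ler_normB _ _) _; have -> : 2 * B = B + B by ring.
 apply: lerD.
  apply: normM_le1 => //; exact: normM_le1.
 rewrite normrM -[leRHS]mul1r; apply: ler_pM => //; first by case: eqP; rewrite ?normr1 ?normr0.
 rewrite normrM -[leRHS]mul1r; apply: ler_pM => //.
 exact: normM_le1.
have [d [d0 Hd Hs]] := max_cube de.
pose de' k := psi K (v k + de k) - psi K (v k).
have pt k := psi_taylor K1 (v k) (de k).
have e1 k : `|de' k| <= d by case: (pt k) => h _ _; exact: le_trans h (Hd k).
have e2 k : `|de' k - de k * cs k| <= d ^+ 2.
 by case: (pt k) => _ h _; apply: le_trans h _; rewrite lerXn2r ?nnegrE.
have e3 k : `|de' k - de k * cs k + 2^-1 * (de k ^+ 2 * sn k)| <= d ^+ 3.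
 by case: (pt k) => _ _ h; apply: le_trans h _; rewrite lerXn2r ?nnegrE.
have udK k : `|u k + de' k| <= K by rewrite /u /de' addrC subrK; exact: psi_bound.
have := @expand2 R p Phi D B K D0 Hder HB u de' d uK udK e1 p (leqnn p).
have -> : mid u de' p = \row_k psi K (v k + de k).
 by apply/rowP => k; rewrite !mxE ltn_ord /u /de' addrC subrK.
rewrite -/u0 !sum_ltN.
move=> main.
have Bd3 : 0 <= B * d ^+ 3 by rewrite mulr_ge0 // exprn_ge0.
have q1 : `|\sum_k de' k * D [:: k] u0 - \sum_k (de k * cs k - 2^-1 * (de k ^+ 2 * sn k)) * D [:: k] u0| <= p%:R * (B * d ^+ 3).
 apply: sumB_le => k.
 rewrite -mulrBl normrM mulrC; apply: ler_pM => //.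
 by have := e3 k; rewrite opprB addrA addrAC.
have q2 : `|\sum_l \sum_k de' k * de' l * cc k l - \sum_l \sum_k (de k * cs k) * (de l * cs l) * cc k l| <= (2 * p ^ 2)%:R * (B * d ^+ 3).
 rewrite -sumrB; apply: le_trans (ler_norm_sum _ _ _) _.
 have -> : (2 * p ^ 2)%:R * (B * d ^+ 3) = p%:R * (p%:R * (2 * d ^+ 3 * B)) :> R by rewrite -mulnn !natrM; ring.
 apply: sum_const_le => l; apply: sumB_le => k.
 rewrite -mulrBl normrM; apply: ler_pM => //; apply: product_expand => //.
 exact: normM_le1.
have E : Phi u0 + \sum_k D [:: k] u0 * cs k * de k + \sum_l \sum_k (cc k l * (cs k * cs l) - (k == l)%:R * (2^-1 * sn k * D [:: k] u0)) * (de k * de l)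
 = Phi u0 + \sum_k (de k * cs k - 2^-1 * (de k ^+ 2 * sn k)) * D [:: k] u0 + \sum_l \sum_k (de k * cs k) * (de l * cs l) * cc k l.
 have -> : \sum_l \sum_k (cc k l * (cs k * cs l) - (k == l)%:R * (2^-1 * sn k * D [:: k] u0)) * (de k * de l) =
  \sum_l \sum_k (de k * cs k) * (de l * cs l) * cc k l - \sum_l 2^-1 * sn l * D [:: l] u0 * de l ^+ 2.
  rewrite -sumrB; apply: eq_bigr => l _.
  rewrite (bigD1 l) //= [in RHS](bigD1 l) //= eqxx [RHS]addrAC; congr (_ + _); first by rewrite mul1r; ring.
  by apply: eq_bigr => k /negPf ->; rewrite mul0r subr0; ring.
 have -> : \sum_k (de k * cs k - 2^-1 * (de k ^+ 2 * sn k)) * D [:: k] u0 =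
  \sum_k D [:: k] u0 * cs k * de k - \sum_l 2^-1 * sn l * D [:: l] u0 * de l ^+ 2.
  by rewrite -sumrB; apply: eq_bigr => k _; ring.
 by ring.
rewrite E; apply: le_trans (_ : expC * B * d ^+ 3 <= _); last by rewrite ler_wpM2l // mulr_ge0 // ler0n.
move: main q1 q2.
set F := Phi (\row_k _); set S1 := \sum_k de' k * _; set S2 := \sum_l \sum_k de' k * _ * _.
set P1 := \sum_k (_ - _) * _; set P2 := \sum_l \sum_k (_ * cs k) * _ * _ => main q1 q2.
have -> : F - (Phi u0 + P1 + P2) = (F - Phi u0 - S1 - S2) + (S1 - P1) + (S2 - P2) by ring.
apply: le_trans (ler_normD _ _) _; apply: le_trans (lerD (le_trans (ler_normD _ _) (lerD main q1)) q2) _.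
by rewrite -!mulrDl -!natrD /expC mulrA.
Qed.

End SmoothExpansion.

Section MomentComparison.
Variables (R : realType) (p : nat).
Context d (T : measurableType d).
Variables mu nu : probability T R.

Lemma moment_comparison (F : T -> R) (de : 'I_p -> T -> R) (c B E e1 e2 e3 : R) (al : 'I_p -> R) (be : 'I_p -> 'I_p -> R) :
 tame mu F -> tame nu F -> (forall k, tame mu (de k)) -> (forall k, tame nu (de k)) ->
 0 <= B -> 0 <= E ->
 (forall k, `|al k| <= B) -> (forall k l, `|be k l| <= 2 * B) ->
 (forall t, `|F t - (c + \sum_k al k * de k t + \sum_l \sum_k be k l * (de k t * de l t))| <= E * \sum_k `|de k t| ^+ 3) ->
 (forall k, `|Ex mu (de k) - Ex nu (de k)| <= e1) ->
 (forall k l, `|Ex mu (fun t => de k t * de l t) - Ex nu (fun t => de k t * de l t)| <= e2) ->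
 (forall k, Ex mu (fun t => `|de k t| ^+ 3) <= e3) -> (forall k, Ex nu (fun t => `|de k t| ^+ 3) <= e3) ->
 `|Ex mu F - Ex nu F| <= p%:R * (B * e1) + p%:R * (p%:R * (2 * B * e2)) + 2 * (E * (p%:R * e3)).
move=> tF tF' td td' B0 E0 Hal Hbe HF H1 H2 H3 H3'.
pose P t := c + \sum_k al k * de k t + \sum_l \sum_k be k l * (de k t * de l t).
have tP la : (forall k, tame la (de k)) -> tame la P.
 move=> tl; apply: tameD; first apply: tameD; first exact: tameC.
  by apply: tame_sum => k; exact: tameZ.
 by apply: tame_sum => l; apply: tame_sum => k; apply: tameZ; exact: tameM.
have EP (la : probability T R) : (forall k, tame la (de k)) -> Ex la P = c + \sum_k al k * Ex la (de k) + \sum_l \sum_k be k l * Ex la (fun t => de k t * de l t).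
 move=> tl; have t1 : tame la (fun t => \sum_k al k * de k t) by apply: tame_sum => k; exact: tameZ.
 have t2 l : tame la (fun t => \sum_k be k l * (de k t * de l t)) by apply: tame_sum => k; apply: tameZ; exact: tameM.
 have t3 : tame la (fun t => \sum_l \sum_k be k l * (de k t * de l t)) by exact: tame_sum.
 rewrite /P (ExD (tameD (tameC la c) t1) t3) (ExD (tameC la c) t1) Ex_cst; congr (_ + _ + _).
  by rewrite Ex_sum => [|k]; [apply: eq_bigr => k _; rewrite ExZ|exact: tameZ].
 rewrite Ex_sum //; apply: eq_bigr => l _; rewrite Ex_sum => [|k]; last by apply: tameZ; exact: tameM.
 by apply: eq_bigr => k _; rewrite ExZ //; exact: tameM.
have rem (la : probability T R) : tame la F -> (forall k, tame la (de k)) -> (forall k, Ex la (fun t => `|de k t| ^+ 3) <= e3) ->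
  `|Ex la F - Ex la P| <= E * (p%:R * e3).
 move=> tf tl He; have tPl := tP la tl; rewrite -ExB //; apply: le_trans (Ex_abs (tameB tf tPl)) _.
 have t3 k : tame la (fun t => `|de k t| ^+ 3) by apply: tameX; exact: tame_abs.
 have ts : tame la (fun t => \sum_k `|de k t| ^+ 3) by exact: tame_sum.
 apply: le_trans (le_Ex (tame_abs (tameB tf tPl)) (tameZ E ts) HF) _.
 by rewrite ExZ // ler_wpM2l // Ex_sum //; exact: sum_const_le.
have main : `|Ex mu P - Ex nu P| <= p%:R * (B * e1) + p%:R * (p%:R * (2 * B * e2)).
 rewrite !EP //.
 have -> : forall x y x' y' : R, c + x + y - (c + x' + y') = (x - x') + (y - y') by move=> *; ring.
 apply: le_trans (ler_normD _ _) _; apply: lerD.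
  apply: sumB_le => k.
  by rewrite -mulrBr normrM; apply: ler_pM.
 apply: sumB_le => l.
 apply: sumB_le => k.
 by rewrite -mulrBr normrM; apply: ler_pM.
have -> : Ex mu F - Ex nu F = (Ex mu F - Ex mu P) + (Ex mu P - Ex nu P) - (Ex nu F - Ex nu P) by ring.
apply: le_trans (ler_normB _ _) _; have r1 := rem mu tF td H3; have r2 := rem nu tF' td' H3'.
apply: le_trans (lerD (le_trans (ler_normD _ _) (lerD r1 main)) r2) _.
by apply: le_of_eq; ring.
Qed.

End MomentComparison.

(** * Exchange of the columns one at a time *)

Section Lindeberg.
Variables (R : realType) (N M : nat).
Local Notation C := R[i].
Local Notation Om := (EntT R N M).
Variables (K eps h : R).
Hypotheses (HK : dominates K h) (HN : N%:R <= h * M%:R) (K1 : 1 <= K).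
Local Notation rho := (rho R M).
Variable b : 'cV[C]_N.
Hypothesis Hb : nv b <= 1.
Variables (n : nat) (I : finType) (a z s : 'I_n -> I -> C).
Hypotheses (z0 : forall k i, Im (z k i) != 0) (Hz : forall k i, `|Im (z k i)|^-1 <= h)
 (Hzc : forall k i, cabs (z k i) <= h) (Ha : \sum_k \sum_i cabs (a k i) <= h).
Local Notation p := (n + n)%N.
Local Notation V := 'rV[R]_p.
Variables (Phi : V -> R) (D : seq 'I_p -> V -> R) (B Bs Kt : R).
Hypothesis D0 : D [::] = Phi.
Hypothesis Hder : forall ks k x, (size ks < 3)%N -> derivable (D ks) x (delta_mx 0 k : V) /\ D (k :: ks) x = derive (D ks) x (delta_mx 0 k : V).
Hypothesis HB : forall ks x, (1 <= size ks <= 3)%N -> box Kt x -> `|D ks x| <= B.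
Hypotheses (Kt1 : 1 <= Kt) (B0 : 0 <= B) (HBs : forall x, `|Phi x| <= Bs).
Local Opaque Rs.

Definition Gsum (Y : 'M[C]_(N, M)) (k : 'I_n) : C :=
 (Num.sqrt (M%:R : R))%:C * \sum_i a k i * (ip b (Rs Y (z k i) *m b) - s k i).
Definition coord (w : 'I_n -> C) (k : 'I_p) : R :=
 match fintype.split k with inl l => Re (w l) | inr l => Im (w l) end.
Definition Ff (c : Om) : R := Phi (\row_k psi Kt (coord (Gsum (entmx c)) k)).

Lemma measurable_psi d (T : measurableType d) (f : T -> R) : measurable_fun setT f -> measurable_fun setT (fun t => psi Kt (f t)).
move=> mf; apply: measurable_funM; first exact: measurable_cst.
apply: (measurableT_comp (f := sin)); first by apply: continuous_measurable_fun => x; exact: continuous_sin.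
by apply: measurable_funM => //; exact: measurable_cst.
Qed.
Lemma mfc_Gsum k : mfc (fun c : Om => Gsum (entmx c) k).
apply: mfcM; first exact: mfcC.
apply: mfc_sum => i; apply: mfcM; first exact: mfcC.
apply: mfcB; last exact: mfcC.
apply: mfc_ip; first exact: mfmxC.
apply: mfmxM; last exact: mfmxC.
apply: mfmx_Rs => // i' j'.
have -> : (fun c : Om => entmx c i' j') = (fun c => (c i' j').1%:C + 'i * (c i' j').2%:C).
 by apply: funext => c; rewrite mxE; apply: eqcP; rewrite ?cReD ?cImD ?cReM ?cImM /=; ring.
apply: mfcD; last (apply: mfcM; first exact: mfcC); apply: mfc_real; [exact: measurable_ent1|exact: measurable_ent2].
Qed.
Lemma measurable_coord d (T : measurableType d) (w : T -> 'I_n -> C) k : (forall l, mfc (fun t => w t l)) ->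
 measurable_fun setT (fun t => coord (w t) k).
by move=> mw; rewrite /coord; case: (fintype.split k) => l; case: (mw l). Qed.
Lemma measurable_Phi d (T : measurableType d) (u : 'I_p -> T -> R) : (forall k, measurable_fun setT (u k)) ->
 measurable_fun setT (fun t => Phi (\row_k psi Kt (u k t))).
move=> mu; apply: (@measurable_lipschitz_comp _ _ R p Phi Kt (p%:R * B) (fun k t => psi Kt (u k t))).
- exact: (lipschitz_box D0 Hder HB).
- by move=> k; exact: measurable_psi.
- by move=> k t; exact: psi_bound.
Qed.
Lemma tame_Ff (la : probability Om R) : tame la Ff.
apply: (@tame_bnd _ _ _ _ _ Bs); last by move=> c; exact: HBs.
apply: (measurable_Phi (u := fun k (c : Om) => coord (Gsum (entmx c)) k)) => k.
by apply: measurable_coord => l; exact: mfc_Gsum.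
Qed.
Lemma tame_Ff_mix (la : probability Om R) S y : tame la (fun x => Ff (mix S x y)).
apply: (@tame_bnd _ _ _ _ _ Bs); last by move=> c; exact: HBs.
have [mF _] := tame_Ff la; apply: (measurableT_comp mF); apply: measurable_EntP => i j; rewrite /mix; case: (S i j).
- exact: measurable_ent1.
- exact: measurable_cst.
- exact: measurable_ent2.
- exact: measurable_cst.
Qed.

Variables mu nu : probability Om R.
Hypotheses (Hmu : goodlaw mu K eps) (Hnu : goodlaw nu K eps).
Hypothesis Hkap : forall j i, kap mu eps j i = kap nu eps j i.

Definition stepE : R := p%:R * (B * (2 * h ^+ 18 * rho ^+ 6)) + p%:R * (p%:R * (2 * B * (4 * h ^+ 19 * rho ^+ 6)))
 + 2 * (expC R p * B * (p%:R * (h ^+ 22 * rho ^+ 6))).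

(** Pairs of a component and a node form one index set, so that the increments of all components
    share the control variable [wsum] with weights [al]. *)
Let zz (q : 'I_n * I) : C := z q.1 q.2.
Let aa (k : 'I_n) (q : 'I_n * I) : C := if q.1 == k then - a q.1 q.2 else 0.
Let al (q : 'I_n * I) : R := cabs (a q.1 q.2).

Lemma Gsum_col (j : 'I_M) (c : Om) k :
 Gsum (entmx c) k = Gsum (zcol j (entmx c)) k + (Num.sqrt (M%:R : R))%:C * dcol j (zcol j (entmx c)) b zz (aa k) c.
rewrite /Gsum -mulrDr; congr (_ * _).
have -> : dcol j (zcol j (entmx c)) b zz (aa k) c =
 \sum_i - a k i * (n_l2 (zcol j (entmx c)) b (z k i) (col j (entmx c)) * n_l1 (zcol j (entmx c)) b (z k i) (col j (entmx c))
   / (1 + n_q (zcol j (entmx c)) (z k i) (col j (entmx c)))).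
 rewrite /dcol; pose F (l : 'I_n) (i : I) := aa k (l, i) * (n_l2 (zcol j (entmx c)) b (z l i) (col j (entmx c)) * n_l1 (zcol j (entmx c)) b (z l i) (col j (entmx c))
   / (1 + n_q (zcol j (entmx c)) (z l i) (col j (entmx c)))).
 rewrite (eq_bigr (fun q => F q.1 q.2)) => [|[l i] _] //; rewrite -(pair_bigA _ F) /= (bigD1 k) //= [X in _ + X]big1 ?addr0.
  by apply: eq_bigr => i _; rewrite /F /aa /= eqxx.
 by move=> l lk; apply: big1 => i _; rewrite /F /aa /= (negPf lk) mul0r.
rewrite -big_split; apply: eq_bigr => i _ /=; rewrite (ip_Rs_sm _ j (z0 k i)) /n_l2 /n_l1 /n_q.
by rewrite mulNr -mulrN -mulrDr addrAC.
Qed.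
Lemma rho2 : (0 < M)%N -> Num.sqrt (M%:R : R) * rho ^+ 2 = 1.
move=> M0; have Mp : (0 : R) < M%:R by rewrite ltr0n.
by rewrite rhoE sqr_sqrtr ?sqrtr_ge0 // -sqrtrM ?ltW // divff ?sqrtr1 // gt_eqF.
Qed.
(** With the other columns [Y] frozen, the argument of the test function is a constant [v] plus
    [sqrt M] times the coordinates of [dcol], to which the Taylor expansion and the moment
    comparison apply. *)
Lemma column_step (j : 'I_M) (y : Om) :
 `|Ex mu (fun x => Ff (mix (colS j) x y)) - Ex nu (fun x => Ff (mix (colS j) x y))| <= stepE.
have M0 : (0 < M)%N by case: Hmu.
set sM := Num.sqrt (M%:R : R); have sM0 : 0 <= sM by exact: sqrtr_ge0.
have sr : sM * rho ^+ 2 = 1 by exact: rho2.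
pose Y := zcol j (entmx y).
pose v k := coord (Gsum Y) k.
pose f k (x : Om) : R := coord (fun l => dcol j Y b zz (aa l) x) k.
have al0 q : 0 <= al q by exact: cabs_ge0.
have Hal : \sum_q al q <= h by move: Ha; rewrite pair_bigA.
have aal k q : cabs (aa k q) <= al q by rewrite /aa /al; case: ifP; rewrite ?cabsN ?cabs0 ?cabs_ge0.
have z0' q : Im (zz q) != 0 by exact: z0.
have Hz' q : `|Im (zz q)|^-1 <= h by exact: Hz.
have Hzc' q : cabs (zz q) <= h by exact: Hzc.
have ad l := appx_dcol Y b Hmu Hnu (Hkap j) z0' Hz' Hzc' (aal l).
have af k : appx h j Y b mu nu zz al (fun x => (f k x)%:C).
 by rewrite /f /coord; case: (fintype.split k) => l; [exact: appx_Re (ad l)|exact: appx_Im (ad l)].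
pose de k x := sM * f k x.
have FE x : Ff (mix (colS j) x y) = Phi (\row_k psi Kt (v k + de k x)).
 rewrite /Ff; congr Phi; apply/rowP => k; rewrite !mxE; congr psi.
 have E l : Gsum (entmx (mix (colS j) x y)) l = Gsum Y l + sM%:C * dcol j Y b zz (aa l) x.
  by rewrite (Gsum_col j) zcol_mix -/Y /dcol col_mix.
 rewrite /v /de /f /coord; case: (fintype.split k) => l; rewrite E.
  by rewrite cReD; congr (_ + _); rewrite cReM cIm_real mul0r subr0 cRe_real.
 by rewrite cImD; congr (_ + _); rewrite cImM cIm_real mul0r addr0 cRe_real.
have [c [be [ga [hbe hga hF]]]] := smooth_expand D0 Hder HB Kt1 B0 v.
have ExcR (la : probability Om R) (g : Om -> R) : Exc la (fun x => (g x)%:C) = (Ex la g)%:C by exact: Exc_real.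
have tfm k : tame mu (f k) by case: (af k) => -[t _] _ _ _.
have tfn k : tame nu (f k) by case: (af k) => _ [t _] _ _.
have r12 : rho ^+ 12 * sM ^+ 3 = rho ^+ 6.
 have -> : rho ^+ 12 * sM ^+ 3 = rho ^+ 6 * (sM * rho ^+ 2) ^+ 3 by ring.
 by rewrite sr expr1n mulr1.
have r10 : rho ^+ 10 * sM ^+ 2 = rho ^+ 6.
 have -> : rho ^+ 10 * sM ^+ 2 = rho ^+ 6 * (sM * rho ^+ 2) ^+ 2 by ring.
 by rewrite sr expr1n mulr1.
have r8 : rho ^+ 8 * sM = rho ^+ 6.
 have -> : rho ^+ 8 * sM = rho ^+ 6 * (sM * rho ^+ 2) by ring.
 by rewrite sr mulr1.
have T3 (la : probability Om R) : goodlaw la K eps -> (forall k, tame la (f k)) -> forall k, Ex la (fun x => `|de k x| ^+ 3) <= h ^+ 22 * rho ^+ 6.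
 move=> Hl tl k.
 have := third_moment HK HN K1 Hb z0' Hz' al0 Hal Hl (tamec_real (tl k)) (af k).
 have -> : (fun x => `|de k x| ^+ 3) = (fun x => sM ^+ 3 * cabs (f k x)%:C ^+ 3).
  by apply: funext => x; rewrite cabs_real normrM (ger0_norm sM0) exprMn.
 rewrite ExZ; last exact: tame_cabsX (tamec_real (tl k)).
 move=> H; apply: le_trans (ler_wpM2l (exprn_ge0 3 sM0) H) _.
 by rewrite mulrCA [sM ^+ 3 * _]mulrC r12.
rewrite (eq_Ex mu FE) (eq_Ex nu FE) /stepE.
have tG la : tame la (fun x => Phi (\row_k psi Kt (v k + de k x))).
 by rewrite -(funext FE); exact: tame_Ff_mix.
apply: (@moment_comparison R p _ _ mu nu _ de c B (expC R p * B) _ _ _ be ga) => //.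
- by move=> k; exact: tameZ.
- by move=> k; exact: tameZ.
- by rewrite mulr_ge0 // /expC ler0n.
- move=> k; rewrite !ExZ // -mulrBr normrM (ger0_norm sM0).
 have := match1 HK HN K1 Hb Hmu Hnu z0' Hz' al0 Hal (af k).
 rewrite !ExcR -rmorphB cabs_real => H; apply: le_trans (ler_wpM2l sM0 H) _.
 by rewrite mulrCA [sM * _]mulrC r8.
- move=> k l.
 have E x : de k x * de l x = sM ^+ 2 * (f k x * f l x) by rewrite /de; ring.
 have t1 := tameM (tfm k) (tfm l); have t2 := tameM (tfn k) (tfn l).
 rewrite (eq_Ex mu E) (eq_Ex nu E) !ExZ // -mulrBr normrM (ger0_norm (sqr_ge0 _)).
 have := match2 HK HN K1 Hb Hmu Hnu (Hkap j) z0' Hz' al0 Hal (af k) (af l).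
 have E2 : (fun x => (f k x)%:C * (f l x)%:C) = (fun x => (f k x * f l x)%:C) by apply: funext => x; rewrite rmorphM.
 rewrite E2 !ExcR -rmorphB cabs_real => H; apply: le_trans (ler_wpM2l (sqr_ge0 _) H) _.
 by rewrite mulrCA [sM ^+ 2 * _]mulrC r10.
- exact: T3.
- exact: T3.
Qed.
(** Hybrid laws: columns before [k] follow the first law and the others the second. The induction
    runs over all probability measures with the hybrid product law, because consecutive hybrids
    appear as two resamplings of one column. *)
Lemma lindeberg : `|Ex mu Ff - Ex nu Ff| <= M%:R * stepE.
have [[pm Hpm] M0 _ _] := Hmu; have [[pn Hpn] _ _ _] := Hnu.
pose S (k : nat) : 'I_N -> 'I_M -> bool := fun _ j => (j < k)%N.
pose r k i j := if S k i j then pm i j else pn i j.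
have H k : (k <= M)%N -> forall ka : probability Om R, prodlaw ka (r k) -> `|Ex ka Ff - Ex nu Ff| <= k%:R * stepE.
 elim: k => [|k IH] kM ka Hka.
  have [_ ->] := @Ex_mix3 R N M ka mu nu pm pn (r 0%N) (fun _ _ => false) Ff Hpm Hpn Hka (fun _ _ => erefl)
   (tame_integrable (tame_Ff ka)) (fun y => tame_integrable (tame_Ff_mix mu _ y)).
  have -> : (fun y => Ex mu (fun x => Ff (mix (fun _ _ => false) x y))) = Ff.
   by apply: funext => y; rewrite -[RHS](Ex_cst mu); apply: eq_Ex => x; congr Ff.
  by rewrite subrr normr0 mul0r.
 (* A realisation of the hybrid with [k] columns exchanged: resampling its column [j] by the first
    law gives the law of [ka], resampling it by the second gives [kb] back. *)
 pose kb := distribution (nu \x mu)%E (mfun_of (@measurable_mix R N M (S k))).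
 have Hkb : prodlaw kb (r k) by exact: prodlaw_mix.
 pose j : 'I_M := Ordinal kM.
 have rX i l : r k.+1 i l = if colS j i l then pm i l else r k i l.
  rewrite /r /S /colS; have [->|lj] := eqVneq l j; first by rewrite /= ltnSn.
  by rewrite ltnS leq_eqVlt; have -> : (l == k :> nat) = false by apply: contraNF lj => /eqP e; apply/eqP/val_inj.
 have rY i l : r k i l = if colS j i l then pn i l else r k i l.
  by rewrite /r /S /colS; have [->|//] := eqVneq l j; rewrite /= ltnn.
 have [iX EX] := Ex_mix3 Hpm Hkb Hka rX (tame_integrable (tame_Ff ka)) (fun y => tame_integrable (tame_Ff_mix mu _ y)).
 have [iY EY] := Ex_mix3 Hpn Hkb Hkb rY (tame_integrable (tame_Ff kb)) (fun y => tame_integrable (tame_Ff_mix nu _ y)).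
 have tX (la : probability Om R) : kb.-integrable setT (EFin \o (fun y => Ex la (fun x => Ff (mix (colS j) x y)))) ->
   tame kb (fun y => Ex la (fun x => Ff (mix (colS j) x y))).
  move=> /integrableP[/measurable_EFinP mi _]; apply: (@tame_bnd _ _ _ _ _ Bs) => // y.
  have tl := tame_Ff_mix la (colS j) y; apply: le_trans (Ex_abs tl) _; rewrite -(Ex_cst la Bs).
  by apply: le_Ex; [exact: tame_abs|exact: tameC|move=> x; exact: HBs].
 have tx := tX mu iX; have ty := tX nu iY.
 have st : `|Ex ka Ff - Ex kb Ff| <= stepE.
  rewrite EX [X in _ - X]EY -ExB //; apply: le_trans (Ex_abs (tameB tx ty)) _; rewrite -[leRHS](Ex_cst kb).
  by apply: le_Ex; [exact: tame_abs (tameB tx ty)|exact: tameC|move=> y; exact: column_step].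
 have -> : Ex ka Ff - Ex nu Ff = (Ex ka Ff - Ex kb Ff) + (Ex kb Ff - Ex nu Ff) by ring.
 rewrite -natr1 mulrDl mul1r; apply: le_trans (ler_normD _ _) _; rewrite addrC.
 by apply: lerD => //; apply: IH => //; exact: ltnW.
have Hm : prodlaw mu (r M).
 have -> : r M = pm by apply: funext => i; apply: funext => l; rewrite /r /S ltn_ord.
 exact: Hpm.
exact: H.
Qed.

End Lindeberg.

(** * Proof of the theorem *)

Section NonMeasurableExpectation.
Context d (T : measurableType d) (R : realType) (P : probability T R).

(** The integral is built from suprema over simple functions below the integrand, so it is monotone
    on arbitrary functions. This matters because the integrand of the theorem depends on a choice
    inside [c0] and is not known to be measurable. *)
Lemma integral_mono (f g : T -> \bar R) : (forall x, (f x <= g x)%E) -> (\int[P]_x f x <= \int[P]_x g x)%E.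
move=> fg; rewrite /integral !patch_setT; apply: leeB; apply: le_ereal_sup => _ [h /= H <-]; exists h => //= x.
- apply: le_trans (H x) _; rewrite unlock ge_max !le_max lexx orbT andbT.
 by rewrite fg.
- apply: le_trans (H x) _; rewrite unlock ge_max !le_max lexx orbT andbT.
 by rewrite leeN2 fg.
Qed.
Lemma expectation_sandwich (f u e : T -> R) : tame P u -> tame P e -> (forall t, `|f t - u t| <= e t) ->
 exists2 r : R, 'E_P[f]%E = r%:E & `|r - Ex P u| <= Ex P e.
move=> tu te H.
have tl := tameB tu te; have tr := tameD tu te.
have fin g : tame P g -> (\int[P]_t (g t)%:E)%E = (Ex P g)%:E.
 by move=> tg; rewrite /Ex /Rintegral fineK //; exact: integrable_fin_num (tame_integrable tg).
have l : ((Ex P (fun t => u t - e t))%:E <= \int[P]_t (f t)%:E)%E.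
 rewrite -fin //; apply: integral_mono => t; rewrite lee_fin; have := H t.
 by rewrite ler_norml; move: (f t) (u t) (e t) => x y z; lra.
have r : (\int[P]_t (f t)%:E <= (Ex P (fun t => u t + e t))%:E)%E.
 rewrite -fin //; apply: integral_mono => t; rewrite lee_fin; have := H t.
 by rewrite ler_norml; move: (f t) (u t) (e t) => x y z; lra.
have ff : (\int[P]_t (f t)%:E)%E \is a fin_num.
 by rewrite fin_real // (lt_le_trans _ l) ?ltNyr // (le_lt_trans r) ?ltry.
exists (fine (\int[P]_t (f t)%:E)%E); first by rewrite unlock fineK.
move: l r; rewrite -[X in (_ <= X)%E -> (X <= _)%E -> _](fineK ff) !lee_fin (ExB tu te) (ExD tu te) ler_norml.
by move: (fine _) (Ex P u) (Ex P e) => x y z; lra.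
Qed.

End NonMeasurableExpectation.

Section AdmissibleGrowth.
Variables (R : realType) (n : nat) (Phi : 'rV[R]_(n + n) -> R) (C0 : R) (c : nat).
Hypotheses (Ha : admissible Phi C0) (Hc : C0 <= c%:R).

(* Choosing M with M^eps' = r turns the scale-dependent condition into
  polynomial growth of the derivatives. *)
Lemma admissible_growth (r : R) (ks : seq 'I_(n + n)) x : 1 < r -> (1 <= size ks <= 5)%N ->
 (forall j, rv_cabs x j <= r) -> `|pdiff ks Phi x| <= r ^+ c.
case: Ha => C00 _ _ [e0 e0p [M0 H]] r1 sk xr.
have r0 : 0 < r by exact: lt_trans r1.
have lr : 0 < ln r by rewrite ln_gt0.
pose M := maxn M0 (Num.truncn (expR (ln r / e0) + 2)).+1.
have M1 : expR (ln r / e0) + 2 < M%:R.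
 apply: lt_le_trans (truncnS_gt _) _; rewrite ler_nat leq_maxr //.
have M2 : 1 < M%:R :> R by apply: lt_trans M1; have := expR_gt0 (ln r / e0); lra.
have Mp : 0 < M%:R :> R by exact: lt_trans M2.
have lM : 0 < ln (M%:R : R) by rewrite ln_gt0.
pose e := ln r / ln (M%:R : R).
have ee : 0 < e < e0.
 rewrite divr_gt0 //= ltr_pdivrMr // -ltr_pdivrMl // mulrC -[X in X < _]expRK ltr_ln ?posrE ?expR_gt0 //.
 by apply: lt_trans M1; rewrite ltrDl.
have eM : powR (M%:R : R) e = r.
 by rewrite /powR gt_eqF // /e divfK ?gt_eqF // lnK.
have := H e M ee (leq_maxl _ _) ks x sk; rewrite eM => /(_ xr) /le_trans; apply.
rewrite mulrC powRrM eM -powR_mulrn; last exact: ltW.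
by rewrite ler_powR // ltW.
Qed.

End AdmissibleGrowth.

Section EntryLaw.
Variables (R : realType) (N M beta : nat) (Cp : nat -> R).
Context dT (T : measurableType dT) (P : probability T R).
Variables (XR XI : 'I_N -> 'I_M -> T -> R).
Hypotheses (M0 : (0 < M)%N) (Hbeta : beta = 1%N \/ beta = 2%N) (HX : sample_cov_entries beta Cp P XR XI).

Definition ent_of (t : T) : EntT R N M := fun i j => (XR i j t, XI i j t).

Lemma measurable_ent_of : measurable_fun setT ent_of.
by case: HX => mX _ _ _; apply: measurable_EntP => i j; case: (mX i j). Qed.
Definition entlaw : mxlaw R N M := distribution P (mfun_of measurable_ent_of).

Lemma tame_entlaw f : measurable_fun setT f -> tame P (fun t => f (ent_of t)) -> tame entlaw f.
move=> mf [_ H]; split => // q; have := H q.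
by rewrite ge0_integral_distribution //; exact: mfun_normX.
Qed.
Lemma tame_ent_of f : tame entlaw f -> tame P (fun t => f (ent_of t)).
move=> [mf H]; split=> [|q]; first exact: measurableT_comp mf measurable_ent_of.
by have := H q; rewrite ge0_integral_distribution //; exact: mfun_normX.
Qed.
Lemma Ex_entlaw f : tame entlaw f -> Ex entlaw f = Ex P (fun t => f (ent_of t)).
move=> tf; have tP := tame_ent_of tf; case: tf => mf _; rewrite /Ex /Rintegral integral_distribution //; first exact/measurable_EFinP.
exact: tame_integrable tP.
Qed.
(** Depends on [Cp] alone, through the two moment orders in [goodlaw]; the summand 1 makes it at
    least 1. *)
Definition entK : R := 1 + `|Cp 4| + `|Cp 8|.

Let x i j (t : T) : R[i] := XR i j t +i* XI i j t.
Let Mp : (0 : R) < M%:R. Proof. by rewrite ltr0n. Qed.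
Let tx_cabs i j : tame P (fun t => Num.sqrt M%:R * cabs (x i j t)) /\
 forall q, Ex P (fun t => (Num.sqrt M%:R * cabs (x i j t)) ^+ q) <= Cp q.
have [mX _ _ H] := HX; have [_ _ _ _ Hq] := H i j; have [m1 m2] := mX i j.
have mr : measurable_fun setT (fun t => Num.sqrt M%:R * cabs (x i j t)).
 by apply: measurable_funM; [exact: measurable_cst|apply: mfc_cabs; split].
have E t : Num.sqrt (M%:R * (XR i j t ^+ 2 + XI i j t ^+ 2)) = Num.sqrt M%:R * cabs (x i j t).
 by rewrite sqrtrM // ltW.
have r0 t : 0 <= Num.sqrt M%:R * cabs (x i j t) by rewrite mulr_ge0 ?sqrtr_ge0 ?cabs_ge0.
have I q : (\int[P]_t ((Num.sqrt M%:R * cabs (x i j t)) ^+ q)%:E <= (Cp q)%:E)%E.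
 by have := Hq q; rewrite unlock; under eq_integral do rewrite E.
have tr : tame P (fun t => Num.sqrt M%:R * cabs (x i j t)).
 split => // q; apply: le_lt_trans (ltry (Cp q)).
 by under eq_integral do rewrite ger0_norm //; exact: I.
split => // q; have := I q.
have ti := integrable_fin_num _ (tame_integrable (tameX q tr)).
by rewrite -(fineK (ti _)) //.
Qed.
Let tx i j : tamec P (x i j).
have [tr _] := tx_cabs i j; have [mX _ _ _] := HX; have [m1 m2] := mX i j.
apply: (tamec_le _ _ tr); first by split.
move=> t; rewrite ler_peMl ?cabs_ge0 //; have := @ler_sqrt R 1 M%:R (ltW Mp); rewrite sqrtr1 => ->.
by rewrite ler1n.
Qed.
Let tent i j : tamec entlaw (fun c => entmx c i j).
have [t1 t2] := tx i j.
split; apply: tame_entlaw.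
- by under eq_fun do rewrite mxE; exact: measurable_ent1.
- by under eq_fun do rewrite mxE.
- by under eq_fun do rewrite mxE; exact: measurable_ent2.
- by under eq_fun do rewrite mxE.
Qed.
Let EP g r : tame P g -> ('E_P[g] = r%:E)%E -> Ex P g = r.
by move=> tg; rewrite unlock /Ex /Rintegral => ->.
Qed.
Let E_ent i j (F : R[i] -> R) : tame entlaw (fun c => F (entmx c i j)) ->
 Ex entlaw (fun c => F (entmx c i j)) = Ex P (fun t => F (x i j t)).
by move=> /Ex_entlaw ->; apply: eq_Ex => t; rewrite mxE. Qed.
(** [2 - beta] is 1 for real and 0 for complex entries, since [E x^2 = E (Re x)^2 - E (Im x)^2] is
    [1 / M] or 0 respectively. *)
Lemma goodlaw_entlaw : goodlaw entlaw entK (2 - beta%:R).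
have [mX ind _ HM] := HX.
split => //; last move=> i j.
- exists (fun i j A B => fine (P [set t | A (XR i j t) /\ B (XI i j t)])); split.
  move=> i j; have -> : [set t | [set: R] (XR i j t) /\ [set: R] (XI i j t)] = setT by apply/seteqP; split.
  by rewrite probability_setT.
 move=> A B mAB; rewrite -(ind A B mAB) fineK; first by [].
 have mr := measurable_rect mAB.
 have -> : [set t | forall i j, A i j (XR i j t) /\ B i j (XI i j t)] = ent_of @^-1` rect A B by [].
 by apply: fin_num_measure; rewrite -[X in measurable X]setTI; exact: (measurable_ent_of measurableT).
- by rewrite /entK -addrA lerDl addr_ge0.
have [[e1 e2] e3 e4 e5 _] := HM i j; have [t1 t2] := tx i j; have [te1 te2] := tent i j.
have m1 := EP t1 e1; have m2 := EP t2 e2; have m3 := EP (tameM t1 t2) e3.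
have m4 := EP (tameX 2 t1) e4; have m5 := EP (tameD (tameX 2 t1) (tameX 2 t2)) e5.
have tc2 := tame_cabsX 2 (tent i j).
split.
- exact: tent.
- by rewrite /Exc (E_ent te1) (E_ent te2) m1 m2.
- rewrite (E_ent (F := fun u => cabs u ^+ 2) tc2) -m5; apply: eq_Ex => t; exact: cabs_sq.
- have [ts1 ts2] := tamecX 2 (tent i j).
 have sR : Ex P (fun t => Re (x i j t ^+ 2)) = (2 - beta%:R) / M%:R.
  have m6 : Ex P (fun t => XI i j t ^+ 2) = M%:R^-1 - (beta%:R * M%:R)^-1.
   by rewrite -m5 (ExD (tameX 2 t1) (tameX 2 t2)) m4 addrAC subrr add0r.
  have -> : Ex P (fun t => Re (x i j t ^+ 2)) = Ex P (fun t => XR i j t ^+ 2) - Ex P (fun t => XI i j t ^+ 2).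
   by rewrite -(ExB (tameX 2 t1) (tameX 2 t2)); apply: eq_Ex => t; rewrite expr2 cReM.
  rewrite m4 m6; have : (M%:R : R) != 0 by rewrite gt_eqF.
  case: Hbeta => ->; move: (M%:R) => u u0; by field.
 have sI : Ex P (fun t => Im (x i j t ^+ 2)) = 0.
  have -> : Ex P (fun t => Im (x i j t ^+ 2)) = 2 * Ex P (fun t => XR i j t * XI i j t).
   by rewrite -(ExZ _ (tameM t1 t2)); apply: eq_Ex => t; rewrite expr2 cImM /=; ring.
  by rewrite m3 mulr0.
 by rewrite /Exc (E_ent (F := fun u => Re (u ^+ 2)) ts1) (E_ent (F := fun u => Im (u ^+ 2)) ts2) sR sI.
have [tr Hq] := tx_cabs i j.
have B q k : (q = k.*2)%N -> Ex entlaw (fun c => cabs (entmx c i j) ^+ q) <= Cp q / M%:R ^+ k.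
 move=> qk; rewrite (E_ent (F := fun u => cabs u ^+ q)); last exact: tame_cabsX q (tent i j).
 rewrite ler_pdivlMr ?exprn_gt0 // mulrC.
 have tq := tame_cabsX q (tx i j).
 rewrite -(ExZ _ tq); apply: le_trans (Hq q); apply: le_of_eq; apply: eq_Ex => t.
 rewrite exprMn; congr (_ * _); rewrite qk -mul2n exprM sqr_sqrtr //; exact: ltW.
have le q k : Cp q <= entK -> Cp q / M%:R ^+ k <= entK / M%:R ^+ k.
 by move=> H; rewrite ler_wpM2r // invr_ge0 exprn_ge0 // ltW.
split; [apply: le_trans (B 4 2 erefl) _|apply: le_trans (B 8 4 erefl) _]; apply: le; rewrite /entK.
- by have := ler_norm (Cp 4); have := normr_ge0 (Cp 8); lra.
- by have := ler_norm (Cp 8); have := normr_ge0 (Cp 4); lra.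
Qed.

End EntryLaw.

Section SupportClose.
Variable R : realType.

Lemma gam_close (d d' k : R) : 0 < d -> 0 <= d' -> `|d' - d| <= k * Num.sqrt d -> 0 <= k -> k <= 1 ->
 `|gam_m d' - gam_m d| <= k * (3 + 2 * Num.sqrt d) /\ `|gam_p d' - gam_p d| <= k * (3 + 2 * Num.sqrt d).
move=> d0 d0' H k0 k1; set a := Num.sqrt d in H *; set a' := Num.sqrt d'.
have a0 : 0 < a by rewrite sqrtr_gt0.
have a0' : 0 <= a' by exact: sqrtr_ge0.
have aE : a ^+ 2 = d by rewrite sqr_sqrtr // ltW.
have aE' : a' ^+ 2 = d' by rewrite sqr_sqrtr.
have da : `|a' - a| <= k.
 rewrite -(ler_pM2r a0); apply: le_trans H; rewrite -aE -aE' subr_sqr normrM ler_wpM2l //.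
 by rewrite ger0_norm ?lerDr // addr_ge0 // ltW.
have a'k : a' <= a + 1 by move: da; rewrite ler_norml; lra.
rewrite /gam_m /gam_p -/a -/a'.
have e1 : (1 - a') ^+ 2 - (1 - a) ^+ 2 = (a' - a) * (a' + a - 2) by ring.
have e2 : (1 + a') ^+ 2 - (1 + a) ^+ 2 = (a' - a) * (a' + a + 2) by ring.
by rewrite e1 e2 !normrM; split; apply: ler_pM => //; rewrite ler_norml; apply/andP; split; lra.
Qed.
(** The edges are continuous in the ratio; only the atom jumps. For [d < 1] the ratio is eventually
    below 1 and carries no atom, and for [d = 1] the origin is the lower edge. *)
Lemma inS_close (d e : R) (dd : nat -> R) : 0 < d -> 0 < e -> (forall M, 0 <= dd M) -> (dd @ \oo --> d) ->
 exists M0 : nat, forall M, (M0 <= M)%N -> `|dd M - d| <= 1 /\ forall x, inS (dd M) x -> exists2 x', inS d x' & `|x - x'| <= e.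
move=> d0 e0 dd0 cv; set a := Num.sqrt d.
have a0 : 0 < a by rewrite sqrtr_gt0.
have a3 : 0 < 3 + 2 * a by rewrite addr_gt0 // mulr_gt0.
pose k := Num.min 1 (e / (3 + 2 * a)).
have k0 : 0 < k by rewrite lt_min ltr01 divr_gt0.
have k1 : k <= 1 by rewrite ge_min lexx.
have ke : k * (3 + 2 * a) <= e by rewrite -ler_pdivlMr // ge_min lexx orbT.
pose r := Num.min 1 (Num.min (k * a) (if d < 1 then (1 - d) / 2 else 1)).
have r0 : 0 < r.
 by rewrite !lt_min ltr01 mulr_gt0 //=; case: ifP => [d1|_]; [rewrite divr_gt0 // subr_gt0|exact: ltr01].
have /cvgrPdist_le/(_ r r0)[M0 _ HM] := cv; exists M0 => M /HM; rewrite distrC /= /r !le_min => /and3P[h1 h2 h3].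
split=> // x Sx.
have [g1 g2] := gam_close d0 (dd0 M) h2 (ltW k0) k1.
have {}g1 := le_trans g1 ke; have {}g2 := le_trans g2 ke.
have gmp : gam_m d <= gam_p d by rewrite /gam_m /gam_p -/a; nra.
case: Sx => [/andP[x1 x2]|[-> d1]].
 have [xm|xm] := leP x (gam_m d).
  exists (gam_m d); first by left; rewrite lexx.
  by rewrite ler_norml; move: g1; rewrite ler_norml => /andP[]; lra.
 have [xp|xp] := leP (gam_p d) x.
  exists (gam_p d); first by left; rewrite lexx gmp.
  by rewrite ler_norml; move: g2; rewrite ler_norml => /andP[]; lra.
 exists x; last by rewrite subrr normr0 ltW.
 by left; rewrite !ltW.
exists 0; last by rewrite subrr normr0 ltW.
have [dl|dl] := ltP 1 d; first by right.
left; have [d1'|d1'] := ltP d 1.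
 by exfalso; move: h3; rewrite d1' ler_norml; lra.
have -> : d = 1 by apply/eqP; rewrite eq_le dl d1'.
by rewrite /gam_m /gam_p sqrtr1 subrr expr0n /= lexx sqr_ge0.
Qed.

End SupportClose.

Lemma le_sum_term (R : numDomainType) (I : finType) (F : I -> R) i : (forall j, 0 <= F j) -> F i <= \sum_j F j.
by move=> F0; rewrite (bigD1 i) //= lerDl sumr_ge0. Qed.
Lemma rv_cabs_le (R : realType) n (x : 'rV[R]_(n + n)) (K : R) j : (forall k, `|x 0 k| <= K) -> rv_cabs x j <= 2 * K.
move=> H; have h1 := H (lshift n j); have h2 := H (rshift n j); rewrite /rv_cabs.
have K0 : 0 <= K by exact: le_trans h1.
rewrite -[leRHS]ger0_norm ?mulr_ge0 // -sqrtr_sqr ler_wsqrtr //.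
have s (y : R) : `|y| <= K -> y ^+ 2 <= K ^+ 2.
 by move=> yK; rewrite -(real_normK (num_real y)) lerXn2r ?nnegrE.
by have := s _ h1; have := s _ h2; have := sqr_ge0 K; rewrite exprMn; move: (_ ^+ 2) (_ ^+ 2) (_ ^+ 2) => u v w; lra.
Qed.
Lemma box_ball (R : realFieldType) (h : R) (c k : nat) : 2 <= h -> (2 * h ^+ k) ^+ c <= h ^+ (k.+1 * c).
move=> h2; have h0 : 0 <= h by exact: le_trans h2.
by rewrite exprM lerXn2r ?nnegrE ?mulr_ge0 ?exprn_ge0 // exprS ler_wpM2r // exprn_ge0.
Qed.
Lemma pow_ratio (R : realFieldType) (h : R) (i j : nat) : 1 <= h -> (i.+1 <= j)%N -> h ^+ i / h ^+ j <= h^-1.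
move=> h1 ij; have h0 : 0 < h by exact: lt_le_trans h1.
by rewrite ler_pdivrMr ?exprn_gt0 // ler_pdivlMl // -exprS ler_weXn2l.
Qed.
(** Markov's inequality in pathwise form: where [t >= 1], the trivial bound [2 * B] is at most
    [2 * B * t]. *)
Lemma sandwich_cases (R : realDomainType) (x y e B t : R) : 0 <= B -> 0 <= t -> 0 <= e -> `|x| <= B -> `|y| <= B ->
 (t < 1 -> `|x - y| <= e) -> `|x - y| <= e + 2 * B * t.
move=> B0 t0 e0 xB yB H; have [t1|t1] := ltP t 1.
 by apply: le_trans (H t1) _; rewrite lerDl !mulr_ge0.
apply: le_trans (ler_normB _ _) _; apply: le_trans (lerD xB yB) _.
have : B <= B * t by rewrite ler_peMr.
by rewrite -mulrA; move: (B * t) => u; move: e0; lra.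
Qed.
(** The truncation level is [h ^+ expA c]. Sums of size [h ^+ 27] are moved by at most
    [h ^+ 81 / h ^+ (2 * expA c)], and this must be [O(1/h)] after multiplication by a Lipschitz
    constant [h ^+ (29 * c)]. *)
Definition expA (c : nat) : nat := (29 * c + 82)%N.
(** Chosen for [rho = h ^- expQ c]: twice it must exceed the exponent [(expA c + 1) * c] of the
    derivative bound plus 22 in the exchange step, and also [29 * c + 1] for the quadrature error;
    100 covers the powers lost in the local law. *)
Definition expQ (c : nat) : nat := ((expA c).+1 * c + 29 * c + 100)%N.

Lemma expQ_ge100 c : (100 <= expQ c)%N. Proof. exact: leq_addl. Qed.
Lemma expQ_2 c : (29 * c + 2 <= 2 * expQ c)%N.
by rewrite mul2n -addnn; apply: leq_trans (leq_addr _ _); rewrite leq_add // leq_addl. Qed.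
Lemma expA_2 c : (29 * c + 82 <= expA c * 2)%N. Proof. exact: leq_pmulr. Qed.
Lemma expQ_step c k : (k <= 22)%N -> (((expA c).+1 * c + k).+1 <= 2 * expQ c)%N.
move=> k22; rewrite mul2n -addnn -addnS; apply: leq_trans (leq_addr _ _).
by rewrite leq_add ?leq_addr // (leq_ltn_trans k22).
Qed.
Lemma rho_pow (R : realType) (M q : nat) (h : R) : (0 < M)%N -> 0 < h -> h ^+ (4 * q) = M%:R -> rho R M = h ^- q.
move=> M0 h0 hM; have p0 : 0 <= h ^- q by rewrite invr_ge0 exprn_ge0 // ltW.
by apply/eqP; rewrite -(@eqrXn2 _ 4) ?rho4 // ?rhoE ?sqrtr_ge0 // exprVn -exprM mulnC hM.
Qed.

(** * From contour integrals to truncated sums *)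

Section Approximation.
Variable R : realType.
Local Notation C := R[i].
Variables (n : nat) (Phi : 'rV[R]_(n + n) -> R) (gx gy : 'I_n -> R -> R) (f : 'I_n -> C -> C).
Local Notation ga k := (cpt (gx k) (gy k)).
Local Notation phi k := (fun t => f k (ga k t) * dcpt (gx k) (gy k) t).
Variables (F L G d dlt Bs D K : R) (c : nat).
Hypotheses (cga : forall k, ccont (ga k)) (cphi : forall k, ccont (phi k)).
Hypotheses (F0 : 0 <= F) (HF : forall k t, 0 <= t <= 1 -> cabs (phi k t) <= F).
Hypotheses (L0 : 0 <= L) (HL : forall k s t, 0 <= s <= t -> t <= 1 -> cabs (ga k t - ga k s) <= L * (t - s)).
Hypotheses (G0 : 0 <= G) (HG : forall k t, cabs (ga k t) <= G).
Hypotheses (dlt0 : 0 < dlt) (Hdlt : forall k t x, inS d x -> dlt <= cabs (x%:C - ga k t)).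
Hypotheses (D0 : 0 <= D) (K1 : 1 <= K).
Hypothesis growth : forall r ks x, 1 < r -> (1 <= size ks <= 3)%N -> (forall j, rv_cabs x j <= r) -> `|pdiff ks Phi x| <= r ^+ c.
Hypothesis Hder : forall ks k x, (size ks < 3)%N -> derivable (pdiff ks Phi) x (delta_mx 0 k : 'rV_(n + n)).
Hypotheses (Bs0 : 0 <= Bs) (HBs : forall x, `|Phi x| <= Bs).
Local Notation p := (n + n)%N.

Local Notation expA := (expA c).
Local Notation q := (expQ c).
Local Notation m := (4 * q)%N.
(** Half of the distance to the support is what remains after passing from the support of [d] to
    that of [N / M], which costs [dlt / 4], and then to the eigenvalues, which costs
    [3 * dlt / 16]. *)
Definition sepR : R := dlt / 2.
Definition quadC : R := 6 * F * (L / sepR ^+ 2 + m`!%:R / sepR ^+ m.+1).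
(** A threshold for [h]: the sum of all quantities it has to dominate, so that each requirement
    follows by dropping the other terms. *)
Definition bigH : R := 10400 * K ^+ 2 + D + (G + dlt + m%:R + 1) + 32 / dlt + n%:R * (4 * F * 2 ^+ m) + quadC + 2.

Let Hder' ks k x : (size ks < 3)%N -> derivable (pdiff ks Phi) x (delta_mx 0 k : 'rV_p) /\
 pdiff (k :: ks) Phi x = derive (pdiff ks Phi) x (delta_mx 0 k : 'rV_p).
by move=> sk; split; [exact: Hder|]. Qed.
Lemma sepR_gt0 : 0 < sepR. Proof. by rewrite divr_gt0. Qed.
Lemma quadC_ge0 : 0 <= quadC.
have s0 := sepR_gt0; rewrite !mulr_ge0 // addr_ge0 ?divr_ge0 ?sqr_ge0 //.
by rewrite exprn_ge0 // ltW.
Qed.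

Section AtScale.
Variables (N M : nat) (h : R).
Hypotheses (N0 : (0 < N)%N) (M0 : (0 < M)%N) (Hh : bigH <= h) (hM : h ^+ m = M%:R).
Hypotheses (HD : N%:R / M%:R <= D).
Hypothesis Hclose : forall x, inS (N%:R / M%:R) x -> exists2 x', inS d x' & `|x - x'| <= dlt / 4.
Local Notation dd := (N%:R / M%:R : R).

Lemma bigH_parts : [/\ dominates K h, D <= h, G + dlt + m%:R + 1 <= h, 32 / dlt <= h & n%:R * (4 * F * 2 ^+ m) <= h] /\
 quadC <= h /\ 2 <= h.
have a1 : 0 <= 10400 * K ^+ 2 by apply: mulr_ge0; [exact: ler0n|exact: sqr_ge0].
have a3 : 0 <= G + dlt + m%:R + 1 by rewrite !addr_ge0 // ltW.
have a4 : 0 <= 32 / dlt by rewrite divr_ge0 // ltW.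
have a5 : 0 <= n%:R * (4 * F * 2 ^+ m) by rewrite !mulr_ge0 // exprn_ge0.
have a6 := quadC_ge0.
move: Hh; rewrite /bigH /dominates.
move: a1 a3 a4 a5 a6 D0; move: (10400 * _) (G + _ + _ + _) (32 / _) (n%:R * _) quadC D => u1 u2 u3 u4 u5 u6.
by move=> *; split; [split|split]; lra.
Qed.
Let h2 : 2 <= h. Proof. by have [_ []] := bigH_parts. Qed.
Let h1 : 1 <= h. Proof. by apply: le_trans h2; rewrite ler1n. Qed.
Let h0 : 0 < h. Proof. exact: lt_le_trans h2. Qed.
Let e0 : 0 < h^-1. Proof. by rewrite invr_gt0. Qed.
Let Mp : (0 : R) < M%:R. Proof. by rewrite ltr0n. Qed.
Let dd0 : 0 < dd. Proof. by rewrite divr_gt0 ?ltr0n. Qed.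
Lemma sqrtM : Num.sqrt (M%:R : R) = h ^+ (2 * q).
by rewrite -hM (_ : m = (2 * q) * 2)%N ?exprM ?sqrtr_sqr ?ger0_norm ?exprn_ge0 ?(ltW h0) // mulnAC. Qed.
Lemma sepS k t x : inS dd x -> 3 * dlt / 4 <= cabs (x%:C - ga k t).
move=> /Hclose[x' Sx' xx']; have := Hdlt k t Sx'.
have := cabsD (x%:C - ga k t) (x' - x)%:C.
have -> : x%:C - ga k t + (x' - x)%:C = x'%:C - ga k t by rewrite rmorphB /=; ring.
rewrite cabs_real distrC; move: xx'; move: (`|_|) (cabs _) (cabs _) => u v w; lra.
Qed.
Lemma sepS2 k t x : inS dd x -> sepR <= cabs (x%:C - ga k t).
by move=> /(sepS k t) H; apply: le_trans H; rewrite /sepR; move: dlt0; lra. Qed.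
Definition ak (k : 'I_n) (i : 'I_M.+1 * 'I_m) : C := quada (gx k) (gy k) (f k) i.
Definition zk (k : 'I_n) (i : 'I_M.+1 * 'I_m) : C := quadz (gx k) (gy k) h^-1 i.
Definition sk (k : 'I_n) (i : 'I_M.+1 * 'I_m) : C := mp_stieltjes dd (zk k i).

Lemma zk_Im k i : h^-1 <= `|Im (zk k i)|.
exact: Im_vstep_ge (ltW e0). Qed.
Lemma zk_neq0 k i : Im (zk k i) != 0.
by rewrite -normr_gt0; exact: lt_le_trans (zk_Im k i). Qed.
Lemma zk_inv k i : `|Im (zk k i)|^-1 <= h.
by rewrite -[leRHS]invrK lef_pV2 ?posrE ?normr_gt0 ?zk_neq0 //; exact: zk_Im. Qed.
Lemma zk_le k i : cabs (zk k i) <= h.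
have [[_ _ H _ _] _] := bigH_parts; apply: le_trans H.
apply: le_trans (cabsD _ _) _; rewrite cabsM cabs_natr cabs_vstep ?(ltW e0) //.
have a1 := HG k (i.1%:R / M%:R).
have a2 : i.2.+1%:R * h^-1 <= m%:R.
 apply: le_trans (_ : i.2.+1%:R <= _); last by rewrite ler_nat; exact: ltn_ord.
 by rewrite ler_piMr // invf_le1.
have aux (u v g e l : R) : u <= g -> v <= l -> 0 < e -> u + v <= g + e + l + 1 by move=> *; lra.
exact: aux a1 a2 dlt0.
Qed.
Lemma zk_sep k i x : inS dd x -> sepR <= cabs (x%:C - zk k i).
by move=> Sx; apply: le_trans (sepS2 k _ Sx) _; exact: vstep_away (ltW e0). Qed.
Lemma sk_le k i : cabs (sk k i) <= h.
apply: le_trans (stieltjes_le dd0 sepR_gt0 (zk_sep k i)) _.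
have [[_ _ _ H _] _] := bigH_parts; apply: le_trans H; rewrite /sepR invf_div mulrA.
by rewrite ler_wpM2r ?invr_ge0 ?(ltW dlt0) // -natrM ler_nat.
Qed.
Lemma sk_mpsol k i : mpsol dd (zk k i) (sk k i).
by apply: mpsol_mp_stieltjes => //; exact: zk_neq0. Qed.
Lemma ak_sum : \sum_k \sum_i cabs (ak k i) <= h.
have [[_ _ _ _ H] _] := bigH_parts; apply: le_trans H; apply: sum_const_le => k.
exact: (quada_sum (cphi k) F0 (HF k) m M0).
Qed.
Lemma HN_h : N%:R <= h * M%:R.
have [[_ H _ _ _] _] := bigH_parts.
by move: (le_trans HD H); rewrite ler_pdivrMr.
Qed.
Lemma HB_box k ks x : (1 <= size ks <= 3)%N -> box (h ^+ k) x -> `|pdiff ks Phi x| <= h ^+ (k.+1 * c).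
move=> s3 bx; apply: le_trans (box_ball c k h2); apply: growth => //.
 by apply: lt_le_trans (_ : 2 * 1 <= _); [rewrite mulr1 ltr1n|rewrite ler_wpM2l // exprn_ege1].
by move=> j; apply: rv_cabs_le.
Qed.

Variables (b : 'cV[C]_N).
Hypothesis Hb : unit_cvec b.
Let nb : nv b = 1. Proof. exact: Hb. Qed.
Let nb1 : nv b <= 1. Proof. by rewrite nb. Qed.
Let bb : ip b b = 1. Proof. by rewrite ipuu nb. Qed.
Local Notation Ff := (Ff b ak zk sk Phi (h ^+ expA)).
Local Notation Gs := (Gsum b ak zk sk).

Definition Iv (c : EntT R N M) (k : 'I_n) : C := Ifun M (gram c) b (gx k) (gy k) (f k).

(** An eigenvalue is harmless if it is close to the support, and also if it exceeds [G + dlt], since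
    the contours lie in the disc of radius [G]. Either way it keeps distance [sepR] from the
    contours; the quadrature error [1 / M] times [sqrt M = h ^+ (2 * q)] leaves [h ^- (2 * q)]. *)
Lemma Iv_close (w : EntT R N M) k :
 (forall l, (exists2 x, inS dd x & `|x - eigv (gram w) l| < 3 * (dlt / 16)) \/
   G + dlt < `|eigv (gram w) l|) ->
 cabs (Iv w k - Gs (entmx w) k) <= h * h ^- (2 * q).
move=> Hl; have s0 := sepR_gt0.
have Hsep x t : inS dd x \/ (exists l, x = eigv (gram w) l) -> sepR <= cabs (x%:C - ga k t).
 case=> [Sx|[l ->]]; first exact: sepS2.
 rewrite /sepR; case: (Hl l); move: (eigv _ l) => x0.
 - move=> [x' Sx' xl]; have a1 := sepS k t Sx'.
  have := cabsD (x0%:C - ga k t) (x' - x0)%:C.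
  rewrite (_ : x0%:C - ga k t + (x' - x0)%:C = x'%:C - ga k t); last by rewrite rmorphB /=; ring.
  rewrite cabs_real; move: a1 xl dlt0; move: (cabs _) (`|_|) (cabs _) => u v y; lra.
 - move=> far; have a1 := HG k t; have := cabsD (x0%:C - ga k t) (ga k t); rewrite subrK cabs_real.
  move: a1 far dlt0; move: (cabs _) (`|_|) (cabs _) => u v y; lra.
have Q := quad_approx (cga k) (cphi k) (HF k) L0 (HL k) m M0 (ltW e0) N0 nb s0 Hsep.
have -> : Gs (entmx w) k = (Num.sqrt (M%:R : R))%:C * \sum_i ak k i * kf (entmx w) b dd (zk k i).
 by rewrite /Gsum; congr (_ * _); apply: eq_bigr => i _; rewrite ip_spec ?zk_neq0.
apply: le_trans Q _; rewrite [h * _]mulrC.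
have [_ [H _]] := bigH_parts; apply: le_trans (_ : h ^- (2 * q) * quadC <= _); last first.
 by rewrite ler_wpM2l // invr_ge0 exprn_ge0 // ltW.
rewrite sqrtM -hM /quadC exprVn (_ : m = 2 * q + 2 * q)%N; last by rewrite -mulnDl.
rewrite (exprD h); have : h ^+ (2 * q) != 0 by rewrite expf_neq0 // gt_eqF.
have : sepR ^+ 2 != 0 by rewrite expf_neq0 // gt_eqF.
have : sepR ^+ (2 * q + 2 * q).+1 != 0 by rewrite expf_neq0 // gt_eqF.
move: (h ^+ _) (sepR ^+ 2) (sepR ^+ _) (_ `!%:R) => X S S' u S'0 S0 X0.
by apply: le_of_eq; field; rewrite X0 S0 S'0.
Qed.
Lemma coord_le (v : 'I_n -> C) e k : (forall l, cabs (v l) <= e) -> `|coord v k| <= e.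
by move=> H; rewrite /coord; case: (fintype.split k) => l; apply: le_trans (H l); [exact: le_Re_cabs|exact: le_Im_cabs].
Qed.
Lemma coord_sub (v w : 'I_n -> C) k : coord (fun l => v l - w l) k = coord v k - coord w k.
by rewrite /coord; case: (fintype.split k) => l; case: (v l); case: (w l). Qed.
Lemma cvec_coord (v : 'I_n -> C) k : cvec_to_rv v 0 k = coord v k.
by rewrite /cvec_to_rv mxE /coord; case: (fintype.split k) => l; rewrite mxE. Qed.
(** Both arguments lie in the box of size [h ^+ 28], where each partial derivative is at most
    [h ^+ (29 * c)]. The two hypotheses bound the quadrature error and, through [psi_id], the effect
    of the truncation. *)
Lemma smooth_close (w : EntT R N M) : (forall k, cabs (Iv w k - Gs (entmx w) k) <= h * h ^- (2 * q)) ->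
 (forall k, cabs (Gs (entmx w) k) <= h ^+ 27) ->
 `|Phi (cvec_to_rv (Iv w)) - Ff w| <= p%:R * (2 * h^-1).
move=> H1 H2; have e1 : h^-1 <= 1 by rewrite invf_le1.
have Kt1 : 1 <= h ^+ expA by rewrite exprn_ege1.
have X27 : 1 <= h ^+ 27 by rewrite exprn_ege1.
have X28 : h ^+ 27 + 1 <= h ^+ 28.
 rewrite (exprS h 27); have : 2 * h ^+ 27 <= h * h ^+ 27 by rewrite ler_wpM2r // exprn_ge0 // ltW.
 by move: X27; move: (h ^+ 27) (h * _) => u v; lra.
have r1 : h * h ^- (2 * q) <= 1.
 apply: le_trans (pow_ratio (i := 1) h1 _) e1.
 exact: leq_trans (leq_addl _ _) (expQ_2 c).
pose r := h ^+ 81 / (h ^+ expA) ^+ 2.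
have r2 : r <= 1.
 by apply: le_trans e1; rewrite /r -exprM; apply: pow_ratio => //; exact: leq_trans (leq_addl _ _) (expA_2 c).
have g1 k := coord_le k H2.
have g2 k : `|psi (h ^+ expA) (coord (Gs (entmx w)) k) - coord (Gs (entmx w)) k| <= r.
 apply: le_trans (psi_id Kt1 _) _; rewrite /r ler_wpM2r ?invr_ge0 ?sqr_ge0 //.
 by rewrite (_ : 81 = 27 * 3)%N // (exprM h) lerXn2r ?nnegrE ?exprn_ge0 // ltW.
have g3 k : `|coord (Iv w) k - coord (Gs (entmx w)) k| <= h * h ^- (2 * q).
 by rewrite -coord_sub; exact: coord_le.
apply: le_trans (lipschitz_box (erefl (pdiff [::] Phi)) Hder' (fun ks x => @HB_box 28 ks x) (e := h * h ^- (2 * q) + r) _ _ _) _.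
- move=> k; rewrite cvec_coord; have := ler_normD (coord (Iv w) k - coord (Gs (entmx w)) k) (coord (Gs (entmx w)) k).
 rewrite subrK; move: (g1 k) (g3 k) r1 X28; move: (h ^+ 27) (h ^+ 28) (`|_|) (`|_|) (`|_|) (h * _) => u1 u2 u3 u4 u5 u6; lra.
- move=> k; rewrite mxE; have := ler_normD (psi (h ^+ expA) (coord (Gs (entmx w)) k) - coord (Gs (entmx w)) k) (coord (Gs (entmx w)) k).
 rewrite subrK; move: (g1 k) (g2 k) r2 X28; move: (h ^+ 27) (h ^+ 28) (`|_|) (`|_|) (`|_|) => u2 u3 u4 u5 u6; lra.
- move=> k; rewrite cvec_coord mxE.
 have := ler_normB (coord (Iv w) k - coord (Gs (entmx w)) k) (psi (h ^+ expA) (coord (Gs (entmx w)) k) - coord (Gs (entmx w)) k).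
 rewrite (_ : forall x y z : R, x - y - (z - y) = x - z); last by move=> x y z; ring.
 move: (g2 k) (g3 k); move: (h * _) (`|_|) (`|_|) (`|_|) => u2 u3 u4 u5; lra.
have q1 : h ^+ (29 * c) * (h * h ^- (2 * q)) <= h^-1.
 by rewrite mulrA -exprSr; apply: pow_ratio => //; rewrite -addn2; exact: expQ_2.
have q2 : h ^+ (29 * c) * r <= h^-1.
 by rewrite /r mulrA -exprD -exprM; apply: pow_ratio => //; rewrite -addnS; exact: expA_2.
rewrite -mulrA ler_wpM2l // mulrDr; move: q1 q2; move: (_ * (h * _)) (_ * r) h^-1 => u1 u2 u3; lra.
Qed.
Lemma replacement (mu nu : mxlaw R N M) eps : goodlaw mu K eps -> goodlaw nu K eps ->
 (forall j i, kap mu eps j i = kap nu eps j i) -> `|Ex mu Ff - Ex nu Ff| <= M%:R * stepE M h n (h ^+ (expA.+1 * c)).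
move=> Hmu Hnu Hk; have [[Hdom _ _ _ _] _] := bigH_parts.
have Kt1 : 1 <= h ^+ expA by rewrite exprn_ege1.
have B0 : 0 <= h ^+ (expA.+1 * c) by rewrite exprn_ge0 // ltW.
have HBx ks (x : 'rV_p) : (1 <= size ks <= 3)%N -> box (h ^+ expA) x -> `|pdiff ks Phi x| <= h ^+ (expA.+1 * c) by exact: HB_box.
exact: (lindeberg Hdom HN_h K1 nb1 sk zk_neq0 zk_inv zk_le ak_sum (erefl (pdiff [::] Phi)) Hder' HBx Kt1 B0 HBs Hmu Hnu Hk).
Qed.

Section Law.
Variables (mu : mxlaw R N M) (eps : R).
Hypotheses (Hg : goodlaw mu K eps) (Heps : eps = 0 \/ eps = 1).

Lemma tame_Gsum k : tamec mu (fun w => Gs (entmx w) k).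
apply: tamecM; first exact: tamecC.
apply: (@tamec_sum _ _ _ _ _ _ xpredT (fun i w => ak k i * Yf (zk k i) (sk k i) b w)) => i.
by apply: tamecM; [exact: tamecC|exact: (tame_Yf Hg (sk k i) (zk_neq0 k i) b)].
Qed.
(** The factor [M] from the prefactor cancels against the isotropic bound [h ^+ 51 / M] at each
    node; the total weight enters squared and contributes [h ^+ 2]. *)
Lemma E_Gsum k : Ex mu (fun w => cabs (Gs (entmx w) k) ^+ 2) <= h ^+ 53.
have [[Hdom _ _ _ _] _] := bigH_parts.
pose Y i (w : EntT R N M) := cabs (Yf (zk k i) (sk k i) b w) ^+ 2.
have tY i : tame mu (Y i) by apply: tame_cabsX; exact: (tame_Yf Hg (sk k i) (zk_neq0 k i) b).
have EY i : Ex mu (Y i) <= h ^+ 51 / M%:R.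
 exact: (E_iso_sq Hg Hdom HN_h (zk_neq0 k i) (zk_inv k i) (zk_le k i) (sk_mpsol k i) (sk_le k i) nb1 bb).
have S0 : 0 <= \sum_i cabs (ak k i) by apply: sumr_ge0 => i _; exact: cabs_ge0.
have Sh : \sum_i cabs (ak k i) <= h.
 apply: le_trans ak_sum; apply: (@le_sum_term _ _ (fun k => \sum_i cabs (ak k i))) => l.
 by apply: sumr_ge0 => i _; exact: cabs_ge0.
have tA i : tame mu (fun w => cabs (ak k i) * Y i w) by exact: tameZ.
have tS : tame mu (fun w => \sum_i cabs (ak k i) * Y i w) by exact: tame_sum.
apply: le_trans (_ : Ex mu (fun w => M%:R * h * (\sum_i cabs (ak k i) * Y i w)) <= _).
 apply: le_Ex => [||w]; [by apply: tame_cabsX; exact: tame_Gsum|exact: tameZ|].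
 rewrite /Gsum cabsM cabs_real exprMn real_normK ?num_real // sqr_sqrtr // -mulrA ler_wpM2l //.
 apply: le_trans (_ : (\sum_i cabs (ak k i) * cabs (Yf (zk k i) (sk k i) b w)) ^+ 2 <= _).
  rewrite lerXn2r ?nnegrE ?cabs_ge0 //.
   by apply: sumr_ge0 => i _; rewrite mulr_ge0 ?cabs_ge0.
  apply: le_trans (cabs_sum _ _ _) _; apply: ler_sum => i _; by rewrite cabsM.
 apply: le_trans (weighted_sq _ _) _; first by move=> i; exact: cabs_ge0.
 rewrite ler_wpM2r // sumr_ge0 // => i _; by rewrite mulr_ge0 ?cabs_ge0 ?sqr_ge0.
rewrite ExZ // Ex_sum //.
apply: le_trans (_ : M%:R * h * (h * (h ^+ 51 / M%:R)) <= _); last first.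
 rewrite (exprS h 52) (exprS h 51); have : (M%:R : R) != 0 by rewrite gt_eqF.
 by move: (h ^+ 51) (M%:R : R) => u v v0; apply: le_of_eq; field.
rewrite ler_wpM2l ?mulr_ge0 ?ler0n ?(ltW h0) //.
apply: le_trans (_ : (\sum_i cabs (ak k i)) * (h ^+ 51 / M%:R) <= _); last first.
 by rewrite ler_wpM2r // divr_ge0 ?ler0n ?exprn_ge0 // ltW.
by rewrite mulr_suml; apply: ler_sum => i _; rewrite ExZ // ler_wpM2l ?cabs_ge0.
Qed.

End Law.
End AtScale.

(** Where the functional [T] is below 1 there are no bounded outliers and all sums are at most
    [h ^+ 27], so [smooth_close] applies; elsewhere [sandwich_cases] uses the boundedness of the
    test function. The exponent 54 is twice 27 and one more than that of [E_Gsum], which leaves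
    [1 / h]. *)
Lemma good_event : exists2 A : R, 0 < A &
 forall (N M : nat) (h : R) (N0 : (0 < N)%N) (M0 : (0 < M)%N), bigH <= h -> h ^+ m = M%:R -> N%:R / M%:R <= D ->
  (forall x, inS (N%:R / M%:R) x -> exists2 x', inS d x' & `|x - x'| <= dlt / 4) ->
  forall b : 'cV[C]_N, unit_cvec b -> forall (mu : mxlaw R N M) eps, goodlaw mu K eps -> eps = 0 \/ eps = 1 ->
  exists e : EntT R N M -> R, [/\ tame mu e, Ex mu e <= A / h &
   forall w, `|Phi (cvec_to_rv (Iv b w)) - Ff b (@ak M) (@zk M h) (@sk N M h) Phi (h ^+ expA) w| <= e w].
have q0 := expQ_ge100 c.
have m0 : (0 < m)%N by rewrite muln_gt0 (leq_trans _ q0).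
have B0 : 0 <= G + dlt by rewrite addr_ge0 // ltW.
have d16 : 0 < dlt / 16 by rewrite divr_gt0.
have [A A0 HA] := no_outliers m0 d16 B0 D0 K1.
have n0 : (0 : R) <= n%:R by exact: ler0n.
have p0 : (0 : R) <= p%:R by exact: ler0n.
exists (p%:R * 2 + 2 * Bs * (A + n%:R) + 1).
 by rewrite ltr_wpDl // addr_ge0 ?mulr_ge0 ?addr_ge0 // ltW.
move=> N M h N0 M0 Hh hM HD Hc b Hb mu eps Hg He.
have [[Hdom _ Hm H32 _] [_ h2]] := bigH_parts Hh.
have h1 : 1 <= h by apply: le_trans h2; rewrite ler1n.
have h0 : 0 < h by exact: lt_le_trans h2.
have i0 : 0 < h^-1 by rewrite invr_gt0.
have rh := rho_pow M0 h0 hM.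
have rle : rho R M <= h^-1 by rewrite rh lef_pV2 ?posrE ?exprn_gt0 // -{1}[h]expr1 ler_weXn2l // (leq_trans _ q0).
have [F1 [tF F1_0 EF HF1]] : exists F1 : EntT R N M -> R,
  [/\ tame mu F1, forall c, 0 <= F1 c, Ex mu F1 <= A / h & forall c, F1 c < 1 -> forall i,
   `|eigv (gram c) i| <= G + dlt ->
   exists2 x, inS (N%:R / M%:R) x & `|x - eigv (gram c) i| < 3 * (dlt / 16)].
 apply: (HA N M mu eps h) => //.
 - exact: (HN_h M0 Hh HD).
 - by rewrite rh ler_pdivrMr ?exprn_gt0 // mul1r ler_weXn2l // (leq_trans _ q0).
 - by apply: le_trans H32; rewrite invf_div mulrA -natrM.
 - apply: le_trans rle _; rewrite -[leRHS]invrK lef_pV2 ?posrE ?invr_gt0 // invf_div.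
  by apply: le_trans H32; rewrite ler_wpM2r ?invr_ge0 ?(ltW dlt0) // ler_nat.
 - rewrite -hM ler_pdivrMr ?exprn_gt0 // ler_pdivlMl ?exprn_gt0 // -exprD ler_weXn2l //.
  by rewrite mul2n -addnn leq_add2r (leq_trans (leq_trans _ q0)) // leq_pmull.
pose Gk k (w : EntT R N M) := cabs (Gsum b (@ak M) (@zk M h) (@sk N M h) (entmx w) k) ^+ 2.
have tG k : tame mu (Gk k) by apply: tame_cabsX; exact: (tame_Gsum Hh b Hg).
have EG k : Ex mu (Gk k) <= h ^+ 53 by exact: (E_Gsum N0 M0 Hh HD Hc Hb Hg).
pose T w := F1 w + \sum_k h ^- 54 * Gk k w.
have c54 : 0 <= h ^- 54 by rewrite invr_ge0 exprn_ge0 // ltW.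
have tk k : tame mu (fun w => h ^- 54 * Gk k w) by exact: tameZ.
have tS : tame mu (fun w => \sum_k h ^- 54 * Gk k w) by exact: tame_sum.
have tT : tame mu T by exact: tameD.
have G_0 k w : 0 <= h ^- 54 * Gk k w by rewrite mulr_ge0 // sqr_ge0.
have T0 w : 0 <= T w by rewrite addr_ge0 // sumr_ge0.
have ET : Ex mu T <= (A + n%:R) / h.
 rewrite /T ExD // mulrDl lerD // Ex_sum //; apply: sum_const_le => k.
 rewrite ExZ //; apply: le_trans (ler_wpM2l c54 (EG k)) _.
 by rewrite mulrC; exact: pow_ratio.
exists (fun w => p%:R * (2 * h^-1) + 2 * Bs * T w); split.
- by apply: tameD; [exact: tameC|exact: tameZ].
- have tc : tame mu (fun=> p%:R * (2 * h^-1)) by exact: tameC.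
 rewrite (ExD tc (tameZ (2 * Bs) tT)) Ex_cst (ExZ _ tT).
 have : 2 * Bs * Ex mu T <= 2 * Bs * ((A + n%:R) / h) by rewrite ler_wpM2l // mulr_ge0.
 have aux (P Q X u : R) : (P * 2 + 2 * Q * X + 1) * u = P * (2 * u) + 2 * Q * (X * u) + u by ring.
 rewrite aux.
 by move=> le; rewrite -addrA lerD2l; apply: le_trans le _; rewrite lerDl (ltW i0).
- move=> w; apply: sandwich_cases => //.
  by rewrite !mulr_ge0 // ltW.
  exact: HBs.
 move=> Tw; apply: (smooth_close Hh) => k.
  apply: (Iv_close N0 M0 Hh hM Hc Hb) => l.
  have F1w : F1 w < 1 by apply: le_lt_trans Tw; rewrite lerDl sumr_ge0.
  by have [le|lt] := leP `|eigv (gram w) l| (G + dlt); [left; exact: HF1|right].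
 have : h ^- 54 * Gk k w < 1.
  apply: le_lt_trans Tw; rewrite /T -[leLHS]add0r lerD //.
  exact: (@le_sum_term _ _ (fun k => h ^- 54 * Gk k w)).
 rewrite mulrC ltr_pdivrMr ?exprn_gt0 // mul1r /Gk (_ : 54 = 27 * 2)%N // exprM => lt.
 by rewrite -(@ler_pXn2r _ 2) ?nnegrE ?cabs_ge0 ?exprn_ge0 ?(ltW h0) // ltW.
Qed.

End Approximation.

Lemma Ex_expectation (R : realType) d (T : measurableType d) (P : probability T R) f : Ex P f = fine 'E_P[f]%E.
by rewrite unlock. Qed.
(** [|x|^4] is a polynomial of degree four in the real and imaginary parts; here the matching of
    moments enters. *)
Lemma kap_entlaw (R : realType) (N M beta : nat) (Cp : nat -> R)
 (dX : measure_display) (TX : measurableType dX) (PX : probability TX R) (XR XI : 'I_N -> 'I_M -> TX -> R)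
 (dY : measure_display) (TY : measurableType dY) (PY : probability TY R) (YR YI : 'I_N -> 'I_M -> TY -> R)
 (HX : sample_cov_entries beta Cp PX XR XI) (HY : sample_cov_entries beta Cp PY YR YI) (eps : R) :
 goodlaw (entlaw HX) (entK Cp) eps -> goodlaw (entlaw HY) (entK Cp) eps ->
 (forall i j (l p : nat), (l + p <= 4)%N ->
   ('E_PX[(fun t => XR i j t ^+ l * XI i j t ^+ p)%R] = 'E_PY[(fun t => YR i j t ^+ l * YI i j t ^+ p)%R])%E) ->
 forall j i, kap (entlaw HX) eps j i = kap (entlaw HY) eps j i.
move=> [_ _ _ gX] [_ _ _ gY] match4 j i; rewrite /kap; congr (_ - _).
have [[tX1 tX2] _ _ _ _] := gX i j; have [[tY1 tY2] _ _ _ _] := gY i j.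
have expand (mu : mxlaw R N M) : tame mu (fun c : EntT R N M => Re (entmx c i j)) ->
  tame mu (fun c : EntT R N M => Im (entmx c i j)) ->
  Ex mu (fun c => cabs (xe j i c) ^+ 4) = Ex mu (fun c => Re (entmx c i j) ^+ 4 * Im (entmx c i j) ^+ 0)
   + 2 * Ex mu (fun c => Re (entmx c i j) ^+ 2 * Im (entmx c i j) ^+ 2) + Ex mu (fun c => Re (entmx c i j) ^+ 0 * Im (entmx c i j) ^+ 4).
 move=> t1 t2; have t l p := tameM (tameX l t1) (tameX p t2).
 rewrite -(ExZ 2 (t 2 2)) -(ExD (t 4 0) (tameZ 2 (t 2 2))) -(ExD (tameD (t 4 0) (tameZ 2 (t 2 2))) (t 0 4)).
 by apply: eq_Ex => c; rewrite /xe (exprM _ 2 2) cabs_sq; move: (Re _) (Im _) => x y; ring.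
rewrite !expand //; have term l p : (l + p <= 4)%N ->
  Ex (entlaw HX) (fun c => Re (entmx c i j) ^+ l * Im (entmx c i j) ^+ p) =
  Ex (entlaw HY) (fun c => Re (entmx c i j) ^+ l * Im (entmx c i j) ^+ p).
 move=> lp; rewrite (Ex_entlaw (tameM (tameX l tX1) (tameX p tX2))) (Ex_entlaw (tameM (tameX l tY1) (tameX p tY2))).
 rewrite (_ : (fun t => _) = (fun t => XR i j t ^+ l * XI i j t ^+ p)); last by apply: funext => t; rewrite mxE.
 rewrite (_ : (fun t : TY => _) = (fun t => YR i j t ^+ l * YI i j t ^+ p)); last by apply: funext => t; rewrite mxE.
 by rewrite !Ex_expectation match4.
by rewrite !term.
Qed.
Lemma uniform_bound (R : realType) (n : nat) (Q : 'I_n -> R -> Prop) : (forall k, exists2 B : R, 0 <= B & Q k B) ->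
 (forall k B B', B <= B' -> Q k B -> Q k B') -> exists2 B : R, 0 <= B & forall k, Q k B.
move=> H mono; have /choice[B HB] : forall k, exists B : R, 0 <= B /\ Q k B by move=> k; have [B] := H k; exists B.
exists (\sum_k B k); first by apply: sumr_ge0 => k _; have [] := HB k.
move=> k; apply: mono (HB k).2; apply: (@le_sum_term _ _ B) => l; by have [] := HB l.
Qed.
(** [M * rho ^+ 6 = rho ^+ 2 = h ^- (2 * expQ c)], and by [expQ_step] this exponent outweighs the
    derivative bound together with up to 22 further powers of [h]. *)
Lemma stepE_small (R : realType) (M n c : nat) (h : R) : (0 < M)%N -> 2 <= h -> h ^+ (4 * expQ c) = M%:R ->
 M%:R * stepE M h n (h ^+ ((expA c).+1 * c)) <=
 ((n + n)%:R * 2 + (n + n)%:R * ((n + n)%:R * 8) + 2 * (expC R (n + n) * (n + n)%:R)) / h.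
move=> M0 h2 hM; have h1 : 1 <= h by apply: le_trans h2; rewrite ler1n.
have h0 : 0 < h by exact: lt_le_trans h2.
have Mp : (0 : R) < M%:R by rewrite ltr0n.
set B := h ^+ _; have B0 : 0 <= B by rewrite exprn_ge0 // ltW.
have rho0 : 0 <= rho R M by exact: sqrtr_ge0.
have key k : (k <= 22)%N -> M%:R * (B * (h ^+ k * rho R M ^+ 6)) <= h^-1.
 move=> k22; have r6 : M%:R * rho R M ^+ 6 = h ^- (2 * expQ c).
  have -> : rho R M ^+ 6 = rho R M ^+ 4 * rho R M ^+ 2 by rewrite -exprD.
  by rewrite rho4 // mulrA divff ?gt_eqF // mul1r (rho_pow M0 h0 hM) exprVn -exprM mulnC.
 rewrite (_ : M%:R * _ = B * h ^+ k * (M%:R * rho R M ^+ 6)); last by move: (rho R M ^+ 6) => r; ring.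
 by rewrite r6 -exprD; apply: pow_ratio => //; exact: expQ_step.
have p0 : (0 : R) <= (n + n)%:R by exact: ler0n.
have C0 : 0 <= expC R (n + n) by exact: ler0n.
have r0 k : 0 <= h ^+ k * rho R M ^+ 6 by rewrite mulr_ge0 ?exprn_ge0 // ltW.
have k1 := key 18 isT; have k2 := key 19 isT; have k3 := key 22 isT.
rewrite /stepE (_ : M%:R * _ = (n + n)%:R * 2 * (M%:R * (B * (h ^+ 18 * rho R M ^+ 6)))
 + (n + n)%:R * ((n + n)%:R * 8) * (M%:R * (B * (h ^+ 19 * rho R M ^+ 6)))
 + 2 * (expC R (n + n) * (n + n)%:R) * (M%:R * (B * (h ^+ 22 * rho R M ^+ 6)))); last first.
 by move: (expC _ _) (rho R M ^+ 6) (h ^+ 18) (h ^+ 19) (h ^+ 22) ((n + n)%:R : R) (M%:R : R) => *; ring.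
rewrite [leRHS]mulrDl; apply: lerD; last by rewrite ler_wpM2l // !mulr_ge0.
by rewrite [leRHS]mulrDl; apply: lerD; rewrite ler_wpM2l // !mulr_ge0.
Qed.
Lemma law_expectation (R : realType) (N M beta : nat) (Cp : nat -> R) (dT : measure_display) (T : measurableType dT)
 (P : probability T R) (XR XI : 'I_N -> 'I_M -> T -> R) (HX : sample_cov_entries beta Cp P XR XI) (F u e : EntT R N M -> R) :
 tame (entlaw HX) u -> tame (entlaw HX) e -> (forall w, `|F w - u w| <= e w) ->
 exists2 r : R, 'E_P[fun t => F (ent_of XR XI t)]%E = r%:E & `|r - Ex (entlaw HX) u| <= Ex (entlaw HX) e.
move=> tu te H; rewrite (Ex_entlaw tu) (Ex_entlaw te).
by apply: expectation_sandwich => [||t]; [exact: (tame_ent_of tu)|exact: (tame_ent_of te)|exact: H].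
Qed.
Lemma bounded_expectation (R : realType) d (T : measurableType d) (P : probability T R) (f : T -> R) B : (forall t, `|f t| <= B) ->
 exists2 r : R, 'E_P[f]%E = r%:E & `|r| <= B.
move=> H; have [|r fr] := @expectation_sandwich _ _ _ P f (fun=> 0) (fun=> B) (tameC _ _) (tameC _ _).
 by move=> t; rewrite subr0.
by rewrite !Ex_cst subr0; exists r.
Qed.
Lemma abse_sub_fin (R : realType) (a b : \bar R) (x y B : R) : a = x%:E -> b = y%:E -> `|x - y| <= B -> (`|a - b| <= B%:E)%E.
by move=> -> ->; rewrite -EFinB abse_EFin lee_fin. Qed.
Lemma unit_cvec_dim (R : realType) N (b : 'cV[R[i]]_N) : unit_cvec b -> (0 < N)%N.
by case: N b => // b; rewrite /unit_cvec big_ord0 => /eqP; rewrite eq_sym oner_eq0. Qed.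
Lemma triangle3 (R : realDomainType) (x y s t a b c : R) : `|x - s| <= a -> `|y - t| <= b -> `|s - t| <= c -> `|x - y| <= a + b + c.
by rewrite !ler_norml => /andP[a1 a2] /andP[b1 b2] /andP[c1 c2]; apply/andP; split; lra. Qed.

Theorem theorem5p14 (R : realType) (C0 : R) (hC0 : 0 < C0) :
  exists2 sigma : R, 0 < sigma &
  forall (beta : nat) (d : R) (Nseq : nat -> nat) (n : nat) (Cp : nat -> R)
         (Phi : 'rV[R]_(n + n) -> R)
         (gx gy : 'I_n -> R -> R) (f : 'I_n -> R[i] -> R[i]),
    (beta = 1%N \/ beta = 2%N) ->
    0 < d ->
    ((fun M : nat => (Nseq M)%:R / M%:R) @ \oo --> d) ->
    (forall j, simple_smooth_closed_curve (gx j) (gy j)) ->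
    (forall j, positively_oriented (gx j) (gy j)) ->
    (exists2 delta : R, 0 < delta & forall j t x, mp_support d x ->
        delta <= Normc.normc (cpt (gx j) (gy j) t - (x%:C)%C)) ->
    (forall j, analytic_near (\bigcup_(k in setT) cregion (gx k) (gy k)) (f j)) ->
    admissible Phi C0 ->
  exists Cst : R, 0 < Cst /\
  forall (M : nat), (1 <= M)%N ->
  forall (dX : measure_display) (TX : measurableType dX) (PX : probability TX R)
         (XR XI : 'I_(Nseq M) -> 'I_M -> TX -> R)
         (dY : measure_display) (TY : measurableType dY) (PY : probability TY R)
         (YR YI : 'I_(Nseq M) -> 'I_M -> TY -> R)
         (b : 'cV[R[i]]_(Nseq M)),
    sample_cov_entries beta Cp PX XR XI ->
    sample_cov_entries beta Cp PY YR YI ->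
    (forall i j (l p : nat), (l + p <= 4)%N ->
       ('E_PX[(fun t => XR i j t ^+ l * XI i j t ^+ p)%R] =
       'E_PY[(fun t => YR i j t ^+ l * YI i j t ^+ p)%R])%E) ->
    unit_cvec b ->
    (`| 'E_PX[fun t => Phi (cvec_to_rv (fun k =>
            Ifun M (covW (fun i j => XR i j t) (fun i j => XI i j t)) b
                 (gx k) (gy k) (f k)))]
      - 'E_PY[fun t => Phi (cvec_to_rv (fun k =>
            Ifun M (covW (fun i j => YR i j t) (fun i j => YI i j t)) b
                 (gx k) (gy k) (f k)))] |
     <= (Cst * powR (M%:R) (- sigma))%:E)%E.
Proof.
have [c cC] : exists c : nat, C0 <= c%:R by exists (Num.bound C0); exact: ltW (archi_boundP (ltW hC0)).
pose m := (4 * expQ c)%N.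
have m0 : (0 < m)%N by rewrite muln_gt0 (leq_trans _ (expQ_ge100 c)).
have mR : (m%:R : R) != 0 by rewrite pnatr_eq0 -lt0n.
(* Every error is [O(1/h)] with [h] equal to [M] to the power [1 / m]; through [c] the exponent
   depends on [C0] only. *)
exists m%:R^-1; first by rewrite invr_gt0 ltr0n.
move=> beta d Nseq n Cp Phi gx gy f Hbeta d0 Hd Hcur _ [dlt dlt0 Hsupp] Han Hadm.
have cga k : ccont (cpt (gx k) (gy k)) := ccont_cpt (Hcur k).
have cphi k : ccont (fun t => f k (cpt (gx k) (gy k) t) * dcpt (gx k) (gy k) t).
 have [U [_ KU aU]] := Han k; apply: (ccont_phi (Hcur k) aU) => w Hw.
 by apply: KU; exists k => //; left.
have [F F0 HF] : exists2 F : R, 0 <= F & forall k t, 0 <= t <= 1 -> cabs (f k (cpt (gx k) (gy k) t) * dcpt (gx k) (gy k) t) <= F.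
 apply: uniform_bound => [k|k B B' le H t t01]; [exact: ccont_bounded|exact: le_trans (H t t01) le].
have [L L0 HL] : exists2 L : R, 0 <= L & forall k s t, 0 <= s <= t -> t <= 1 ->
  cabs (cpt (gx k) (gy k) t - cpt (gx k) (gy k) s) <= L * (t - s).
 apply: uniform_bound => [k|k B B' le H s t st t1]; first exact: cpt_lipschitz.
 by apply: le_trans (H s t st t1) _; rewrite ler_wpM2r // subr_ge0; case/andP: st.
have [G G0 HG] : exists2 G : R, 0 <= G & forall k t, cabs (cpt (gx k) (gy k) t) <= G.
 apply: uniform_bound => [k|k B B' le H t]; [exact: cpt_bounded|exact: le_trans (H t) le].
have Hdlt k t x : inS d x -> dlt <= cabs (x%:C%C - cpt (gx k) (gy k) t).
 by move=> Sx; rewrite cabsBC; apply: Hsupp; exact: mp_support_inS.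
have D0 : 0 <= d + 1 by rewrite addr_ge0 // ltW.
have K1 : 1 <= entK Cp by rewrite /entK -addrA lerDl addr_ge0.
have growth r ks x : 1 < r -> (1 <= size ks <= 3)%N -> (forall j, rv_cabs x j <= r) -> `|pdiff ks Phi x| <= r ^+ c.
 move=> r1 /andP[s1 s3]; apply: (admissible_growth Hadm cC r1).
 by rewrite s1 (leq_trans s3).
have [_ [Bs HBs] Hder5 _] := Hadm.
have Bs0 : 0 <= Bs by exact: le_trans (HBs 0).
have Hder ks k x : (size ks < 3)%N -> derivable (pdiff ks Phi) x (delta_mx 0 k : 'rV_(n + n)).
 by move=> s3; apply: Hder5; exact: leq_trans s3 _.
have [A A0 HA] := good_event cga cphi F0 HF L0 HL G0 HG dlt0 Hdlt D0 K1 growth Hder Bs0 HBs.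
have dd0 M : (0 : R) <= (Nseq M)%:R / M%:R by rewrite divr_ge0.
have d4 : 0 < dlt / 4 by rewrite divr_gt0.
have [M1 HM1] := inS_close d0 d4 dd0 Hd.
pose Cl : R := (n + n)%:R * 2 + (n + n)%:R * ((n + n)%:R * 8) + 2 * (expC R (n + n) * (n + n)%:R).
have Cl0 : 0 <= Cl by rewrite !addr_ge0 // !mulr_ge0.
pose H0 := bigH n F L G dlt (d + 1) (entK Cp) c.
(* The value of [h] at the threshold [M1]: for smaller [M] the scale [h] is at most [h1], which
   enters the constant. *)
pose h1 := powR (M1%:R : R) m%:R^-1.
have h1_0 : 0 <= h1 by exact: powR_ge0.
have Bs2 : 0 <= 2 * Bs by exact: mulr_ge0.
have HH0 : 0 <= `|H0| + h1 by exact: addr_ge0.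
have A2 : 0 <= 2 * A by apply: mulr_ge0 => //; exact: ltW.
have AC : 0 <= 2 * A + Cl by exact: addr_ge0.
have BH : 0 <= 2 * Bs * (`|H0| + h1) by exact: mulr_ge0.
exists (2 * Bs * (`|H0| + h1) + (2 * A + Cl) + 1); split.
 by apply: ltr_wpDl => //; exact: addr_ge0.
move=> M M0 dX TX PX XR XI dY TY PY YR YI b HX HY match4 Hb.
have N0 := unit_cvec_dim Hb.
pose h := powR (M%:R : R) m%:R^-1.
have Mp : (0 : R) < M%:R by rewrite ltr0n.
have h0 : 0 < h by exact: powR_gt0.
have hM : h ^+ m = M%:R by rewrite -powR_mulrn ?powR_ge0 // -powRrM mulVf // powRr1 // ltW.
rewrite powRN -/h.
have up (x y B : R) : `|x - y| <= B / h -> B <= 2 * Bs * (`|H0| + h1) + (2 * A + Cl) + 1 ->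
  `|x - y| <= (2 * Bs * (`|H0| + h1) + (2 * A + Cl) + 1) / h.
 by move=> r le; apply: le_trans r _; rewrite ler_wpM2r // invr_ge0 ltW.
(* Either [M] is large enough for the estimates, or [h] is bounded and the trivial bound [2 * Bs] is
   at most a constant divided by [h]. *)
have [[Hh MM]|small] : (H0 <= h /\ (M1 <= M)%N) \/ h <= `|H0| + h1.
 have [Hh|Hh] := leP H0 h; last by right; apply: le_trans (ltW Hh) _; apply: le_trans (ler_norm H0) _; rewrite lerDl.
 have [MM|MM] := leqP M1 M; [by left|right].
 apply: le_trans (_ : h1 <= _); last by rewrite lerDr.
 by apply: ge0_ler_powR; rewrite ?invr_ge0 ?nnegrE // ler_nat ltnW.
- have [close Hclose] := HM1 M MM.
 have HD : (Nseq M)%:R / M%:R <= d + 1 by move: close; rewrite ler_norml lerBlDl => /andP[_].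
 pose eps : R := 2 - beta%:R.
 have gX : goodlaw (entlaw HX) (entK Cp) eps by exact: goodlaw_entlaw.
 have gY : goodlaw (entlaw HY) (entK Cp) eps by exact: goodlaw_entlaw.
 have Heps : eps = 0 \/ eps = 1.
  by rewrite /eps; case: Hbeta => ->; [right|left]; ring.
 have [u [teX EeX HeX]] := HA _ _ h N0 M0 Hh hM HD Hclose b Hb (entlaw HX) eps gX Heps.
 have [v [teY EeY HeY]] := HA _ _ h N0 M0 Hh hM HD Hclose b Hb (entlaw HY) eps gY Heps.
 have [[Hdom _ _ _ _] [_ h2]] := bigH_parts F0 L0 G0 dlt0 D0 Hh.
 have h_1 : 1 <= h by apply: le_trans h2; rewrite ler1n.
 set u0 := Ff b _ _ _ Phi _ in HeX HeY.
 have tF (mu : mxlaw R (Nseq M) M) : tame mu u0.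
  apply: (tame_Ff b _ _ (D := fun ks => pdiff ks Phi) (B := h ^+ ((expA c).+1 * c)) _ (erefl _) _ _ _ HBs).
  - exact: (zk_neq0 gx gy F0 L0 G0 dlt0 D0 Hh).
  - by move=> ks k x sk; split; [exact: Hder|].
  - by move=> ks x sk bx; exact: (HB_box F0 L0 G0 dlt0 D0 growth Hh).
  - by rewrite exprn_ege1.
 have [rX eX dX'] := law_expectation (tF _) teX HeX.
 have [rY eY dY'] := law_expectation (tF _) teY HeY.
 have lind : `|Ex (entlaw HX) u0 - Ex (entlaw HY) u0| <= Cl / h.
  apply: le_trans (_ : _ <= M%:R * stepE M h n (h ^+ ((expA c).+1 * c))) _; last exact: stepE_small.
  exact: (replacement cphi F0 HF L0 G0 HG dlt0 D0 K1 growth Hder HBs M0 Hh HD Hb gX gY (kap_entlaw gX gY match4)).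
 apply: (abse_sub_fin eX eY); apply: (up _ _ (2 * A + Cl)).
  apply: le_trans (triangle3 dX' dY' lind) _; rewrite [leRHS]mulrDl -[X in _ <= X + _]mulrA.
  by rewrite lerD2r mulr_natl mulr2n lerD.
 rewrite -[leRHS]addrA [leRHS]addrC -addrA lerDl; exact: addr_ge0.
- have [rX eX bX] := bounded_expectation PX (fun t : TX => HBs (cvec_to_rv (Iv gx gy f b (ent_of XR XI t)))).
 have [rY eY bY] := bounded_expectation PY (fun t : TY => HBs (cvec_to_rv (Iv gx gy f b (ent_of YR YI t)))).
 apply: (abse_sub_fin eX eY); apply: (up _ _ (2 * Bs * (`|H0| + h1))).
  rewrite ler_pdivlMr // (le_trans (_ : _ <= 2 * Bs * h)) //; last exact: ler_wpM2l.
  rewrite ler_wpM2r ?(ltW h0) //; apply: le_trans (ler_normB _ _) _.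
  by rewrite mulr_natl mulr2n lerD.
 by rewrite -addrA lerDl; exact: addr_ge0.
Qed.
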